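(* Suppose $p(\lambda)$ is a polynomial conserved quantity of type $d$ of a constrained Willmore surface $(\Lambda,q)$. Suppose $\alpha,L$ are Bäcklund transformation parameters to $(\Lambda,q)$ with $$p(\alpha)\perp \overline{L}.$$ Then $$\hat p(\lambda):=r(1)^{-1}r(\overline{\lambda}^{\,-1})p(\lambda)$$ is a polynomial conserved quantity of type $d$ of the Bäcklund transform $(\hat\Lambda,\hat q)$ of $(\Lambda,q)$ of parameters $\alpha,L$.
   Context: Ambient setting. Let $n\ge 3$ and let $\mathbb{R}^{n+1,1}$ be Lorentzian space of dimension $n+2$, with inner product $(\,,\,)$, extended complex bilinearly to $\mathbb{C}^{n+2}=(\mathbb{R}^{n+1,1})^{\mathbb{C}}$; $\perp$ refers to this bilinear form. Identify $\wedge^2\mathbb{R}^{n+1,1}$ with $o(\mathbb{R}^{n+1,1})$ by $(u\wedge v)(w)=(u,w)v-(v,w)u$. Let $\mathcal{L}$ be the light-cone and $\mathbb{P}(\mathcal{L})$ its projectivisation, the conformal $n$-sphere. Let $\Lambda:\Sigma\to\mathbb{P}(\mathcal{L})$ be an immersion of an oriented surface, viewed as a null line subbundle of the trivial bundle $\Sigma\times\mathbb{R}^{n+1,1}$; trivial bundles are underlined. $\Sigma$ carries the conformal structure induced by $\Lambda$ (the class of $g_\sigma(X,Y)=(\mathrm{d}\sigma(X),\mathrm{d}\sigma(Y))$, $\sigma$ a never-zero section of $\Lambda$) and the corresponding complex structure. Bundles and their complexifications are not distinguished notationally. Set $\Lambda^{1,0}=\Lambda\oplus\mathrm{d}\sigma(T^{1,0}\Sigma)$,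 $\Lambda^{0,1}=\Lambda\oplus\mathrm{d}\sigma(T^{0,1}\Sigma)$, $\Lambda^{(1)}=\Lambda^{1,0}+\Lambda^{0,1}$. The central sphere congruence is the rank $4$ subbundle $S=\Lambda^{(1)}\oplus\langle\triangle\sigma\rangle$, of signature $(3,1)$, with $\triangle$ the Laplacian of $g_\sigma$. Write $\mathrm{d}=\mathcal{D}+\mathcal{N}$ for the trivial flat connection, where $\mathcal{D}$ is the sum of the connections induced by $\mathrm{d}$ on $S$ and $S^\perp$. Superscripts $1,0$ and $0,1$ on forms denote type components. Constrained Willmore surfaces. $(\Lambda,q)$ is a constrained Willmore surface (and $q$ a multiplier) if $q\in\Omega^1(\Lambda\wedge\Lambda^{(1)})$ is a real form with $\mathrm{d}^{\mathcal{D}}q=0$ and $\mathrm{d}^{\mathcal{D}}{*\mathcal{N}}=2[q\wedge *\mathcal{N}]$, where $[\,\wedge\,]$ is the $2$-form defined from the Lie bracket of $o(\mathbb{R}^{n+1,1})$. Set, for $\lambda\in\mathbb{C}\setminus\{0\}$, $$\mathrm{d}^\lambda_q=\mathcal{D}+\lambda\mathcal{N}^{1,0}+\lambda^{-1}\mathcal{N}^{0,1}+(\lambda^2-1)q^{1,0}+(\lambda^{-2}-1)q^{0,1}.$$ Polynomial conserved quantities. For $d\in\mathbb{N}_0$, a polynomial conserved quantity of type $d$ of a constrained Willmore surface $(\Lambda,q)$ is a Laurent polynomial $p(\lambda)=\sum_{k=-d}^d p_k\lambda^k$ with $p_k\in\Gamma(\underline{\mathbb{C}}^{n+2})$ such that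 $p_{-k}=\overline{p_k}$ for all $k$; $p_d\in\Gamma(S^\perp)$; $p_k\in\Gamma(S^\perp)$ if $k,d$ have the same parity and $p_k\in\Gamma(S)$ otherwise; $p(1)\neq0$; and $\mathrm{d}^\lambda_q p(\lambda)=0$ for all $\lambda\in\mathbb{C}\setminus\{0\}$. Bäcklund transformation. Let $\rho=\pi_S-\pi_{S^\perp}$ be reflection across $S$. Bäcklund transformation parameters $\alpha,L$ to $(\Lambda,q)$ consist of a non-zero $\alpha\in\mathbb{C}\setminus S^1$ and a null line bundle $L\subset\underline{\mathbb{C}}^{n+2}$ such that $L$ and $\rho L$ are never orthogonal. For such data let $p_{\alpha,L}(\lambda)\in\Gamma(O(\underline{\mathbb{C}}^{n+2}))$ act as $\frac{\lambda-\alpha}{\lambda+\alpha}$ on $L$, $1$ on $(L\oplus\rho L)^\perp$, $\frac{\lambda+\alpha}{\lambda-\alpha}$ on $\rho L$, and let $p^-_{\alpha,L}(\lambda)$ act as $-\frac{\lambda-\alpha}{\lambda+\alpha}$ on $L$, $1$ on $(L\oplus\rho L)^\perp$, $-\frac{\lambda+\alpha}{\lambda-\alpha}$ on $\rho L$. Both extend holomorphically in $\lambda$ to $\mathbb{P}^1\setminus\{\pm\alpha\}$, with $p_{\alpha,L}(\infty)=I$ and $p^-_{\alpha,L}(\infty)$ equal to $-1$ on $L\oplus\rho L$ and $1$ on $(L\oplus\rho L)^\perp$. Set $\hat\alpha=\overline{\alpha}^{\,-1}$, $\tilde L=p_{\hat\alpha,\overline L}(\alpha)L$ and $r=p^-_{\alpha,\tilde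 L}\,p_{\hat\alpha,\overline L}$ (this presupposes that $\tilde L$ and $\rho\tilde L$ are never orthogonal, so that $p^-_{\alpha,\tilde L}$ is defined). Set $\hat S=r(1)^{-1}S$, $\hat\Lambda^{1,0}=r(1)^{-1}r(0)\Lambda^{1,0}$, $\hat\Lambda^{0,1}=r(1)^{-1}r(\infty)\Lambda^{0,1}$, $\hat\Lambda=\hat\Lambda^{1,0}\cap\hat\Lambda^{0,1}$. Define $\tilde q$ by $\tilde q^{1,0}=r(\infty)q^{1,0}r(\infty)^{-1}$, $\tilde q^{0,1}=r(0)q^{0,1}r(0)^{-1}$, and $\hat q=r(1)^{-1}\tilde q\,r(1)$. By a result quoted from Burstall–Quintino, $\hat\Lambda$ is a surface with central sphere congruence $\hat S$ and $(\hat\Lambda,\hat q)$ is a constrained Willmore surface, called the Bäcklund transform of $(\Lambda,q)$ of parameters $\alpha,L$. The theory is local: restriction to a suitable non-empty open subset of $\Sigma$ is understood throughout.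
   Formalization: L is also required to be d^α_q-parallel; the condition is p(α) ⊥ L instead of p(α) ⊥ L̄; and p̂(λ) is r(1)^{-1}r(λ)p(λ), which agrees with the printed r(1)^{-1}r(λ̄^{-1})p(λ) only for |λ|=1, the printed factor being antiholomorphic in λ. *)

(* Defs.v *)
From mathcomp Require Import all_boot all_order all_algebra.
From mathcomp Require Import complex.
From mathcomp Require Import boolp classical_sets reals topology normedtype derive.

Set Implicit Arguments.
Unset Strict Implicit.
Unset Printing Implicit Defensive.

Import Order.TTheory GRing.Theory Num.Theory.
Import numFieldNormedType.Exports.

Local Open Scope classical_set_scope.
Local Open Scope ring_scope.

(* The theory is local, so the oriented surface is an open subset U of the
   plane, with its standard orientation; the coordinates are arbitrary, not
   assumed to be conformal.  Real bundles are represented by their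
   complexifications: a bundle assigns to each point a set of vectors of
   C^(n+2).  Sections, bundles and forms are functions on the whole plane of
   which only the values on U matter.                                       *)

Section ConstrainedWillmore.
Context {R : realType} {n : nat}.

Local Notation C := R[i].
Local Notation I := ('i%C : C).
Local Notation pt := (R * R)%type.
Local Notation vec := 'cV[C]_n.+2.
Local Notation endo := 'M[C]_n.+2.
Local Notation bundle := (pt -> set vec).

Implicit Types (U : set pt) (x X Y : pt) (u v w : vec) (V : set vec).
Implicit Types (s : pt -> vec) (B Lam L : bundle) (q om : pt -> pt -> endo).

Definition e1 : pt := (1, 0).
Definition e2 : pt := (0, 1).

(** Lorentzian space R^(n+1,1), complexified *)

Definition gram : endo :=
  diag_mx (\row_i (if i == ord_max then - 1 else 1)).

Definition ip u v : C := (u^T *m gram *m v) 0 0.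

Definition conjm {m k} (A : 'M[C]_(m, k)) : 'M[C]_(m, k) := map_mx conjc A.

Definition perp V : set vec := [set v | forall w, V w -> ip v w = 0].

(* (u /\ v) w = (u, w) v - (v, w) u *)
Definition wedge u v : endo := v *m (u^T *m gram) - u *m (v^T *m gram).

Definition line v : set vec := [set c *: v | c in [set: C]].

Definition addV V W : set vec := [set v | exists u w, [/\ V u, W w & v = u + w]].

Definition img (A : endo) V : set vec := [set A *m v | v in V].

(* Orthogonal projection onto V (unique when V is a nondegenerate subspace). *)
Definition proj V : endo :=
  xget 0 [set P : endo | forall v, V (P *m v) /\ perp V (v - P *m v)].

(** Calculus *)

Fixpoint Ck U (k : nat) (f : pt -> R) : Prop :=
  (forall x, U x -> {for x, continuous f}) /\
  match k with
  | 0 => True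
  | k'.+1 => forall X, (forall x, U x -> derivable f x X) /\
                       Ck U k' (fun x => 'D_X f x)
  end.

Definition smooth {m k} U (A : pt -> 'M[C]_(m, k)) : Prop :=
  forall (r : nat) i j, Ck U r (fun x => complex.Re (A x i j)) /\
                        Ck U r (fun x => complex.Im (A x i j)).

(* d_X A, entrywise *)
Definition der {m k} (A : pt -> 'M[C]_(m, k)) x X : 'M[C]_(m, k) :=
  \matrix_(i, j) ('D_X (fun y => complex.Re (A y i j)) x +i*
                  'D_X (fun y => complex.Im (A y i j)) x)%C.

(** Surfaces in the conformal n-sphere *)

Definition is_lift U Lam s : Prop :=
  smooth U s /\
  forall x, U x ->
    [/\ conjm (s x) = s x, s x != 0, ip (s x) (s x) = 0 & Lam x = line (s x)].

(* Lam is a (real) null line bundle and Lam : U -> P(light-cone) is an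
   immersion.                                                                *)
Definition is_surface U Lam : Prop :=
  exists2 s, is_lift U Lam s &
    forall x X, U x -> X != 0 -> ~ Lam x (der s x X).

(* A never-zero section of Lam.  The conformal structure and the central
   sphere congruence below do not depend on which one is chosen.             *)
Definition lift U Lam : pt -> vec := xget (fun=> 0) [set s | is_lift U Lam s].

Section Surface.
Variables (U : set pt) (Lam : bundle).
Let s := lift U Lam.

Definition metric x X Y : R := complex.Re (ip (der s x X) (der s x Y)).

Let E x := metric x e1 e1.
Let F x := metric x e1 e2.
Let G x := metric x e2 e2.
Let area x : R := Num.sqrt (E x * G x - F x ^+ 2).

(* The complex structure: rotation by +pi/2 for the metric. *)
Definition cpx x X : pt :=
  ((- F x * X.1 - G x * X.2) / area x, (E x * X.1 + F x * X.2) / area x).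

(* The Laplace-Beltrami operator of the metric, in coordinates. *)
Definition laplacian {m} (f : pt -> 'cV[C]_m) x : 'cV[C]_m :=
  let c (a : R) : C := a%:C%C in
  c (area x)^-1 *:
    (der (fun y => c (area y)^-1 *:
            (c (G y) *: der f y e1 - c (F y) *: der f y e2)) x e1 +
     der (fun y => c (area y)^-1 *:
            (c (E y) *: der f y e2 - c (F y) *: der f y e1)) x e2).

(* Type components and Hodge star of a form given on real tangent vectors. *)
Definition tp10 om x X : endo := 2^-1 *: (om x X - I *: om x (cpx x X)).
Definition tp01 om x X : endo := 2^-1 *: (om x X + I *: om x (cpx x X)).
Definition star om x X : endo := - om x (cpx x X).

(* T^(1,0) consists of the X - i J X, for X a real tangent vector. *)
Definition L10 : bundle := fun x =>
  addV (Lam x) [set v | exists X, v = der s x X - I *: der s x (cpx x X)].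
Definition L01 : bundle := fun x =>
  addV (Lam x) [set v | exists X, v = der s x X + I *: der s x (cpx x X)].
Definition L1 : bundle := fun x => addV (L10 x) (L01 x).

Definition csc : bundle := fun x => addV (L1 x) (line (laplacian s x)).
Definition cscp : bundle := fun x => perp (csc x).

Definition piS x : endo := proj (csc x).
Definition piN x : endo := 1%:M - piS x.
Definition refl x : endo := piS x - piN x.

Definition Dconn (t : pt -> vec) x X : vec :=
  piS x *m der (fun y => piS y *m t y) x X +
  piN x *m der (fun y => piN y *m t y) x X.

(* N = d - D is tensorial, hence determined by its values on constant
   sections.                                                                 *)
Definition Nform x X : endo := - (piS x *m der piS x X + piN x *m der piN x X).

(* D on sections of End, from d = D + N *)
Definition Dend (A : pt -> endo) x X : endo :=
  der A x X - (Nform x X *m A x - A x *m Nform x X).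

(* Two-forms are evaluated on the coordinate fields. *)
Definition extD om x : endo :=
  Dend (fun y => om y e2) x e1 - Dend (fun y => om y e1) x e2.
Definition brak (om1 om2 : pt -> pt -> endo) x : endo :=
  (om1 x e1 *m om2 x e2 - om2 x e2 *m om1 x e1) -
  (om1 x e2 *m om2 x e1 - om2 x e1 *m om1 x e2).

Definition is_form om : Prop :=
  (forall X, smooth U (fun x => om x X)) /\
  forall x (a : R) X Y, U x -> om x (a *: X + Y) = a%:C%C *: om x X + om x Y.

Definition constrained_willmore q : Prop :=
  [/\ is_surface U Lam,
      is_form q,
      forall x X, U x -> conjm (q x X) = q x X,
      (* as Lam is a line bundle, these decomposable elements exhaust
         Lam /\ L1 *)
      forall x X, U x -> exists u v, [/\ Lam x u, L1 x v & q x X = wedge u v] &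
      forall x, U x -> extD q x = 0 /\
                       extD (star Nform) x = 2 *: brak q (star Nform) x].

Definition dlq q (lam : C) (t : pt -> vec) x X : vec :=
  Dconn t x X +
  (lam *: tp10 Nform x X + lam^-1 *: tp01 Nform x X
   + (lam ^+ 2 - 1) *: tp10 q x X + (lam ^- 2 - 1) *: tp01 q x X) *m t x.

(* The Laurent polynomial with coefficients p_k, -d <= k <= d. *)
Definition laurent (d : nat) (p : int -> pt -> vec) (lam : C) x : vec :=
  \sum_(k < (d + d).+1) lam ^ (k%:Z - d%:Z) *: p (k%:Z - d%:Z) x.

Definition is_pcq q (d : nat) (p : int -> pt -> vec) : Prop :=
  [/\ forall k : int, (`|k| <= d)%N ->
        smooth U (p k) /\ forall x, U x -> p (- k) x = conjm (p k x),
      forall x, U x -> cscp x (p d%:Z x),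
      forall (k : int) x, (`|k| <= d)%N -> U x ->
        if odd `|k| == odd d then cscp x (p k x) else csc x (p k x),
      forall x, U x -> laurent d p 1 x <> 0 &
      forall lam x X, lam != 0 -> U x -> dlq q lam (laurent d p lam) x X = 0].

(** Baecklund transformation *)

Definition null_line_bundle L : Prop :=
  exists2 t, smooth U t &
    forall x, U x -> [/\ t x != 0, ip (t x) (t x) = 0 & L x = line (t x)].

Definition parallel q (lam : C) L : Prop :=
  forall t, smooth U t -> (forall x, U x -> L x (t x)) ->
  forall x X, U x -> L x (dlq q lam t x X).

Definition reflB L : bundle := fun x => img (refl x) (L x).
Definition conjB L : bundle := fun x => [set conjm v | v in L x].

Definition never_orth (B1 B2 : bundle) : Prop :=
  forall x, U x -> exists u v, [/\ B1 x u, B2 x v & ip u v <> 0].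

Definition baecklund_parameters q (alpha : C) L : Prop :=
  [/\ alpha != 0 /\ `|alpha| != 1,
      null_line_bundle L,
      never_orth L (reflB L) &
      parallel q alpha L].

(* The endomorphism acting as a on L, a^-1 on rho L, 1 on their perp. *)
Definition acting (a : C) L x : endo :=
  xget 0 [set A : endo |
    [/\ forall v, L x v -> A *m v = a *: v,
        forall v, reflB L x v -> A *m v = a^-1 *: v &
        forall v, perp (addV (L x) (reflB L x)) v -> A *m v = v]].

(* (lam - alpha) / (lam + alpha) on P^1, where None is infinity *)
Definition cross (alpha : C) (lam : option C) : C :=
  if lam is Some l then (l - alpha) / (l + alpha) else 1.

Definition pfac alpha L lam : pt -> endo := acting (cross alpha lam) L.
Definition pfacm alpha L lam : pt -> endo := acting (- cross alpha lam) L.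

Section Transform.
Variables (q : pt -> pt -> endo) (alpha : C) (L : bundle).

Definition ahat : C := (conjc alpha)^-1.

Definition Ltilde : bundle := fun x =>
  img (pfac ahat (conjB L) (Some alpha) x) (L x).

Definition bt_r lam x : endo :=
  pfacm alpha Ltilde lam x *m pfac ahat (conjB L) lam x.

Let r0 := bt_r (Some 0).
Let rinf := bt_r None.
Let r1 := bt_r (Some 1).
Let r1V x := invmx (r1 x).

Definition bt_L10 : bundle := fun x => img (r1V x *m r0 x) (L10 x).
Definition bt_L01 : bundle := fun x => img (r1V x *m rinf x) (L01 x).
Definition bt_Lam : bundle := fun x => bt_L10 x `&` bt_L01 x.

Definition bt_qtilde x X : endo :=
  rinf x *m tp10 q x X *m invmx (rinf x) + r0 x *m tp01 q x X *m invmx (r0 x).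
Definition bt_q x X : endo := r1V x *m bt_qtilde x X *m r1 x.

(* For |lam| = 1 this is also r(1)^-1 r(conj(lam)^-1), whose continuation off
   the unit circle is antiholomorphic in lam; the holomorphic one is used.  If
   p(lam) is a polynomial conserved quantity, p(ahat) = conj p(alpha) and
   p(-lam) = +- rho p(lam), so the poles of r p at alpha, ahat and their
   opposites cancel when (p(alpha), L) = 0, that is (p(ahat), conj L) = 0.   *)
Definition bt_op (lam : C) x : endo := r1V x *m bt_r (Some lam) x.

End Transform.
End Surface.
End ConstrainedWillmore.

(* Main.v *)
Require Import Defs.
From mathcomp Require Import all_boot all_order all_algebra.
From mathcomp Require Import complex.
From mathcomp Require Import boolp classical_sets reals topology normedtype derive.
From mathcomp Require Import realfun ring lra zify.

Set Implicit Arguments.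
Unset Strict Implicit.
Unset Printing Implicit Defensive.

Import Order.TTheory GRing.Theory Num.Theory.
Import numFieldNormedType.Exports.

Local Open Scope classical_set_scope.
Local Open Scope ring_scope.

(** Along the vector [e1 - i J e1] of type (1,0) the connection [dlq] is
    [d + (lam - 1) N + (lam^2 - 1) q], a quadratic polynomial in [lam]; the (0,1) direction follows
    by conjugation ([dlq_conj], [dlq_eq0]). The heart of the matter is that [r(1)^-1 r(lam)] gauges
    this loop of connections into the loop of the transform, so that it carries the parallel section
    [p(lam)] to a parallel section. It then remains to remove the poles and to check reality and
    parity.

    Dressing. Gauging by one simple factor multiplies the obstructions to parallelism of a null line
    and of its reflection by scalars with simple poles at [beta] and [- beta]. The line is parallel
    at [beta], and reflection exchanges [lam] with [- lam], so the poles cancel and the family stays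
    quadratic ([gauge_step]). Two such steps give [transform_family]; expanding them at infinity
    controls the leading coefficients. After the further gauge by [r(1)^-1] the family vanishes at
    [lam = 1], and its parity under the conjugated reflection identifies its middle coefficient with
    the form [N] of the projection [hatP = r(1)^-1 P r(1)] ([hat_family]).

    Geometry. The loop of the transform is built from its own central sphere congruence, so [hatP]
    must be shown to project onto that. At [lam = 0] the gauge relation puts the (1,0) derivative of
    the new lift into the image of the old (1,0) osculating plane ([dz_hat_lift]). Hence the
    conformal structure is unchanged ([hat_cpx]), and the new lift and its first derivatives lie in
    the range of [hatP]. As the new [N] kills the (0,1) osculating direction, the Laplacian lies
    there too ([NN_trace], [hat_lap]), and a rank count concludes ([hat_cproj]).

    Reality. The conjugate of [r(lam)], and [r] at the inverse conjugate of [lam], are products of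
    simple factors with the same poles in opposite orders. By a Liouville argument they differ by a
    factor independent of [lam] ([permutability], [rr_conj]), which [r(1)^-1] absorbs ([conj_RR],
    [hatP_real]).

    Poles. Multiplying [r(lam)] by [(lam^2 - alpha^2) (lam^2 - ahat^2)] clears its poles. At [ahat]
    the cleared first factor annihilates vectors orthogonal to the conjugate of [L], and [p(ahat)]
    is the conjugate of [p(alpha)]; at [alpha] the second one annihilates vectors orthogonal to
    [Ltilde], the isometric image of [L]. Since [p(alpha)] is orthogonal to [L], the numerator
    vanishes at both points, and by parity at their opposites ([numer_exc]). Division gives the
    coefficients [hat_coef] ([hat_laurent]), and identities known for generic [lam] extend to all
    [lam] by comparing coefficients ([hat_pcq]). *)

(** * Functions of class C^k of two real variables *)

Section RealCalculus.
Context {R : realType}.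
Local Notation pt := (R * R)%type.
Implicit Types (U : set pt) (f g : pt -> R) (x X Y : pt).

Lemma open_near U x (P : pt -> Prop) :
  open U -> U x -> (forall y, U y -> P y) -> \near x, P x.
Proof.
move=> oU Ux UP; have : nbhs x U by exact: open_nbhs_nbhs.
by apply: filterS.
Qed.

Lemma Ck_ext U k f g : open U -> (forall x, U x -> f x = g x) ->
  Ck U k f -> Ck U k g.
Proof.
move=> oU; elim: k f g => [|k IH] f g fg [cf df]; split.
- move=> x Ux; have fgx : \near x, f x = g x by exact: open_near oU Ux fg.
  change (g @ x --> g x); rewrite -(fg x Ux); apply: cvg_trans (cf x Ux).
  exact: near_eq_cvg.
- by [].
- move=> x Ux; have fgx : \near x, f x = g x by exact: open_near oU Ux fg.
  change (g @ x --> g x); rewrite -(fg x Ux); apply: cvg_trans (cf x Ux).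
  exact: near_eq_cvg.
- move=> X; have [dfX CX] := df X; split.
    move=> x Ux; apply: near_eq_derivable (dfX x Ux).
    exact: open_near oU Ux fg.
  apply: IH CX => x Ux; apply: near_eq_derive.
  exact: open_near oU Ux fg.
Qed.

Lemma CkS U k f : Ck U k.+1 f -> Ck U k f.
Proof.
elim: k f => [|k IH] f [cf df]; split=> // X.
by have [dX CX] := df X; split=> //; exact: IH.
Qed.

Lemma Ck_cont U k f x : U x -> Ck U k f -> {for x, continuous f}.
Proof. by move=> Ux; case: k => [|k] [cf _]; exact: cf. Qed.

Lemma Ck_cst U k (c : R) : open U -> Ck U k (fun=> c).
Proof.
move=> oU; elim: k c => [|k IH] c; split=> //.
- by move=> x _; exact: cvg_cst.
- by move=> x _; exact: cvg_cst.
- move=> X; split; first by move=> x _; exact: derivable_cst.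
  by apply: Ck_ext (IH 0) => // x _; rewrite derive_cst.
Qed.

Lemma CkD U k f g : open U -> Ck U k f -> Ck U k g ->
  Ck U k (fun x => f x + g x).
Proof.
move=> oU; elim: k f g => [|k IH] f g [cf df] [cg dg]; split=> //.
- by move=> x Ux; apply: cvgD; [exact: cf|exact: cg].
- by move=> x Ux; apply: cvgD; [exact: cf|exact: cg].
- move=> X; have [dfX CfX] := df X; have [dgX CgX] := dg X; split.
    by move=> x Ux; apply: derivableD; [exact: dfX|exact: dgX].
  apply: Ck_ext (IH _ _ CfX CgX) => // x Ux.
  by rewrite (@deriveD _ _ _ f g); [|exact: dfX|exact: dgX].
Qed.

Lemma CkM U k f g : open U -> Ck U k f -> Ck U k g ->
  Ck U k (fun x => f x * g x).
Proof.
move=> oU; elim: k f g => [|k IH] f g Cf Cg; split=> //.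
- by move=> x Ux; apply: cvgM; [exact: (Ck_cont Ux Cf)|exact: (Ck_cont Ux Cg)].
- by move=> x Ux; apply: cvgM; [exact: (Ck_cont Ux Cf)|exact: (Ck_cont Ux Cg)].
- move=> X; have [dfX CfX] := Cf.2 X; have [dgX CgX] := Cg.2 X; split.
    by move=> x Ux; apply: derivableM; [exact: dfX|exact: dgX].
  have C1 := IH _ _ (CkS Cf) CgX; have C2 := IH _ _ (CkS Cg) CfX.
  apply: Ck_ext (CkD oU C1 C2) => // x Ux.
  by rewrite (@deriveM _ _ f g); [|exact: dfX|exact: dgX].
Qed.

Lemma CkN U k f : open U -> Ck U k f -> Ck U k (fun x => - f x).
Proof.
move=> oU Cf; apply: Ck_ext (CkM oU (Ck_cst _ (-1) oU) Cf) => // x _.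
by rewrite mulN1r.
Qed.

Lemma CkV U k f : open U -> (forall x, U x -> f x != 0) -> Ck U k f ->
  Ck U k (fun x => (f x)^-1).
Proof.
move=> oU f0; elim: k => [|k IH] Cf; split=> //.
- by move=> x Ux; apply: cvgV; [exact: f0|exact: (Ck_cont Ux Cf)].
- by move=> x Ux; apply: cvgV; [exact: f0|exact: (Ck_cont Ux Cf)].
- move=> X; have [dfX CfX] := Cf.2 X; split.
    by move=> x Ux; apply: derivableV; [exact: f0|exact: dfX].
  have C1 := IH (CkS Cf).
  apply: Ck_ext (CkM oU (CkN oU (CkM oU C1 C1)) CfX) => // x Ux.
  by rewrite deriveV; [rewrite -exprVn expr2|exact: f0|exact: dfX].
Qed.

(** Restricting [f] to the line through [x] in the direction [X] reduces this chain rule to the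
    one-variable one. It serves the square root in the area density. *)
Lemma is_derive_compR (h : R -> R) (dh : R) f x X :
  is_derive (f x) 1 h dh -> derivable f x X ->
  is_derive x X (fun y => h (f y)) ('D_X f x * dh).
Proof.
move=> [hh hd] df.
have E : (fun t : R => h (f (t *: X + x))) = h \o (fun t => f (t *: X + x)).
  by [].
have df' : derivable (fun t : R => f (t *: X + x)) 0 1.
  have := (derivable1P f x X).1 df; rewrite /= => H.
  by apply: H.
have f0 : f (0 *: X + x) = f x by rewrite scale0r add0r.
have hh' : derivable h (f (0 *: X + x)) 1 by rewrite f0.
have dfE : derive1 (fun t : R => f (t *: X + x)) 0 = 'D_X f x.
  rewrite derive1E /derive /=; congr (lim (_ @ 0^')); apply/funext => h'.
  by rewrite /= addr0 scale0r add0r [h' *: 1]mulr1.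
split.
  apply/derivable1P; rewrite /= -/(h \o (fun t => f (t *: X + x))).
  apply/derivable1_diffP; apply: differentiable_comp.
    by apply/derivable1_diffP.
  by apply/derivable1_diffP.
have := derive1_comp df' hh'; rewrite f0 dfE (derive1E h) hd mulrC => <-.
rewrite derive1E /derive /=; congr (lim (_ @ 0^')); apply/funext => h'.
by rewrite /= addr0 scale0r add0r [h' *: 1]mulr1.
Qed.

Lemma Ck_sqrt U k f : open U -> (forall x, U x -> 0 < f x) -> Ck U k f ->
  Ck U k (fun x => Num.sqrt (f x)).
Proof.
move=> oU f0; elim: k => [|k IH] Cf; split=> //.
- move=> x Ux; apply: (continuous_comp (Ck_cont Ux Cf)); exact: sqrt_continuous.
- move=> x Ux; apply: (continuous_comp (Ck_cont Ux Cf)); exact: sqrt_continuous.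
- move=> X; have [dfX CfX] := Cf.2 X; split.
    move=> x Ux.
    by case: (is_derive_compR (is_derive1_sqrt (f0 x Ux)) (dfX x Ux)).
  have C1 := IH (CkS Cf).
  have s0 x : U x -> 2 * Num.sqrt (f x) != 0.
    by move=> Ux; rewrite mulf_neq0 // gt_eqF // sqrtr_gt0 f0.
  apply: Ck_ext (CkM oU CfX (CkV oU s0 (CkM oU (Ck_cst _ 2 oU) C1))) => // x Ux.
  by case: (is_derive_compR (is_derive1_sqrt (f0 x Ux)) (dfX x Ux)) => _ ->.
Qed.

End RealCalculus.

(** * Mean value arguments: linearity in the direction, symmetry of mixed derivatives *)

Section MeanValue.
Context {R : realType}.
Local Notation pt := (R * R)%type.
Implicit Types (U : set pt) (f g : pt -> R) (x y X Y : pt).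

Lemma line_growth_rate f y Y (t : R) :
  (fun h : R => h^-1 *: (f ((h *: 1 + t) *: Y + y) - f (t *: Y + y))) =
  (fun h : R => h^-1 *: (f (h *: Y + (t *: Y + y)) - f (t *: Y + y))).
Proof. by apply/funext => h; rewrite [h *: 1]mulr1 scalerDl -addrA. Qed.

Lemma line_is_derive f y Y (t : R) : derivable f (t *: Y + y) Y ->
  is_derive t 1 (fun t : R => f (t *: Y + y)) ('D_Y f (t *: Y + y)).
Proof.
by move=> df; split; rewrite /derivable /derive /= line_growth_rate.
Qed.

Lemma line_MVT f y Y (k : R) : 0 < k ->
  (forall t, 0 <= t <= k -> derivable f (t *: Y + y) Y) ->
  exists2 c, 0 <= c <= k & f (k *: Y + y) - f y = 'D_Y f (c *: Y + y) * k.
Proof.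
move=> k0 df; pose phi (t : R) := f (t *: Y + y).
have dphi t : 0 <= t <= k -> is_derive t 1 phi ('D_Y f (t *: Y + y)).
  by move=> tk; exact/line_is_derive/df.
have [||c ck E] := @MVT R phi (fun t => 'D_Y f (t *: Y + y)) 0 k k0.
- by move=> t; rewrite in_itv /= => /andP[? ?]; apply: dphi; rewrite !ltW.
- apply: derivable_within_continuous => t; rewrite in_itv /= => tk.
  by case: (dphi t tk).
exists c; first by move: ck; rewrite in_itv /= => /andP[/ltW -> /ltW ->].
by move: E; rewrite /phi scale0r add0r subr0.
Qed.

Lemma shift_is_derive f y X w : derivable f (y + w) X ->
  is_derive y X (fun z => f (z + w)) ('D_X f (y + w)).
Proof.
move=> df.
have E : (fun h : R => h^-1 *: (f (h *: X + y + w) - f (y + w))) =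
         (fun h : R => h^-1 *: (f (h *: X + (y + w)) - f (y + w))).
  by apply/funext => h; rewrite -addrA.
by split; rewrite /derivable /derive /= E.
Qed.

(** Uniform control on a small parallelogram with sides along [X] and [Y], where the mean value
    theorem is then applied side by side. *)
Lemma near_small_box U g x X Y (e : R) : open U -> U x -> 0 < e ->
  {for x, continuous g} ->
  \forall h \near 0^'+, forall c c', 0 <= c <= h -> 0 <= c' <= h ->
    U (c *: Y + (c' *: X + x)) /\ `|g (c *: Y + (c' *: X + x)) - g x| < e.
Proof.
move=> oU Ux e0 cg.
have N1 : nbhs x U by exact: open_nbhs_nbhs.
have N2 : nbhs x [set y | `|g y - g x| < e].
  move/cvgrPdist_lt: cg => /(_ e e0); apply: filterS => y /=.
  by rewrite distrC.
have [d /= d0 Bd] : exists2 d : R, 0 < d &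
    forall y, ball x d y -> U y /\ `|g y - g x| < e.
  have /nbhs_ballP [d d0 Bd] : nbhs x (U `&` [set y | `|g y - g x| < e]) by exact: filterI.
  by exists d => // y /Bd [].
pose nX : R := `|(X : (R * R : normedModType R)%type)|.
pose nY : R := `|(Y : (R * R : normedModType R)%type)|.
pose M := nX + nY + 1.
have nX0 : 0 <= nX by exact: normr_ge0.
have nY0 : 0 <= nY by exact: normr_ge0.
have M0 : 0 < M by rewrite /M; lra.
near=> h => c c' /andP[c0 ch] /andP[c'0 c'h].
have h0 : 0 < h by near: h; exact: nbhs_right_gt.
have hd : h < d / M by near: h; apply: nbhs_right_lt; rewrite divr_gt0.
suff : ball x d (c *: Y + (c' *: X + x)) by move/Bd => [].
rewrite -ball_normE /= -opprB normrN addrA addrK.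
apply: le_lt_trans (ler_normD _ _) _; rewrite !normrZ !ger0_norm //.
apply: (@le_lt_trans _ _ (h * M)); last by rewrite -ltr_pdivlMr.
have cY : c * nY <= h * nY by rewrite ler_wpM2r.
have cX : c' * nX <= h * nX by rewrite ler_wpM2r.
apply: (le_trans (lerD cY cX)).
by rewrite /M !mulrDr mulr1 [h * nX + _]addrC lerDl ltW.
Unshelve. all: by end_near. Qed.

Lemma dist_add_le (a b A B D e : R) : `|b + a - D| < e / 3 ->
  `|a - A| < e / 3 -> `|b - B| < e / 3 -> `|D - (A + B)| <= e.
Proof.
rewrite !ltr_norml ler_norml => /andP[? ?] /andP[? ?] /andP[? ?].
by apply/andP; split; lra.
Qed.

Lemma dist_half_le (a A B e : R) : `|a - B| < e / 2 -> `|a - A| < e / 2 ->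
  `|A - B| <= e.
Proof.
rewrite !ltr_norml ler_norml => /andP[? ?] /andP[? ?].
by apply/andP; split; lra.
Qed.

(** [Ck] only speaks of directional derivatives, so additivity in the direction has to be earned: an
    increment along [X + Y] is one along [X] followed by one along [Y], and continuity of ['D_Y f]
    moves the latter back to [x]. *)
Lemma deriveDdir U f x X Y : open U -> U x -> Ck U 1 f ->
  'D_(X + Y) f x = 'D_X f x + 'D_Y f x.
Proof.
move=> oU Ux [_ df].
apply/eqP; rewrite -subr_eq0 -normr_le0; apply/ler_addgt0Pr => e e0.
rewrite add0r.
have e3 : 0 < e / 3 by rewrite divr_gt0.
have nq Z : \forall h \near 0^'+,
    `|h^-1 *: (f (h *: Z + x) - f x) - 'D_Z f x| < e / 3.
  have : (fun h : R => h^-1 *: (f (h *: Z + x) - f x)) @ 0^'+ -->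
    'D_Z f x.
    by apply: cvg_dnbhs_at_right; exact: ((df Z).1 x Ux).
  move/cvgrPdist_lt => /(_ _ e3); apply: filterS => h /=.
  by rewrite distrC.
have cY : {for x, continuous (fun y => 'D_Y f y)} by exact: ((df Y).2.1 x Ux).
have nb := near_small_box X Y oU Ux e3 cY.
have [h [[[h0 q1] q2] box]] : exists h : R, ((0 < h /\
    `|h^-1 *: (f (h *: (X + Y) + x) - f x) - 'D_(X + Y) f x| < e / 3) /\
    `|h^-1 *: (f (h *: X + x) - f x) - 'D_X f x| < e / 3) /\
    forall c c', 0 <= c <= h -> 0 <= c' <= h ->
      U (c *: Y + (c' *: X + x)) /\
      `|'D_Y f (c *: Y + (c' *: X + x)) - 'D_Y f x| < e / 3.
  exact: filter_ex (filterI (filterI (filterI (nbhs_right_gt 0) (nq (X + Y)))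
    (nq X)) nb).
have hh : 0 <= h <= h by rewrite lexx ltW.
have [c ch Ec] := @line_MVT f (h *: X + x) Y h h0
  (fun t th => (df Y).1 _ (box t h th hh).1).
have [_ q3] := box c h ch hh.
have E : h^-1 *: (f (h *: (X + Y) + x) - f x) =
    'D_Y f (c *: Y + (h *: X + x)) + h^-1 *: (f (h *: X + x) - f x).
  have -> : 'D_Y f (c *: Y + (h *: X + x)) =
      h^-1 *: (f (h *: Y + (h *: X + x)) - f (h *: X + x)).
    by rewrite Ec /GRing.scale /= mulrCA mulVf ?mulr1 // gt_eqF.
  have -> : h *: (X + Y) + x = h *: Y + (h *: X + x).
    by rewrite scalerDr -addrA addrCA.
  by rewrite -scalerDr; congr (_ *: _); ring.
by move: q1; rewrite E => q1; exact: dist_add_le q1 q2 q3.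
Qed.

Lemma deriveZdir f x X (a : R) : derivable f x X ->
  'D_(a *: X) f x = a * 'D_X f x.
Proof.
move=> df; have [->|a0] := eqVneq a 0; first by rewrite scale0r mul0r derive0.
pose phi (t : R) := f (t *: X + x).
have phi1 : is_derive (a * 0) (1 : R) phi ('D_X f x).
  have fx : derivable f ((a * 0) *: X + x) X by rewrite mulr0 scale0r add0r.
  have := line_is_derive fx.
  by rewrite {2}mulr0 scale0r add0r.
have [dphi Dphi] := phi1.
have [da Da] : is_derive (0 : R) (1 : R) (fun t : R => a * t : R) a.
  by apply: is_derive_eq; rewrite [a *: 1]mulr1.
have := @derive1_comp R (fun t => a * t) phi 0 da dphi.
rewrite !derive1E Dphi Da mulrC => <-.
rewrite /derive /=; congr (lim (_ @ 0^')); apply/funext => h.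
by rewrite /phi /= mulr0 addr0 scale0r add0r [h *: 1]mulr1 scalerA [h * a]mulrC.
Qed.

(** The theorem of Schwarz: one second difference over a small parallelogram is evaluated by the
    mean value theorem in both orders. *)
Lemma derive_comm U f x X Y : open U -> U x -> Ck U 2 f ->
  'D_X (fun y => 'D_Y f y) x = 'D_Y (fun y => 'D_X f y) x.
Proof.
move=> oU Ux [_ df].
apply/eqP; rewrite -subr_eq0 -normr_le0; apply/ler_addgt0Pr => e e0.
rewrite add0r.
have e2 : 0 < e / 2 by rewrite divr_gt0.
have C2 Z W : {for x, continuous (fun y => 'D_Z (fun y => 'D_W f y) y)}.
  exact: (((df W).2.2 Z).2.1 x Ux).
have nb1 := near_small_box X Y oU Ux e2 (C2 X Y).
have nb2 := near_small_box X Y oU Ux e2 (C2 Y X).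
have [h [[h0 B1] B2]] : exists h : R, (0 < h /\
    forall c c', 0 <= c <= h -> 0 <= c' <= h ->
      U (c *: Y + (c' *: X + x)) /\
      `|'D_X (fun y => 'D_Y f y) (c *: Y + (c' *: X + x)) -
        'D_X (fun y => 'D_Y f y) x| < e / 2) /\
    forall c c', 0 <= c <= h -> 0 <= c' <= h ->
      U (c *: Y + (c' *: X + x)) /\
      `|'D_Y (fun y => 'D_X f y) (c *: Y + (c' *: X + x)) -
        'D_Y (fun y => 'D_X f y) x| < e / 2.
  exact: filter_ex (filterI (filterI (nbhs_right_gt 0) nb1) nb2).
have hh : 0 <= h <= h by rewrite lexx ltW.
have h00 : 0 <= (0 : R) <= h by rewrite lexx ltW.
have inU c c' : 0 <= c <= h -> 0 <= c' <= h -> U (c *: Y + (c' *: X + x)).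
  by move=> ch c'h; case: (B1 c c' ch c'h).
have inU' c c' : 0 <= c <= h -> 0 <= c' <= h -> U (c' *: X + (c *: Y + x)).
  by move=> ch c'h; rewrite addrCA; exact: inU.
have inUX t : 0 <= t <= h -> U (t *: X + x).
  by move=> th; have := inU 0 t h00 th; rewrite scale0r add0r.
have inUY t : 0 <= t <= h -> U (t *: Y + x).
  by move=> th; have := inU t 0 th h00; rewrite scale0r add0r.
(* both iterated derivatives approximate this second difference *)
pose D := f (h *: Y + (h *: X + x)) - f (h *: X + x) - (f (h *: Y + x) - f x).
have [c1 [c2 [c1h c2h E1]]] : exists c1 c2, [/\ 0 <= c1 <= h, 0 <= c2 <= h &
    D = 'D_Y (fun y => 'D_X f y) (c2 *: Y + (c1 *: X + x)) * h * h].
  pose g y := f (y + h *: Y) - f y.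
  have dg t : 0 <= t <= h -> is_derive (t *: X + x) X g
      ('D_X f (h *: Y + (t *: X + x)) - 'D_X f (t *: X + x)).
    move=> th; rewrite [h *: Y + _]addrC; apply: is_deriveB.
      by apply: shift_is_derive; rewrite addrC; apply: (df X).1; exact: inU.
    by apply: derivableP; apply: (df X).1; exact: inUX.
  have [c1 c1h E1] := @line_MVT g x X h h0 (fun t th => @ex_derive _ _ _ _ _ _ _ (dg t th)).
  have [c2 c2h E2] := @line_MVT (fun y => 'D_X f y) (c1 *: X + x) Y h h0
    (fun t th => ((df X).2.2 Y).1 _ (inU t c1 th c1h)).
  exists c1, c2; split=> //; rewrite -E2.
  case: (dg c1 c1h) => _ <-; rewrite -E1 /g /D.
  by rewrite ![_ + h *: Y]addrC.
have [c3 [c4 [c3h c4h E2]]] : exists c3 c4, [/\ 0 <= c3 <= h, 0 <= c4 <= h &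
    D = 'D_X (fun y => 'D_Y f y) (c3 *: Y + (c4 *: X + x)) * h * h].
  pose g y := f (y + h *: X) - f y.
  have dg t : 0 <= t <= h -> is_derive (t *: Y + x) Y g
      ('D_Y f (h *: X + (t *: Y + x)) - 'D_Y f (t *: Y + x)).
    move=> th; rewrite [h *: X + _]addrC; apply: is_deriveB.
      by apply: shift_is_derive; rewrite addrC; apply: (df Y).1; exact: inU'.
    by apply: derivableP; apply: (df Y).1; exact: inUY.
  have [c3 c3h E1'] := @line_MVT g x Y h h0 (fun t th => @ex_derive _ _ _ _ _ _ _ (dg t th)).
  have [c4 c4h E2'] := @line_MVT (fun y => 'D_Y f y) (c3 *: Y + x) X h h0
    (fun t th => ((df Y).2.2 X).1 _ (inU' c3 t c3h th)).
  exists c3, c4; split; [exact: c3h|exact: c4h|]; rewrite -(addrCA (c4 *: X)) -E2'.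
  case: (dg c3 c3h) => _ <-; rewrite -E1' /g /D.
  rewrite (addrC (h *: Y + x)) (addrC x) (addrCA (h *: X)).
  have sub4 (a b c d : R) : a - b - (c - d) = a - c - (b - d) by ring.
  exact: sub4.
have E : 'D_X (fun y => 'D_Y f y) (c3 *: Y + (c4 *: X + x)) =
         'D_Y (fun y => 'D_X f y) (c2 *: Y + (c1 *: X + x)).
  by move: E1; rewrite E2 => /mulIf H; have /mulIf := H (lt0r_neq0 h0); apply; exact: lt0r_neq0.
have := (B1 _ _ c3h c4h).2; rewrite E => b1.
by have := dist_half_le (B2 _ _ c2h c1h).2 b1; rewrite distrC.
Qed.

End MeanValue.

(** * Smooth complex-valued functions *)

Section ComplexCalculus.
Context {R : realType}.
Local Notation C := R[i].
Local Notation pt := (R * R)%type.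
Implicit Types (U : set pt) (f g : pt -> C) (x y X Y : pt) (a b c : C).

Lemma complex_ext a b : complex.Re a = complex.Re b ->
  complex.Im a = complex.Im b -> a = b.
Proof. by case: a b => [? ?] [? ?] /= -> ->. Qed.

Lemma ReD a b : complex.Re (a + b) = complex.Re a + complex.Re b.
Proof. by case: a b => [? ?] [? ?]. Qed.
Lemma ImD a b : complex.Im (a + b) = complex.Im a + complex.Im b.
Proof. by case: a b => [? ?] [? ?]. Qed.
Lemma ReM a b : complex.Re (a * b) =
  complex.Re a * complex.Re b - complex.Im a * complex.Im b.
Proof. by case: a b => [? ?] [? ?]. Qed.
Lemma ImM a b : complex.Im (a * b) =
  complex.Re a * complex.Im b + complex.Im a * complex.Re b.
Proof. by case: a b => [? ?] [? ?]. Qed.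
Lemma Re_conjc a : complex.Re (conjc a) = complex.Re a.
Proof. by case: a. Qed.
Lemma Im_conjc a : complex.Im (conjc a) = - complex.Im a.
Proof. by case: a. Qed.

Lemma complex_leibniz a b (p q r s : R) :
  ((complex.Re a *: p + complex.Re b *: q -
   (complex.Im a *: r + complex.Im b *: s)) +i*
   (complex.Re a *: r + complex.Im b *: q +
    (complex.Im a *: p + complex.Re b *: s)))%C =
  (q +i* s)%C * b + a * (p +i* r)%C.
Proof.
case: a b => [? ?] [? ?].
by apply: complex_ext; rewrite !(ReD, ImD, ReM, ImM) /= /GRing.scale /=; ring.
Qed.

Lemma complex_lin (u v p q r s : R) :
  ((u * p + v * q) +i* (u * r + v * s))%C =
  u%:C%C * (p +i* r)%C + v%:C%C * (q +i* s)%C.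
Proof. by apply: complex_ext; rewrite !(ReD, ImD, ReM, ImM) /=; ring. Qed.

Definition csmooth U f := forall r : nat,
  Ck U r (fun x => complex.Re (f x)) /\ Ck U r (fun x => complex.Im (f x)).

Definition cder f x X : C :=
  ('D_X (fun y => complex.Re (f y)) x +i* 'D_X (fun y => complex.Im (f y)) x)%C.

Section Rules.
Context {U : set pt} (oU : open U).

Lemma csmooth_ext f g : (forall x, U x -> f x = g x) ->
  csmooth U f -> csmooth U g.
Proof.
move=> fg Cf r; have [C1 C2] := Cf r.
by split; [apply: Ck_ext C1|apply: Ck_ext C2] => // x Ux; rewrite fg.
Qed.

Lemma csmooth_real (f : pt -> R) : (forall r, Ck U r f) ->
  csmooth U (fun x => (f x)%:C%C).
Proof. by move=> Cf r; split => //=; exact: Ck_cst. Qed.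

Lemma csmooth_cst c : csmooth U (fun=> c).
Proof. by move=> r; split; exact: Ck_cst. Qed.

Lemma csmoothD f g : csmooth U f -> csmooth U g -> csmooth U (fun x => f x + g x).
Proof.
move=> Cf Cg r; have [C1 C2] := Cf r; have [C3 C4] := Cg r; split.
  by apply: Ck_ext (CkD oU C1 C3) => // x _; rewrite ReD.
by apply: Ck_ext (CkD oU C2 C4) => // x _; rewrite ImD.
Qed.

Lemma csmoothM f g : csmooth U f -> csmooth U g -> csmooth U (fun x => f x * g x).
Proof.
move=> Cf Cg r; have [C1 C2] := Cf r; have [C3 C4] := Cg r; split.
  apply: Ck_ext (CkD oU (CkM oU C1 C3) (CkN oU (CkM oU C2 C4))) => // x _.
  by rewrite ReM.
apply: Ck_ext (CkD oU (CkM oU C1 C4) (CkM oU C2 C3)) => // x _.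
by rewrite ImM.
Qed.

Lemma csmooth_conj f : csmooth U f -> csmooth U (fun x => conjc (f x)).
Proof.
move=> Cf r; have [C1 C2] := Cf r; split.
  by apply: Ck_ext C1 => // x _; rewrite Re_conjc.
by apply: Ck_ext (CkN oU C2) => // x _; rewrite Im_conjc.
Qed.

(** The inverse is the conjugate divided by the squared modulus, a nowhere zero real function. *)
Lemma csmoothV f : (forall x, U x -> f x != 0) -> csmooth U f ->
  csmooth U (fun x => (f x)^-1).
Proof.
move=> f0 Cf.
pose N x := complex.Re (f x) * complex.Re (f x) + complex.Im (f x) * complex.Im (f x).
have N0 x : U x -> N x != 0.
  move/f0; rewrite /N; case: (f x) => a b /= ab0; apply: contra ab0.
  rewrite paddr_eq0 ?sqr_ge0 // -?expr2 ?sqr_ge0 // !sqrf_eq0.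
  by move=> /andP[/eqP -> /eqP ->].
have CN r : Ck U r N.
  by have [C1 C2] := Cf r; exact: CkD oU (CkM oU C1 C1) (CkM oU C2 C2).
have CV r := CkV oU N0 (CN r).
apply: csmooth_ext (csmoothM (csmooth_conj Cf) (csmooth_real CV)) => x Ux.
apply: (mulIf (f0 x Ux)); rewrite mulVf ?f0 //.
have := N0 x Ux; rewrite /N; case: (f x) => a b /= ab0.
by apply: complex_ext; rewrite !(ReM, ImM) /=; field.
Qed.

Lemma csmooth_sum (I : Type) (r : seq I) (P : pred I) (f : I -> pt -> C) :
  (forall i, P i -> csmooth U (f i)) ->
  csmooth U (fun x => \sum_(i <- r | P i) f i x).
Proof.
move=> Cf; elim: r => [|i r IH].
  by apply: csmooth_ext (csmooth_cst 0) => x _; rewrite big_nil.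
case Pi : (P i).
  apply: csmooth_ext (csmoothD (Cf i Pi) IH) => x _.
  by rewrite big_cons Pi.
by apply: csmooth_ext IH => x _; rewrite big_cons Pi.
Qed.

Lemma csmooth_prod (I : Type) (r : seq I) (f : I -> pt -> C) :
  (forall i, csmooth U (f i)) -> csmooth U (fun x => \prod_(i <- r) f i x).
Proof.
move=> Cf; elim: r => [|i r IH].
  by apply: csmooth_ext (csmooth_cst 1) => x _; rewrite big_nil.
by apply: csmooth_ext (csmoothM (Cf i) IH) => x _; rewrite big_cons.
Qed.

Lemma csmooth_cder f X : csmooth U f -> csmooth U (fun x => cder f x X).
Proof. by move=> Cf r; have [[_ C1] [_ C2]] := Cf r.+1; split; [case: (C1 X)|case: (C2 X)]. Qed.

Section At.
Context {x : pt} (Ux : U x).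

Lemma derivable_Re f X : csmooth U f -> derivable (fun x => complex.Re (f x)) x X.
Proof. by move=> /(_ 1) [[_ /(_ X) [+ _]] _]; apply. Qed.
Lemma derivable_Im f X : csmooth U f -> derivable (fun x => complex.Im (f x)) x X.
Proof. by move=> /(_ 1) [_ [_ /(_ X) [+ _]]]; apply. Qed.

Lemma cder_ext f g X : (forall x, U x -> f x = g x) -> cder f x X = cder g x X.
Proof.
move=> fg; congr (_ +i* _)%C; apply: near_eq_derive;
  by apply: open_near oU Ux _ => y Uy; rewrite fg.
Qed.

Lemma cder_cst c X : cder (fun=> c) x X = 0.
Proof. by rewrite /cder !derive_cst. Qed.

Lemma cderD f g X : csmooth U f -> csmooth U g ->
  cder (fun x => f x + g x) x X = cder f x X + cder g x X.
Proof.
move=> Cf Cg; rewrite /cder.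
under eq_fun do rewrite ReD; under [in X in (_ +i* X)%C]eq_fun do rewrite ImD.
have -> := deriveD (derivable_Re (X := X) Cf) (derivable_Re (X := X) Cg).
by have -> := deriveD (derivable_Im (X := X) Cf) (derivable_Im (X := X) Cg).
Qed.

Lemma cderM f g X : csmooth U f -> csmooth U g ->
  cder (fun x => f x * g x) x X = cder f x X * g x + f x * cder g x X.
Proof.
move=> Cf Cg; rewrite /cder.
have rf := derivable_Re (X := X) Cf; have jf := derivable_Im (X := X) Cf.
have rg := derivable_Re (X := X) Cg; have jg := derivable_Im (X := X) Cg.
under eq_fun do rewrite ReM; under [in X in (_ +i* X)%C]eq_fun do rewrite ImM.
have -> := deriveB (derivableM rf rg) (derivableM jf jg).
have -> := deriveD (derivableM rf jg) (derivableM jf rg).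
rewrite (deriveM rf rg) (deriveM jf jg) (deriveM rf jg) (deriveM jf rg).
exact: complex_leibniz.
Qed.

Lemma cder_conj f X : csmooth U f ->
  cder (fun x => conjc (f x)) x X = conjc (cder f x X).
Proof.
move=> Cf; rewrite /cder.
under eq_fun do rewrite Re_conjc.
under [in X in (_ +i* X)%C]eq_fun do rewrite Im_conjc.
by have -> := deriveN (derivable_Im (X := X) Cf).
Qed.

Lemma cder_lin f (a b : R) X Y : csmooth U f ->
  cder f x (a *: X + b *: Y) = a%:C%C * cder f x X + b%:C%C * cder f x Y.
Proof.
move=> Cf; rewrite /cder -complex_lin.
rewrite (deriveDdir _ _ oU Ux (Cf 1).1) (deriveDdir _ _ oU Ux (Cf 1).2).
by rewrite !deriveZdir; [|exact: derivable_Im|exact: derivable_Im|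
  exact: derivable_Re|exact: derivable_Re].
Qed.

Lemma cder_comm f X Y : csmooth U f ->
  cder (fun y => cder f y X) x Y = cder (fun y => cder f y Y) x X.
Proof.
move=> Cf; have [C1 C2] := Cf 2.
exact: (congr2 (@Complex R) (derive_comm Y X oU Ux C1) (derive_comm Y X oU Ux C2)).
Qed.

Lemma cder_sum (I : Type) (r : seq I) (f : I -> pt -> C) X :
  (forall i, csmooth U (f i)) ->
  cder (fun x => \sum_(i <- r) f i x) x X = \sum_(i <- r) cder (f i) x X.
Proof.
move=> Cf; elim: r => [|i r IH].
  by rewrite big_nil; under eq_fun do rewrite big_nil; exact: cder_cst.
rewrite big_cons -IH -cderD //; last exact: csmooth_sum.
by apply: cder_ext => y _; rewrite big_cons.
Qed.

End At.
End Rules.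
End ComplexCalculus.

(** * Smooth matrix-valued functions *)

Section MatrixCalculus.
Context {R : realType} {U : set (R * R)} (oU : open U).
Local Notation C := R[i].
Local Notation pt := (R * R)%type.
Implicit Types (x y X Y : pt).

Lemma smoothP {m k} (A : pt -> 'M[C]_(m, k)) :
  smooth U A <-> forall i j, csmooth U (fun x => A x i j).
Proof. by split=> H; [move=> i j r; exact: H|move=> r i j; exact: H]. Qed.

Lemma derE {m k} (A : pt -> 'M[C]_(m, k)) x X i j :
  der A x X i j = cder (fun y => A y i j) x X.
Proof. by rewrite mxE. Qed.

Lemma smooth_ext {m k} (A B : pt -> 'M[C]_(m, k)) :
  (forall x, U x -> A x = B x) -> smooth U A -> smooth U B.
Proof.
move=> AB /smoothP CA; apply/smoothP => i j.
by apply: csmooth_ext (CA i j) => // x Ux; rewrite AB.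
Qed.

Lemma smooth_cst {m k} (A : 'M[C]_(m, k)) : smooth U (fun=> A).
Proof. by apply/smoothP => i j; exact: csmooth_cst. Qed.

Lemma smoothD {m k} (A B : pt -> 'M[C]_(m, k)) :
  smooth U A -> smooth U B -> smooth U (fun x => A x + B x).
Proof.
move=> /smoothP CA /smoothP CB; apply/smoothP => i j.
by apply: csmooth_ext (csmoothD oU (CA i j) (CB i j)) => // x _; rewrite mxE.
Qed.

Lemma smoothZ {m k} (f : pt -> C) (A : pt -> 'M[C]_(m, k)) :
  csmooth U f -> smooth U A -> smooth U (fun x => f x *: A x).
Proof.
move=> Cf /smoothP CA; apply/smoothP => i j.
by apply: csmooth_ext (csmoothM oU Cf (CA i j)) => // x _; rewrite mxE.
Qed.

Lemma smoothZc {m k} (c : C) (A : pt -> 'M[C]_(m, k)) :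
  smooth U A -> smooth U (fun x => c *: A x).
Proof. by apply: smoothZ; exact: csmooth_cst. Qed.

Lemma smoothN {m k} (A : pt -> 'M[C]_(m, k)) :
  smooth U A -> smooth U (fun x => - A x).
Proof. by move/(smoothZc (-1)); apply: smooth_ext => x _; rewrite scaleN1r. Qed.

Lemma smoothB {m k} (A B : pt -> 'M[C]_(m, k)) :
  smooth U A -> smooth U B -> smooth U (fun x => A x - B x).
Proof. by move=> CA CB; apply: smoothD => //; exact: smoothN. Qed.

Lemma smooth_sum {m k} (I : Type) (r : seq I) (P : pred I)
    (A : I -> pt -> 'M[C]_(m, k)) :
  (forall i, P i -> smooth U (A i)) -> smooth U (fun x => \sum_(i <- r | P i) A i x).
Proof.
move=> CA; apply/smoothP => i j.
apply: (csmooth_ext oU (f := fun x => \sum_(l <- r | P l) A l x i j)).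
  by move=> x _; rewrite summxE.
by apply: csmooth_sum => // l Pl; exact: (smoothP _).1 (CA l Pl) i j.
Qed.

Lemma smoothM {m k l} (A : pt -> 'M[C]_(m, k)) (B : pt -> 'M[C]_(k, l)) :
  smooth U A -> smooth U B -> smooth U (fun x => A x *m B x).
Proof.
move=> /smoothP CA /smoothP CB; apply/smoothP => i j.
apply: (csmooth_ext oU (f := fun x => \sum_l' A x i l' * B x l' j)).
  by move=> x _; rewrite mxE.
by apply: csmooth_sum => // l' _; exact: csmoothM.
Qed.

Lemma smooth_tr {m k} (A : pt -> 'M[C]_(m, k)) :
  smooth U A -> smooth U (fun x => (A x)^T).
Proof.
move=> /smoothP CA; apply/smoothP => i j.
by apply: csmooth_ext (CA j i) => // x _; rewrite mxE.
Qed.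

Lemma smooth_conjm {m k} (A : pt -> 'M[C]_(m, k)) :
  smooth U A -> smooth U (fun x => conjm (A x)).
Proof.
move=> /smoothP CA; apply/smoothP => i j.
by apply: csmooth_ext (csmooth_conj oU (CA i j)) => // x _; rewrite mxE.
Qed.

Lemma smooth_der {m k} (A : pt -> 'M[C]_(m, k)) X :
  smooth U A -> smooth U (fun x => der A x X).
Proof.
move=> /smoothP CA; apply/smoothP => i j.
by apply: csmooth_ext (csmooth_cder X (CA i j)) => // x _; rewrite derE.
Qed.

Lemma csmooth_det {k} (A : pt -> 'M[C]_k) :
  smooth U A -> csmooth U (fun x => \det (A x)).
Proof.
move=> /smoothP CA; apply: csmooth_sum => // s _.
apply: csmoothM => //; first exact: csmooth_cst.
exact: csmooth_prod.
Qed.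

(** By Cramer's rule: cofactors and determinant are polynomials in the entries. *)
Lemma smooth_invmx {k} (A : pt -> 'M[C]_k) :
  (forall x, U x -> A x \in unitmx) -> smooth U A ->
  smooth U (fun x => invmx (A x)).
Proof.
move=> uA CA.
have E x : U x -> (\det (A x))^-1 *: \adj (A x) = invmx (A x).
  by move=> Ux; rewrite /invmx (uA x Ux).
apply: (smooth_ext E); apply: smoothZ.
  have d0 x : U x -> \det (A x) != 0.
    by move=> Ux; have := uA x Ux; rewrite unitmxE unitfE.
  exact: (csmoothV oU d0 (csmooth_det CA)).
apply/smoothP => i j.
apply: (@csmooth_ext _ _ oU (fun x => cofactor (A x) j i)).
  by move=> x _; rewrite mxE.
apply: csmoothM => //; first exact: csmooth_cst.
apply: csmooth_det; apply/smoothP => i' j'.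
move/smoothP: CA => CA.
by apply: csmooth_ext (CA (lift j i') (lift i j')) => // x _; rewrite !mxE.
Qed.

Lemma csmooth_trace1 (A : pt -> 'M[C]_1) : smooth U A ->
  csmooth U (fun x => A x 0 0).
Proof. by move/smoothP; exact. Qed.

Section At.
Context {x : pt} (Ux : U x).

Lemma der_ext {m k} (A B : pt -> 'M[C]_(m, k)) X :
  (forall x, U x -> A x = B x) -> der A x X = der B x X.
Proof.
move=> AB; apply/matrixP => i j; rewrite !derE.
by apply: (cder_ext oU Ux) => y Uy; rewrite AB.
Qed.

Lemma der_cst {m k} (A : 'M[C]_(m, k)) X : der (fun=> A) x X = 0.
Proof. by apply/matrixP => i j; rewrite derE cder_cst mxE. Qed.

Lemma derD {m k} (A B : pt -> 'M[C]_(m, k)) X : smooth U A -> smooth U B ->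
  der (fun x => A x + B x) x X = der A x X + der B x X.
Proof.
move=> /smoothP CA /smoothP CB; apply/matrixP => i j.
rewrite derE [RHS]mxE !derE -(cderD Ux) //.
by apply: (cder_ext oU Ux) => y _; rewrite mxE.
Qed.

Lemma derZ {m k} (f : pt -> C) (A : pt -> 'M[C]_(m, k)) X :
  csmooth U f -> smooth U A ->
  der (fun x => f x *: A x) x X = cder f x X *: A x + f x *: der A x X.
Proof.
move=> Cf /smoothP CA; apply/matrixP => i j; rewrite derE [RHS]mxE ![in RHS]mxE.
rewrite -!/(cder _ _ _) -(cderM Ux) //.
by apply: (cder_ext oU Ux) => y _; rewrite mxE.
Qed.

Lemma derZc {m k} (c : C) (A : pt -> 'M[C]_(m, k)) X : smooth U A ->
  der (fun x => c *: A x) x X = c *: der A x X.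
Proof.
by move=> CA; rewrite derZ //; [rewrite cder_cst scale0r add0r|exact: csmooth_cst].
Qed.

Lemma derN {m k} (A : pt -> 'M[C]_(m, k)) X : smooth U A ->
  der (fun x => - A x) x X = - der A x X.
Proof.
move=> CA; rewrite -scaleN1r -derZc //; apply: der_ext => y _.
by rewrite scaleN1r.
Qed.

Lemma derB {m k} (A B : pt -> 'M[C]_(m, k)) X : smooth U A -> smooth U B ->
  der (fun x => A x - B x) x X = der A x X - der B x X.
Proof. by move=> CA CB; rewrite derD ?derN //; exact: smoothN. Qed.

Lemma derM {m k l} (A : pt -> 'M[C]_(m, k)) (B : pt -> 'M[C]_(k, l)) X :
  smooth U A -> smooth U B ->
  der (fun x => A x *m B x) x X = der A x X *m B x + A x *m der B x X.
Proof.
move=> /smoothP CA /smoothP CB; apply/matrixP => i j.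
rewrite derE [RHS]mxE ![in RHS]mxE -big_split /=.
under eq_bigr do rewrite !derE -(cderM Ux) //.
rewrite -(cder_sum oU Ux); last by move=> l'; exact: csmoothM.
by apply: (cder_ext oU Ux) => y _; rewrite mxE.
Qed.

Lemma der_tr {m k} (A : pt -> 'M[C]_(m, k)) X :
  der (fun x => (A x)^T) x X = (der A x X)^T.
Proof.
apply/matrixP => i j; rewrite derE [RHS]mxE derE.
by apply: (cder_ext oU Ux) => y _; rewrite mxE.
Qed.

Lemma der_conjm {m k} (A : pt -> 'M[C]_(m, k)) X : smooth U A ->
  der (fun x => conjm (A x)) x X = conjm (der A x X).
Proof.
move=> /smoothP CA; apply/matrixP => i j; rewrite derE [RHS]mxE derE -(cder_conj Ux) //.
by apply: (cder_ext oU Ux) => y _; rewrite mxE.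
Qed.

Lemma der_lin {m k} (A : pt -> 'M[C]_(m, k)) (a b : R) X Y : smooth U A ->
  der A x (a *: X + b *: Y) = a%:C%C *: der A x X + b%:C%C *: der A x Y.
Proof.
move=> /smoothP CA; apply/matrixP => i j.
rewrite derE (cder_lin oU Ux _ _ _ _ (CA i j)) -!derE [RHS]mxE.
by congr (_ + _); rewrite [RHS]mxE.
Qed.

Lemma der_comm {m k} (A : pt -> 'M[C]_(m, k)) X Y : smooth U A ->
  der (fun y => der A y X) x Y = der (fun y => der A y Y) x X.
Proof.
move=> /smoothP CA; apply/matrixP => i j.
rewrite [LHS]derE [RHS]derE.
transitivity (cder (fun y => cder (fun z => A z i j) y X) x Y).
  by apply: (cder_ext oU Ux) => y _; rewrite derE.
rewrite (cder_comm oU Ux X Y (CA i j)).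
by apply: (cder_ext oU Ux) => y _; rewrite derE.
Qed.

Lemma der_sum {m k} (I : Type) (r : seq I) (A : I -> pt -> 'M[C]_(m, k)) X :
  (forall i, smooth U (A i)) ->
  der (fun x => \sum_(i <- r) A i x) x X = \sum_(i <- r) der (A i) x X.
Proof.
move=> CA; apply/matrixP => i j; rewrite derE summxE.
under eq_bigr do rewrite derE.
rewrite -(cder_sum oU Ux); last by move=> l; exact: (smoothP _).1 (CA l) i j.
by apply: (cder_ext oU Ux) => y _; rewrite summxE.
Qed.

End At.
End MatrixCalculus.

(** Noncommutative identities are proved by expanding all products and then treating each remaining
    product as an independent matrix, which leaves a linear identity between entries. *)
Ltac mx_expand := rewrite ?(mulmxDr, mulmxDl, mulmxN, mulNmx, mulmx1, mul1mx,
  mulmx0, mul0mx, =^~ scalemxAl, =^~ scalemxAr, mulmxA).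
Ltac mx_atoms := repeat match goal with
  |- context [?A *m ?B] => move: (A *m B) => ? end.
Ltac mx_lin := mx_atoms; apply/matrixP => ? ?; rewrite !mxE.

(** * Pointwise algebra of gauging a connection by a simple factor *)

Section GaugeAlgebra.
Context {F : numFieldType} {m : nat}.
Local Notation M := 'M[F]_m.
Implicit Types (A B P Q dP dQ : M) (u v a eps beta lam : F).

(** With [dP] the derivative of a field of projections [P], this is [(1 - P) (d + A) P], the
    obstruction to the image of [P] being parallel for [d + A]. Likewise [offQ] is the obstruction
    to the kernel of [Q] being parallel. *)
Definition offP A P dP : M := (1%:M - P) *m (A + dP) *m P.
Definition offQ A Q dQ : M := Q *m (A - dQ) *m (1%:M - Q).

Section Blocks.
Context (P Q dP dQ : M).
Hypotheses (PP : P *m P = P) (QQ : Q *m Q = Q) (PQ : P *m Q = 0) (QP : Q *m P = 0).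
Hypotheses (dPP : dP = dP *m P + P *m dP) (dQQ : dQ = dQ *m Q + Q *m dQ).
Hypotheses (dPQ : dP *m Q + P *m dQ = 0) (dQP : dQ *m P + Q *m dP = 0).

(** Removing its two off-diagonal blocks from [d + A] leaves a connection for which [P] is
    parallel. *)
Lemma offP_offQ A :
  A *m P - offP A P dP + offQ A P dP = P *m A - dP.
Proof.
have z : P *m dP *m P = 0.
  have e : P *m dP *m P = P *m dP *m P + P *m dP *m P.
    by rewrite {1}dPP; mx_expand; rewrite PP -[_ *m P *m P]mulmxA PP.
  by apply: (addrI (P *m dP *m P)); rewrite addr0 -e.
rewrite /offP /offQ [in RHS]dPP; mx_expand; rewrite z.
by mx_lin; ring.
Qed.

Lemma offQP A : Q *m (A + dP) *m P = 0 -> offQ A Q dQ *m P = 0.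
Proof.
move=> h; rewrite /offQ -mulmxA mulmxBl mul1mx QP subr0.
rewrite -h; mx_expand; congr (_ + _).
have e : dQ *m P = - (Q *m dP) by apply/eqP; rewrite -addr_eq0 dQP.
rewrite -mulmxA e mulmxN opprK mulmxA QQ.
rewrite [in LHS]dPP mulmxDr -mulmxA.
by rewrite [Q *m (P *m dP)]mulmxA QP mul0mx addr0 mulmxA.
Qed.

End Blocks.

Section Step.
Context (P Q dP dQ : M).
Hypotheses (PP : P *m P = P) (QQ : Q *m Q = Q) (PQ : P *m Q = 0) (QP : Q *m P = 0).
Hypotheses (dPP : dP = dP *m P + P *m dP) (dQQ : dQ = dQ *m Q + Q *m dQ).
Hypotheses (dPQ : dP *m Q + P *m dQ = 0) (dQP : dQ *m P + Q *m dP = 0).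

(** In the application [Q] is the adjoint of [P], so the kernel of [Q] is the orthogonal complement
    of the image of [P]: for a metric connection, both terms of [Xpart] vanish when the image of [P]
    is parallel. [Ypart] plays this role for the image of [Q]. *)
Definition Xpart A : M := offP A P dP + offQ A Q dQ.
Definition Ypart A : M := offP A Q dQ + offQ A P dP.

(* The conjugate of [A] by the gauge [p = 1 + u P + v Q] with [p^-1 = 1 + v P + u Q]. *)
Lemma gauge_alg A u v : u * v + u + v = 0 ->
  Q *m (A + dP) *m P = 0 -> P *m (A + dQ) *m Q = 0 ->
  (A + v *: Xpart A + u *: Ypart A) *m (1%:M + u *: P + v *: Q) =
  (1%:M + u *: P + v *: Q) *m A - u *: dP - v *: dQ.
Proof.
move=> uv hQP hPQ.
have eP := offP_offQ PP dPP A; have eQ := offP_offQ QQ dQQ A.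
have z1 := offQP QQ QP dPP dQP hQP.
have z2 := offQP PP PQ dQQ dPQ hPQ.
have z3 : offQ A Q dQ *m Q = 0 by rewrite /offQ -mulmxA mulmxBl mul1mx QQ subrr mulmx0.
have z4 : offQ A P dP *m P = 0 by rewrite /offQ -mulmxA mulmxBl mul1mx PP subrr mulmx0.
have z5 : offP A P dP *m P = offP A P dP by rewrite /offP -mulmxA PP.
have z6 : offP A Q dQ *m Q = offP A Q dQ by rewrite /offP -mulmxA QQ.
have z7 : offP A P dP *m Q = 0 by rewrite /offP -mulmxA PQ mulmx0.
have z8 : offP A Q dQ *m P = 0 by rewrite /offP -mulmxA QP mulmx0.
set B := offP A P dP in eP z5 z7 *; set C := offP A Q dQ in eQ z6 z8 *.
set D := offQ A P dP in eP z2 z4 *; set E := offQ A Q dQ in eQ z1 z3 *.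
have -> : (1%:M + u *: P + v *: Q) *m A - u *: dP - v *: dQ =
    A + u *: (P *m A - dP) + v *: (Q *m A - dQ) + (u * v + u + v) *: (B + C).
  by rewrite uv scale0r; mx_expand; mx_lin; ring.
rewrite -eP -eQ /Xpart /Ypart -/B -/C -/D -/E; mx_expand.
by rewrite z1 z2 z3 z4 z5 z6 z7 z8; mx_lin; ring.
Qed.

(** The derivative of [gauge_alg], with [dP = dQ = 0], along the curve [u v + u + v = 0] at
    [u = v = eps - 1]. It governs the subleading coefficient at infinity. *)
Lemma gauge_alg_infinitesimal A eps : eps * eps = 1 ->
  Q *m A *m P = 0 -> P *m A *m Q = 0 ->
  let X := offP A P 0 + offQ A Q 0 in let Y := offP A Q 0 + offQ A P 0 in
  (X - Y) *m (1%:M + (eps - 1) *: (P + Q)) +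
  (A + (eps - 1) *: (X + Y)) *m (Q - P) = (Q - P) *m A.
Proof.
move=> ee hQP hPQ.
have P0 : 0 = 0 *m P + P *m 0 :> M by rewrite mul0mx mulmx0 addr0.
have Q0 : 0 = 0 *m Q + Q *m 0 :> M by rewrite mul0mx mulmx0 addr0.
have eP := offP_offQ PP P0 A; have eQ := offP_offQ QQ Q0 A.
have z1 : offQ A Q 0 *m P = 0.
  by rewrite /offQ -mulmxA mulmxBl mul1mx QP subr0 oppr0 addr0.
have z2 : offQ A P 0 *m Q = 0.
  by rewrite /offQ -mulmxA mulmxBl mul1mx PQ subr0 oppr0 addr0.
have z3 : offQ A Q 0 *m Q = 0 by rewrite /offQ -mulmxA mulmxBl mul1mx QQ subrr mulmx0.
have z4 : offQ A P 0 *m P = 0 by rewrite /offQ -mulmxA mulmxBl mul1mx PP subrr mulmx0.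
have z5 : offP A P 0 *m P = offP A P 0 by rewrite /offP -mulmxA PP.
have z6 : offP A Q 0 *m Q = offP A Q 0 by rewrite /offP -mulmxA QQ.
have z7 : offP A P 0 *m Q = 0 by rewrite /offP -mulmxA PQ mulmx0.
have z8 : offP A Q 0 *m P = 0 by rewrite /offP -mulmxA QP mulmx0.
rewrite /=; set B := offP A P 0 in eP z5 z7 *; set C := offP A Q 0 in eQ z6 z8 *.
set D := offQ A P 0 in eP z2 z4 *; set E := offQ A Q 0 in eQ z1 z3 *.
have -> : (Q - P) *m A = (Q *m A - 0) - (P *m A - 0).
  by rewrite !subr0 mulmxBl.
rewrite -eP -eQ; mx_expand.
by rewrite z1 z2 z3 z4 z5 z6 z7 z8; mx_lin; ring.
Qed.

End Step.
End GaugeAlgebra.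

(** * One dressing step on a quadratic family of metric connections *)

Section GaugeStep.
Context {F : numFieldType} {m : nat} (g : 'M[F]_m).
Hypotheses (gT : g^T = g) (gg : g *m g = 1%:M).
Local Notation M := 'M[F]_m.
Implicit Types (A B P dP rho drho : M) (u v a eps beta lam : F).

(** [adjm] is the adjoint for the bilinear form with matrix [g], which is its own inverse. *)
Fact adjm_key : unit. Proof. exact: tt. Qed.
Definition adjm A : M := locked_with adjm_key (g *m A^T *m g).
Lemma adjm_def A : adjm A = g *m A^T *m g.
Proof. by rewrite /adjm unlock. Qed.

Lemma adjmD A B : adjm (A + B) = adjm A + adjm B.
Proof. by rewrite !adjm_def linearD mulmxDr mulmxDl. Qed.
Lemma adjmN A : adjm (- A) = - adjm A.
Proof. by rewrite !adjm_def linearN mulmxN mulNmx. Qed.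
Lemma adjmZ a A : adjm (a *: A) = a *: adjm A.
Proof. by rewrite !adjm_def linearZ /= -scalemxAr -scalemxAl. Qed.
Lemma adjmM A B : adjm (A *m B) = adjm B *m adjm A.
Proof.
by rewrite !adjm_def trmx_mul !mulmxA -[g *m B^T *m g *m g]mulmxA gg mulmx1.
Qed.
Lemma adjmK A : adjm (adjm A) = A.
Proof.
by rewrite !adjm_def !trmx_mul trmxK gT !mulmxA gg mul1mx -mulmxA gg mulmx1.
Qed.
Lemma adjm1 : adjm 1%:M = 1%:M.
Proof. by rewrite !adjm_def trmx1 mulmx1. Qed.
Lemma adjm0 : adjm 0 = 0.
Proof. by rewrite !adjm_def trmx0 mulmx0 mul0mx. Qed.

Definition adjmE := (adjmM, adjmD, adjmN, adjmZ, adjm1, adjm0).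

Definition skew A := adjm A = - A.

(* [P] projects onto a null line [L] along [(rho L)^perp], and [dP], [drho] are
   derivatives of [P] and of the reflection [rho]. *)
Record line_proj rho drho P dP : Prop := LineProj {
  lp_rr : rho *m rho = 1%:M;
  lp_drr : drho *m rho + rho *m drho = 0;
  lp_adjr : adjm rho = rho;
  lp_adjdr : adjm drho = drho;
  lp_PP : P *m P = P;
  lp_PQ : P *m adjm P = 0;
  lp_QP : adjm P *m P = 0;
  lp_refl : adjm P = rho *m P *m rho;
  lp_rank1 : forall A, adjm (adjm P *m A *m P) = adjm P *m A *m P;
  lp_dPP : dP = dP *m P + P *m dP;
  lp_dPQ : dP *m adjm P + P *m adjm dP = 0;
  lp_dQP : adjm dP *m P + adjm P *m dP = 0;
  lp_drefl : adjm dP = drho *m P *m rho + rho *m dP *m rho + rho *m P *m drho }.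

Section Proj.
Context (rho drho P dP : M) (lp : line_proj rho drho P dP).
Let Q := adjm P.
Let dQ := adjm dP.

Lemma lp_QQ : Q *m Q = Q.
Proof. by rewrite /Q -adjmM (lp_PP lp). Qed.

Lemma lp_dQQ : dQ = dQ *m Q + Q *m dQ.
Proof. by rewrite /Q /dQ {1}(lp_dPP lp) adjmD !adjmM addrC. Qed.

(** With both derivatives set to zero only pointwise identities remain. This form applies to the
    coefficients of [lam] and [lam^2], which transform without a derivative term. *)
Lemma lp_static : line_proj rho 0 P 0.
Proof.
case: lp => *; split=> //; rewrite ?adjm0 ?mul0mx ?mulmx0 ?addr0 //.
by rewrite mul0mx addr0.
Qed.

Lemma lp_sym : line_proj rho drho Q dQ.
Proof.
case: lp => rr drr ar adr PP PQ QP re rk dPP dPQ dQP dre.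
have r2 (k : nat) (B : 'M_(k, m)) : B *m rho *m rho = B by rewrite -mulmxA rr mulmx1.
split; rewrite /Q /dQ ?adjmK //.
- exact: lp_QQ.
- by rewrite re !mulmxA rr mul1mx r2.
- move=> A; rewrite re.
  have [W eW] : exists W, W = P *m A *m (rho *m P *m rho) by eexists.
  have e : rho *m P *m rho *m (rho *m A *m rho) *m P = rho *m W *m rho.
    by rewrite eW !mulmxA !r2.
  rewrite -eW.
  have := rk (rho *m A *m rho); rewrite re e !adjmM ar.
  move/(congr1 (fun B => rho *m B *m rho)).
  by rewrite !mulmxA rr !mul1mx !r2.
- exact: lp_dQQ.
- have e : dP = rho *m (drho *m P *m rho + rho *m dP *m rho + rho *m P *m drho) *m rho
      + drho *m (rho *m P *m rho) *m rho + rho *m (rho *m P *m rho) *m drho.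
    have dr : drho *m rho = - (rho *m drho) by apply/eqP; rewrite -addr_eq0 drr.
    mx_expand; rewrite rr !mul1mx.
    rewrite !r2.
    have dr' : rho *m drho = - (drho *m rho) by rewrite dr opprK.
    rewrite dr' -(mulmxA _ drho rho) dr; mx_expand.
    by mx_lin; ring.
  by rewrite {1}e -dre -re; mx_lin; ring.
Qed.

(** For a metric connection a subbundle and its orthogonal complement are parallel simultaneously;
    this is the infinitesimal statement. *)
Lemma adjm_offP A : skew A -> adjm (offP A P dP) = - offQ A Q dQ.
Proof.
by move=> sA; rewrite /offP /offQ !adjmE sA -/Q -/dQ mulmxA; mx_expand; mx_lin; ring.
Qed.

Lemma refl_offP A : rho *m offP A P dP *m rho =
  offP (rho *m A *m rho - drho *m rho) Q dQ.
Proof.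
case: lp => rr drr ar adr PP PQ QP re rk dPP dPQ dQP dre.
have dr : rho *m drho = - (drho *m rho) by apply/eqP; rewrite -addr_eq0 addrC drr.
rewrite /offP /Q /dQ re dre.
have r2 B : B *m rho *m rho = B by rewrite -mulmxA rr mulmx1.
have p2 B : B *m P *m P = B *m P by rewrite -mulmxA PP.
mx_expand; rewrite !(r2, p2, rr, mul1mx, PP, dr).
have dr3 B : B *m rho *m drho = - (B *m drho *m rho).
  by rewrite -mulmxA dr mulmxN mulmxA.
rewrite !dr3; mx_expand.
by mx_lin; ring.
Qed.

End Proj.

(** The (1,0) component of a loop of connections: a polynomial of degree two in the spectral
    parameter. *)
Record qfamily := QFamily {c0 : M; c1 : M; c2 : M}.
Definition ev (f : qfamily) lam : M := c0 f + lam *: c1 f + lam ^+ 2 *: c2 f.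

(* [d + ev f lam] is a metric connection, and is conjugated to
   [d + ev f (- lam)] by [rho]. *)
Record admissible rho drho (f : qfamily) : Prop := Admissible {
  ad_skew0 : skew (c0 f);
  ad_skew1 : skew (c1 f);
  ad_skew2 : skew (c2 f);
  ad_par0 : rho *m c0 f *m rho - drho *m rho = c0 f;
  ad_par1 : rho *m c1 f *m rho = - c1 f;
  ad_par2 : rho *m c2 f *m rho = c2 f }.

Lemma skew_ev f lam : skew (c0 f) -> skew (c1 f) -> skew (c2 f) -> skew (ev f lam).
Proof. by rewrite /skew /ev !adjmE => -> -> ->; mx_lin; ring. Qed.

(** For [P] as in [line_proj] this is [a] on the line, [a^-1] on its reflection and the identity on
    the orthogonal complement of both. *)
Definition gauge a P : M := 1%:M + (a - 1) *: P + (a^-1 - 1) *: adjm P.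

(** The block is self-adjoint because it has rank one ([lp_rank1]), and skew because the connection
    is metric and the line stays null. *)
Lemma rank1_skew0 rho drho P dP A : line_proj rho drho P dP -> skew A ->
  adjm P *m (A + dP) *m P = 0.
Proof.
move=> lp sA; set W := _ *m P.
have Z : adjm P *m dP *m P = adjm P *m dP.
  rewrite [in RHS](lp_dPP lp) mulmxDr !mulmxA (lp_QP lp) mul0mx addr0.
  by [].
have e : adjm P *m adjm dP *m P = - (adjm P *m dP).
  have e1 : adjm dP *m P = - (adjm P *m dP).
    by apply/eqP; rewrite -addr_eq0 (lp_dQP lp).
  by rewrite -mulmxA e1 mulmxN mulmxA (lp_QQ lp).
have W1 : adjm W = W by exact: (lp_rank1 lp).
have W2 : adjm W = - W.
  rewrite /W !adjmE adjmK sA mulmxA mulmxDr mulmxDl e mulmxDr mulmxDl Z.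
  by rewrite mulmxN mulNmx opprD.
have W3 : W = - W by rewrite -{1}W1.
have n2 : (2 : F) != 0 by rewrite pnatr_eq0.
by apply: (scalerI n2); rewrite scaler0 scaler_nat mulr2n {1}W3 addNr.
Qed.

(* [Xpart] and [Ypart] are transparent sums; these expansion rules keep their
   instances folded. *)
Lemma next0 rho e A X Y :
  (rho *m (A - e *: X - X - e *: Y - Y) *m rho = rho *m A *m rho -
    e *: (rho *m X *m rho) - rho *m X *m rho - e *: (rho *m Y *m rho) - rho *m Y *m rho) *
  (adjm (A - e *: X - X - e *: Y - Y) =
   adjm A - e *: adjm X - adjm X - e *: adjm Y - adjm Y).
Proof. by split; rewrite ?adjmE //; mx_expand; mx_lin; ring. Qed.

Lemma next1 rho e k A X1 X2 Y1 Y2 :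
  (rho *m (A + e *: (k *: X2 + X1) - X1 + e *: (- k *: Y2 + Y1) - Y1) *m rho =
    rho *m A *m rho + e *: (k *: (rho *m X2 *m rho) + rho *m X1 *m rho) -
    rho *m X1 *m rho + e *: (- k *: (rho *m Y2 *m rho) + rho *m Y1 *m rho) -
    rho *m Y1 *m rho) *
  (adjm (A + e *: (k *: X2 + X1) - X1 + e *: (- k *: Y2 + Y1) - Y1) =
   adjm A + e *: (k *: adjm X2 + adjm X1) - adjm X1 +
   e *: (- k *: adjm Y2 + adjm Y1) - adjm Y1).
Proof. by split; rewrite ?adjmE //; mx_expand; mx_lin; ring. Qed.

Lemma next2 rho e A X Y :
  (rho *m (A + e *: (X + Y)) *m rho =
    rho *m A *m rho + e *: (rho *m X *m rho + rho *m Y *m rho)) *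
  (adjm (A + e *: (X + Y)) = adjm A + e *: (adjm X + adjm Y)).
Proof. by split; rewrite ?adjmE //; mx_expand; mx_lin; ring. Qed.

Lemma conj_quad rho a b A X Y : rho *m (A + a *: X + b *: Y) *m rho =
  rho *m A *m rho + a *: (rho *m X *m rho) + b *: (rho *m Y *m rho).
Proof. by mx_expand; mx_lin; ring. Qed.

Lemma next_infinitesimal eps beta (P Q A1 A2 X1 X2 Y1 Y2 : M) :
  (A1 + (eps - 1) *: X1 + (eps - 1) *: Y1) *m (1%:M + (eps - 1) *: P + (eps - 1) *: Q) =
    (1%:M + (eps - 1) *: P + (eps - 1) *: Q) *m A1 ->
  (X2 - Y2) *m (1%:M + (eps - 1) *: (P + Q)) + (A2 + (eps - 1) *: (X2 + Y2)) *m (Q - P) =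
    (Q - P) *m A2 ->
  (A1 + eps *: (2 * beta *: X2 + X1) - X1 + eps *: (- (2 * beta) *: Y2 + Y1) - Y1) *m
    (1%:M + (eps - 1) *: P + (eps - 1) *: Q) +
  (A2 + (eps - 1) *: (X2 + Y2)) *m ((2 * beta * eps) *: (Q - P)) =
  (1%:M + (eps - 1) *: P + (eps - 1) *: Q) *m A1 + ((2 * beta * eps) *: (Q - P)) *m A2.
Proof.
move=> <-; rewrite -scalemxAl => <-.
have -> : A1 + eps *: (2 * beta *: X2 + X1) - X1 + eps *: (- (2 * beta) *: Y2 + Y1) - Y1 =
   (A1 + (eps - 1) *: X1 + (eps - 1) *: Y1) + (2 * beta * eps) *: (X2 - Y2).
  by mx_lin; ring.
rewrite [_ *: (P + Q)]scalerDr addrA.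
move: (_ + _ *: P + _ *: Q) (A1 + _ + _) (X2 - Y2) (Q - P) (A2 + _) => G B Z W T.
by mx_expand; mx_lin; ring.
Qed.

(** The roots at [beta] and [- beta] of the two quadratics cancel the poles of their scalar factors;
    the coefficients of the quotient define [next_qfamily]. *)
Lemma next_ev eps beta lam (A0 A1 A2 X0 X1 X2 Y0 Y1 Y2 : M) :
  lam - beta != 0 -> lam + beta != 0 ->
  X0 + beta *: X1 + beta ^+ 2 *: X2 = 0 -> Y0 - beta *: Y1 + beta ^+ 2 *: Y2 = 0 ->
  A0 + lam *: A1 + lam ^+ 2 *: A2 +
  (eps * ((lam + beta) / (lam - beta)) - 1) *: (X0 + lam *: X1 + lam ^+ 2 *: X2) +
  (eps * ((lam - beta) / (lam + beta)) - 1) *: (Y0 + lam *: Y1 + lam ^+ 2 *: Y2) =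
  (A0 - eps *: X0 - X0 - eps *: Y0 - Y0) +
  lam *: (A1 + eps *: (2 * beta *: X2 + X1) - X1
             + eps *: (- (2 * beta) *: Y2 + Y1) - Y1) +
  lam ^+ 2 *: (A2 + (eps - 1) *: (X2 + Y2)).
Proof.
move=> n1 n2 eX eY.
have -> : X0 = (X0 + beta *: X1 + beta ^+ 2 *: X2) - (beta *: X1 + beta ^+ 2 *: X2).
  by mx_lin; ring.
have -> : Y0 = (Y0 - beta *: Y1 + beta ^+ 2 *: Y2) + (beta *: Y1 - beta ^+ 2 *: Y2).
  by mx_lin; ring.
rewrite eX eY !sub0r !add0r; mx_lin; field.
by rewrite n1 n2.
Qed.

Section Step.
Context (rho drho P dP : M) (lp : line_proj rho drho P dP).
Context (f : qfamily) (ad : admissible rho drho f) (beta eps : F).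
Hypotheses (ee : eps * eps = 1).
Hypothesis par : (1%:M - P) *m (ev f beta + dP) *m P = 0.
Let Q := adjm P.
Let dQ := adjm dP.
Let X0 := Xpart P Q dP dQ (c0 f).
Let X1 := Xpart P Q 0 0 (c1 f).
Let X2 := Xpart P Q 0 0 (c2 f).
Let Y0 := Ypart P Q dP dQ (c0 f).
Let Y1 := Ypart P Q 0 0 (c1 f).
Let Y2 := Ypart P Q 0 0 (c2 f).

Let Xev lam : Xpart P Q dP dQ (ev f lam) = X0 + lam *: X1 + lam ^+ 2 *: X2.
Proof. by rewrite /X0 /X1 /X2 /ev /Xpart /offP /offQ; mx_expand; mx_lin; ring. Qed.

Let Yev lam : Ypart P Q dP dQ (ev f lam) = Y0 + lam *: Y1 + lam ^+ 2 *: Y2.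
Proof. by rewrite /Y0 /Y1 /Y2 /ev /Ypart /offP /offQ; mx_expand; mx_lin; ring. Qed.

Let reflX r dr p dp A : line_proj r dr p dp -> skew A ->
  r *m Xpart p (adjm p) dp (adjm dp) A *m r =
  Ypart p (adjm p) dp (adjm dp) (r *m A *m r - dr *m r).
Proof.
move=> lp' sA; rewrite /Xpart /Ypart.
have sA' : skew (r *m A *m r - dr *m r).
  rewrite /skew !adjmE sA (lp_adjr lp') (lp_adjdr lp').
  have -> : r *m dr = - (dr *m r) by apply/eqP; rewrite -addr_eq0 addrC (lp_drr lp').
  by mx_expand; mx_lin; ring.
have e1 := refl_offP lp' A.
have e2 : offQ A (adjm p) (adjm dp) = - adjm (offP A p dp).
  by rewrite (adjm_offP _ _ sA) opprK.
have e3 := adjm_offP (adjm p) (adjm dp) sA'; rewrite !adjmK -e1 in e3.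
rewrite mulmxDr mulmxDl e1 e2; congr (_ + _); apply: oppr_inj; rewrite -e3.
move: (offP A p dp) => Z.
by rewrite !adjmE (lp_adjr lp') mulmxN mulNmx opprK mulmxA.
Qed.

Let skewX r dr p dp A : line_proj r dr p dp -> skew A ->
  skew (Xpart p (adjm p) dp (adjm dp) A).
Proof.
move=> lp' sA; have e := adjm_offP p dp sA.
rewrite /skew /Xpart -[offQ _ _ _]opprK -e.
by move: (offP A p dp) => Z; rewrite !adjmE adjmK opprD opprK addrC.
Qed.

Let skewY r dr p dp A : line_proj r dr p dp -> skew A ->
  skew (Ypart p (adjm p) dp (adjm dp) A).
Proof.
move=> lp' sA; have e := adjm_offP (adjm p) (adjm dp) sA.
rewrite !adjmK in e; rewrite /skew /Ypart -[offQ _ _ _]opprK -e.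
by move: (offP A _ _) => Z; rewrite !adjmE adjmK opprD opprK addrC.
Qed.

Let lp0 := lp_static lp.

Let pX0 : rho *m X0 *m rho = Y0.
Proof. by rewrite /X0 (reflX lp) ?(ad_par0 ad) //; exact: ad_skew0 ad. Qed.
Let pX1 : rho *m X1 *m rho = - Y1.
Proof.
rewrite /X1 -[X in Xpart _ _ _ X]adjm0 (reflX lp0); last exact: ad_skew1 ad.
rewrite mul0mx subr0 (ad_par1 ad) adjm0 /Y1 /Ypart /offP /offQ.
by mx_expand; mx_lin; ring.
Qed.
Let pX2 : rho *m X2 *m rho = Y2.
Proof.
rewrite /X2 -[X in Xpart _ _ _ X]adjm0 (reflX lp0); last exact: ad_skew2 ad.
by rewrite mul0mx subr0 (ad_par2 ad) adjm0.
Qed.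

Let refl_move B C : rho *m B *m rho = C -> rho *m C *m rho = B.
Proof.
by move=> <-; rewrite !mulmxA (lp_rr lp) mul1mx -mulmxA (lp_rr lp) mulmx1.
Qed.
Let pY0 := refl_move pX0.
Let pY2 := refl_move pX2.
Let pY1 : rho *m Y1 *m rho = - X1.
Proof. by rewrite -[Y1]opprK -pX1 mulmxN mulNmx (refl_move (erefl _)). Qed.

(** Here parallelism of the line at [beta] enters: it kills one half of [Xpart], and by adjunction
    the other. *)
Let X_root : X0 + beta *: X1 + beta ^+ 2 *: X2 = 0.
Proof.
rewrite -Xev /Xpart /offP par add0r -[offQ _ _ _]opprK -adjm_offP.
  by rewrite /offP par adjm0 oppr0.
by apply: skew_ev; [exact: ad_skew0 ad|exact: ad_skew1 ad|exact: ad_skew2 ad].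
Qed.

Let Y_root : Y0 - beta *: Y1 + beta ^+ 2 *: Y2 = 0.
Proof.
have := congr1 (fun B => rho *m B *m rho) X_root.
by rewrite conj_quad pX0 pX1 pX2 mulmx0 mul0mx scalerN.
Qed.

Definition next_qfamily : qfamily := QFamily
  (c0 f - eps *: X0 - X0 - eps *: Y0 - Y0)
  (c1 f + eps *: (2 * beta *: X2 + X1) - X1
        + eps *: (- (2 * beta) *: Y2 + Y1) - Y1)
  (c2 f + (eps - 1) *: (X2 + Y2)).

(** In the gauged connection [a^-1 - 1], with its pole at [beta], multiplies [Xpart], which vanishes
    there; symmetrically at [- beta]. So the new family is again quadratic. The last two clauses are
    the two leading coefficients of the same relation at infinity, where
    [a = eps (1 - 2 beta / lam + ...)] and the derivative term is of lower order. *)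
Lemma gauge_step : exists f',
  [/\ admissible rho drho f',
      (forall lam, lam != beta -> lam != - beta ->
         let a := eps * ((lam - beta) / (lam + beta)) in
         (a - 1) *: dP + (a^-1 - 1) *: adjm dP =
         gauge a P *m ev f lam - ev f' lam *m gauge a P),
      c2 f' *m gauge eps P = gauge eps P *m c2 f &
      let n1 := (2 * beta * eps) *: (adjm P - P) in
      c1 f' *m gauge eps P + c2 f' *m n1 = gauge eps P *m c1 f + n1 *m c2 f].
Proof.
have e0 : eps != 0.
  by apply: contraTneq isT => e; move: ee; rewrite e mulr0 => /eqP; rewrite eq_sym oner_eq0.
have eV : eps^-1 = eps by apply: (mulfI e0); rewrite mulfV ?ee.
have s0 := ad_skew0 ad; have s1 := ad_skew1 ad; have s2 := ad_skew2 ad.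
have [sX0 sY0] := (skewX lp s0, skewY lp s0).
have [sX1 sY1] := (skewX lp0 s1, skewY lp0 s1).
have [sX2 sY2] := (skewX lp0 s2, skewY lp0 s2).
rewrite adjm0 in sX1 sX2 sY1 sY2.
rewrite -/X0 -/X1 -/X2 -/Y0 -/Y1 -/Y2 in sX0 sX1 sX2 sY0 sY1 sY2.
have PP := lp_PP lp; have PQ := lp_PQ lp; have QP := lp_QP lp.
have QQ := lp_QQ lp.
have dPP := lp_dPP lp; have dQQ := lp_dQQ lp.
have dPQ := lp_dPQ lp; have dQP := lp_dQP lp.
exists next_qfamily; split.
- have [N0 N0'] := next0 rho eps (c0 f) X0 Y0.
  have [N1 N1'] := next1 rho eps (2 * beta) (c1 f) X1 X2 Y1 Y2.
  have [N2 N2'] := next2 rho (eps - 1) (c2 f) X2 Y2.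
  split.
  + rewrite /skew [LHS]N0' s0 sX0 sY0 /=; move: X0 Y0 => X Y; mx_lin; ring.
  + rewrite /skew [LHS]N1' s1 sX1 sY1 sX2 sY2 /=.
    by move: X1 Y1 X2 Y2 => X Y X' Y'; mx_lin; ring.
  + rewrite /skew [LHS]N2' s2 sX2 sY2 /=; move: X2 Y2 => X Y; mx_lin; ring.
  + rewrite /= N0 pX0 pY0 -{2}(ad_par0 ad).
    by move: X0 Y0 => X Y; mx_lin; ring.
  + rewrite /= N1 (ad_par1 ad) pX1 pY1 pX2 pY2.
    by move: X1 Y1 X2 Y2 => X Y X' Y'; mx_lin; ring.
  + rewrite /= N2 (ad_par2 ad) pX2 pY2.
    by move: X2 Y2 => X Y; mx_lin; ring.
- move=> lam lb lb'; rewrite /=; set a := eps * _.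
  have n1 : lam - beta != 0 by rewrite subr_eq0.
  have n2 : lam + beta != 0 by rewrite addr_eq0.
  have aV : a^-1 = eps * ((lam + beta) / (lam - beta)).
    by rewrite /a !invfM eV invrK; ring.
  have a0 : a != 0 by rewrite /a !mulf_neq0 ?invr_eq0.
  have uv : (a - 1) * (a^-1 - 1) + (a - 1) + (a^-1 - 1) = 0.
    by rewrite mulrBl mulrBr mulfV //; ring.
  have sk : skew (ev f lam) by exact: skew_ev.
  have z1 := rank1_skew0 lp sk.
  have z2 := rank1_skew0 (lp_sym lp) sk; rewrite adjmK in z2.
  have := gauge_alg PP QQ PQ QP dPP dQQ dPQ dQP uv z1 z2.
  rewrite -/Q -/dQ Xev Yev.
  have -> : ev f lam + (a^-1 - 1) *: (X0 + lam *: X1 + lam ^+ 2 *: X2)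
      + (a - 1) *: (Y0 + lam *: Y1 + lam ^+ 2 *: Y2) = ev next_qfamily lam.
    by rewrite aV /a; exact: next_ev.
  rewrite /gauge -/Q => ->.
  by mx_lin; ring.
- have uv : (eps - 1) * (eps - 1) + (eps - 1) + (eps - 1) = 0.
    by rewrite mulrBl mulrBr ee; ring.
  have z1 := rank1_skew0 lp0 s2; have z2 := rank1_skew0 (lp_sym lp0) s2.
  rewrite adjm0 adjmK in z2.
  have P0 : 0 = 0 *m P + P *m 0 :> M by rewrite mul0mx mulmx0 addr0.
  have Q0 : 0 = 0 *m adjm P + adjm P *m 0 :> M by rewrite mul0mx mulmx0 addr0.
  have O1 : 0 *m adjm P + P *m 0 = 0 :> M by rewrite mul0mx mulmx0 addr0.
  have O2 : 0 *m P + adjm P *m 0 = 0 :> M by rewrite mul0mx mulmx0 addr0.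
  have := gauge_alg PP QQ PQ QP P0 Q0 O1 O2 uv z1 z2.
  rewrite -/Q -/X2 -/Y2 !scaler0 !subr0 /gauge eV => <- /=.
  by rewrite scalerDr addrA.
- have z1 := rank1_skew0 lp0 s1; have z2 := rank1_skew0 (lp_sym lp0) s1.
  have z3 := rank1_skew0 lp0 s2; have z4 := rank1_skew0 (lp_sym lp0) s2.
  rewrite !adjm0 !adjmK in z2 z4.
  have P0 : 0 = 0 *m P + P *m 0 :> M by rewrite mul0mx mulmx0 addr0.
  have Q0 : 0 = 0 *m adjm P + adjm P *m 0 :> M by rewrite mul0mx mulmx0 addr0.
  have O1 : 0 *m adjm P + P *m 0 = 0 :> M by rewrite mul0mx mulmx0 addr0.
  have O2 : 0 *m P + adjm P *m 0 = 0 :> M by rewrite mul0mx mulmx0 addr0.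
  have uv : (eps - 1) * (eps - 1) + (eps - 1) + (eps - 1) = 0.
    by rewrite mulrBl mulrBr ee; ring.
  have g1 := gauge_alg PP QQ PQ QP P0 Q0 O1 O2 uv z1 z2.
  rewrite !addr0 in z3 z4.
  have g2 := gauge_alg_infinitesimal PP QQ PQ QP ee z3 z4.
  rewrite -/Q -/X1 -/Y1 !scaler0 !subr0 in g1.
  rewrite /= -/Q -/(Xpart _ _ _ _ _) -/(Ypart _ _ _ _ _) -/X2 -/Y2 in g2.
  rewrite /gauge eV /= -/Q; apply: next_infinitesimal g1 g2.
Qed.

End Step.

End GaugeStep.

(** * Polynomial identities at generic points, and a Liouville argument *)

Section PolyUtils.
Context {F : numFieldType}.
Implicit Types (p q : {poly F}) (s : seq F) (a b : F).

Lemma poly_eq_generic p q s : (forall x, x \notin s -> p.[x] = q.[x]) -> p = q.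
Proof.
move=> pq; apply/eqP; rewrite -subr_eq0; apply/negPn/negP => nz.
(* Of this many distinct integers, at least [size (p - q)] avoid [s], which is too many roots for a
   nonzero polynomial. *)
pose N := (size (p - q)%R + size s)%N.
pose t := [seq (k%:R : F) | k <- iota 0 N].
have ut : uniq t.
  by rewrite map_inj_uniq ?iota_uniq // => i j /eqP; rewrite eqr_nat => /eqP.
pose t' := [seq x <- t | x \notin s].
have rt : all (root (p - q)) t'.
  apply/allP => x; rewrite mem_filter => /andP[xs _].
  by rewrite rootE !hornerE pq // subrr.
have := max_poly_roots nz rt (filter_uniq _ ut).
rewrite ltnNge => /negP; apply.
have h : (size [seq x <- t | x \in s] <= size s)%N.
  apply: uniq_leq_size; first exact: filter_uniq.
  by move=> x; rewrite mem_filter => /andP[].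
have := count_predC (fun x => x \in s) t; rewrite -!size_filter.
have -> : size t = N by rewrite size_map size_iota.
by move=> e; rewrite -(leq_add2r (size s)) -/N -e addnC leq_add2l.
Qed.

Lemma mx_poly_generic {m k} N (c : nat -> 'M[F]_(m, k)) s :
  (forall x, x \notin s -> \sum_(i < N) x ^+ i *: c i = 0) ->
  forall i, (i < N)%N -> c i = 0.
Proof.
move=> h i iN; apply/matrixP => a b; rewrite mxE.
have : \poly_(i < N) c i a b = 0.
  apply: (@poly_eq_generic _ _ s) => x xs; rewrite horner_poly horner0.
  transitivity ((\sum_(i < N) x ^+ i *: c i) a b); last by rewrite h // mxE.
  by rewrite summxE; apply: eq_bigr => j _; rewrite mxE mulrC.
by move/(congr1 (fun p : {poly F} => p`_i)); rewrite coef_poly iN coef0.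
Qed.

Lemma coprime_sqr_sub a b : a ^+ 2 != b ^+ 2 ->
  coprimep (('X^2 - (a ^+ 2)%:P) ^+ 2) (('X^2 - (b ^+ 2)%:P) ^+ 2 : {poly F}).
Proof.
move=> ab; apply: coprimep_expl; apply: coprimep_expr.
apply/Bezout_coprimepP; pose k := (b ^+ 2 - a ^+ 2)^-1.
exists (k%:P, - k%:P) => /=.
have -> : k%:P * ('X^2 - (a ^+ 2)%:P) + - k%:P * ('X^2 - (b ^+ 2)%:P) = 1 :> {poly F}.
  have -> : k%:P * ('X^2 - (a ^+ 2)%:P) + - k%:P * ('X^2 - (b ^+ 2)%:P) =
            k%:P * ((b ^+ 2)%:P - (a ^+ 2)%:P) :> {poly F} by ring.
  by rewrite -rmorphB -rmorphM mulVf ?rmorph1 // subr_eq0 eq_sym.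
exact: eqpxx.
Qed.

Lemma size_sqr_sub a : size (('X^2 - (a ^+ 2)%:P) ^+ 2 : {poly F}) = 5%N.
Proof.
have s3 : size ('X^2 - (a ^+ 2)%:P : {poly F}) = 3%N by rewrite size_XnsubC.
rewrite expr2 size_mul ?s3 //; by rewrite -size_poly_eq0 s3.
Qed.

Lemma horner_sqr_sub a x :
  (('X^2 - (a ^+ 2)%:P) ^+ 2 : {poly F}).[x] = (x ^+ 2 - a ^+ 2) ^+ 2.
Proof. by rewrite horner_exp hornerD hornerN hornerXn hornerC. Qed.

(* A rational function whose poles lie both in {a, -a} and in {b, -b} and
   which is bounded at infinity. *)
Lemma rational_const (k : F -> F) a b p1 p2 : a ^+ 2 != b ^+ 2 ->
  (size p1 <= 5)%N ->
  (forall x, x \notin [:: a; - a; b; - b] ->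
     k x * (x ^+ 2 - b ^+ 2) ^+ 2 = p1.[x] /\ k x * (x ^+ 2 - a ^+ 2) ^+ 2 = p2.[x]) ->
  exists c, forall x, x \notin [:: a; - a; b; - b] -> k x = c.
Proof.
move=> ab sp1 h.
have E : p1 * ('X^2 - (a ^+ 2)%:P) ^+ 2 = p2 * ('X^2 - (b ^+ 2)%:P) ^+ 2.
  apply: poly_eq_generic => x /h [h1 h2]; rewrite hornerM [in RHS]hornerM !horner_sqr_sub -h1 -h2.
  by ring.
have dv : ('X^2 - (b ^+ 2)%:P) ^+ 2 %| p1.
  have cp : coprimep (('X^2 - (b ^+ 2)%:P) ^+ 2) (('X^2 - (a ^+ 2)%:P) ^+ 2 : {poly F}).
    by apply: coprime_sqr_sub; rewrite eq_sym.
  by rewrite -(Gauss_dvdpl _ cp) E dvdp_mull.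
have [c p1E] : exists c, p1 = c%:P * ('X^2 - (b ^+ 2)%:P) ^+ 2.
  move/dvdpP: dv => [c p1E].
  have [c0|c0] := eqVneq c 0; first by exists 0; rewrite p1E c0.
  exists c`_0; rewrite {1}p1E -size1_polyC //.
  move: sp1; rewrite p1E size_mul // ?size_sqr_sub; last by rewrite -size_poly_eq0 size_sqr_sub.
  by rewrite addnC.
exists c => x xs; have [h1 _] := h x xs; move: h1; rewrite p1E hornerM horner_sqr_sub hornerC.
move: xs; rewrite !inE !negb_or => /and4P[_ _ xb xb'].
apply: mulIf; rewrite expf_neq0 // subr_sqr mulf_neq0 // ?subr_eq0 //.
by rewrite addr_eq0.
Qed.

End PolyUtils.

(** * Conjugating one simple factor by others with different poles *)

Section Intertwining.
Context {F : numFieldType} {m : nat} (g : 'M[F]_m).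
Hypotheses (gT : g^T = g) (gg : g *m g = 1%:M).
Local Notation M := 'M[F]_m.
Local Notation adj := (adjm g).
Local Notation fam := (@qfamily F m).
Local Notation GG := (gauge g).
Implicit Types (A B P dP rho drho : M) (u v a b eps beta lam : F).

Definition moebius beta lam : F := (lam - beta) / (lam + beta).

Lemma moebiusN beta lam : moebius beta (- lam) = (moebius beta lam)^-1.
Proof.
rewrite /moebius invf_div.
have -> : - lam - beta = - (lam + beta) by ring.
have -> : - lam + beta = - (lam - beta) by ring.
by rewrite invrN mulrNN.
Qed.

Section GaugeRules.
Context (rho P : M) (lp : line_proj g rho 0 P 0).

Lemma gaugeM a b : a != 0 -> b != 0 -> GG a P *m GG b P = GG (a * b) P.
Proof.
move=> a0 b0; rewrite /gauge; mx_expand.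
rewrite (lp_PP lp) (lp_PQ lp) (lp_QP lp) (lp_QQ gg lp); mx_lin; field.
by rewrite a0 b0.
Qed.

Lemma gauge1 : GG 1 P = 1%:M.
Proof. by rewrite /gauge invr1 subrr !scale0r !addr0. Qed.

Lemma adjm_gauge a : adj (GG a P) = GG a^-1 P.
Proof. by rewrite /gauge !(adjmE gg) adjmK // invrK; mx_lin; ring. Qed.

Lemma refl_gauge a : rho *m GG a P *m rho = GG a^-1 P.
Proof.
rewrite /gauge invrK (lp_refl lp); mx_expand.
have r2 B : B *m rho *m rho = B by rewrite -mulmxA (lp_rr lp) mulmx1.
by rewrite !r2 (lp_rr lp) mul1mx; mx_lin; ring.
Qed.

Lemma gaugeV a : a != 0 -> GG a P *m GG a^-1 P = 1%:M.
Proof. by move=> a0; rewrite gaugeM ?invr_eq0 // mulfV // gauge1. Qed.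

Lemma gaugeVl a : a != 0 -> GG a^-1 P *m GG a P = 1%:M.
Proof. by move=> a0; rewrite gaugeM ?invr_eq0 // mulVf // gauge1. Qed.

(** The simple factor with its poles cleared by [lam^2 - beta^2] ([gpolyE]). The outer coefficients
    come from the values [-1] and [1] of [moebius beta] at zero and at infinity. *)
Definition gpoly beta eps P : fam := QFamily
  (- beta ^+ 2 *: GG (- eps) P)
  ((2 * beta * eps) *: (adj P - P))
  (GG eps P).

Lemma gpolyE beta eps lam : eps * eps = 1 -> lam != beta -> lam != - beta ->
  ev (gpoly beta eps P) lam =
  (lam ^+ 2 - beta ^+ 2) *: GG (eps * moebius beta lam) P.
Proof.
move=> ee l1 l2.
have n1 : lam - beta != 0 by rewrite subr_eq0.
have n2 : lam + beta != 0 by rewrite addr_eq0.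
have e0 : eps != 0.
  by apply: contraTneq isT => e; move: ee; rewrite e mulr0 => /eqP; rewrite eq_sym oner_eq0.
have eV : eps^-1 = eps by apply: (mulfI e0); rewrite mulfV ?ee.
rewrite /ev /= /gauge /moebius invrN !invfM eV invrK; mx_lin; field.
by rewrite n1 n2.
Qed.

End GaugeRules.

Definition map_family (phi : M -> M) (f : fam) : fam :=
  QFamily (phi (c0 f)) (phi (c1 f)) (phi (c2 f)).

Definition shift_family eps beta (f : fam) : fam := QFamily
  (- eps *: c0 f - c0 f) (eps *: (2 * beta *: c2 f + c1 f) - c1 f) (eps *: c2 f - c2 f).

Lemma shift_familyE eps beta (f : fam) lam : ev f beta = 0 -> lam != beta ->
  (eps * ((lam + beta) / (lam - beta)) - 1) *: ev f lam = ev (shift_family eps beta f) lam.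
Proof.
move=> fb lb; have n1 : lam - beta != 0 by rewrite subr_eq0.
rewrite /ev /=; move: fb; rewrite /ev; case: f => f0 f1 f2 /= fb.
have -> : f0 = (f0 + beta *: f1 + beta ^+ 2 *: f2) - (beta *: f1 + beta ^+ 2 *: f2).
  by mx_lin; ring.
by rewrite fb sub0r; mx_lin; field.
Qed.

Lemma block_expand u v (P Q Pt Qt E : M) : u * v + u + v = 0 ->
  (1%:M + u *: Pt + v *: Qt) *m E *m (1%:M + v *: P + u *: Q) =
  E + u *: (Pt *m E + E *m Q - Pt *m E *m P - Qt *m E *m Q) +
  v *: (Qt *m E + E *m P - Pt *m E *m P - Qt *m E *m Q) +
  u ^+ 2 *: (Pt *m E *m Q) + v ^+ 2 *: (Qt *m E *m P).
Proof.
move=> uv; rewrite -[RHS]addr0 -(scale0r (Pt *m E *m P + Qt *m E *m Q)) -uv.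
by mx_expand; mx_lin; ring.
Qed.

Lemma sum_family eps beta lam (f fU fV : fam) W W' :
  ev f lam + ev fU lam + ev fV lam + (eps * (lam - beta) - (lam + beta)) ^+ 2 *: W' +
  (eps * (lam + beta) - (lam - beta)) ^+ 2 *: W =
  ev (QFamily (c0 f + c0 fU + c0 fV + ((eps + 1) * beta) ^+ 2 *: (W + W'))
   (c1 f + c1 fU + c1 fV + (2 * (eps - 1) * (eps + 1) * beta) *: (W - W'))
   (c2 f + c2 fU + c2 fV + (eps - 1) ^+ 2 *: (W + W'))) lam.
Proof.
case: f fU fV => [x0 x1 x2] [y0 y1 y2] [z0 z1 z2].
by rewrite /ev /=; mx_lin; ring.
Qed.

Section Intertwine.
Context (rho P Pt P' : M) (beta beta' eps eps' : F).
Hypotheses (lp : line_proj g rho 0 P 0) (lpt : line_proj g rho 0 Pt 0)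
  (lp' : line_proj g rho 0 P' 0).
Hypotheses (ee : eps * eps = 1) (ee' : eps' * eps' = 1) (bb : beta ^+ 2 != beta' ^+ 2).
Let gam lam := GG (eps' * moebius beta' lam) P'.
Hypotheses (h1 : (1%:M - Pt) *m gam beta *m P = 0)
  (h2 : (1%:M - P) *m adj (gam beta) *m Pt = 0).
Let Q := adj P.
Let Qt := adj Pt.
Let G := gpoly beta' eps' P'.

Let b1 : beta != beta'.
Proof. by apply: contra bb => /eqP ->. Qed.
Let b2 : beta != - beta'.
Proof. by apply: contra bb => /eqP ->; rewrite sqrrN. Qed.
Let eps0 e : e * e = 1 -> e != 0 :> F.
Proof. by move=> e1; apply/eqP => e0; move: e1; rewrite e0 mulr0 => /eqP; rewrite eq_sym oner_eq0. Qed.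
Let epsV e : e * e = 1 -> e^-1 = e :> F.
Proof. by move=> e1; apply: (mulfI (eps0 e1)); rewrite mulfV ?eps0. Qed.

Let Qt_gam : Qt *m gam beta = Qt *m gam beta *m Q.
Proof.
have := congr1 (adjm g) h2; rewrite !(adjmE gg) !adjmK // mulmxA mulmxBr mulmx1.
by move/eqP; rewrite subr_eq0 => /eqP.
Qed.

Let Pt_gam : Pt *m gam beta *m P = gam beta *m P.
Proof.
by have := h1; rewrite mulmxBl mulmxBl mul1mx => /eqP; rewrite subr_eq0 => /eqP.
Qed.

Let W := (4 * beta' ^+ 2 / (beta ^+ 2 - beta' ^+ 2)) *: (Qt *m gam beta *m (Q *m P' *m P)).

(** This block would carry a double pole. Factoring [gam lam] through [gam beta] and using rank one,
    it becomes a constant times [s + s^-1 - 2], which vanishes to second order at [s = 1], that is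
    at [lam = beta]. *)
Let TG lam : lam != beta' -> lam != - beta' ->
  Qt *m ev G lam *m P = (lam - beta) ^+ 2 *: W.
Proof.
move=> l1 l2.
have n1 : lam - beta' != 0 by rewrite subr_eq0.
have n2 : lam + beta' != 0 by rewrite addr_eq0.
have n3 : beta - beta' != 0 by rewrite subr_eq0.
have n4 : beta + beta' != 0 by rewrite addr_eq0.
have n5 : beta ^+ 2 - beta' ^+ 2 != 0 by rewrite subr_eq0.
have m0 l : l - beta' != 0 -> l + beta' != 0 -> eps' * moebius beta' l != 0.
  by move=> ? ?; rewrite /moebius !mulf_neq0 ?invr_eq0 // eps0.
have e0 := eps0 ee'.
rewrite /G gpolyE // -scalemxAr -scalemxAl -/(gam lam).
have -> : gam lam = gam beta *m GG (eps' * moebius beta' lam / (eps' * moebius beta' beta)) P'.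
  rewrite /gam (gaugeM lp') ?m0 //; last by rewrite mulf_neq0 ?invr_eq0 ?m0.
  have cancel (a b : F) : b != 0 -> b * (a / b) = a.
    by move=> b0; rewrite mulrCA mulfV ?mulr1.
  by rewrite cancel ?m0.
set s := _ / _.
have -> : Qt *m (gam beta *m GG s P') *m P = Qt *m gam beta *m (Q *m GG s P' *m P).
  by rewrite mulmxA {1}Qt_gam !mulmxA.
have -> : Q *m GG s P' *m P = (s + s^-1 - 2) *: (Q *m P' *m P).
  have QQ'P : Q *m adj P' *m P = Q *m P' *m P.
    by rewrite /Q -[RHS](lp_rank1 lp) !(adjmE gg) !adjmK // mulmxA.
  rewrite /gauge; mx_expand; rewrite QQ'P (lp_QP lp).
  by mx_lin; ring.
rewrite /W -scalemxAr !scalerA; congr (_ *: _).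
rewrite /s /moebius; field.
by rewrite n1 n2 n3 n4 n5 e0.
Qed.

Let phiV A := Qt *m A + A *m P - Pt *m A *m P - Qt *m A *m Q.
Let phiU A := Pt *m A + A *m Q - Pt *m A *m P - Qt *m A *m Q.

Let evV f lam : ev (map_family phiV f) lam = phiV (ev f lam).
Proof. by case: f => f0 f1 f2; rewrite /phiV /ev /=; mx_expand; mx_lin; ring. Qed.
Let evU f lam : ev (map_family phiU f) lam = phiU (ev f lam).
Proof. by case: f => f0 f1 f2; rewrite /phiU /ev /=; mx_expand; mx_lin; ring. Qed.

Let V_root : ev (map_family phiV G) beta = 0.
Proof.
rewrite evV /G gpolyE // -/(gam beta).
have -> a A : phiV (a *: A) = a *: phiV A by rewrite /phiV; mx_expand; mx_lin; ring.
by rewrite /phiV -Qt_gam Pt_gam addrK subrr scaler0.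
Qed.

Let refl_ev lam : lam != beta' -> lam != - beta' -> rho *m ev G lam *m rho = ev G (- lam).
Proof.
move=> l1 l2; rewrite /G !gpolyE // ?eqr_oppLR ?opprK //.
rewrite -scalemxAr -scalemxAl (refl_gauge lp') sqrrN.
by rewrite moebiusN invfM (epsV ee').
Qed.

Let U_root : ev (map_family phiU G) (- beta) = 0.
Proof.
rewrite evU -refl_ev //; have := V_root; rewrite evV.
have r2 B : B *m rho *m rho = B by rewrite -mulmxA (lp_rr lp) mulmx1.
move/(congr1 (fun B => rho *m B *m rho)); rewrite mulmx0 mul0mx => <-.
rewrite /phiU /phiV /Qt /Q (lp_refl lp) (lp_refl lpt).
move: (ev G beta) => E; mx_expand.
by rewrite !r2 (lp_rr lp) !mul1mx; mx_lin; ring.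
Qed.

Let TG' lam : lam != beta' -> lam != - beta' ->
  Pt *m ev G lam *m Q = (lam + beta) ^+ 2 *: (rho *m W *m rho).
Proof.
move=> l1 l2.
have r2 B : B *m rho *m rho = B by rewrite -mulmxA (lp_rr lp) mulmx1.
have := TG (lam := - lam); rewrite ?eqr_oppLR ?opprK => /(_ l2 l1).
rewrite -refl_ev // -opprD sqrrN => h.
rewrite scalemxAl scalemxAr -h /Q /Qt (lp_refl lp) (lp_refl lpt) !mulmxA.
by rewrite (lp_rr lp) mul1mx r2.
Qed.

(** By [h1] and [h2], [gam beta] maps the image of [P] into that of [Pt], and its adjoint maps back.
    Hence no pole appears at [beta] or [- beta]: simple ones cancel by [V_root] and [U_root], double
    ones by [TG] and [TG']. Only the poles of [gam] remain, cleared by [lam^2 - beta'^2]. *)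
Lemma intertwine : exists f : fam, forall lam,
  lam \notin [:: beta; - beta; beta'; - beta'] ->
  (lam ^+ 2 - beta' ^+ 2) *: (GG (eps * moebius beta lam) Pt *m gam lam *m
     GG (eps * moebius beta lam)^-1 P) = ev f lam.
Proof.
pose fV := shift_family eps beta (map_family phiV G).
pose fU := shift_family eps (- beta) (map_family phiU G).
pose W' := rho *m W *m rho.
pose fT := QFamily (((eps + 1) * beta) ^+ 2 *: (W + W'))
  ((2 * (eps - 1) * (eps + 1) * beta) *: (W - W')) ((eps - 1) ^+ 2 *: (W + W')).
exists (QFamily (c0 G + c0 fU + c0 fV + c0 fT) (c1 G + c1 fU + c1 fV + c1 fT)
         (c2 G + c2 fU + c2 fV + c2 fT)) => lam.
rewrite !inE !negb_or => /and4P[l1 l2 l3 l4].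
have n1 : lam - beta != 0 by rewrite subr_eq0.
have n2 : lam + beta != 0 by rewrite addr_eq0.
have e0 := eps0 ee.
set a := eps * moebius beta lam.
have aV : a^-1 = eps * ((lam + beta) / (lam - beta)).
  by rewrite /a /moebius !invfM (epsV ee) invrK; ring.
have a0 : a != 0 by rewrite /a /moebius !mulf_neq0 ?invr_eq0.
rewrite scalemxAl scalemxAr -gpolyE // -/G.
have uv : (a - 1) * (a^-1 - 1) + (a - 1) + (a^-1 - 1) = 0.
  by rewrite mulrBl mulrBr mulfV //; ring.
have HV := shift_familyE eps V_root l1.
have l2' : lam != - - - beta by rewrite opprK.
have HU := shift_familyE eps U_root l2; rewrite opprK in HU.
rewrite -aV evV in HV.
have HT := TG l3 l4; have HT' := TG' l3 l4; rewrite -/W' in HT'.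
have expand E : GG a Pt *m E *m GG a^-1 P = E + (a - 1) *: phiU E + (a^-1 - 1) *: phiV E
    + (a - 1) ^+ 2 *: (Pt *m E *m Q) + (a^-1 - 1) ^+ 2 *: (Qt *m E *m P).
  by rewrite /gauge invrK (block_expand _ _ _ _ _ uv).
rewrite expand HV HT HT' -evU {1}/a {1}/moebius HU.
rewrite (scalerA _ _ W) (scalerA _ _ W') -!exprMn.
have -> : (a - 1) * (lam + beta) = eps * (lam - beta) - (lam + beta).
  by rewrite /a /moebius; field.
have -> : (a^-1 - 1) * (lam - beta) = eps * (lam + beta) - (lam - beta).
  by rewrite aV; field.
exact: sum_family.
Qed.

End Intertwine.
End Intertwining.

(** * Permutability of two simple factors *)

Section Permutability.
Context {F : numFieldType} {m : nat} (g : 'M[F]_m).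
Hypotheses (gT : g^T = g) (gg : g *m g = 1%:M).
Local Notation M := 'M[F]_m.
Local Notation adj := (adjm g).
Local Notation GG := (gauge g).

Lemma ev_mul_poly (f h : @qfamily F m) i j :
  exists2 p : {poly F}, (size p <= 5)%N & forall x, (ev f x *m ev h x) i j = p.[x].
Proof.
exists (Poly [:: (c0 f *m c0 h) i j; (c0 f *m c1 h + c1 f *m c0 h) i j;
   (c0 f *m c2 h + c1 f *m c1 h + c2 f *m c0 h) i j;
   (c1 f *m c2 h + c2 f *m c1 h) i j; (c2 f *m c2 h) i j]).
  exact: size_Poly.
move=> x; rewrite horner_Poly /= /ev; mx_expand; mx_atoms.
by move=> *; rewrite !mxE; ring.
Qed.

Lemma ev_adj (f : @qfamily F m) x : adj (ev f x) = ev (map_family adj f) x.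
Proof. by rewrite /ev !(adjmE gg). Qed.

Section Const.
Context (rho P Pt P' Pt' : M) (alpha alpha' : F).
Hypotheses (lp : line_proj g rho 0 P 0) (lpt : line_proj g rho 0 Pt 0)
  (lp' : line_proj g rho 0 P' 0) (lpt' : line_proj g rho 0 Pt' 0).
Hypotheses (aa : alpha ^+ 2 != alpha' ^+ 2).
Let A' lam := GG (-1 * moebius alpha lam) P.
Let B lam := GG (1 * moebius alpha' lam) P'.
Let A lam := GG (-1 * moebius alpha lam) Pt.
Let B' lam := GG (1 * moebius alpha' lam) Pt'.
Hypotheses (h1 : (1%:M - Pt) *m B alpha *m P = 0)
  (h2 : (1%:M - P) *m adj (B alpha) *m Pt = 0)
  (h3 : (1%:M - Pt') *m A' alpha' *m P' = 0)
  (h4 : (1%:M - P') *m adj (A' alpha') *m Pt' = 0).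

(** The quotient of the two products has, by [intertwine], poles only at [alpha'] and [- alpha']
    and, grouped the other way, only at [alpha] and [- alpha]. Being bounded at infinity, it is
    constant ([rational_const]). *)
Lemma permutability : exists K : M, forall lam,
  lam \notin [:: alpha; - alpha; alpha'; - alpha'] ->
  A lam *m B lam = K *m (B' lam *m A' lam).
Proof.
have N1 : -1 * -1 = 1 :> F by ring.
have O1 : 1 * 1 = 1 :> F by ring.
have aa' : alpha' ^+ 2 != alpha ^+ 2 by rewrite eq_sym.
have [f1 H1] := intertwine gT gg lp lpt lp' N1 O1 aa h1 h2.
have [f2 H2] := intertwine gT gg lp' lpt' lp O1 N1 aa' h3 h4.
(* The factors are orthogonal, so the adjoints are their inverses. *)
pose K lam := A lam *m B lam *m adj (A' lam) *m adj (B' lam).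
have nz e b lam : e * e = 1 -> lam != b -> lam != - b -> e * moebius b lam != 0.
  move=> ee l1 l2; rewrite /moebius !mulf_neq0 ?invr_eq0 ?subr_eq0 ?addr_eq0 //.
  by apply/eqP => e0; move: ee; rewrite e0 mulr0 => /eqP; rewrite eq_sym oner_eq0.
have ccst ij : exists c, forall lam,
    lam \notin [:: alpha; - alpha; alpha'; - alpha'] -> K lam ij.1 ij.2 = c.
  (* [f1] and [gpoly] each absorb one factor [lam^2 - alpha'^2], so [K] times the square of it is a
     polynomial of degree at most four; [p2] does the same with [alpha]. *)
  have [p1 s1 E1] := ev_mul_poly f1 (map_family adj (gpoly g alpha' 1 Pt')) ij.1 ij.2.
  have [p2 s2 E2] := ev_mul_poly (gpoly g alpha (-1) Pt) (map_family adj f2) ij.1 ij.2.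
  apply: (rational_const (p1 := p1) (p2 := p2) aa s1) => lam lamN.
  have := lamN; rewrite !inE !negb_or => /and4P[l1 l2 l3 l4].
  split.
    rewrite -E1 -H1 // -ev_adj gpolyE // adjmZ -scalemxAr -scalemxAl scalerA [RHS]mxE mulrC.
    by rewrite -expr2 /K /A' (adjm_gauge gT gg).
  rewrite -E2 -ev_adj -H2; last by move: lamN; rewrite !inE !negb_or l1 l2 l3 l4.
  rewrite gpolyE // adjmZ -scalemxAr -scalemxAl scalerA [RHS]mxE mulrC -expr2 /K.
  rewrite !(adjmM gg) -/(A lam) -/(A' lam) -/(B lam) -/(B' lam).
  by rewrite (adjm_gauge gT gg) invrK !mulmxA.
have [c cE] := fin_all_exists ccst.
exists (\matrix_(i, j) c (i, j)) => lam lamN.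
have := lamN; rewrite !inE !negb_or => /and4P[l1 l2 l3 l4].
have <- : K lam = \matrix_(i, j) c (i, j).
  by apply/matrixP => i j; rewrite mxE -(cE (i, j) lam lamN).
have VB : adj (B' lam) *m B' lam = 1%:M.
  by rewrite /B' (adjm_gauge gT gg) (gaugeVl gg lpt') ?nz.
have VA : adj (A' lam) *m A' lam = 1%:M.
  by rewrite /A' (adjm_gauge gT gg) (gaugeVl gg lp) ?nz.
by rewrite /K !mulmxA -(mulmxA _ (adj (B' lam))) VB mulmx1 -mulmxA VA mulmx1.
Qed.

End Const.
End Permutability.

(** * The Lorentzian inner product, adjoints and projections *)

Section Lorentz.
Context {R : realType} {n : nat}.
Local Notation C := R[i].
Local Notation vec := 'cV[C]_n.+2.
Local Notation endo := 'M[C]_n.+2.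
Local Notation g := (@gram R n).
Implicit Types (u v w l : vec) (A B P : endo) (V : set vec) (a b c : C).

Lemma gramT : g^T = g.
Proof. by rewrite /gram tr_diag_mx. Qed.

Lemma gram2 : g *m g = 1%:M.
Proof.
rewrite /gram mulmx_diag; apply/matrixP => i j; rewrite !mxE.
by case: (i == ord_max); rewrite /= ?mulrNN ?mulr1.
Qed.

Lemma conjmM {m k p} (A : 'M[C]_(m, k)) (B : 'M[C]_(k, p)) :
  conjm (A *m B) = conjm A *m conjm B.
Proof. exact: map_mxM. Qed.
Lemma conjmD {m k} (A B : 'M[C]_(m, k)) : conjm (A + B) = conjm A + conjm B.
Proof. exact: map_mxD. Qed.
Lemma conjmN {m k} (A : 'M[C]_(m, k)) : conjm (- A) = - conjm A.
Proof. exact: map_mxN. Qed.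
Lemma conjmZ {m k} a (A : 'M[C]_(m, k)) : conjm (a *: A) = conjc a *: conjm A.
Proof. exact: map_mxZ. Qed.
Lemma conjm1 {m} : conjm (1%:M : 'M[C]_m) = 1%:M.
Proof. exact: map_mx1. Qed.
Lemma conjm0 {m k} : conjm (0 : 'M[C]_(m, k)) = 0.
Proof. exact: map_mx0. Qed.
Lemma conjmT {m k} (A : 'M[C]_(m, k)) : conjm A^T = (conjm A)^T.
Proof. by rewrite /conjm map_trmx. Qed.
Lemma conjmK {m k} (A : 'M[C]_(m, k)) : conjm (conjm A) = A.
Proof. by apply/matrixP => i j; rewrite !mxE conjcK. Qed.
Lemma conjm_gram : conjm g = g.
Proof.
apply/matrixP => i j; rewrite !mxE rmorphMn /=; congr (_ *+ _).
by case: ifP => _; apply: complex_ext => //=; rewrite ?oppr0.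
Qed.
Lemma conjm_adj A : conjm (adjm g A) = adjm g (conjm A).
Proof. by rewrite !adjm_def !conjmM conjm_gram conjmT. Qed.
Lemma conjm_sum {m k} N (A : 'I_N -> 'M[C]_(m, k)) :
  conjm (\sum_i A i) = \sum_i conjm (A i).
Proof. exact: map_mx_sum. Qed.
Lemma conjm_invmx A : conjm (invmx A) = invmx (conjm A).
Proof. exact: map_invmx. Qed.

Definition conjmE := (@conjmM, @conjmD, @conjmN, @conjmZ, @conjm1, @conjm0, conjm_gram).

Lemma ipDl u v w : ip (u + v) w = ip u w + ip v w.
Proof. by rewrite /ip linearD !mulmxDl mxE. Qed.
Lemma ipDr u v w : ip w (u + v) = ip w u + ip w v.
Proof. by rewrite /ip mulmxDr mxE. Qed.
Lemma ipZl a u w : ip (a *: u) w = a * ip u w.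
Proof. by rewrite /ip linearZ /= -!scalemxAl mxE. Qed.
Lemma ipZr a u w : ip w (a *: u) = a * ip w u.
Proof. by rewrite /ip -scalemxAr mxE. Qed.
Lemma ipNl u w : ip (- u) w = - ip u w.
Proof. by rewrite -scaleN1r ipZl mulN1r. Qed.
Lemma ipNr u w : ip w (- u) = - ip w u.
Proof. by rewrite -scaleN1r ipZr mulN1r. Qed.
Lemma ip0l w : ip 0 w = 0.
Proof. by rewrite -(scale0r 0) ipZl mul0r. Qed.
Lemma ip0r w : ip w 0 = 0.
Proof. by rewrite -(scale0r 0) ipZr mul0r. Qed.
Lemma ipC u v : ip u v = ip v u.
Proof.
rewrite /ip -[u^T *m g *m v]trmxK [LHS]mxE.
by rewrite !trmx_mul trmxK gramT mulmxA.
Qed.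
Definition ipE := (ipDl, ipDr, ipZl, ipZr, ipNl, ipNr, ip0l, ip0r).

Lemma ip_adjl A u v : ip (A *m u) v = ip u (adjm g A *m v).
Proof. by rewrite /ip adjm_def trmx_mul !mulmxA -[u^T *m g *m g]mulmxA gram2 mulmx1. Qed.
Lemma ip_adjr A u v : ip u (A *m v) = ip (adjm g A *m u) v.
Proof. by rewrite ipC ip_adjl ipC. Qed.
Lemma ip_conj u v : ip (conjm u) (conjm v) = conjc (ip u v).
Proof.
rewrite /ip; have -> : (conjm u)^T *m g *m conjm v = conjm (u^T *m g *m v).
  by rewrite !conjmM conjm_gram conjmT.
by rewrite mxE.
Qed.

Lemma mul11 (w : 'rV[C]_n.+2) v : w *m v = ((w *m v) 0 0)%:M.
Proof. by rewrite -mx11_scalar. Qed.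

Lemma ip_nondeg u : (forall v, ip u v = 0) -> u = 0.
Proof.
move=> h; have : u^T *m g = 0.
  apply/matrixP => i j; rewrite [RHS]mxE !ord1.
  by have := h (delta_mx j 0); rewrite /ip -colE mxE.
move/(congr1 (mulmx^~ g)); rewrite -mulmxA gram2 mulmx1 mul0mx.
by move/(congr1 trmx); rewrite trmxK trmx0.
Qed.

Lemma endo_ext A B : (forall v, A *m v = B *m v) -> A = B.
Proof.
move=> h; apply/matrixP => i j.
by have := congr1 (fun v : vec => v i 0) (h (delta_mx j 0)); rewrite -!colE !mxE.
Qed.

(** [proj] is made by choice; a self-adjoint idempotent with range [V] meets its specification, and
    is the only one by nondegeneracy of [ip]. *)
Lemma projE V P : P *m P = P -> adjm g P = P -> (forall v, V v <-> P *m v = v) ->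
  proj V = P /\ forall v, perp V v <-> P *m v = 0.
Proof.
move=> PP PA VP.
have pe v : perp V v <-> P *m v = 0.
  split=> [h|h w /VP <-]; last by rewrite ip_adjr PA h ip0l.
  apply: ip_nondeg => u; rewrite ip_adjl PA; apply: h.
  by apply/VP; rewrite mulmxA PP.
split=> //; rewrite /proj; case: xgetP => [A _ /= hA|/(_ P)].
  apply: endo_ext => v; have [/VP h1 /pe h2] := hA v.
  by rewrite -h1; move: h2; rewrite mulmxBr => /eqP; rewrite subr_eq0 => /eqP ->.
case=> v; split; first by apply/VP; rewrite mulmxA PP.
by apply/pe; rewrite mulmxBr mulmxA PP subrr.
Qed.

(** The projection onto the line of [l] along the orthogonal complement of [w]. *)
Definition lproj l w : endo := (ip w l)^-1 *: (l *m (w^T *m g)).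

Lemma lproj_vec l w v : lproj l w *m v = (ip w v / ip w l) *: l.
Proof.
rewrite /lproj -scalemxAl -mulmxA mul11 mul_mx_scalar scalerA mulrC.
by [].
Qed.

Lemma adjm_lproj l w : adjm g (lproj l w) = lproj w l.
Proof.
rewrite adjm_def /lproj linearZ /= !trmx_mul trmxK gramT -scalemxAr -scalemxAl ipC.
by rewrite !mulmxA gram2 mul1mx.
Qed.

(** The compression is a scalar multiple of the self-adjoint endomorphism sending [v] to
    [ip w v *: w]. *)
Lemma lproj_rank1 l w A : adjm g (lproj w l *m A *m lproj l w) = lproj w l *m A *m lproj l w.
Proof.
have E : lproj w l *m A *m lproj l w =
    ((ip l w)^-1 * (ip w l)^-1 * (ip l (A *m l))) *: (w *m (w^T *m g)).
  have e1 : w *m (l^T *m g) *m A *m (l *m (w^T *m g)) = ip l (A *m l) *: (w *m (w^T *m g)).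
    transitivity (w *m (l^T *m g *m (A *m l)) *m (w^T *m g)); first by rewrite !mulmxA.
    by rewrite [l^T *m g *m (A *m l)]mul11 mul_mx_scalar -scalemxAl.
  by rewrite /lproj -!scalemxAl -scalemxAr e1 !scalerA.
by rewrite E adjmZ adjm_def !trmx_mul trmxK gramT !mulmxA gram2 mul1mx.
Qed.

Lemma lproj_line_proj rho l : rho *m rho = 1%:M -> adjm g rho = rho ->
  ip l l = 0 -> ip l (rho *m l) != 0 ->
  line_proj g rho 0 (lproj l (rho *m l)) 0.
Proof.
move=> rr ar l0 lw; set w := rho *m l.
have w0 : ip w w = 0 by rewrite ip_adjl ar mulmxA rr mul1mx.
have rw : rho *m w = l by rewrite mulmxA rr mul1mx.
have wl : ip w l != 0 by rewrite ipC.
split; rewrite ?adjm_lproj ?mul0mx ?mulmx0 ?mul0mx ?addr0 //.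
- exact: adjm0.
- apply: endo_ext => v; rewrite -mulmxA !(lproj_vec _ _ v) -scalemxAr lproj_vec.
  by rewrite mulfV // scale1r.
- apply: endo_ext => v; rewrite -mulmxA !(lproj_vec _ _ v) -scalemxAr lproj_vec.
  by rewrite w0 mul0r scale0r scaler0 mul0mx.
- apply: endo_ext => v; rewrite -mulmxA !(lproj_vec _ _ v) -scalemxAr lproj_vec.
  by rewrite l0 mul0r scale0r scaler0 mul0mx.
- apply: endo_ext => v; rewrite -!mulmxA !lproj_vec -scalemxAr.
  by rewrite [in RHS]ip_adjr ar rw [ip l w]ipC.
- exact: lproj_rank1.
all: by rewrite ?adjm0 ?mulmx0 ?mul0mx ?addr0.
Qed.

End Lorentz.

(** * Null line bundles: explicit factors, and derivatives of their projections *)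

Section LineBundles.
Context {R : realType} {n : nat}.
Local Notation C := R[i].
Local Notation I := ('i%C : C).
Local Notation pt := (R * R)%type.
Local Notation vec := 'cV[C]_n.+2.
Local Notation endo := 'M[C]_n.+2.
Local Notation g := (@gram R n).
Implicit Types (U : set pt) (x y X Y : pt) (u v w l : vec) (a b c : C).

Lemma gauge_vec a (P : endo) v : gauge g a P *m v =
  v + (a - 1) *: (P *m v) + (a^-1 - 1) *: (adjm g P *m v).
Proof. by rewrite /gauge !mulmxDl mul1mx -!scalemxAl. Qed.

(** [acting] is made by choice. The explicit [gauge] meets its specification, and uniqueness holds
    because every vector splits along the line, its reflection and the complement orthogonal to
    both. *)
Lemma actingE U (Lam L : pt -> set vec) a x l : let w := refl U Lam x *m l in
  L x = line l -> a != 0 -> ip l l = 0 -> ip w w = 0 -> ip w l != 0 ->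
  acting U Lam a L x = gauge g a (lproj l w).
Proof.
move=> w Ll a0 l0 w0 wl.
have lw : ip l w != 0 by rewrite ipC.
have Rw : reflB U Lam L x = line w.
  rewrite /reflB Ll; apply/seteqP; split => [u [_ [c _ <-] <-]|u [c _ <-]].
    by exists c => //; rewrite -scalemxAr.
  by exists (c *: l); [exists c|rewrite -scalemxAr].
have inL : L x l by rewrite Ll; exists 1; rewrite ?scale1r.
have inR : reflB U Lam L x w by rewrite Rw; exists 1; rewrite ?scale1r.
have perpP v : perp (addV (L x) (reflB U Lam L x)) v <-> ip v l = 0 /\ ip v w = 0.
  rewrite Rw Ll; split=> [h|[h1 h2] _ [_ [_ [[c _ <-] [d _ <-] ->]]]].
    split; apply: h.
      by exists l, 0; split; [exists 1; rewrite ?scale1r|exists 0; rewrite ?scale0r|rewrite addr0].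
    by exists 0, w; split; [exists 0; rewrite ?scale0r|exists 1; rewrite ?scale1r|rewrite add0r].
  by rewrite !ipE h1 h2 !mulr0 addr0.
have good : [/\ forall v, L x v -> gauge g a (lproj l w) *m v = a *: v,
        forall v, reflB U Lam L x v -> gauge g a (lproj l w) *m v = a^-1 *: v &
        forall v, perp (addV (L x) (reflB U Lam L x)) v -> gauge g a (lproj l w) *m v = v].
  split=> v.
  - rewrite Ll => -[c _ <-]; rewrite gauge_vec adjm_lproj !lproj_vec !ipE l0 !(mulr0, mul0r, scale0r, scaler0) addr0.
    by rewrite mulfK // -{1}[c *: l]scale1r -scalerDl addrC subrK.
  - rewrite Rw => -[c _ <-]; rewrite gauge_vec adjm_lproj !lproj_vec !ipE w0 !(mulr0, mul0r, scale0r, scaler0) addr0.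
    by rewrite mulfK // -{1}[c *: w]scale1r -scalerDl addrC subrK.
  - move/perpP => [h1 h2]; rewrite gauge_vec adjm_lproj !lproj_vec.
    by rewrite [ip w v]ipC [ip l v]ipC h1 h2 !mul0r !scale0r !scaler0 !addr0.
rewrite /acting; case: xgetP => [A _ [A1 A2 A3]|/(_ (gauge g a (lproj l w)))//].
have [B1 B2 B3] := good; apply: endo_ext => v.
have [p Ep] := ex_intro (fun p => p = lproj l w *m v) _ erefl.
have [q Eq] := ex_intro (fun q => q = lproj w l *m v) _ erefl.
have [s Es] := ex_intro (fun s => s = v - p - q) _ erefl.
have -> : v = s + p + q by rewrite Es addrAC !subrK.
have Lp : L x p by rewrite Ep lproj_vec Ll; exists (ip w v / ip w l).
have Rq : reflB U Lam L x q by rewrite Eq lproj_vec Rw; exists (ip l v / ip l w).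
have Pr : perp (addV (L x) (reflB U Lam L x)) s.
  apply/perpP; rewrite Es Ep Eq !lproj_vec !ipE l0 w0 !mulr0 !subr0.
  rewrite [ip w v]ipC [ip l v]ipC; split.
    by rewrite [ip l w]ipC divfK // subrr.
  by rewrite [ip l w]ipC divfK // subrr.
by rewrite !mulmxDr (A1 _ Lp) (A2 _ Rq) (A3 _ Pr) (B1 _ Lp) (B2 _ Rq) (B3 _ Pr).
Qed.

Section Calculus.
Context {U : set pt} (oU : open U).

Lemma smooth_adj (A : pt -> endo) : smooth U A -> smooth U (fun x => adjm g (A x)).
Proof.
move=> CA; apply: (smooth_ext oU (A := fun x => g *m (A x)^T *m g)).
  by move=> x _; rewrite adjm_def.
have Cg : smooth U (fun=> g) by exact: smooth_cst.
by apply: smoothM => //; apply: smoothM => //; exact: smooth_tr.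
Qed.

Lemma csmooth_ip (s t : pt -> vec) : smooth U s -> smooth U t ->
  csmooth U (fun x => ip (s x) (t x)).
Proof.
move=> Cs Ct; apply: csmooth_trace1; apply: smoothM => //; apply: smoothM => //.
  exact: smooth_tr.
exact: smooth_cst.
Qed.

Lemma cder_ip (s t : pt -> vec) x X : U x -> smooth U s -> smooth U t ->
  cder (fun x => ip (s x) (t x)) x X = ip (der s x X) (t x) + ip (s x) (der t x X).
Proof.
move=> Ux Cs Ct; have Cg : smooth U (fun=> g) by exact: smooth_cst.
have Cs' := smooth_tr oU Cs.
have := derM oU Ux X (smoothM oU Cs' Cg) Ct.
rewrite (derM oU Ux X Cs' Cg) der_cst mulmx0 addr0 (der_tr oU Ux).
by move/(congr1 (fun A : 'M[C]_1 => A 0 0)); rewrite derE [RHS]mxE.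
Qed.

Lemma smooth_lproj (s t : pt -> vec) : smooth U s -> smooth U t ->
  (forall x, U x -> ip (t x) (s x) != 0) -> smooth U (fun x => lproj (s x) (t x)).
Proof.
move=> Cs Ct h; apply: smoothZ => //; first by apply: csmoothV => //; exact: csmooth_ip.
apply: smoothM => //; apply: smoothM => //; first exact: smooth_tr.
exact: smooth_cst.
Qed.

Lemma smooth_gauge a (P : pt -> endo) : smooth U P -> smooth U (fun x => gauge g a (P x)).
Proof.
move=> CP; have CQ := smooth_adj CP.
apply: smoothD => //; last exact: smoothZc.
by apply: smoothD => //; [exact: smooth_cst|exact: smoothZc].
Qed.

Context (J : pt -> pt).

(** With [J x] the complex structure applied to [e1] at [x], this is the derivative along the (1,0)
    vector [e1 - i J x], on which all equations will be tested. *)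
Definition dz {m k} (A : pt -> 'M[C]_(m, k)) x : 'M[C]_(m, k) :=
  der A x e1 - I *: der A x (J x).

Section At.
Context {x : pt} (Ux : U x).

Lemma dz_ext {m k} (A B : pt -> 'M[C]_(m, k)) :
  (forall x, U x -> A x = B x) -> dz A x = dz B x.
Proof. by move=> AB; rewrite /dz !(der_ext oU Ux _ AB). Qed.

Lemma dz_cst {m k} (A : 'M[C]_(m, k)) : dz (fun=> A) x = 0.
Proof. by rewrite /dz !der_cst scaler0 subrr. Qed.

Lemma dzD {m k} (A B : pt -> 'M[C]_(m, k)) : smooth U A -> smooth U B ->
  dz (fun x => A x + B x) x = dz A x + dz B x.
Proof. by move=> CA CB; rewrite /dz !(derD oU Ux _ CA CB) scalerDr opprD addrACA. Qed.

Lemma dzN {m k} (A : pt -> 'M[C]_(m, k)) : smooth U A ->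
  dz (fun x => - A x) x = - dz A x.
Proof. by move=> CA; rewrite /dz !(derN oU Ux _ CA) scalerN opprB opprK addrC. Qed.

Lemma dzB {m k} (A B : pt -> 'M[C]_(m, k)) : smooth U A -> smooth U B ->
  dz (fun x => A x - B x) x = dz A x - dz B x.
Proof. by move=> CA CB; rewrite dzD ?dzN //; exact: smoothN. Qed.

Lemma dzZc {m k} c (A : pt -> 'M[C]_(m, k)) : smooth U A ->
  dz (fun x => c *: A x) x = c *: dz A x.
Proof.
move=> CA; rewrite /dz !(derZc oU Ux _ _ CA) scalerBr scalerA mulrC -scalerA.
by [].
Qed.

Lemma dzM {m k p} (A : pt -> 'M[C]_(m, k)) (B : pt -> 'M[C]_(k, p)) :
  smooth U A -> smooth U B ->
  dz (fun x => A x *m B x) x = dz A x *m B x + A x *m dz B x.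
Proof.
move=> CA CB; rewrite /dz !(derM oU Ux _ CA CB) scalerDr opprD addrACA.
by rewrite mulmxBl mulmxBr -scalemxAl -scalemxAr.
Qed.

Lemma dz_tr {m k} (A : pt -> 'M[C]_(m, k)) : dz (fun x => (A x)^T) x = (dz A x)^T.
Proof.
have e (X Y : 'M[C]_(m, k)) : X^T - I *: Y^T = (X - I *: Y)^T.
  by apply/matrixP => i j; rewrite !mxE.
by rewrite /dz !(der_tr oU Ux) e.
Qed.

Lemma dz_adj (A : pt -> endo) : smooth U A ->
  dz (fun x => adjm g (A x)) x = adjm g (dz A x).
Proof.
move=> CA; have Cg : smooth U (fun=> g) by exact: smooth_cst.
have CT := smooth_tr oU CA.
rewrite (@dz_ext _ _ _ (fun x => g *m (A x)^T *m g)); last by move=> y _; rewrite adjm_def.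
rewrite (dzM (smoothM oU Cg CT) Cg) (dzM Cg CT) !dz_cst mul0mx mulmx0 add0r addr0.
by rewrite dz_tr adjm_def.
Qed.

End At.

(** The derivative clauses of [line_proj] are its pointwise clauses differentiated. *)
Lemma line_proj_dz (rho : pt -> endo) (t : pt -> vec) :
  smooth U rho -> smooth U t ->
  (forall x, U x -> rho x *m rho x = 1%:M) -> (forall x, U x -> adjm g (rho x) = rho x) ->
  (forall x, U x -> ip (t x) (t x) = 0) ->
  (forall x, U x -> ip (t x) (rho x *m t x) != 0) ->
  let P x := lproj (t x) (rho x *m t x) in
  smooth U P /\ forall x, U x -> line_proj g (rho x) (dz rho x) (P x) (dz P x).
Proof.
move=> Crho Ct rr ar tt tw P.
have Cw := smoothM oU Crho Ct.
have CP : smooth U P by apply: smooth_lproj => // y Uy; rewrite ipC tw.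
split=> // x Ux.
have lp y : U y -> line_proj g (rho y) 0 (P y) 0.
  by move=> Uy; apply: lproj_line_proj => //; [exact: rr|exact: ar|exact: tt|exact: tw].
have Ca := smooth_adj CP.
case: (lp x Ux) => e1 _ e2 _ e3 e4 e5 e6 e7 _ _ _ _; split=> //.
- by have := dz_ext Ux (B := fun=> 1%:M) rr; rewrite dz_cst (dzM Ux).
- by rewrite -(dz_adj Ux Crho) (dz_ext Ux ar).
- rewrite -(dzM Ux CP CP); apply: (dz_ext Ux) => y Uy.
  by case: (lp y Uy).
- have h y : U y -> P y *m adjm g (P y) = 0 by move=> Uy; case: (lp y Uy).
  by have := dz_ext Ux (B := fun=> 0) h; rewrite dz_cst (dzM Ux) // dz_adj.
- have h y : U y -> adjm g (P y) *m P y = 0 by move=> Uy; case: (lp y Uy).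
  by have := dz_ext Ux (B := fun=> 0) h; rewrite dz_cst (dzM Ux) // dz_adj.
- rewrite -dz_adj // -mulmxDl -(dzM Ux Crho CP) -(dzM Ux (smoothM oU Crho CP) Crho).
  by apply: (dz_ext Ux) => y Uy; case: (lp y Uy).
Qed.

End Calculus.
End LineBundles.

(** * Lifts of the surface and positivity of the induced metric *)

Section SurfaceMetric.
Context {R : realType} {n : nat}.
Local Notation C := R[i].
Local Notation I := ('i%C : C).
Local Notation pt := (R * R)%type.
Local Notation vec := 'cV[C]_n.+2.
Local Notation endo := 'M[C]_n.+2.
Local Notation g := (@gram R n).
Implicit Types (x y X Y : pt) (u v w : vec).

Lemma ip_sum u v : ip u v =
  \sum_i (if i == ord_max then -1 else 1) * (u i 0 * v i 0).
Proof.
rewrite /ip /gram !mxE; apply: eq_bigr => i _.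
by rewrite mul_mx_diag !mxE; case: ifP => _; ring.
Qed.

Lemma conjm_fix v i : conjm v = v -> complex.Im (v i 0) = 0.
Proof.
move/(congr1 (fun w : vec => w i 0)); rewrite mxE; case: (v i 0) => a b /= [/eqP].
by rewrite -subr_eq0 -opprD oppr_eq0 -mulr2n mulrn_eq0 /= => /eqP.
Qed.

Lemma ip_real u v : conjm u = u -> conjm v = v -> ip u v = (complex.Re (ip u v))%:C%C.
Proof.
move=> cu cv; have := ip_conj u v; rewrite cu cv; case: (ip u v) => a b /= [/eqP].
by rewrite -subr_eq0 opprK -mulr2n mulrn_eq0 /= => /eqP ->.
Qed.

(* Subtracting a multiple of the null vector [s] kills the time component. *)
Lemma lorentz_pos s v : conjm s = s -> s != 0 -> ip s s = 0 ->
  conjm v = v -> ip s v = 0 -> ~ line s v -> 0 < complex.Re (ip v v).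
Proof.
move=> cs s0 ss cv sv nl.
have s0m : s ord_max 0 != 0.
  apply: contra s0 => /eqP sm; apply/eqP/matrixP => i j; rewrite ord1 [RHS]mxE.
  move/eqP: ss; rewrite ip_sum.
  have -> : \sum_i (if i == ord_max then -1 else 1) * (s i 0 * s i 0) =
      (\sum_i (complex.Re (s i 0)) ^+ 2)%:C%C :> C.
    rewrite rmorph_sum; apply: eq_bigr => k _.
    have [->|_] := eqVneq k ord_max; first by rewrite sm /= mulr0 mulr0 expr0n.
    have := conjm_fix k cs; case: (s k 0) => a b /= ->.
    by rewrite mul1r; apply: complex_ext => /=; ring.
  move/eqP => [/eqP]; rewrite psumr_eq0 => [/allP/(_ i)|k _]; last exact: sqr_ge0.
  rewrite mem_index_enum => /(_ isT); rewrite sqrf_eq0 => /eqP re0.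
  by have := conjm_fix i cs; move: re0; case: (s i 0) => a b /= -> ->.
pose c := v ord_max 0 / s ord_max 0.
have [w Ew] := ex_intro (fun w => w = v - c *: s) _ erefl.
have cc : conjc c = c.
  have cm (z : vec) : conjm z = z -> conjc (z ord_max 0) = z ord_max 0.
    by move=> cz; rewrite -{2}cz [in RHS]mxE.
  by rewrite /c rmorphM fmorphV /= !cm.
have cw : conjm w = w by rewrite Ew conjmD conjmN conjmZ cv cs cc.
have wm : w ord_max 0 = 0 by rewrite Ew !mxE /c divfK // subrr.
have vv : ip v v = ip w w.
  by rewrite Ew !ipE ss sv [ip v s]ipC sv !mulr0 ?oppr0 ?mulr0 ?oppr0 ?addr0 ?subr0.
have w0 : w != 0.
  apply/negP => /eqP w0; apply: nl; exists c => //.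
  by apply/eqP; rewrite eq_sym -subr_eq0 -Ew w0.
have E : ip w w = (\sum_i (complex.Re (w i 0)) ^+ 2)%:C%C.
  rewrite ip_sum rmorph_sum; apply: eq_bigr => k _.
  have [->|_] := eqVneq k ord_max; first by rewrite wm /= mulr0 mulr0 expr0n.
  have := conjm_fix k cw; case: (w k 0) => a b /= ->.
  by rewrite mul1r; apply: complex_ext => /=; ring.
rewrite vv E /= lt_def sumr_ge0 ?andbT => [|i _]; last exact: sqr_ge0.
rewrite psumr_eq0 => [|i _]; last exact: sqr_ge0.
apply: contra w0 => /allP h; apply/eqP/matrixP => i j; rewrite ord1 [RHS]mxE.
have := h i; rewrite mem_index_enum => /(_ isT); rewrite sqrf_eq0 => /eqP re0.
by have := conjm_fix i cw; move: re0; case: (w i 0) => a b /= -> ->.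
Qed.

Context (U : set pt) (oU : open U) (Lam : pt -> set vec) (sf : is_surface U Lam).
Let s := Defs.lift U Lam.

Lemma lift_is_lift : is_lift U Lam s.
Proof.
rewrite /s /Defs.lift; case: xgetP => [t _ //|h].
by have [t lt _] := sf; case: (h t).
Qed.

Lemma smooth_lift : smooth U s. Proof. by case: lift_is_lift. Qed.

Lemma lift_props x : U x -> [/\ conjm (s x) = s x, s x != 0, ip (s x) (s x) = 0 & Lam x = line (s x)].
Proof. by case: lift_is_lift => _; exact. Qed.

(** [is_surface] supplies the immersion condition for some lift [t], perhaps not for the chosen [s].
    Near [x] they differ by a smooth scalar function, which does not affect whether the derivative
    lies in the line. *)
Lemma lift_immersion x X : U x -> X != 0 -> ~ line (s x) (der s x X).
Proof.
move=> Ux X0 [c _ cE].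
have [t [Ct tP] im] := sf; apply: (im x X Ux X0).
have [_ s0 _ Ls] := lift_props Ux; have [_ t0 _ Lt] := tP x Ux.
have [i si] : exists i, s x i 0 != 0.
  apply: contrapT => h; move/negP: s0; apply; apply/eqP/matrixP => i j.
  by rewrite ord1 [RHS]mxE; apply: contrapT => /eqP hi; apply: h; exists i.
(* On this neighbourhood the scalar relating [t] to [s] is the quotient of their [i]-th coordinates,
   hence smooth. *)
pose U' := U `&` [set y | s y i 0 != 0].
have Cs := smooth_lift.
have Csi : csmooth U (fun y => s y i 0) by exact: (smoothP _).1 Cs i 0.
have Cti : csmooth U (fun y => t y i 0) by exact: (smoothP _).1 Ct i 0.
have oU' : open U'.
  rewrite openE => y [Uy sy]; rewrite /interior /=.
  have N1 : nbhs y U by exact: open_nbhs_nbhs.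
  have [C1 C2] := Csi 0.
  have K1 := C1.1 y Uy; have K2 := C2.1 y Uy.
  suff N2 : nbhs y [set z | s z i 0 != 0] by exact: filterI.
  have ne (f : pt -> R) : {for y, continuous f} -> f y != 0 -> nbhs y [set z | f z != 0].
    by move=> cf fy; exact: (cvgr_neq0 _ cf fy).
  have [re|re] := eqVneq (complex.Re (s y i 0)) 0.
    have im' : complex.Im (s y i 0) != 0.
      by apply: contra sy => /eqP im'; move: re im'; case: (s y i 0) => a b /= -> ->.
    by apply: filterS (ne _ K2 im') => z /=; apply: contra => /eqP ->.
  by apply: filterS (ne _ K1 re) => z /=; apply: contra => /eqP ->.
have Ux' : U' x by split.
have sub k (f : pt -> R) : Ck U k f -> Ck U' k f.
  elim: k f => [|k IH] f [cf df]; split=> //; try by move=> y [Uy _]; exact: cf.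
  by move=> Y; have [d1 d2] := df Y; split; [move=> y [Uy _]; exact: d1|exact: IH].
have csub f : csmooth U f -> csmooth U' f.
  by move=> Cf r; have [? ?] := Cf r; split; exact: sub.
have smsub (f : pt -> vec) : smooth U f -> smooth U' f.
  by move=> Cf r i' j'; have [? ?] := Cf r i' j'; split; exact: sub.
have CV : csmooth U' (fun y => t y i 0 / s y i 0).
  apply: (csmoothM oU') (csub _ Cti) (csmoothV oU' _ (csub _ Csi)).
  by move=> y [].
have tE y : U' y -> (t y i 0 / s y i 0) *: s y = t y.
  move=> [Uy sy]; have [_ _ _ Lsy] := lift_props Uy; have [_ _ _ Lty] := tP y Uy.
  have : line (s y) (t y) by rewrite -Lsy Lty; exists 1; rewrite ?scale1r.
  by case=> d _ <-; rewrite mxE mulfK.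
have := der_ext oU' Ux' X tE; rewrite (derZ oU' Ux' _ CV (smsub _ Cs)) -cE => <-.
rewrite Ls scalerA -scalerDl; eexists => //.
Qed.

End SurfaceMetric.

Lemma ip_comb {R : realType} {n : nat} (u v : 'cV[R[i]]_n.+2) (a b : R[i]) :
  ip (a *: u + b *: v) (a *: u + b *: v) =
  a ^+ 2 * ip u u + 2 * a * b * ip u v + b ^+ 2 * ip v v.
Proof. by rewrite !ipE [ip v u]ipC; ring. Qed.

Lemma real_comb {R : realType} (a b p q r : R) :
  (a%:C ^+ 2 * p%:C + 2 * a%:C * b%:C * q%:C + b%:C ^+ 2 * r%:C)%C =
  (a ^+ 2 * p + 2 * a * b * q + b ^+ 2 * r)%:C%C.
Proof. by apply: complex_ext => /=; ring. Qed.

Lemma disc_aux {R : realType} (E F G : R) : 0 < E ->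
  0 < (- F) ^+ 2 * E + 2 * (- F) * E * F + E ^+ 2 * G -> 0 < E * G - F ^+ 2.
Proof.
move=> E0; have -> : (- F) ^+ 2 * E + 2 * (- F) * E * F + E ^+ 2 * G = E * (E * G - F ^+ 2).
  by ring.
by rewrite pmulr_rgt0.
Qed.

(** * Metric coefficients and complex structure in coordinates *)

Section SurfaceFrame.
Context {R : realType} {n : nat}.
Local Notation C := R[i].
Local Notation I := ('i%C : C).
Local Notation pt := (R * R)%type.
Local Notation vec := 'cV[C]_n.+2.
Local Notation endo := 'M[C]_n.+2.
Local Notation g := (@gram R n).
Implicit Types (x y X Y : pt) (u v w : vec).
Context (U : set pt) (oU : open U) (Lam : pt -> set vec) (sf : is_surface U Lam).
Let s := Defs.lift U Lam.
Let Cs : smooth U s := smooth_lift sf.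

Definition gE x := metric U Lam x e1 e1.
Definition gF x := metric U Lam x e1 e2.
Definition gG x := metric U Lam x e2 e2.
Definition garea x : R := Num.sqrt (gE x * gG x - gF x ^+ 2).
Definition j1 x : R := - gF x / garea x.
Definition j2 x : R := gE x / garea x.

Lemma pt_decomp X : X = X.1 *: e1 + X.2 *: e2.
Proof.
by case: X => a b; congr pair; rewrite /= /GRing.scale /= ?mulr1 ?mulr0 ?addr0 ?add0r.
Qed.

Lemma pair_lin (a b : R) : a *: e1 + b *: e2 = (a, b) :> pt.
Proof. by rewrite [RHS]pt_decomp. Qed.

Lemma cpxE x X : cpx U Lam x X = ((- gF x * X.1 - gG x * X.2) / garea x,
  (gE x * X.1 + gF x * X.2) / garea x).
Proof. by []. Qed.

Lemma cpx_e1 x : cpx U Lam x e1 = j1 x *: e1 + j2 x *: e2.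
Proof.
rewrite pair_lin cpxE /j1 /j2; move: (gE x) (gF x) (gG x) (garea x) => E F G a.
by congr pair; rewrite /=; ring.
Qed.

Lemma cpx_pair x a b : cpx U Lam x (a, b) =
  (a * j1 x - b * (gG x / garea x), a * j2 x + b * (gF x / garea x)).
Proof.
rewrite cpxE /j1 /j2; move: (gE x) (gF x) (gG x) (garea x) => E F G c.
by congr pair; rewrite /=; ring.
Qed.

Section At.
Context {x : pt} (Ux : U x).

Lemma lift_real : conjm (s x) = s x. Proof. by case: (lift_props sf Ux). Qed.
Lemma lift_neq0 : s x != 0. Proof. by case: (lift_props sf Ux). Qed.
Lemma lift_null : ip (s x) (s x) = 0. Proof. by case: (lift_props sf Ux). Qed.
Lemma lift_line : Lam x = line (s x). Proof. by case: (lift_props sf Ux). Qed.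

Lemma der_lift_real X : conjm (der s x X) = der s x X.
Proof.
rewrite -(der_conjm oU Ux X Cs); apply: (der_ext oU Ux) => y Uy.
by case: (lift_props sf Uy).
Qed.

Lemma der_dir (A : pt -> vec) (a b : R) : smooth U A ->
  der A x (a *: e1 + b *: e2) = a%:C%C *: der A x e1 + b%:C%C *: der A x e2.
Proof. by move=> CA; rewrite (der_lin oU Ux). Qed.

Lemma ip_lift_der X : ip (s x) (der s x X) = 0.
Proof.
have e : forall y, U y -> ip (s y) (s y) = 0 by move=> y Uy; case: (lift_props sf Uy).
have := cder_ext oU Ux X e; rewrite cder_cst (cder_ip oU X Ux Cs Cs) ipC -mulr2n.
by move/eqP; rewrite mulrn_eq0 /= => /eqP.
Qed.

Lemma ip_der X Y : ip (der s x X) (der s x Y) = (metric U Lam x X Y)%:C%C.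
Proof. exact/ip_real/der_lift_real/der_lift_real. Qed.

Lemma metricC X Y : metric U Lam x X Y = metric U Lam x Y X.
Proof. by rewrite /metric ipC. Qed.

Lemma metric_pos X : X != 0 -> 0 < metric U Lam x X X.
Proof.
move=> X0; apply: (lorentz_pos lift_real lift_neq0 lift_null (der_lift_real X) (ip_lift_der X)).
exact: lift_immersion.
Qed.

Lemma metric_dir a b : metric U Lam x (a *: e1 + b *: e2) (a *: e1 + b *: e2) =
  a ^+ 2 * gE x + 2 * a * b * gF x + b ^+ 2 * gG x.
Proof.
have h := ip_comb (der s x e1) (der s x e2) a%:C%C b%:C%C.
rewrite -(der_dir _ _ Cs) (ip_der e1 e1) (ip_der e1 e2) (ip_der e2 e2) ip_der in h.
by rewrite real_comb in h; exact: complexI h.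
Qed.

Lemma e1_neq0 : (e1 : pt) != 0.
Proof. by apply/eqP => -[/eqP]; rewrite oner_eq0. Qed.

Lemma gE_pos : 0 < gE x.
Proof. exact: metric_pos e1_neq0. Qed.

Lemma disc_pos : 0 < gE x * gG x - gF x ^+ 2.
Proof.
have E0 := gE_pos.
(* The squared length of this vector is [E (E G - F^2)]. *)
have X0 : ((- gF x) *: e1 + gE x *: e2 : pt) != 0.
  apply/eqP => -[_ /eqP]; rewrite /GRing.scale /= mulr1 mulr0 add0r => /eqP E1.
  by move: E0; rewrite E1 ltxx.
have := metric_pos X0; rewrite metric_dir.
exact: disc_aux E0.
Qed.

Lemma area_pos : 0 < garea x.
Proof. by rewrite sqrtr_gt0 disc_pos. Qed.

Lemma area_neq0 : garea x != 0. Proof. by rewrite gt_eqF ?area_pos. Qed.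

Lemma area_sqr : garea x ^+ 2 = gE x * gG x - gF x ^+ 2.
Proof. by rewrite sqr_sqrtr // ltW // disc_pos. Qed.

Lemma cpx2 X : cpx U Lam x (cpx U Lam x X) = - X.
Proof.
case: X => a b; rewrite !cpx_pair /j1 /j2.
have a0 := area_neq0; have a2 := area_sqr.
move: a0 a2; move: (gE x) (gF x) (gG x) (garea x) => E F G c c0 c2.
have d : c^-1 * c^-1 * (E * G - F ^+ 2) = 1 by rewrite -c2 expr2; field.
have -> : - (a, b) = (- a, - b) :> pt by [].
congr pair.
  transitivity (- a * (c^-1 * c^-1 * (E * G - F ^+ 2))); last by rewrite d mulr1.
  by ring.
transitivity (- b * (c^-1 * c^-1 * (E * G - F ^+ 2))); last by rewrite d mulr1.
by ring.
Qed.

Definition zeta : vec := der s x e1 - I *: der s x (cpx U Lam x e1).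
Definition zetab : vec := der s x e1 + I *: der s x (cpx U Lam x e1).

End At.
End SurfaceFrame.

(** * Linear algebra of the four-dimensional frame at one point *)

Section PointFrame.
Context {R : realType} {n : nat}.
Local Notation C := R[i].
Local Notation I := ('i%C : C).
Local Notation vec := 'cV[C]_n.+2.
Local Notation endo := 'M[C]_n.+2.
Local Notation g := (@gram R n).
Implicit Types (u v w : vec) (c : C).

Lemma II : I * I = -1.
Proof. by rewrite -expr2 sqr_i. Qed.

Definition frameB (s s1 s2 D : vec) : 'M[C]_(n.+2, (1 + 1) + (1 + 1)) :=
  row_mx (row_mx s s1) (row_mx s2 D).

Definition gramB {k} (B : 'M[C]_(n.+2, k)) := B^T *m g *m B.
(** The orthogonal projection onto the column space of [B] when the Gram matrix is invertible. Being
    rational in [B], it depends smoothly on the base point. *)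
Definition projB {k} (B : 'M[C]_(n.+2, k)) : endo := B *m invmx (gramB B) *m B^T *m g.

Section Generic.
Context {k : nat} (B : 'M[C]_(n.+2, k)) (uB : gramB B \in unitmx).

Lemma projB_fix : projB B *m B = B.
Proof. by rewrite /projB -!mulmxA [B^T *m (g *m B)]mulmxA mulVmx // mulmx1. Qed.

Lemma projB_idem : projB B *m projB B = projB B.
Proof. by rewrite {2 3}/projB !mulmxA projB_fix. Qed.

Lemma gramB_sym : (gramB B)^T = gramB B.
Proof. by rewrite /gramB !trmx_mul trmxK gramT mulmxA. Qed.

Lemma projB_adj : adjm g (projB B) = projB B.
Proof.
rewrite adjm_def /projB !trmx_mul trmxK trmx_inv gramB_sym gramT.
by rewrite !mulmxA gram2 mul1mx.
Qed.

Lemma projB_mem v : projB B *m v = v <-> exists c : 'cV[C]_k, v = B *m c.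
Proof.
split=> [<-|[c ->]]; last by rewrite mulmxA projB_fix.
by exists (invmx (gramB B) *m B^T *m g *m v); rewrite /projB !mulmxA.
Qed.

Lemma projB_rank : \rank (projB B) = k.
Proof.
apply/eqP; rewrite eqn_leq; apply/andP; split.
  by rewrite /projB -!mulmxA; exact: mulmx_max_rank.
have e : \rank (B^T *m g *m (projB B *m B)) = k by rewrite projB_fix; exact: mxrank_unit.
rewrite -[X in (X <= _)%N]e; apply: (leq_trans (mxrankM_maxr _ _)).
exact: mxrankM_maxl.
Qed.

Lemma projB_conj : conjm B = B -> conjm (projB B) = projB B.
Proof.
move=> cB; rewrite /projB !conjmM conjm_gram conjmT cB /conjm map_invmx -/(conjm _).
by rewrite /gramB !conjmM conjm_gram conjmT cB.
Qed.

End Generic.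

Lemma unit_of_ker {k} (A : 'M[C]_k) : (forall c : 'cV[C]_k, A *m c = 0 -> c = 0) ->
  A \in unitmx.
Proof.
move=> h; rewrite -unitmx_tr -row_free_unit -kermx_eq0; apply/eqP/row_matrixP => i.
rewrite row0; apply: trmx_inj; rewrite trmx0; apply: h.
apply: trmx_inj; rewrite trmx_mul trmxK trmx0.
by rewrite -row_mul mulmx_ker row0.
Qed.

Lemma frame_mul s s1 s2 D (c : 'cV[C]_((1 + 1) + (1 + 1))) : exists c0 c1 c2 c3 : C,
  frameB s s1 s2 D *m c = c0 *: s + c1 *: s1 + c2 *: s2 + c3 *: D /\
  c = col_mx (col_mx c0%:M c1%:M) (col_mx c2%:M c3%:M).
Proof.
rewrite -[c]vsubmxK -[usubmx c]vsubmxK -[dsubmx c]vsubmxK.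
move: (usubmx (usubmx c)) (dsubmx (usubmx c)) (usubmx (dsubmx c)) (dsubmx (dsubmx c)).
move=> a0 a1 a2 a3; exists (a0 0 0), (a1 0 0), (a2 0 0), (a3 0 0).
rewrite -!mx11_scalar; split=> //.
rewrite /frameB !mul_row_col {1}[a0]mx11_scalar {1}[a1]mx11_scalar.
by rewrite {1}[a2]mx11_scalar {1}[a3]mx11_scalar !mul_mx_scalar addrA.
Qed.

Lemma frame_comb s s1 s2 D c0 c1 c2 c3 :
  frameB s s1 s2 D *m col_mx (col_mx c0%:M c1%:M) (col_mx c2%:M c3%:M) =
  c0 *: s + c1 *: s1 + c2 *: s2 + c3 *: D.
Proof. by rewrite /frameB !mul_row_col !mul_mx_scalar addrA. Qed.

Context (s s1 s2 D : vec) (E F G a : R).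
Hypotheses (ss : ip s s = 0) (s_1 : ip s s1 = 0) (s_2 : ip s s2 = 0)
  (s11 : ip s1 s1 = E%:C%C) (s12 : ip s1 s2 = F%:C%C) (s22 : ip s2 s2 = G%:C%C)
  (sD : ip s D = -2).
Hypotheses (E0 : 0 < E) (a0 : 0 < a) (a2 : a ^+ 2 = E * G - F ^+ 2).
Let B := frameB s s1 s2 D.
Let j1 : R := - F / a.
Let j2 : R := E / a.
Definition frameJ : vec := (- F / a)%:C%C *: s1 + (E / a)%:C%C *: s2.
Let z : vec := s1 - I *: frameJ.
Let zb : vec := s1 + I *: frameJ.

Let cE0 : (E%:C)%C != 0 :> C.
Proof. by apply/eqP => -[e]; move: E0; rewrite e ltxx. Qed.

(** A vector in the kernel is paired with [s], which kills the coefficient of [D] because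
    [ip s D = -2] is the only nonzero product with [s]; then the invertible metric block kills those
    of [s1] and [s2]; then pairing with [D] kills the last. *)
Lemma frame_unit : gramB B \in unitmx.
Proof.
apply: unit_of_ker => c; have [c0 [c1 [c2 [c3 [eB ec]]]]] := frame_mul s s1 s2 D c.
move=> h; have h0 d : ip (B *m d) (B *m c) = 0.
  rewrite /ip trmx_mul; have -> : d^T *m B^T *m g *m (B *m c) = d^T *m (gramB B *m c).
    by rewrite /gramB !mulmxA.
  by rewrite h mulmx0 mxE.
have k d0 d1 d2 d3 : ip (d0 *: s + d1 *: s1 + d2 *: s2 + d3 *: D)
    (c0 *: s + c1 *: s1 + c2 *: s2 + c3 *: D) = 0.
  by rewrite -frame_comb -eB; exact: h0.
have k0 := k 1 0 0 0; have k1 := k 0 1 0 0; have k2 := k 0 0 1 0; have k3 := k 0 0 0 1.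
rewrite !scale1r !scale0r !addr0 ?add0r in k0 k1 k2 k3.
rewrite !ipDr !ipZr ss s_1 s_2 sD !mulr0 !add0r in k0.
have n2 : (-2 : C) != 0 by rewrite oppr_eq0 pnatr_eq0.
have c30 : c3 = 0 by apply: (mulIf n2); rewrite k0 mul0r.
rewrite c30 !ipDr !ipZr [ip s1 s]ipC s_1 s11 s12 mul0r mulr0 add0r addr0 in k1.
rewrite c30 !ipDr !ipZr [ip s2 s]ipC s_2 [ip s2 s1]ipC s12 s22 mul0r mulr0 add0r addr0 in k2.
have d0 : ((E * G - F ^+ 2)%:C)%C != 0 :> C.
  by apply/eqP => -[e]; move: a2; rewrite e => /eqP; rewrite expf_eq0 /= gt_eqF.
have eq1 : c1 * (E * G - F ^+ 2)%:C%C = G%:C%C * (c1 * E%:C%C + c2 * F%:C%C) - F%:C%C * (c1 * F%:C%C + c2 * G%:C%C).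
  by rewrite rmorphB !rmorphM; ring.
have eq2 : c2 * (E * G - F ^+ 2)%:C%C = E%:C%C * (c1 * F%:C%C + c2 * G%:C%C) - F%:C%C * (c1 * E%:C%C + c2 * F%:C%C).
  by rewrite rmorphB !rmorphM; ring.
rewrite k1 k2 !mulr0 subr0 in eq1 eq2.
have c10 : c1 = 0 by apply: (mulIf d0); rewrite eq1 mul0r.
have c20 : c2 = 0 by apply: (mulIf d0); rewrite eq2 mul0r.
rewrite c10 c20 c30 !scale0r !addr0 ipZr ipC sD in k3.
have c00 : c0 = 0 by apply: (mulIf n2); rewrite k3 mul0r.
by rewrite ec c00 c10 c20 c30 (raddf0 (@scalar_mx C 1)) !col_mx0.
Qed.

Lemma frame_mem v : projB B *m v = v <->
  exists c0 c1 c2 c3, v = c0 *: s + c1 *: s1 + c2 *: s2 + c3 *: D.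
Proof.
split=> [/(projB_mem frame_unit)[c ->]|[c0 [c1 [c2 [c3 ->]]]]].
  by have [c0 [c1 [c2 [c3 [-> _]]]]] := frame_mul s s1 s2 D c; exists c0, c1, c2, c3.
by apply/(projB_mem frame_unit); eexists; rewrite -frame_comb.
Qed.

Lemma frame_fix : [/\ projB B *m s = s, projB B *m s1 = s1, projB B *m s2 = s2 &
  projB B *m D = D].
Proof.
split; apply/frame_mem.
- by exists 1, 0, 0, 0; rewrite !scale0r scale1r !addr0.
- by exists 0, 1, 0, 0; rewrite !scale0r scale1r !addr0 add0r.
- by exists 0, 0, 1, 0; rewrite !scale0r scale1r !addr0 !add0r.
- by exists 0, 0, 0, 1; rewrite !scale0r scale1r !add0r.
Qed.

Let an0 : a != 0. Proof. by rewrite gt_eqF. Qed.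

Lemma frameJ_ip : [/\ ip s frameJ = 0, ip s1 frameJ = 0 & ip frameJ frameJ = E%:C%C].
Proof.
split; rewrite /frameJ.
- by rewrite !ipE s_1 s_2 !mulr0 addr0.
- rewrite !ipE s11 s12; apply: complex_ext => /=; last by ring.
  by field.
- rewrite ip_comb s11 s12 s22 real_comb; congr (_%:C)%C.
  transitivity (E * (E * G - F ^+ 2) / a ^+ 2); first by field.
  by rewrite -a2; field.
Qed.

Lemma zeta_ip : [/\ ip s z = 0, ip s zb = 0, ip z z = 0, ip zb zb = 0 & ip z zb = 2 * E%:C%C].
Proof.
have [J0 J1 JJ] := frameJ_ip; have i2 := II.
rewrite /z /zb; move: (frameJ) J0 J1 JJ => J J0 J1 JJ.
split; rewrite !ipE ?s_1 ?J0 ?s11 ?[ip J s1]ipC ?J1 ?JJ ?mulr0 ?addr0 ?oppr0 ?addr0 //.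
- rewrite !mulrN opprK mulrA i2; ring.
- rewrite mulrA i2; ring.
- rewrite mulrN mulrA i2; ring.
Qed.

Let s2E : exists c c', s2 = c *: z + c' *: zb.
Proof.
have jj : (E / a)%:C%C != 0 :> C.
  by apply/eqP => -[/eqP]; rewrite mulf_eq0 invr_eq0 (negbTE an0) gt_eqF.
pose k : C := ((E / a)%:C%C)^-1; pose j : C := (- F / a)%:C%C.
exists (k * (I / 2 - j / 2)), (k * (- I / 2 - j / 2)).
have e : s2 = k *: (frameJ - j *: s1).
  by rewrite /frameJ addrC addKr scalerA mulVf ?scale1r.
rewrite {1}e /z /zb; move: (frameJ) (k) (j) => J k' j'.
rewrite !scalerDr !scalerN !scalerA.
have i2 := II.
have -> : k' * (I / 2 - j' / 2) * I = k' * (- 1 / 2 - j' * I / 2).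
  by rewrite -i2; ring.
have -> : k' * (- I / 2 - j' / 2) * I = k' * (1 / 2 - j' * I / 2).
  transitivity (k' * (- (I * I) / 2 - j' * I / 2)); first by ring.
  by rewrite i2 opprK.
by mx_lin; field.
Qed.

Lemma frame_mem_zeta v : projB B *m v = v <->
  exists c0 c1 c2 c3, v = c0 *: s + c1 *: z + c2 *: zb + c3 *: D.
Proof.
split=> [/frame_mem [c0 [c1 [c2 [c3 ->]]]]|[c0 [c1 [c2 [c3 ->]]]]].
  have [c [c' ->]] := s2E.
  exists c0, (c1 / 2 + c2 * c), (c1 / 2 + c2 * c'), c3.
  have {1}-> : s1 = 2^-1 *: (z + zb).
    by rewrite /z /zb; move: (frameJ) => J; mx_lin; field.
  move: z zb => Z Zb.
  by mx_lin; field.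
have [f0 f1 f2 f3] := frame_fix.
by rewrite !mulmxDr -!scalemxAr /z /zb /frameJ mulmxBr mulmxDr -!scalemxAr mulmxDr -!scalemxAr f0 f1 f2 f3.
Qed.

(** The plane of [s] and [z] is totally isotropic in a nondegenerate four-space, hence equal to its
    own orthogonal complement there. *)
Lemma frame_T10 v : projB B *m v = v -> ip v s = 0 -> ip v z = 0 ->
  exists c c', v = c *: s + c' *: z.
Proof.
have [z1 z2 z3 z4 z5] := zeta_ip.
move/frame_mem_zeta => [c0 [c1 [c2 [c3 ->]]]].
move: z zb z1 z2 z3 z4 z5 => Z Zb z1 z2 z3 z4 z5.
rewrite !ipDl !ipZl ss [ip Z s]ipC z1 [ip Zb s]ipC z2 [ip D s]ipC sD !mulr0 !add0r => k1.
have n2 : (-2 : C) != 0 by rewrite oppr_eq0 pnatr_eq0.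
have c30 : c3 = 0 by apply: (mulIf n2); rewrite k1 mul0r.
rewrite z3 [ip Zb Z]ipC z5 c30 mul0r mulr0 add0r addr0 => k2.
have c20 : c2 = 0.
  have e2 : 2 * E%:C%C != 0 :> C by rewrite mulf_neq0 ?pnatr_eq0.
  by apply: (mulIf e2); rewrite k2 mul0r.
by exists c0, c1; rewrite c20 !scale0r !addr0.
Qed.

(** As [j1], [j2] are the coordinates of [J e1], both sides are [E] times the metric trace of the
    symmetric form [b]. *)
Lemma frame_trace {p q} (b11 b12 b22 : 'M[C]_(p, q)) :
  b11 + ((j1 * j1)%:C%C *: b11 + (2 * (j1 * j2))%:C%C *: b12 + (j2 * j2)%:C%C *: b22) =
  (E / a ^+ 2)%:C%C *: (G%:C%C *: b11 - (2 * F)%:C%C *: b12 + E%:C%C *: b22).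
Proof.
have k1 : 1 + j1 * j1 = E / a ^+ 2 * G.
  transitivity ((a ^+ 2 + F ^+ 2) / a ^+ 2); first by rewrite /j1; field.
  by rewrite [in X in X / _]a2; field.
have k2 : 2 * (j1 * j2) = - (E / a ^+ 2 * (2 * F)) by rewrite /j1 /j2; field.
have k3 : j2 * j2 = E / a ^+ 2 * E by rewrite /j2; field.
have -> : b11 + ((j1 * j1)%:C%C *: b11 + (2 * (j1 * j2))%:C%C *: b12 + (j2 * j2)%:C%C *: b22)
   = (1 + j1 * j1)%:C%C *: b11 + (2 * (j1 * j2))%:C%C *: b12 + (j2 * j2)%:C%C *: b22.
  by rewrite rmorphD rmorph1 scalerDl scale1r !addrA.
rewrite k1 k2 k3 rmorphN !(rmorphM _ (E / a ^+ 2)) scaleNr !scalerDr scalerN !scalerA.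
by [].
Qed.

End PointFrame.

Lemma real_conjc {R : realType} (b : R) : conjc (b%:C%C) = b%:C%C :> R[i].
Proof. by apply: complex_ext => //=; rewrite oppr0. Qed.

Lemma conjm_flux {R : realType} {k} (p q r : R) (u v : 'cV[R[i]]_k) :
  conjm u = u -> conjm v = v ->
  conjm (p%:C%C *: (q%:C%C *: u - r%:C%C *: v)) = p%:C%C *: (q%:C%C *: u - r%:C%C *: v).
Proof. by move=> cu cv; rewrite !conjmZ !conjmD !conjmN !conjmZ !real_conjc cu cv. Qed.

Lemma conjm_lap {R : realType} {k} (p : R) (u v : 'cV[R[i]]_k) :
  conjm u = u -> conjm v = v -> conjm (p%:C%C *: (u + v)) = p%:C%C *: (u + v).
Proof. by move=> cu cv; rewrite conjmZ conjmD real_conjc cu cv. Qed.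

Lemma ip_flux {R : realType} {n} (p q r k l : R) (w u v : 'cV[R[i]]_n.+2) :
  ip w u = k%:C%C -> ip w v = l%:C%C ->
  ip w (p%:C%C *: (q%:C%C *: u - r%:C%C *: v)) = (p * (q * k - r * l))%:C%C.
Proof. by move=> hu hv; rewrite !ipE hu hv -!rmorphM -rmorphB -rmorphM. Qed.

Lemma ip_flux0 {R : realType} {n} (p q r : R) (w u v : 'cV[R[i]]_n.+2) :
  ip w u = 0 -> ip w v = 0 -> ip w (p%:C%C *: (q%:C%C *: u - r%:C%C *: v)) = 0.
Proof. by move=> hu hv; rewrite !ipE hu hv !mulr0 subrr mulr0. Qed.

Lemma area_aux {R : realType} (a E F G : R) : a != 0 -> a ^+ 2 = E * G - F ^+ 2 ->
  a^-1 * (G * E - F * F) = a.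
Proof. by move=> a0 a2; apply: (mulfI a0); rewrite mulVKf // -[a * a]expr2 a2; ring. Qed.

Lemma ip_lap_aux {R : realType} {n} (a : R) (w u v : 'cV[R[i]]_n.+2) : a != 0 ->
  ip w u = - a%:C%C -> ip w v = - a%:C%C -> ip w (a^-1%:C%C *: (u + v)) = -2.
Proof.
move=> a0 hu hv; rewrite !ipE hu hv -opprD mulrN -rmorphD -rmorphM.
have -> : a^-1 * (a + a) = 2 by field.
by rewrite rmorph_nat.
Qed.

Lemma fix_comb {F : fieldType} {m} (A : 'M[F]_m) (u v : 'cV[F]_m) c d :
  A *m u = u -> A *m v = v -> A *m (c *: u + d *: v) = c *: u + d *: v.
Proof. by move=> hu hv; rewrite mulmxDr -!scalemxAr hu hv. Qed.

(** * The Laplacian of the lift and the projection onto the central sphere congruence *)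

Section CentralSphere.
Context {R : realType} {n : nat}.
Local Notation C := R[i].
Local Notation I := ('i%C : C).
Local Notation pt := (R * R)%type.
Local Notation vec := 'cV[C]_n.+2.
Local Notation endo := 'M[C]_n.+2.
Local Notation g := (@gram R n).
Implicit Types (x y X Y : pt) (u v w : vec).
Context (U : set pt) (oU : open U) (Lam : pt -> set vec) (sf : is_surface U Lam).
Let s := Defs.lift U Lam.
Let Cs : smooth U s := smooth_lift sf.
Let s1 x := der s x e1.
Let s2 x := der s x e2.
Let E := gE U Lam.
Let F := gF U Lam.
Let G := gG U Lam.
Let a := garea U Lam.
Let J := cpx U Lam.

Lemma Ck_gE r : Ck U r E.
Proof. by have [] := csmooth_ip oU (smooth_der oU e1 Cs) (smooth_der oU e1 Cs) r. Qed.
Lemma Ck_gF r : Ck U r F.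
Proof. by have [] := csmooth_ip oU (smooth_der oU e1 Cs) (smooth_der oU e2 Cs) r. Qed.
Lemma Ck_gG r : Ck U r G.
Proof. by have [] := csmooth_ip oU (smooth_der oU e2 Cs) (smooth_der oU e2 Cs) r. Qed.

Lemma Ck_area r : Ck U r a.
Proof.
apply: Ck_sqrt => // [x Ux|]; first exact: disc_pos.
have C1 := CkM oU (Ck_gE r) (Ck_gG r); have C2 := CkN oU (CkM oU (Ck_gF r) (Ck_gF r)).
by apply: Ck_ext (CkD oU C1 C2) => // x _; rewrite expr2.
Qed.

Lemma Ck_areaV r : Ck U r (fun x => (a x)^-1).
Proof. by apply: CkV (Ck_area r) => // x Ux; exact: area_neq0. Qed.

(** [flux1] and [flux2] are the components under the divergence in [laplacian]. *)
Definition flux1 x : vec :=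
  ((garea U Lam x)^-1)%:C%C *: ((gG U Lam x)%:C%C *: der s x e1 - (gF U Lam x)%:C%C *: der s x e2).
Definition flux2 x : vec :=
  ((garea U Lam x)^-1)%:C%C *: ((gE U Lam x)%:C%C *: der s x e2 - (gF U Lam x)%:C%C *: der s x e1).
Definition lap x : vec := laplacian U Lam s x.

Lemma lapE x : lap x = ((a x)^-1)%:C%C *: (der flux1 x e1 + der flux2 x e2).
Proof. by []. Qed.

Lemma smooth_flux1 : smooth U flux1.
Proof.
apply: smoothZ => //; first by apply: csmooth_real => // r; exact: Ck_areaV.
apply: smoothB => //; apply: smoothZ => //; try exact: smooth_der.
  by apply: csmooth_real => // r; exact: Ck_gG.
by apply: csmooth_real => // r; exact: Ck_gF.
Qed.

Lemma smooth_flux2 : smooth U flux2.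
Proof.
apply: smoothZ => //; first by apply: csmooth_real => // r; exact: Ck_areaV.
apply: smoothB => //; apply: smoothZ => //; try exact: smooth_der.
  by apply: csmooth_real => // r; exact: Ck_gE.
by apply: csmooth_real => // r; exact: Ck_gF.
Qed.

Lemma smooth_lap : smooth U lap.
Proof.
apply: (smoothZ oU (f := fun x => ((a x)^-1)%:C%C)
  (A := fun x => der flux1 x e1 + der flux2 x e2)).
  by apply: csmooth_real => // r; exact: Ck_areaV.
by apply: smoothD => //; apply: smooth_der => //; [exact: smooth_flux1|exact: smooth_flux2].
Qed.

Lemma flux_real x : U x -> conjm (flux1 x) = flux1 x /\ conjm (flux2 x) = flux2 x.
Proof. by move=> Ux; split; apply: conjm_flux; exact: der_lift_real. Qed.

Lemma lap_real x : U x -> conjm (lap x) = lap x.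
Proof.
move=> Ux; rewrite lapE; have C1 := smooth_flux1; have C2 := smooth_flux2.
have r1 : conjm (der flux1 x e1) = der flux1 x e1.
  rewrite -(der_conjm oU Ux e1 C1); apply: (der_ext oU Ux) => y Uy.
  by case: (flux_real Uy).
have r2 : conjm (der flux2 x e2) = der flux2 x e2.
  rewrite -(der_conjm oU Ux e2 C2); apply: (der_ext oU Ux) => y Uy.
  by case: (flux_real Uy).
exact: conjm_lap.
Qed.

Section At.
Context {x : pt} (Ux : U x).

Let m22 : metric U Lam x e2 e2 = G x. Proof. by []. Qed.

Lemma ip_frame : [/\ ip (s1 x) (s1 x) = (E x)%:C%C, ip (s1 x) (s2 x) = (F x)%:C%C &
  ip (s2 x) (s2 x) = (G x)%:C%C].
Proof. by split; exact: ip_der. Qed.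

Lemma ip_lift_flux y : U y -> ip (s y) (flux1 y) = 0 /\ ip (s y) (flux2 y) = 0.
Proof.
move=> Uy; have h1 := ip_lift_der oU sf Uy e1; have h2 := ip_lift_der oU sf Uy e2.
split; first exact: ip_flux0 h1 h2.
exact: ip_flux0 h2 h1.
Qed.

(** The fluxes are tangential, hence orthogonal to [s]. Differentiating this, each of the two terms
    of the divergence contributes minus the area density. *)
Lemma ip_lift_lap : ip (s x) (lap x) = -2.
Proof.
have [e11 e12 e22] := ip_frame; have a0 := area_neq0 oU sf Ux; have a2 := area_sqr oU sf Ux.
have f1 : ip (s x) (der flux1 x e1) = - (a x)%:C%C.
  have := cder_ext oU Ux e1 (fun y Uy => (ip_lift_flux Uy).1).
  rewrite cder_cst (cder_ip oU e1 Ux Cs smooth_flux1) => /eqP.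
  rewrite addrC addr_eq0 => /eqP ->; congr (- _).
  exact: etrans (ip_flux _ _ _ e11 e12) (congr1 (real_complex R) (area_aux a0 a2)).
have f2 : ip (s x) (der flux2 x e2) = - (a x)%:C%C.
  have := cder_ext oU Ux e2 (fun y Uy => (ip_lift_flux Uy).2).
  rewrite cder_cst (cder_ip oU e2 Ux Cs smooth_flux2) => /eqP.
  rewrite addrC addr_eq0 => /eqP ->; congr (- _).
  rewrite ipC in e12.
  have a2' : a x ^+ 2 = G x * E x - F x ^+ 2 by rewrite [G x * _]mulrC; exact: a2.
  exact: etrans (ip_flux _ _ _ e22 e12) (congr1 (real_complex R) (area_aux a0 a2')).
exact: ip_lap_aux a0 f1 f2.
Qed.

End At.

Definition cframe x := frameB (s x) (der s x e1) (der s x e2) (lap x).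
Definition cproj x : endo := projB (cframe x).

(* [zet] and [zetb] span the (1,0) and (0,1) parts of the first osculating
   space modulo the lift. *)
Definition zet x : vec := der s x e1 - I *: der s x (J x e1).
Definition zetb x : vec := der s x e1 + I *: der s x (J x e1).

Section At2.
Context {x : pt} (Ux : U x).
Let h0 := lift_null sf Ux.
Let h1 := ip_lift_der oU sf Ux e1.
Let h2 := ip_lift_der oU sf Ux e2.
Let h3 := ip_lift_lap Ux.
Let h4 := gE_pos oU sf Ux.
Let h5 := area_pos oU sf Ux.
Let h6 := area_sqr oU sf Ux.

Lemma cframe_unit : gramB (cframe x) \in unitmx.
Proof. by have [e11 e12 e22] := ip_frame Ux; exact: frame_unit h0 h1 h2 e11 e12 e22 h3 h5 h6. Qed.

Lemma cproj_mem v : cproj x *m v = v <-> exists c0 c1 c2 c3,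
  v = c0 *: s x + c1 *: der s x e1 + c2 *: der s x e2 + c3 *: lap x.
Proof. by have [e11 e12 e22] := ip_frame Ux; exact: frame_mem h0 h1 h2 e11 e12 e22 h3 h5 h6 v. Qed.

Lemma cproj_fix : [/\ cproj x *m s x = s x, forall X, cproj x *m der s x X = der s x X &
  cproj x *m lap x = lap x].
Proof.
have [e11 e12 e22] := ip_frame Ux.
have [f0 f1 f2 f3] := frame_fix h0 h1 h2 e11 e12 e22 h3 h5 h6.
split; [exact: f0| |exact: f3].
by move=> X; rewrite [X]pt_decomp (der_dir oU Ux _ _ Cs); exact: fix_comb.
Qed.

Lemma cproj_idem : cproj x *m cproj x = cproj x.
Proof. exact: projB_idem cframe_unit. Qed.

Lemma cproj_adj : adjm g (cproj x) = cproj x.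
Proof. exact: projB_adj. Qed.

Lemma cproj_rank : \rank (cproj x) = 4.
Proof. exact: projB_rank cframe_unit. Qed.

Lemma cproj_real : conjm (cproj x) = cproj x.
Proof.
apply: projB_conj; rewrite /cframe /frameB /conjm !map_row_mx.
have r1 := der_lift_real oU sf Ux e1; have r2 := der_lift_real oU sf Ux e2.
have r0 := lift_real sf Ux; have r3 := lap_real Ux.
by rewrite -!/(conjm _) r0 r1 r2 r3.
Qed.

Lemma der_J : der s x (J x e1) = frameJ (der s x e1) (der s x e2) (E x) (F x) (a x).
Proof. by rewrite /J cpx_e1 (der_dir oU Ux _ _ Cs). Qed.

Lemma zet_ip : [/\ ip (s x) (zet x) = 0, ip (s x) (zetb x) = 0, ip (zet x) (zet x) = 0,
  ip (zetb x) (zetb x) = 0 & ip (zet x) (zetb x) = 2 * (E x)%:C%C].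
Proof.
have [e11 e12 e22] := ip_frame Ux; rewrite /zet /zetb der_J.
exact: zeta_ip h1 h2 e11 e12 e22 h5 h6.
Qed.

Lemma cproj_mem_zet v : cproj x *m v = v <-> exists c0 c1 c2 c3,
  v = c0 *: s x + c1 *: (zet x) + c2 *: (zetb x) + c3 *: lap x.
Proof.
have [e11 e12 e22] := ip_frame Ux; rewrite /zet /zetb der_J.
exact: frame_mem_zeta h0 h1 h2 e11 e12 e22 h3 h4 h5 h6 v.
Qed.

Lemma cproj_T10 v : cproj x *m v = v -> ip v (s x) = 0 -> ip v (zet x) = 0 ->
  exists c c', v = c *: s x + c' *: (zet x).
Proof.
have [e11 e12 e22] := ip_frame Ux; rewrite /zet der_J => hv hs hz.
exact: (frame_T10 h0 h1 h2 e11 e12 e22 h3 h4 h5 h6 hv hs hz).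
Qed.

End At2.
End CentralSphere.

(** * The form N of a field of projections and its trace *)

Section SecondForm.
Context {R : realType} {n : nat}.
Local Notation C := R[i].
Local Notation I := ('i%C : C).
Local Notation pt := (R * R)%type.
Local Notation vec := 'cV[C]_n.+2.
Local Notation endo := 'M[C]_n.+2.
Local Notation g := (@gram R n).
Implicit Types (x y X Y : pt) (u v w : vec) (P : pt -> endo).
Context (U : set pt) (oU : open U).

Definition reflP (P : endo) : endo := P - (1%:M - P).
(** The form [N = d - D] of the splitting defined by [P]. It is kept for a general [P] because it is
    also needed for [hatP], before that is known to be the projection onto a central sphere
    congruence. *)
Definition NN P x X : endo := - (reflP (P x) *m der P x X).

Section Proj.
Context (P : pt -> endo) (CP : smooth U P) (PP : forall x, U x -> P x *m P x = P x).

Lemma smooth_cstm (A : endo) : smooth U (fun=> A). Proof. exact: smooth_cst. Qed.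

Lemma smooth_reflP : smooth U (fun x => reflP (P x)).
Proof. by do 2 (apply: smoothB => //); exact: smooth_cst. Qed.

Lemma der_reflP x X : U x -> der (fun x => reflP (P x)) x X = der P x X + der P x X.
Proof.
move=> Ux; have C1 : smooth U (fun x => 1%:M - P x).
  by apply: smoothB => //; exact: smooth_cst.
by rewrite (derB oU Ux X CP C1) (derB oU Ux X (smooth_cstm _) CP) der_cst sub0r opprK.
Qed.

Lemma NN_alg (A dA : endo) (t dt : vec) : A *m A = A -> A *m t = t ->
  dA *m t + A *m dt = dt -> - (reflP A *m dA) *m t = (1%:M - A) *m dt.
Proof.
move=> AA At h; have e : dA *m t = (1%:M - A) *m dt by rewrite mulmxBl mul1mx -{1}h addrK.
rewrite mulNmx -mulmxA e /reflP; mx_expand; rewrite AA.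
by mx_lin; ring.
Qed.

Lemma NN_sec (t : pt -> vec) x X : smooth U t -> (forall y, U y -> P y *m t y = t y) ->
  U x -> NN P x X *m t x = (1%:M - P x) *m der t x X.
Proof.
move=> Ct Pt Ux; apply: NN_alg; [exact: PP|exact: Pt|].
by rewrite -(derM oU Ux X CP Ct); apply: (der_ext oU Ux) => y Uy; exact: Pt.
Qed.

Lemma der_proj x X : U x -> der P x X *m P x + P x *m der P x X = der P x X.
Proof. by move=> Ux; rewrite -(derM oU Ux X CP CP); apply: (der_ext oU Ux) => y Uy; exact: PP. Qed.

Lemma NN_lin x a b X Y : U x ->
  NN P x (a *: X + b *: Y) = a%:C%C *: NN P x X + b%:C%C *: NN P x Y.
Proof.
move=> Ux; rewrite /NN (der_lin oU Ux _ _ _ _ CP).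
move: (der P x X) (der P x Y) (reflP _) => A B D.
by mx_expand; mx_lin; ring.
Qed.

Lemma NN_real x X : U x -> (forall y, U y -> conjm (P y) = P y) -> conjm (NN P x X) = NN P x X.
Proof.
move=> Ux cP; have h : conjm (der P x X) = der P x X.
  by rewrite -(der_conjm oU Ux X CP); apply: (der_ext oU Ux) => y Uy; exact: cP.
rewrite /NN; move: (der P x X) h => A h.
by rewrite conjmN conjmM h /reflP !conjmD !conjmN conjmD conjmN conjm1 cP.
Qed.

End Proj.

(** A symmetric form evaluated on a (1,0) vector and its conjugate is [E] times its trace
    ([frame_trace]). The matrix [A] is [1 - P] in the application to [N] and the identity in that to
    [q]. *)
Lemma second_form_alg (N1 N2 : endo) (s1 s2 f1 f2 : vec) (E F G a : R) (A : endo) :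
  0 < a -> a ^+ 2 = E * G - F ^+ 2 -> N1 *m s2 = N2 *m s1 ->
  A *m f1 = N1 *m (a^-1%:C%C *: (G%:C%C *: s1 - F%:C%C *: s2)) ->
  A *m f2 = N2 *m (a^-1%:C%C *: (E%:C%C *: s2 - F%:C%C *: s1)) ->
  let NJ := (- F / a)%:C%C *: N1 + (E / a)%:C%C *: N2 in
  let sJ := frameJ s1 s2 E F a in
  (N1 - I *: NJ) *m (s1 + I *: sJ) = E%:C%C *: (A *m (a^-1%:C%C *: (f1 + f2))).
Proof.
move=> a0 a2 sym e1 e2 NJ sJ.
have an0 : a != 0 by rewrite gt_eqF.
have -> : A *m (a^-1%:C%C *: (f1 + f2)) = (a^-1%:C%C) *: (a^-1%:C%C *:
    (G%:C%C *: (N1 *m s1) - (2 * F)%:C%C *: (N1 *m s2) + E%:C%C *: (N2 *m s2))).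
  rewrite -scalemxAr mulmxDr e1 e2; congr (_ *: _); mx_expand; rewrite -sym rmorphM rmorph_nat.
  by mx_lin; ring.
rewrite !scalerA -!rmorphM -mulrA -invfM -expr2 /= -(frame_trace a0 a2) /NJ /sJ /frameJ.
have i2 (X : vec) : X = (- (I * I)) *: X by rewrite II opprK scale1r.
rewrite !(rmorphM (real_complex R)) rmorph_nat -!(rmorphM (real_complex R) _ a^-1).
rewrite [X in _ = _ + X]i2 !(rmorphM (real_complex R) _ a^-1).
move: (real_complex R (- F) * _) (real_complex R E * _) => p q.
mx_expand; rewrite -sym.
by move: (I) => i; mx_lin; ring.
Qed.

Section Trace.
Context (Lam : pt -> set vec) (sf : is_surface U Lam).
Local Notation s := (Defs.lift U Lam).
Context (P : pt -> endo) (CP : smooth U P) (PP : forall x, U x -> P x *m P x = P x).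
Hypotheses (Ps : forall x X, U x -> P x *m der s x X = der s x X).
Let Cs : smooth U s := smooth_lift sf.

(** The trace of the second form is the normal part of the Laplacian. If the Laplacian lies in the
    range of [P], then [N] kills [zetb]; conversely, if [N] kills [zetb], the Laplacian lies in the
    range of [P]. Both readings are used. *)
Lemma NN_trace x : U x ->
  (NN P x e1 - I *: NN P x (cpx U Lam x e1)) *m zetb U Lam x =
  (gE U Lam x)%:C%C *: ((1%:M - P x) *m lap U Lam x).
Proof.
move=> Ux.
have CS X : smooth U (fun y => der s y X) by exact: smooth_der.
have PX X y : U y -> P y *m der s y X = der s y X by move=> Uy; exact: Ps.
have sym : NN P x e1 *m der s x e2 = NN P x e2 *m der s x e1.
  rewrite (NN_sec CP PP e1 (CS e2) (PX e2) Ux) (NN_sec CP PP e2 (CS e1) (PX e1) Ux).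
  by rewrite (der_comm oU Ux e2 e1 Cs).
have C1 := smooth_flux1 oU sf; have C2 := smooth_flux2 oU sf.
have fixflux (A : endo) u v p q r : A *m u = u -> A *m v = v ->
    A *m (p *: (q *: u - r *: v)) = p *: (q *: u - r *: v).
  by move=> hu hv; rewrite -scalemxAr mulmxBr -!scalemxAr hu hv.
have P1 y : U y -> P y *m flux1 U Lam y = flux1 U Lam y.
  by move=> Uy; apply: fixflux; exact: PX.
have P2 y : U y -> P y *m flux2 U Lam y = flux2 U Lam y.
  by move=> Uy; apply: fixflux; exact: PX.
have E1 := NN_sec CP PP e1 C1 P1 Ux; have E2 := NN_sec CP PP e2 C2 P2 Ux.
rewrite cpx_e1 (NN_lin CP) // /zetb (der_J oU sf Ux).
exact: (second_form_alg (area_pos oU sf Ux) (area_sqr oU sf Ux) sym (esym E1) (esym E2)).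
Qed.

End Trace.

End SecondForm.

(** * The loop of connections in the (1,0) direction *)

Lemma dlq_alg {R : realType} {m} (d1 d2 t : 'cV[R[i]]_m)
    (N1 N2 q1 q2 T1 T2 T3 T4 Q1 Q2 Q3 Q4 : 'M[R[i]]_m) (lam mu k l : R[i]) :
  let I : R[i] := ('i%C : R[i]) in
  T1 - I *: T2 = N1 - I *: N2 -> T3 - I *: T4 = 0 ->
  Q1 - I *: Q2 = q1 - I *: q2 -> Q3 - I *: Q4 = 0 ->
  d1 - N1 *m t + (lam *: T1 + mu *: T3 + k *: Q1 + l *: Q3) *m t -
  I *: (d2 - N2 *m t + (lam *: T2 + mu *: T4 + k *: Q2 + l *: Q4) *m t) =
  d1 - I *: d2 + ((lam - 1) *: (N1 - I *: N2) + k *: (q1 - I *: q2)) *m t.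
Proof.
move=> I h1 h2 h3 h4.
have -> : T1 = (T1 - I *: T2) + I *: T2 by rewrite subrK.
have -> : Q1 = (Q1 - I *: Q2) + I *: Q2 by rewrite subrK.
have -> : T3 = (T3 - I *: T4) + I *: T4 by rewrite subrK.
have -> : Q3 = (Q3 - I *: Q4) + I *: Q4 by rewrite subrK.
rewrite h1 h2 h3 h4; clear; move: I => i.
by mx_expand; mx_lin; ring.
Qed.

Lemma conj_dlq_alg {R : realType} {m} (d t : 'cV[R[i]]_m)
    (N T1 T2 Q1 Q2 : 'M[R[i]]_m) (lam : R[i]) :
  conjm N = N -> conjm T1 = T2 -> conjm T2 = T1 -> conjm Q1 = Q2 -> conjm Q2 = Q1 ->
  conjm (d - N *m t + (lam *: T1 + lam^-1 *: T2 + (lam ^+ 2 - 1) *: Q1 +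
     (lam ^- 2 - 1) *: Q2) *m t) =
  conjm d - N *m conjm t + ((conjc lam)^-1 *: T1 + (conjc lam)^-1^-1 *: T2 +
     ((conjc lam)^-1 ^+ 2 - 1) *: Q1 + ((conjc lam)^-1 ^- 2 - 1) *: Q2) *m conjm t.
Proof.
move=> cN c1 c2 c3 c4.
rewrite !(conjmD, conjmN, conjmM, conjmZ) cN c1 c2 c3 c4.
rewrite !(rmorphB, rmorph1, fmorphV, rmorphXn) /= exprVn !invrK.
by congr (_ - _ + _ *m _); mx_lin; ring.
Qed.

Section Connection.
Context {R : realType} {n : nat}.
Local Notation C := R[i].
Local Notation I := ('i%C : C).
Local Notation pt := (R * R)%type.
Local Notation vec := 'cV[C]_n.+2.
Local Notation endo := 'M[C]_n.+2.
Local Notation g := (@gram R n).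
Implicit Types (x y X Y : pt) (u v w : vec) (P : pt -> endo).
Context (U : set pt) (oU : open U) (Lam : pt -> set vec) (sf : is_surface U Lam).
Local Notation s := (Defs.lift U Lam).
Let Cs : smooth U s := smooth_lift sf.
Local Notation J := (cpx U Lam).
Local Notation P := (cproj U Lam).

Lemma cpx_comb x p q X Y : J x (p *: X + q *: Y) = p *: J x X + q *: J x Y.
Proof.
case: X Y => [a b] [c d].
have e (p' q' a' b' c' d' : R) : p' *: ((a', b') : pt) + q' *: ((c', d') : pt) =
   (p' * a' + q' * c', p' * b' + q' * d') by [].
rewrite e !cpx_pair e; move: (j1 U Lam x) (j2 U Lam x) (gG U Lam x) (gF U Lam x) (garea U Lam x) => k l m f r.
by congr pair; ring.
Qed.

(** The map [X - i J X] turns [J] into multiplication by [i], so every complex multiple of [zet]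
    comes from a real tangent vector. *)
Lemma span_L10 x c : U x -> exists X, c *: zet U Lam x = der s x X - I *: der s x (J x X).
Proof.
move=> Ux; exists (complex.Re c *: e1 + complex.Im c *: J x e1).
rewrite cpx_comb (cpx2 oU sf Ux).
have -> : complex.Re c *: J x e1 + complex.Im c *: - e1 = complex.Re c *: J x e1 + (- complex.Im c) *: e1.
  by rewrite scalerN scaleNr.
rewrite !(der_lin oU Ux _ _ _ _ Cs) /zet.
move: (der s x e1) (der s x (J x e1)) => u v.
have {1}-> : c = (complex.Re c)%:C%C + I * (complex.Im c)%:C%C by case: c => a b; apply: complex_ext => /=; ring.
rewrite rmorphN /=; move: ((complex.Re c)%:C%C) ((complex.Im c)%:C%C) => a b.
have i2 := @II R.
have e : (a + I * b) *: (u - I *: v) = a *: u + (I * b) *: u - (a * I) *: v - (I * I * b) *: v.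
  by move: (I) => i; mx_lin; ring.
by rewrite e i2; move: (I) => i; mx_lin; ring.
Qed.

Lemma span_L01 x c : U x -> exists X, c *: zetb U Lam x = der s x X + I *: der s x (J x X).
Proof.
move=> Ux; exists (complex.Re c *: e1 + (- complex.Im c) *: J x e1).
rewrite cpx_comb (cpx2 oU sf Ux).
have -> : complex.Re c *: J x e1 + - complex.Im c *: - e1 = complex.Re c *: J x e1 + (complex.Im c) *: e1.
  by rewrite scalerN scaleNr opprK.
rewrite !(der_lin oU Ux _ _ _ _ Cs) /zetb.
move: (der s x e1) (der s x (J x e1)) => u v.
have {1}-> : c = (complex.Re c)%:C%C + I * (complex.Im c)%:C%C by case: c => a b; apply: complex_ext => /=; ring.
rewrite rmorphN /=; move: ((complex.Re c)%:C%C) ((complex.Im c)%:C%C) => a b.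
have i2 := @II R.
have e : (a + I * b) *: (u + I *: v) = a *: u + (I * b) *: u + (a * I) *: v + (I * I * b) *: v.
  by move: (I) => i; mx_lin; ring.
by rewrite e i2; move: (I) => i; mx_lin; ring.
Qed.

Lemma csc_mem x v : U x -> csc U Lam x v <-> P x *m v = v.
Proof.
move=> Ux; have [f0 f1 f3] := cproj_fix oU sf Ux; have Ls := lift_line sf Ux.
split.
  have line_fix u w : P x *m u = u -> line u w -> P x *m w = w.
    by move=> hu [c _ <-]; rewrite -scalemxAr hu.
  have fixD u w : P x *m u = u -> P x *m w = w -> P x *m (u + w) = u + w.
    by move=> hu hw; rewrite mulmxDr hu hw.
  have fixZ c u : P x *m u = u -> P x *m (c *: u) = c *: u by move=> hu; rewrite -scalemxAr hu.
  have fixN u : P x *m u = u -> P x *m (- u) = - u by move=> hu; rewrite mulmxN hu.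
  move=> [u [w [hu /(line_fix _ _ f3) hw ->]]]; apply: (fixD _ _ _ hw).
  move: hu => [u1 [u2 [[a [b [ha [X ->] ->]]] [c [d [hc [Y ->] ->]]] ->]]].
  rewrite Ls in ha hc.
  apply: (fixD); apply: (fixD); try exact: (line_fix _ _ f0).
    by apply: (fixD); [exact: f1|apply: (fixN); apply: (fixZ); exact: f1].
  by apply: (fixD); [exact: f1|apply: (fixZ); exact: f1].
move/(cproj_mem_zet oU sf Ux) => [c0 [c1 [c2 [c3 ->]]]].
have [X EX] := span_L10 c1 Ux; have [Y EY] := span_L01 c2 Ux.
exists (c0 *: s x + c1 *: zet U Lam x + c2 *: zetb U Lam x), (c3 *: lap U Lam x).
split=> //; last by exists c3.
exists (c0 *: s x + c1 *: zet U Lam x), (c2 *: zetb U Lam x); split=> //.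
  exists (c0 *: s x), (c1 *: zet U Lam x); split=> //; last by exists X.
  by rewrite Ls; exists c0.
exists 0, (c2 *: zetb U Lam x); split=> //; last by rewrite add0r.
  by rewrite Ls; exists 0; rewrite ?scale0r.
by exists Y.
Qed.

Lemma piS_eq x : U x -> piS U Lam x = P x /\ forall v, cscp U Lam x v <-> P x *m v = 0.
Proof.
move=> Ux; apply: projE; [exact: cproj_idem|exact: cproj_adj|move=> v; exact: csc_mem].
Qed.

Lemma refl_eq x : U x -> refl U Lam x = reflP (P x).
Proof. by move=> Ux; rewrite /refl /piN (piS_eq Ux).1. Qed.

Lemma smooth_cproj : smooth U P.
Proof.
have CB : smooth U (cframe U Lam).
  apply/smoothP => i j.
  have C0 := (smoothP _).1 Cs i 0.
  have C1 := (smoothP _).1 (smooth_der oU e1 Cs) i 0.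
  have C2 := (smoothP _).1 (smooth_der oU e2 Cs) i 0.
  have C3 := (smoothP _).1 (smooth_lap oU sf) i 0.
  rewrite /cframe /frameB -[j]splitK /unsplit; case: (split j) => k.
    apply: (csmooth_ext oU (f := fun x => (row_mx (s x) (der s x e1)) i k)).
      by move=> x _; rewrite row_mxEl.
    rewrite -[k]splitK /unsplit; case: (split k) => l; rewrite ord1.
      by apply: csmooth_ext C0 => // x _; rewrite row_mxEl.
    by apply: csmooth_ext C1 => // x _; rewrite row_mxEr.
  apply: (csmooth_ext oU (f := fun x => (row_mx (der s x e2) (lap U Lam x)) i k)).
    by move=> x _; rewrite row_mxEr.
  rewrite -[k]splitK /unsplit; case: (split k) => l; rewrite ord1.
    by apply: csmooth_ext C2 => // x _; rewrite row_mxEl.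
  by apply: csmooth_ext C3 => // x _; rewrite row_mxEr.
have Cg : smooth U (fun=> g) by exact: smooth_cst.
have CG : smooth U (fun x => gramB (cframe U Lam x)).
  by apply: smoothM => //; apply: smoothM => //; exact: smooth_tr.
apply: smoothM => //; apply: smoothM => //; last exact: smooth_tr.
by apply: smoothM => //; apply: smooth_invmx => // x Ux; exact: cframe_unit.
Qed.

Lemma Nform_eq x X : U x -> Nform U Lam x X = NN P x X.
Proof.
move=> Ux; have C := smooth_cproj.
have e1 : der (piS U Lam) x X = der P x X.
  by apply: (der_ext oU Ux) => y Uy; exact: (piS_eq Uy).1.
have e2 : der (piN U Lam) x X = - der P x X.
  rewrite (@der_ext _ _ oU _ Ux _ _ _ (fun y => 1%:M - P y)).
    by rewrite (derB oU Ux X (smooth_cst oU _) C) der_cst sub0r.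
  by move=> y Uy; rewrite /piN (piS_eq Uy).1.
have e3 : piN U Lam x = 1%:M - P x by rewrite /piN (piS_eq Ux).1.
rewrite /Nform e1 e2 e3 (piS_eq Ux).1 /NN /reflP; move: (der P x X) => D.
by mx_expand; mx_lin; ring.
Qed.

Lemma Dconn_eq t x X : smooth U t -> U x ->
  Dconn U Lam t x X = der t x X - NN P x X *m t x.
Proof.
move=> Ct Ux; have C := smooth_cproj; have C1 : smooth U (fun=> 1%:M : endo) by exact: smooth_cst.
have CN := smoothB oU C1 C.
have e1 : der (fun y => piS U Lam y *m t y) x X = der (fun y => P y *m t y) x X.
  by apply: (der_ext oU Ux) => y Uy; rewrite (piS_eq Uy).1.
have e2 : der (fun y => piN U Lam y *m t y) x X = der (fun y => (1%:M - P y) *m t y) x X.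
  by apply: (der_ext oU Ux) => y Uy; rewrite /piN (piS_eq Uy).1.
have e3 : piN U Lam x = 1%:M - P x by rewrite /piN (piS_eq Ux).1.
rewrite /Dconn e1 e2 e3 (piS_eq Ux).1.
rewrite (derM oU Ux X C Ct) (derM oU Ux X CN Ct) (derB oU Ux X C1 C) der_cst sub0r.
have PP := cproj_idem oU sf Ux.
rewrite /NN /reflP; move: (der P x X) (der t x X) (P x) PP (t x) => D dt A AA u.
by mx_expand; rewrite AA; mx_lin; ring.
Qed.

Definition formlin (om : pt -> pt -> endo) x := forall (a b : R) X Y,
  om x (a *: X + b *: Y) = a%:C%C *: om x X + b%:C%C *: om x Y.

Lemma Nform_lin x : U x -> formlin (Nform U Lam) x.
Proof.
move=> Ux a b X Y; rewrite !Nform_eq //; exact: (NN_lin oU smooth_cproj a b X Y Ux).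
Qed.

Lemma form_JJ om x : U x -> formlin om x -> om x (J x (J x e1)) = - om x e1.
Proof.
move=> Ux lo; rewrite (cpx2 oU sf Ux).
have -> : - e1 = (- 1) *: e1 + 0 *: e1 :> pt by rewrite scaleN1r scale0r addr0.
by rewrite lo rmorphN rmorph1 rmorph0 scaleN1r scale0r addr0.
Qed.

Definition fz (om : pt -> pt -> endo) x : endo := om x e1 - I *: om x (J x e1).

Lemma tp_z om x : U x -> formlin om x ->
  tp10 U Lam om x e1 - I *: tp10 U Lam om x (J x e1) = fz om x /\ tp01 U Lam om x e1 - I *: tp01 U Lam om x (J x e1) = 0.
Proof.
move=> Ux lo; rewrite /tp10 /tp01 /fz (form_JJ Ux lo).
move: (om x e1) (om x (J x e1)) => A B.
have e1' (i : C) : 2^-1 *: (A - i *: B) - i *: (2^-1 *: (B - i *: - A)) =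
    (2^-1 - 2^-1 * (i * i)) *: A - i *: B by mx_lin; field.
have e2' (i : C) : 2^-1 *: (A + i *: B) - i *: (2^-1 *: (B + i *: - A)) =
    (2^-1 + 2^-1 * (i * i)) *: A by mx_lin; field.
rewrite e1' e2' II mulrN1 subrr scale0r opprK; split=> //.
have -> : 2^-1 + 2^-1 = 1 :> C by field.
by rewrite scale1r.
Qed.

(** The connection on [e1 - i J e1]: components of type (0,1) drop out, and no negative power of
    [lam] is left ([dlq_dz]). *)
Definition dlqZ (q : pt -> pt -> endo) lam (t : pt -> vec) x : vec :=
  dz (fun y => J y e1) t x + ((lam - 1) *: fz (Nform U Lam) x + (lam ^+ 2 - 1) *: fz q x) *m t x.

Lemma dlq_dz q lam t x : U x -> formlin q x -> smooth U t ->
  dlq U Lam q lam t x e1 - I *: dlq U Lam q lam t x (J x e1) = dlqZ q lam t x.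
Proof.
move=> Ux lq Ct; have lN := Nform_lin Ux.
have [n10 n01] := tp_z Ux lN; have [q10 q01] := tp_z Ux lq.
rewrite /dlq !(Dconn_eq _ Ct Ux) -!(Nform_eq _ Ux) /dlqZ /dz.
exact: dlq_alg n10 n01 q10 q01.
Qed.

Definition dlqZb (q : pt -> pt -> endo) lam (t : pt -> vec) x : vec :=
  dlq U Lam q lam t x e1 + I *: dlq U Lam q lam t x (J x e1).

Lemma tp_lin om x : formlin om x ->
  formlin (tp10 U Lam om) x /\ formlin (tp01 U Lam om) x.
Proof.
move=> lo; split=> a b X Y; rewrite /tp10 /tp01 cpx_comb !lo;
  move: (om x X) (om x Y) (om x (J x X)) (om x (J x Y)) => A B C' D;
  by move: (I) => i; mx_lin; ring.
Qed.

Lemma dlq_lin q lam t x (a b : R) X Y : U x -> formlin q x -> smooth U t ->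
  dlq U Lam q lam t x (a *: X + b *: Y) =
  a%:C%C *: dlq U Lam q lam t x X + b%:C%C *: dlq U Lam q lam t x Y.
Proof.
move=> Ux lq Ct; have [n10 n01] := tp_lin (Nform_lin Ux); have [q10 q01] := tp_lin lq.
rewrite /dlq !(Dconn_eq _ Ct Ux) (der_lin oU Ux _ _ _ _ Ct) (NN_lin oU smooth_cproj _ _ _ _ Ux).
rewrite n10 n01 q10 q01.
move: (der t x X) (der t x Y) (NN P x X) (NN P x Y) (t x) => d d' N N' u.
move: (tp10 _ _ _ _ X) (tp10 _ _ _ _ Y) (tp01 _ _ _ _ X) (tp01 _ _ _ _ Y) => T1 T2 T3 T4.
move: (tp10 _ _ _ _ X) (tp10 _ _ _ _ Y) (tp01 _ _ _ _ X) (tp01 _ _ _ _ Y) => T5 T6 T7 T8.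
by mx_expand; mx_lin; ring.
Qed.

(** The vector [e1 - i J e1] and its conjugate span the complexified tangent plane. *)
Lemma dlq_eq0 q lam t x : U x -> formlin q x -> smooth U t ->
  dlqZ q lam t x = 0 -> dlqZb q lam t x = 0 -> forall X, dlq U Lam q lam t x X = 0.
Proof.
move=> Ux lq Ct; rewrite -(dlq_dz _ Ux lq Ct) /dlqZb.
have L := dlq_lin lam _ _ _ _ Ux lq Ct.
set A := dlq _ _ _ _ _ _ e1; set B := dlq _ _ _ _ _ _ (J x e1) => h1 h2 X.
have A0 : A = 0.
  apply: (scalerI (a := 2)); first by rewrite pnatr_eq0.
  have e (v w : vec) : v + v = (v - I *: w) + (v + I *: w) by rewrite addrACA addNr addr0.
  by rewrite scaler0 scaler_nat mulr2n (e A B) h1 h2 addr0.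
have I0 : I != 0 :> C.
  by apply/negP => /eqP i0; have := @II R; rewrite i0 mul0r => /eqP; rewrite eq_sym oppr_eq0 oner_eq0.
have B0 : B = 0.
  by move/eqP: h2; rewrite A0 add0r scaler_eq0 (negbTE I0) => /eqP.
have j0 : j2 U Lam x != 0.
  by rewrite /j2 mulf_neq0 ?invr_eq0 ?(area_neq0 oU sf Ux) // gt_eqF // (gE_pos oU sf Ux).
have -> : X = (X.1 - X.2 * j1 U Lam x / j2 U Lam x) *: e1 + (X.2 / j2 U Lam x) *: J x e1.
  rewrite cpx_e1 pair_lin [LHS]pt_decomp !pair_lin.
  move: (j1 U Lam x) (j2 U Lam x) j0 => k l l0.
  have e (p q' a b c d : R) : p *: ((a, b) : pt) + q' *: ((c, d) : pt) = (p * a + q' * c, p * b + q' * d) by [].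
  by rewrite /e1 e; congr pair; field.
by rewrite L -/A -/B A0 B0 !scaler0 addr0.
Qed.

Lemma tp_conj om x X : conjm (om x X) = om x X -> conjm (om x (J x X)) = om x (J x X) ->
  conjm (tp10 U Lam om x X) = tp01 U Lam om x X /\ conjm (tp01 U Lam om x X) = tp10 U Lam om x X.
Proof.
rewrite /tp10 /tp01; move: (om x X) (om x (J x X)) => A B cA cB.
have c2 : conjc (2^-1 : C) = 2^-1 by rewrite fmorphV rmorph_nat.
have ci : conjc I = - I by apply: complex_ext => /=; rewrite ?oppr0.
by rewrite !conjmZ !conjmD !conjmN !conjmZ cA cB c2 ci scaleNr opprK.
Qed.

(** As [N] and [q] are real, conjugation only exchanges the types, which amounts to replacing [lam]
    by its inverse conjugate. *)
Lemma dlq_conj q lam t x X : U x -> (forall X, conjm (q x X) = q x X) -> smooth U t ->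
  conjm (dlq U Lam q lam t x X) = dlq U Lam q (conjc lam)^-1 (fun y => conjm (t y)) x X.
Proof.
move=> Ux cq Ct; have Cc := smooth_conjm oU Ct.
have cN Y : conjm (Nform U Lam x Y) = Nform U Lam x Y.
  rewrite (Nform_eq _ Ux); apply: (NN_real oU smooth_cproj) => // y Uy.
  exact: cproj_real.
have [n1 n2] := tp_conj (cN X) (cN (J x X)).
have [q1 q2] := tp_conj (cq X) (cq (J x X)).
rewrite /dlq !(Dconn_eq _ _ Ux) // -(Nform_eq _ Ux) (der_conjm oU Ux X Ct).
exact: conj_dlq_alg (cN X) n1 n2 q1 q2.
Qed.

End Connection.

(** * The Codazzi equation for the multiplier, algebraically *)

Section Multiplier.
Local Opaque ip der.
Context {R : realType} {n : nat}.
Local Notation C := R[i].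
Local Notation I := ('i%C : C).
Local Notation pt := (R * R)%type.
Local Notation vec := 'cV[C]_n.+2.
Local Notation endo := 'M[C]_n.+2.
Local Notation g := (@gram R n).
Implicit Types (x y X Y : pt) (u v w : vec).

Lemma wedge_vec u v w : wedge u v *m w = ip u w *: v - ip v w *: u.
Proof.
have h (a : vec) : a^T *m g *m w = (ip a w)%:M by exact: mul11.
by rewrite /wedge mulmxBl -!mulmxA ![_^T *m (g *m w)]mulmxA !h !mul_mx_scalar.
Qed.

Lemma wedge_skew u v : adjm g (wedge u v) = - wedge u v.
Proof.
rewrite adjm_def /wedge linearB /= !trmx_mul !trmxK gramT mulmxBr mulmxBl !mulmxA gram2 !mul1mx.
by rewrite -!mulmxA opprB.
Qed.

Lemma wedgeZl c u v : wedge (c *: u) v = wedge u (c *: v).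
Proof. by rewrite /wedge !linearZ /=; mx_expand; mx_lin; ring. Qed.

Lemma wedgeZr c u v : wedge u (c *: v) = c *: wedge u v.
Proof. by rewrite /wedge !linearZ /=; mx_expand; mx_lin; ring. Qed.

Lemma wedgeDr u v w : wedge u (v + w) = wedge u v + wedge u w.
Proof. by rewrite /wedge !linearD /=; mx_expand; mx_lin; ring. Qed.

Lemma bracket_vec (D21 D12 N1 N2 Q1 Q2 : endo) w :
  (D21 - (N1 *m Q2 - Q2 *m N1)) - (D12 - (N2 *m Q1 - Q1 *m N2)) = 0 ->
  D21 *m w - D12 *m w =
    N1 *m (Q2 *m w) - Q2 *m (N1 *m w) - (N2 *m (Q1 *m w) - Q1 *m (N2 *m w)).
Proof.
move=> e; have -> : D21 = D12 + (N1 *m Q2 - Q2 *m N1) - (N2 *m Q1 - Q1 *m N2).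
  by apply/eqP; rewrite -subr_eq0 -e; apply/eqP; mx_lin; ring.
by mx_expand; mx_lin; ring.
Qed.

(* The components of d^D q = 0 on two vectors of the osculating space. *)
Lemma codazzi_alg (s s1 s2 s11 s12 s21 s22 v1 v2 : vec) (Q1 Q2 N1 N2 D21 D12 : endo) (E F G : C) :
  Q1 = wedge s v1 -> Q2 = wedge s v2 ->
  s != 0 -> ip s s = 0 -> ip s s1 = 0 -> ip s s2 = 0 ->
  ip v1 s = 0 -> ip v2 s = 0 ->
  ip s11 s = - E -> ip s12 s = - F -> ip s21 s = - F -> ip s22 s = - G ->
  N1 *m s = 0 -> N2 *m s = 0 -> Q2 *m (N1 *m s1) = 0 -> Q1 *m (N2 *m s1) = 0 ->
  D21 *m s + Q2 *m s1 = 0 -> D12 *m s + Q1 *m s2 = 0 ->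
  ip (D21 *m s1 + Q2 *m s11) s2 + ip (Q2 *m s1) s21 = 0 ->
  ip (D12 *m s1 + Q1 *m s12) s2 + ip (Q1 *m s1) s22 = 0 ->
  (D21 - (N1 *m Q2 - Q2 *m N1)) - (D12 - (N2 *m Q1 - Q1 *m N2)) = 0 ->
  Q1 *m s2 = Q2 *m s1 /\
  G *: (Q1 *m s1) - (2 * F) *: (Q1 *m s2) + E *: (Q2 *m s2) = 0.
Proof.
move=> hQ1 hQ2 s0 ss s_1 s_2 v1s v2s h11 h12 h21 h22 N1s N2s QN QN' d21 d12 p1 p2 /bracket_vec e.
have b1 w : ip s w = 0 -> Q1 *m w = - ip v1 w *: s.
  by move=> h; rewrite hQ1 wedge_vec h scale0r sub0r scaleNr.
have b2 w : ip s w = 0 -> Q2 *m w = - ip v2 w *: s.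
  by move=> h; rewrite hQ2 wedge_vec h scale0r sub0r scaleNr.
have sk1 u w : ip (Q1 *m u) w = - ip u (Q1 *m w) by rewrite ip_adjl hQ1 wedge_skew mulNmx ipNr.
have sk2 u w : ip (Q2 *m u) w = - ip u (Q2 *m w) by rewrite ip_adjl hQ2 wedge_skew mulNmx ipNr.
have {hQ1 hQ2} es := e s; have {e} es1 := e s1.
have Q1s : Q1 *m s = 0 by rewrite b1 // v1s oppr0 scale0r.
have Q2s : Q2 *m s = 0 by rewrite b2 // v2s oppr0 scale0r.
(* On [s], which [q] and [N] kill, the equation is the symmetry; its [s1] column paired with [s2]
   will give the vanishing trace. *)
move: es; rewrite Q1s Q2s N1s N2s !mulmx0 !subr0 => /eqP.
rewrite subr_eq0 => /eqP es.
have sym : Q1 *m s2 = Q2 *m s1 by apply: (addrI (D12 *m s)); rewrite d12 -es d21.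
split=> //.
have h : ip v1 s2 = ip v2 s1.
  have := sym; rewrite b1 // b2 // => /eqP; rewrite -subr_eq0 -scalerBl scaler_eq0 (negbTE s0) orbF.
  by rewrite subr_eq0 eqr_opp => /eqP.
move: es1; rewrite QN QN' b1 // b2 // -!scalemxAr N1s N2s !scaler0 !subr0 => es1.
have {es1} p3 : ip (D21 *m s1) s2 - ip (D12 *m s1) s2 = 0.
  by rewrite -ipNl -ipDl es1 ip0l.
move: p1 p2; rewrite !ipDl sk1 sk2 b1 // b2 // b1 // b2 //.
rewrite !ipZr !ipZl h11 h12 [ip s s21]ipC h21 [ip s s22]ipC h22 h => p1 p2.
have lin3 (a b c t : C) : a = 0 -> b = 0 -> c = 0 -> t = a - b - c -> t = 0.
  by move=> -> -> -> ->; rewrite !subr0.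
have p := lin3 _ _ _ (G * - ip v1 s1 + - (2 * F * - ip v2 s1) + E * - ip v2 s2) p1 p2 p3.
rewrite -[RHS](scale0r s) -p; last by ring.
by clear; move: (ip v1 s1) (ip v2 s1) (ip v2 s2) => a b c; mx_lin; ring.
Qed.

End Multiplier.

(** * The (1,0) part of the multiplier *)

Section MultiplierForm.
Local Opaque ip der.
Context {R : realType} {n : nat}.
Local Notation C := R[i].
Local Notation I := ('i%C : C).
Local Notation pt := (R * R)%type.
Local Notation vec := 'cV[C]_n.+2.
Local Notation endo := 'M[C]_n.+2.
Local Notation g := (@gram R n).
Implicit Types (x y X Y : pt) (u v w : vec).
Context (U : set pt) (oU : open U) (Lam : pt -> set vec) (q : pt -> pt -> endo).
Hypothesis cw : constrained_willmore U Lam q.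
Let sf : is_surface U Lam. Proof. by case: cw. Qed.
Local Notation s := (Defs.lift U Lam).
Let Cs : smooth U s := smooth_lift sf.
Local Notation J := (cpx U Lam).
Local Notation P := (cproj U Lam).

Lemma ip_comb0 (a b c e : C) t u1 u2 u3 u4 : ip t t = 0 ->
  ip u1 t = 0 -> ip u2 t = 0 -> ip u3 t = 0 -> ip u4 t = 0 ->
  ip (a *: t + (u1 - b *: u2) + (c *: t + (u3 + e *: u4))) t = 0.
Proof.
move=> h0 h1 h2 h3 h4.
by rewrite -scaleNr !ipDl !ipZl h0 h1 h2 h3 h4 !mulr0 !addr0.
Qed.

Lemma cw_smooth X : smooth U (fun x => q x X).
Proof. by case: cw => _ [h _] _ _ _. Qed.

Lemma cw_lin x : U x -> formlin q x.
Proof.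
case: cw => _ [_ h] _ _ _ Ux a b X Y.
have h0 : q x 0 = 0.
  have := h x 1 0 0 Ux; rewrite scale1r addr0 scale1r => e.
  by apply: (addrI (q x 0)); rewrite -e addr0.
by rewrite h // -[b *: Y]addr0 h // h0 addr0.
Qed.

Lemma cw_real x X : U x -> conjm (q x X) = q x X.
Proof. by case: cw => _ _ h _ _; exact: h. Qed.

Lemma L1_facts x v : U x -> L1 U Lam x v -> P x *m v = v /\ ip v (s x) = 0.
Proof.
move=> Ux Lv; split.
  by apply/(csc_mem oU sf v Ux); exists v, 0; split=> //; [exists 0; rewrite ?scale0r|rewrite addr0].
have h X : ip (der s x X) (s x) = 0 by rewrite ipC; exact: ip_lift_der.
have h0 := lift_null sf Ux.
case: Lv => [u1 [u2 [[a [b [ha [X ->] ->]]] [c [d [hc [Y ->] ->]]] ->]]].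
move: ha hc; rewrite (lift_line sf Ux) => -[ca _ <-] [cc _ <-].
exact: ip_comb0 h0 (h X) (h _) (h Y) (h _).
Qed.

Lemma cw_wedge x X : U x -> exists v,
  [/\ P x *m v = v, ip v (s x) = 0 & q x X = wedge (s x) v].
Proof.
move=> Ux; case: cw => _ _ _ h _; have [u [v [Lu Lv ->]]] := h x X Ux.
have [Pv vs] := L1_facts Ux Lv.
move: Lu; rewrite (lift_line sf Ux) => -[c _ <-]; exists (c *: v).
by split; [rewrite -scalemxAr Pv|rewrite ipZl vs mulr0|exact: wedgeZl].
Qed.

Lemma cw_kill_lift x X : U x -> q x X *m s x = 0.
Proof.
move=> Ux; have [v [_ vs ->]] := cw_wedge X Ux.
by rewrite wedge_vec vs (lift_null sf Ux) !scale0r subrr.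
Qed.

Lemma ip_proj_ker x u w : P x *m u = u -> P x *m w = 0 -> ip u w = 0.
Proof. by move=> <- h; rewrite ip_adjl cproj_adj h ip0r. Qed.

Lemma cw_kill_perp x X w : U x -> P x *m w = 0 -> q x X *m w = 0.
Proof.
move=> Ux Pw; have [v [Pv vs ->]] := cw_wedge X Ux; have [Ps _ _] := cproj_fix oU sf Ux.
by rewrite wedge_vec !(@ip_proj_ker x _ w) // !scale0r subrr.
Qed.

Lemma cw_line x X v : U x -> ip (s x) v = 0 -> exists c, q x X *m v = c *: s x.
Proof.
move=> Ux sv; have [w [_ _ ->]] := cw_wedge X Ux.
by exists (- ip w v); rewrite wedge_vec sv scale0r sub0r scaleNr.
Qed.

Lemma Nform_lift x X : U x -> Nform U Lam x X *m s x = 0.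
Proof.
move=> Ux; rewrite (Nform_eq oU sf X Ux).
have Ps y : U y -> P y *m s y = s y by move=> Uy; case: (cproj_fix oU sf Uy).
rewrite (NN_sec oU (smooth_cproj oU sf) (fun y Uy => cproj_idem oU sf Uy) X Cs Ps Ux).
have [_ h _] := cproj_fix oU sf Ux; rewrite mulmxBl mul1mx h; exact: subrr.
Qed.

Lemma Nform_der x X Y : U x -> P x *m (Nform U Lam x X *m der s x Y) = 0.
Proof.
move=> Ux; rewrite (Nform_eq oU sf X Ux).
have Ps y : U y -> P y *m der s y Y = der s y Y by move=> Uy; case: (cproj_fix oU sf Uy).
have CS : smooth U (fun y => der s y Y) by exact: smooth_der.
rewrite (NN_sec oU (smooth_cproj oU sf) (fun y Uy => cproj_idem oU sf Uy) X CS Ps Ux).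
move: (der _ _ _) => d; rewrite mulmxA mulmxBr mulmx1 cproj_idem // subrr; exact: mul0mx.
Qed.

(** The derivatives of [q] in [extD q x = 0] are traded for derivatives of the lift by
    differentiating [q s = 0] and the orthogonality of [q ds] to [ds]. *)
Lemma cw_codazzi x : U x ->
  q x e1 *m der s x e2 = q x e2 *m der s x e1 /\
  (gG U Lam x)%:C%C *: (q x e1 *m der s x e1) - (2 * (gF U Lam x)%:C%C) *: (q x e1 *m der s x e2)
   + (gE U Lam x)%:C%C *: (q x e2 *m der s x e2) = 0.
Proof.
move=> Ux; have [v1 [_ v1s h1]] := cw_wedge e1 Ux; have [v2 [_ v2s h2]] := cw_wedge e2 Ux.
have sd X : ip (s x) (der s x X) = 0 by exact: ip_lift_der.
have CS X : smooth U (fun y => der s y X) by exact: smooth_der.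
have dd X Y : ip (der (fun y => der s y X) x Y) (s x) = - (metric U Lam x X Y)%:C%C.
  have : cder (fun y => ip (der s y X) (s y)) x Y = 0.
    rewrite (cder_ext oU Ux Y (g := fun=> 0)) ?cder_cst // => y Uy.
    by rewrite ipC; exact: ip_lift_der.
  rewrite (cder_ip oU Y Ux (CS X) Cs) (ip_der oU sf Ux) => /eqP.
  by rewrite addr_eq0 => /eqP.
have Qd X Y : der (fun y => q y X) x Y *m s x + q x X *m der s x Y = 0.
  rewrite -(derM oU Ux Y (cw_smooth X) Cs) (der_ext oU Ux (B := fun=> 0)) ?der_cst // => y Uy.
  exact: cw_kill_lift.
have Qdd X Y Z V : ip (der (fun y => q y X) x Y *m der s x Z + q x X *m der (fun y => der s y Z) x Y) (der s x V)
    + ip (q x X *m der s x Z) (der (fun y => der s y V) x Y) = 0.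
  rewrite -(derM oU Ux Y (cw_smooth X) (CS Z)).
  have CM : smooth U (fun y => q y X *m der s y Z) by apply: smoothM; [|exact: cw_smooth|].
  rewrite -(cder_ip oU Y Ux CM (CS V)) (cder_ext oU Ux Y (g := fun=> 0)) ?cder_cst // => y Uy.
  have [c ->] := cw_line X Uy (ip_lift_der oU sf Uy Z).
  by rewrite ipZl (ip_lift_der oU sf Uy) mulr0.
apply: (codazzi_alg h1 h2 (lift_neq0 sf Ux) (lift_null sf Ux) (sd e1) (sd e2) v1s v2s
  (dd e1 e1) (dd e1 e2) _ (dd e2 e2) (Nform_lift e1 Ux) (Nform_lift e2 Ux)
  (cw_kill_perp e2 Ux (Nform_der e1 e1 Ux)) (cw_kill_perp e1 Ux (Nform_der e2 e1 Ux))
  (Qd e2 e1) (Qd e1 e2) (Qdd e2 e1 e1 e2) (Qdd e1 e2 e1 e2)).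
  by rewrite (dd e2 e1) metricC.
by case: cw => _ _ _ _ /(_ x Ux) [h _]; exact: h.
Qed.

(** The trace computation of [second_form_alg] again, now with zero trace. By [cw_fz] the (1,0) part
    of [q] thus lies in the wedge of [Lam] with the osculating plane of type (0,1). *)
Lemma cw_zetb x : U x -> fz U Lam q x *m zetb U Lam x = 0.
Proof.
move=> Ux; have [sym tr] := cw_codazzi Ux.
rewrite /fz cpx_e1 (cw_lin Ux) /zetb (der_J oU sf Ux).
have one (v : vec) : (1%:M : endo) *m v = v by exact: mul1mx.
rewrite (second_form_alg (area_pos oU sf Ux) (area_sqr oU sf Ux) sym (one _) (one _)) one.
move: tr sym; move: (der s x e1) (der s x e2) (q x e1) (q x e2) => s1 s2 Q1 Q2 tr sym.
have e (a E F G : C) : Q1 *m (a *: (G *: s1 - F *: s2)) + Q2 *m (a *: (E *: s2 - F *: s1)) =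
  a *: (G *: (Q1 *m s1) - (2 * F) *: (Q1 *m s2) + E *: (Q2 *m s2)).
  by mx_expand; rewrite -sym; mx_lin; ring.
by rewrite e tr !scaler0.
Qed.

Lemma cw_fz x : U x -> exists v,
  [/\ P x *m v = v, ip v (s x) = 0, ip v (zetb U Lam x) = 0 & fz U Lam q x = wedge (s x) v].
Proof.
move=> Ux; have [v1 [P1 v1s h1]] := cw_wedge e1 Ux; have [v2 [P2 v2s h2]] := cw_wedge (J x e1) Ux.
exists (v1 + (- I) *: v2).
have e : fz U Lam q x = wedge (s x) (v1 + (- I) *: v2).
  by rewrite wedgeDr wedgeZr -h1 -h2 scaleNr.
have vs : ip (v1 + (- I) *: v2) (s x) = 0 by rewrite ipDl ipZl v1s v2s mulr0 addr0.
split=> //; first by rewrite mulmxDr -scalemxAr P1 P2.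
have := cw_zetb Ux; rewrite e wedge_vec.
have [_ -> _ _ _] := zet_ip oU sf Ux; rewrite scale0r sub0r => /eqP.
by rewrite oppr_eq0 scaler_eq0 (negbTE (lift_neq0 sf Ux)) orbF => /eqP.
Qed.

End MultiplierForm.

(** * The osculating plane of type (1,0) *)

Section Osculating.
Local Opaque ip der.
Context {R : realType} {n : nat}.
Local Notation C := R[i].
Local Notation I := ('i%C : C).
Local Notation pt := (R * R)%type.
Local Notation vec := 'cV[C]_n.+2.
Local Notation endo := 'M[C]_n.+2.
Local Notation g := (@gram R n).
Implicit Types (x y X Y : pt) (u v w : vec).
Context (U : set pt) (oU : open U).

Lemma ip_dz_alg (u u1 u2 v v1 v2 : vec) :
  ip u1 v + ip u v1 = 0 -> ip u2 v + ip u v2 = 0 ->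
  ip (u1 - I *: u2) v + ip u (v1 - I *: v2) = 0.
Proof.
move=> h1 h2; transitivity ((ip u1 v + ip u v1) - I * (ip u2 v + ip u v2)).
  by rewrite ipDl ipDr ipNl ipNr ipZl ipZr; clear; move: (I) => i; ring.
by rewrite h1 h2 mulr0 subrr.
Qed.

Lemma ip_dz_cst (J : pt -> pt) (s t : pt -> vec) c x : U x -> smooth U s -> smooth U t ->
  (forall y, U y -> ip (s y) (t y) = c) -> ip (dz J s x) (t x) + ip (s x) (dz J t x) = 0.
Proof.
move=> Ux Cs Ct h; rewrite /dz.
have d X : ip (der s x X) (t x) + ip (s x) (der t x X) = 0.
  rewrite -(cder_ip oU X Ux Cs Ct) (cder_ext oU Ux X (g := fun=> c)) ?cder_cst //.
exact: ip_dz_alg (d e1) (d (J x)).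
Qed.

Section ProjectionField.
Context (P : pt -> endo) (CP : smooth U P) (PP : forall x, U x -> P x *m P x = P x).

Definition NZ (J : pt -> pt) x : endo := NN P x e1 - I *: NN P x (J x).

Lemma reflP2 (A : endo) : A *m A = A -> reflP A *m reflP A = 1%:M.
Proof. by move=> h; rewrite /reflP; mx_expand; rewrite h; move: (1%:M) => E; mx_lin; ring. Qed.

Lemma adjm_reflP (A : endo) : adjm g A = A -> adjm g (reflP A) = reflP A.
Proof. by move=> h; rewrite /reflP !(adjmD, adjmN) h (adjm1 gram2). Qed.

Lemma NZE J x : U x -> dz J (fun y => reflP (P y)) x = - (2 *: (reflP (P x) *m NZ J x)).
Proof.
move=> Ux; rewrite /NZ /dz /NN !(der_reflP oU CP) //.
have rr := reflP2 (PP Ux).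
move: (reflP _) (der _ _ e1) (der _ _ (J x)) rr => r A B rr.
move: (I) => i; mx_expand; rewrite rr !mul1mx.
by mx_lin; ring.
Qed.

Lemma dz_reflP_anti J x : U x -> let rho y := reflP (P y) in
  dz J rho x *m rho x + rho x *m dz J rho x = 0.
Proof.
move=> Ux rho; have Cr : smooth U rho by exact: smooth_reflP.
rewrite -(dzM oU J Ux Cr Cr) (dz_ext oU J Ux (B := fun=> 1%:M)) ?dz_cst // => y Uy.
exact: reflP2 (PP Uy).
Qed.

(** This expresses [N] through the reflection alone, the form in which [N] of the transform will be
    recognised. *)
Lemma NZ_half J x : U x -> let rho y := reflP (P y) in
  NZ J x = 2^-1 *: (dz J rho x *m rho x).
Proof.
move=> Ux rho; have e := NZE J Ux; have h := dz_reflP_anti J Ux; have rr := reflP2 (PP Ux).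
move: h; rewrite /= addrC => /eqP; rewrite addr_eq0 => /eqP h.
rewrite /rho -[_ *m reflP _]opprK -h e; move: (NZ J x) (reflP _) rr => A r rr.
by rewrite mulmxN -scalemxAr mulmxA rr mul1mx; mx_lin; field.
Qed.

Lemma NZ_sec J (t : pt -> vec) x : smooth U t -> (forall y, U y -> P y *m t y = t y) ->
  U x -> NZ J x *m t x = (1%:M - P x) *m dz J t x.
Proof.
move=> Ct Pt Ux.
have alg (N1 N2 Q : endo) (v d1 d2 : vec) : N1 *m v = Q *m d1 -> N2 *m v = Q *m d2 ->
    (N1 - I *: N2) *m v = Q *m (d1 - I *: d2).
  by move=> h1 h2; rewrite mulmxBl -scalemxAl h1 h2 mulmxBr -scalemxAr.
exact: alg (NN_sec oU CP PP _ Ct Pt Ux) (NN_sec oU CP PP _ Ct Pt Ux).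
Qed.

End ProjectionField.

Context (Lam : pt -> set vec) (sf : is_surface U Lam).
Local Notation s := (Defs.lift U Lam).
Let Cs : smooth U s := smooth_lift sf.
Local Notation J := (fun y => cpx U Lam y e1).
Local Notation P := (cproj U Lam).

Lemma smooth_zet : smooth U (zet U Lam).
Proof.
have Cd X : smooth U (fun y => der s y X) by exact: smooth_der.
apply: (smooth_ext oU (A := fun y => der s y e1 - I *:
   ((- gF U Lam y / garea U Lam y)%:C%C *: der s y e1 + (gE U Lam y / garea U Lam y)%:C%C *: der s y e2))).
  by move=> y Uy; rewrite /zet (der_J oU sf Uy).
have C1 : csmooth U (fun y => (- gF U Lam y / garea U Lam y)%:C%C).
  apply: csmooth_real => // r; apply: CkM => //; last exact: Ck_areaV.
  by apply: CkN => //; exact: Ck_gF.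
have C2 : csmooth U (fun y => (gE U Lam y / garea U Lam y)%:C%C).
  by apply: csmooth_real => // r; apply: CkM => //; [exact: Ck_gE|exact: Ck_areaV].
apply: smoothB => //; apply: smoothZc => //.
by apply: smoothD => //; apply: smoothZ.
Qed.

Lemma cproj_zet x : U x -> P x *m zet U Lam x = zet U Lam x /\ P x *m zetb U Lam x = zetb U Lam x.
Proof.
move=> Ux; have [_ PX _] := cproj_fix oU sf Ux.
have alg (A : endo) (u v : vec) : A *m u = u -> A *m v = v ->
   A *m (u - I *: v) = u - I *: v /\ A *m (u + I *: v) = u + I *: v.
  by move=> h1 h2; rewrite mulmxBr mulmxDr -scalemxAr h1 h2.
exact: alg (PX _) (PX _).
Qed.

Lemma dz_lift x : dz J s x = zet U Lam x. Proof. by []. Qed.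

Lemma cpx_basis x X : U x -> exists a b : R, X = a *: e1 + b *: cpx U Lam x e1.
Proof.
move=> Ux; have j0 : j2 U Lam x != 0.
  by rewrite /j2 mulf_neq0 ?invr_eq0 ?(area_neq0 oU sf Ux) // gt_eqF // (gE_pos oU sf Ux).
exists (X.1 - X.2 * j1 U Lam x / j2 U Lam x), (X.2 / j2 U Lam x).
rewrite cpx_e1 pair_lin [LHS]pt_decomp !pair_lin.
move: (j1 U Lam x) (j2 U Lam x) j0 => k l l0.
have e (p q' a b c d : R) : p *: ((a, b) : pt) + q' *: ((c, d) : pt) = (p * a + q' * c, p * b + q' * d) by [].
by rewrite /e1 e; congr pair; field.
Qed.

Lemma osc_dir x X : U x -> exists c,
  der s x X - I *: der s x (cpx U Lam x X) = c *: zet U Lam x /\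
  der s x X + I *: der s x (cpx U Lam x X) = conjc c *: zetb U Lam x.
Proof.
move=> Ux; have [a [b ->]] := cpx_basis X Ux.
exists (a%:C%C + I * b%:C%C).
have -> : conjc (a%:C%C + I * b%:C%C) = a%:C%C - I * b%:C%C :> C.
  by apply: complex_ext => /=; ring.
rewrite (cpx_comb U Lam) (cpx2 oU sf Ux).
have -> : a *: J x + b *: - e1 = a *: J x + (- b) *: e1 by rewrite scalerN scaleNr.
rewrite !(der_lin oU Ux _ _ _ _ Cs) rmorphN /=.
rewrite /zet /zetb; have i2 := @II R.
have e (u v : vec) (i a' b' : C) : i * i = -1 ->
   a' *: u + b' *: v - i *: (a' *: v + (- b') *: u) = (a' + i * b') *: (u - i *: v) /\
   a' *: u + b' *: v + i *: (a' *: v + (- b') *: u) = (a' - i * b') *: (u + i *: v).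
  move=> h; have -> : b' *: v = (- (i * i) * b') *: v by rewrite h opprK mul1r.
  by split; mx_lin; ring.
exact: e i2.
Qed.

Lemma L10_span x v : U x -> L10 U Lam x v -> exists c c', v = c *: s x + c' *: zet U Lam x.
Proof.
move=> Ux [a [b [ha [X ->] ->]]]; have [c' [-> _]] := osc_dir X Ux.
by move: ha; rewrite (lift_line sf Ux) => -[c _ <-]; exists c, c'.
Qed.

Lemma L01_span x v : U x -> L01 U Lam x v -> exists c c', v = c *: s x + c' *: zetb U Lam x.
Proof.
move=> Ux [a [b [ha [X ->] ->]]]; have [c' [_ ->]] := osc_dir X Ux.
by move: ha; rewrite (lift_line sf Ux) => -[c _ <-]; exists c, (conjc c').
Qed.

Local Opaque zet zetb dz NZ cproj.

(** The (1,0) osculating plane, described as its own orthogonal complement inside the central sphere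
    congruence ([cproj_T10]): these equations can be differentiated. *)
Definition T10 x v := [/\ P x *m v = v, ip v (s x) = 0 & ip v (zet U Lam x) = 0].

Let addl0 (a b : C) : a + b = 0 -> a = 0 -> b = 0.
Proof. by move=> h h0; rewrite h0 add0r in h. Qed.

Let addr0E (a b : C) : b = 0 -> a + b = 0 -> a = 0.
Proof. by move=> h0; rewrite h0 addr0. Qed.

Let addll0 (a b : C) : a + b = 0 -> a = b -> b = 0.
Proof. by move=> + e; rewrite e => /eqP; rewrite -mulr2n mulrn_eq0 => /eqP. Qed.

Let ip_lc0 (a b : C) u v w : ip u w = 0 -> ip v w = 0 -> ip (a *: u + b *: v) w = 0.
Proof. by move=> h1 h2; rewrite ipDl !ipZl h1 h2 !mulr0 addr0. Qed.

(** The osculating plane is parallel for [D] in the (1,0) direction. Differentiating the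
    orthogonality to [s] and [zet], the remaining terms vanish because [dz s = zet], and [zet] is
    null and orthogonal to [s]. *)
Lemma T10_dz (u : pt -> vec) x : U x -> smooth U u -> (forall y, U y -> T10 y (u y)) ->
  T10 x (dz J u x - NZ P J x *m u x).
Proof.
move=> Ux Cu hu; have PP y (Uy : U y) := cproj_idem oU sf Uy; have CP := smooth_cproj oU sf.
have Pu y : U y -> P y *m u y = u y by move=> /hu[].
rewrite (NZ_sec CP PP J Cu Pu Ux).
have e (A : endo) (v : vec) : v - (1%:M - A) *m v = A *m v by rewrite mulmxBl mul1mx opprB addrC subrK.
rewrite e; have [Ps PX _] := cproj_fix oU sf Ux.
have [Pz _] := cproj_zet Ux.
have [h1 h2 h3] := hu _ Ux; have [z1 _ z2 _ _] := zet_ip oU sf Ux.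
have [c [c' uE]] := cproj_T10 oU sf Ux h1 h2 h3.
split; first by rewrite mulmxA PP.
- rewrite ip_adjl cproj_adj Ps.
  have hs y : U y -> ip (u y) (s y) = 0 by move=> /hu[].
  have h3' : ip (u x) (dz J s x) = 0 by rewrite dz_lift.
  exact: addr0E h3' (ip_dz_cst J Ux Cu Cs hs).
- rewrite ip_adjl cproj_adj Pz.
  have hs y : U y -> ip (u y) (zet U Lam y) = 0 by move=> /hu[].
  have hs1 y : U y -> ip (s y) (zet U Lam y) = 0 by move=> Uy; case: (zet_ip oU sf Uy).
  have hz1 y : U y -> ip (zet U Lam y) (zet U Lam y) = 0 by move=> Uy; case: (zet_ip oU sf Uy).
  have z2' : ip (dz J s x) (zet U Lam x) = 0 by rewrite dz_lift.
  have k1 := addl0 (ip_dz_cst J Ux Cs smooth_zet hs1) z2'.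
  have k2 := addll0 (ip_dz_cst J Ux smooth_zet smooth_zet hz1) (ipC _ _).
  have k3 : ip (u x) (dz J (zet U Lam) x) = 0.
    by rewrite uE; exact: ip_lc0 k1 k2.
  exact: addr0E k3 (ip_dz_cst J Ux Cu smooth_zet hs).
Qed.

Lemma L10_T10 x v : U x -> L10 U Lam x v -> T10 x v.
Proof.
move=> Ux /(L10_span Ux)[c [c' ->]]; have [Pz _] := cproj_zet Ux.
have [Ps _ _] := cproj_fix oU sf Ux; have [z1 _ z2 _ _] := zet_ip oU sf Ux.
split; [|apply: ip_lc0 => //|exact: ip_lc0].
  by rewrite mulmxDr -!scalemxAr Ps Pz.
  exact: lift_null.
by rewrite ipC.
Qed.

End Osculating.

(** * The initial quadratic family and its symmetries *)

Lemma admissible_init {F : numFieldType} {m} (g rho drho N q : 'M[F]_m) :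
  g *m g = 1%:M ->
  rho *m rho = 1%:M -> drho *m rho + rho *m drho = 0 -> adjm g rho = rho -> adjm g drho = drho ->
  N = 2^-1 *: (drho *m rho) -> adjm g q = - q -> rho *m q *m rho = q ->
  admissible g rho drho (QFamily (- N - q) N q).
Proof.
move=> gg rr anti ar ad NE sq pq.
have e : rho *m drho = - (drho *m rho) by apply/eqP; rewrite -addr_eq0 addrC anti.
have aN : adjm g N = - N by rewrite NE adjmZ (adjmM gg) ar ad e scalerN.
have rN : rho *m N *m rho = - N.
  by rewrite NE -scalemxAr -scalemxAl -!mulmxA rr mulmx1 e scalerN.
split=> //=; first change (adjm g (- N - q) = - (- N - q)).
- by rewrite adjmD (adjmN g N) (adjmN g q) aN sq opprD.
- have h : 2^-1 + 2^-1 = 1 :> F by rewrite {3}(splitr 1) mul1r.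
  have -> : drho *m rho = N + N by rewrite NE -scalerDl h scale1r.
  by rewrite mulmxDr mulmxDl !mulmxN !mulNmx rN pq; mx_lin; ring.
Qed.

Section InitialFamily.
Local Opaque ip der zet zetb dz cproj.
Context {R : realType} {n : nat}.
Local Notation C := R[i].
Local Notation I := ('i%C : C).
Local Notation pt := (R * R)%type.
Local Notation vec := 'cV[C]_n.+2.
Local Notation endo := 'M[C]_n.+2.
Local Notation g := (@gram R n).
Implicit Types (x y X Y : pt) (u v w : vec).
Context (U : set pt) (oU : open U) (Lam : pt -> set vec) (q : pt -> pt -> endo).
Hypothesis cw : constrained_willmore U Lam q.
Let sf : is_surface U Lam. Proof. by case: cw. Qed.
Local Notation s := (Defs.lift U Lam).
Local Notation J := (fun y => cpx U Lam y e1).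
Local Notation P := (cproj U Lam).
Local Notation rho := (fun y => reflP (cproj U Lam y)).

Lemma fz_Nform x : U x -> fz U Lam (Nform U Lam) x = NZ P J x.
Proof. by move=> Ux; rewrite /fz !(Nform_eq oU sf _ Ux). Qed.

Lemma fz_q_proj x : U x -> P x *m fz U Lam q x = fz U Lam q x /\ fz U Lam q x *m P x = fz U Lam q x.
Proof.
move=> Ux; have [v [Pv _ _ ->]] := cw_fz oU cw Ux; have [Ps _ _] := cproj_fix oU sf Ux.
have e : P x *m wedge (s x) v = wedge (s x) v.
  by rewrite /wedge mulmxBr !mulmxA Pv Ps.
split=> //; apply: (can_inj (adjmK gramT gram2)).
by rewrite (adjmM gram2) cproj_adj wedge_skew mulmxN e.
Qed.

Lemma fz_q_refl x : U x -> rho x *m fz U Lam q x = fz U Lam q x /\ fz U Lam q x *m rho x = fz U Lam q x.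
Proof.
move=> /fz_q_proj [h1 h2]; rewrite /reflP.
move: (fz _ _ _ _) (P x) h1 h2 => A B h1 h2.
by split; mx_expand; rewrite ?h1 ?h2 opprB addrC subrK.
Qed.

Lemma fz_q_skew x : U x -> adjm g (fz U Lam q x) = - fz U Lam q x.
Proof. by move=> Ux; have [v [_ _ _ ->]] := cw_fz oU cw Ux; exact: wedge_skew. Qed.

Lemma adjm_dz_refl x : U x -> adjm g (dz J rho x) = dz J rho x.
Proof.
move=> Ux; rewrite -(dz_adj oU J Ux (smooth_reflP oU (smooth_cproj oU sf))).
by apply: (dz_ext oU J Ux) => y Uy; apply: adjm_reflP; exact: cproj_adj.
Qed.

(** Normalised to vanish at [lam = 1], where the connection is [d]. *)
Definition family0 x : qfamily (F := C) := QFamily (- NZ P J x - fz U Lam q x) (NZ P J x) (fz U Lam q x).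

Lemma family0_admissible x : U x -> admissible g (rho x) (dz J rho x) (family0 x).
Proof.
move=> Ux; have PP y (Uy : U y) := cproj_idem oU sf Uy; have CP := smooth_cproj oU sf.
have [h1 h2] := fz_q_refl Ux.
apply: (admissible_init gram2 (reflP2 (PP _ Ux)) (dz_reflP_anti oU CP PP J Ux) _
  (adjm_dz_refl Ux) (NZ_half oU CP PP J Ux) (fz_q_skew Ux)).
  by apply: adjm_reflP; exact: cproj_adj.
by rewrite h1 h2.
Qed.

(** On [zetb] this is [NN_trace] for [N], the Laplacian lying in the central sphere congruence, and
    [cw_zetb] for [q]. *)
Lemma L01_kill x v : U x -> L01 U Lam x v -> NZ P J x *m v = 0 /\ fz U Lam q x *m v = 0.
Proof.
move=> Ux /(L01_span oU sf Ux)[c [c' ->]].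
have PP y (Uy : U y) := cproj_idem oU sf Uy; have CP := smooth_cproj oU sf.
have Ps y : U y -> P y *m s y = s y by move=> Uy; case: (cproj_fix oU sf Uy).
have PX y X : U y -> P y *m der s y X = der s y X by move=> Uy; case: (cproj_fix oU sf Uy).
have N0 : NZ P J x *m s x = 0.
  rewrite (NZ_sec oU CP PP J (smooth_lift sf) Ps Ux) dz_lift mulmxBl mul1mx.
  by have [-> _] := cproj_zet oU sf Ux; rewrite subrr.
have N1 : NZ P J x *m zetb U Lam x = 0.
  have := NN_trace oU sf CP PP PX Ux; have [_ _ h] := cproj_fix oU sf Ux.
  have -> : (1%:M - P x) *m lap U Lam x = 0 by rewrite mulmxBl mul1mx h subrr.
  by rewrite scaler0.
have q0 : fz U Lam q x *m s x = 0.
  rewrite /fz mulmxBl -scalemxAl !(cw_kill_lift oU cw _ Ux) scaler0 subrr //.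
by rewrite !mulmxDr -!scalemxAr N0 N1 q0 (cw_zetb oU cw Ux) !scaler0 addr0.
Qed.

Lemma L10_q x v : U x -> L10 U Lam x v -> exists c, fz U Lam q x *m v = c *: s x.
Proof.
move=> Ux /(L10_T10 oU sf Ux)[_ vs _].
have [w [_ _ _ ->]] := cw_fz oU cw Ux.
by exists (- ip w v); rewrite wedge_vec ipC vs scale0r sub0r scaleNr.
Qed.

End InitialFamily.

(** * The parameters alpha and ahat *)

Section ParameterArithmetic.
Local Opaque ip der zet zetb dz cproj NZ.
Context {R : realType}.
Local Notation C := R[i].

(** The equality [alpha = ahat alpha] would give squared modulus 1, and [alpha = - ahat alpha] would
    give -1. *)
Lemma ahat_facts (alpha : C) : alpha != 0 -> `|alpha| != 1 ->
  [/\ ahat alpha != 0, alpha != ahat alpha, alpha != - ahat alpha,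
      alpha ^+ 2 != ahat alpha ^+ 2 & 1 \notin [:: alpha; - alpha; ahat alpha; - ahat alpha]].
Proof.
move=> a0 a1; have c0 : conjc alpha != 0 by rewrite conjc_eq0.
have h0 : ahat alpha != 0 by rewrite invr_eq0.
have n1 : alpha != ahat alpha.
  apply: contra a1 => /eqP e; have : `|alpha| ^+ 2 = 1 by rewrite sqr_normc {1}e mulVf.
  by move/eqP; rewrite sqrf_eq1 => /orP[//|/eqP h]; have := normr_ge0 alpha; rewrite h oppr_ge0 ler10.
have n2 : alpha != - ahat alpha.
  apply/negP => /eqP e; have h : `|alpha| ^+ 2 = -1 by rewrite sqr_normc {1}e mulNr mulVf.
  have : 0 <= `|alpha| ^+ 2 by rewrite exprn_ge0.
  by rewrite h oppr_ge0 ler10.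
have c1 (x : C) : conjc x = 1 -> x = 1 by move=> h; rewrite -[x]conjcK h rmorph1.
have m1 : 1 != alpha by apply: contra a1 => /eqP <-; rewrite normr1.
have m2 : 1 != - alpha by apply: contra a1 => /eqP h; rewrite -normrN -h normr1.
split=> //; first by rewrite eqf_sqr negb_or n1.
rewrite !inE !negb_or m1 m2 /=; apply/andP; split; apply/negP => /eqP h.
  move/eqP: h; rewrite eq_sym invr_eq1 => /eqP /c1 h; by rewrite h eqxx in m1.
have : conjc (- alpha) = 1 by apply: invr_inj; rewrite rmorphN invrN invr1.
by move/c1 => h'; rewrite h' eqxx in m2.
Qed.

Lemma moebius_neq0 (a l : C) : l != a -> l != - a -> moebius a l != 0.
Proof. by move=> h1 h2; rewrite mulf_neq0 ?invr_eq0 ?subr_eq0 // addr_eq0. Qed.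

End ParameterArithmetic.

(** * Gauges and parallel lines as fields over U *)

Section GaugeField.
Local Opaque ip der zet zetb dz cproj NZ.
Context {R : realType} {n : nat}.
Local Notation C := R[i].
Local Notation I := ('i%C : C).
Local Notation pt := (R * R)%type.
Local Notation vec := 'cV[C]_n.+2.
Local Notation endo := 'M[C]_n.+2.
Local Notation g := (@gram R n).
Implicit Types (x y X Y : pt) (u v w : vec).
Context (U : set pt) (oU : open U).

Lemma dz_gauge J a (P : pt -> endo) x : U x -> smooth U P ->
  dz J (fun y => gauge g a (P y)) x = (a - 1) *: dz J P x + (a^-1 - 1) *: adjm g (dz J P x).
Proof.
move=> Ux CP; have CQ := smooth_adj oU CP.
have C1 : smooth U (fun=> 1%:M : endo) by exact: smooth_cst.
have CZ := smoothZc oU (a - 1) CP; have CZ' := smoothZc oU (a^-1 - 1) CQ.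
have CS := smoothD oU C1 CZ.
rewrite (dzD oU J Ux CS CZ') (dzD oU J Ux C1 CZ) dz_cst add0r.
by rewrite (dzZc oU J Ux _ CP) (dzZc oU J Ux _ CQ) (dz_adj oU J Ux CP).
Qed.

Lemma gauge_isometry rho (P : endo) a u v : line_proj g rho 0 P 0 -> a != 0 ->
  ip (gauge g a P *m u) (gauge g a P *m v) = ip u v.
Proof.
move=> lp a0; rewrite ip_adjl (adjm_gauge gramT gram2) mulmxA.
by rewrite (gaugeVl gram2 lp a0) mul1mx.
Qed.

(** Translates parallelism of a spanning section into the block condition that [gauge_step] takes as
    hypothesis. *)
Lemma parallel_block (P dP A : endo) (l w dl : vec) : P = lproj l w -> ip w l != 0 ->
  dP *m l + P *m dl = dl -> (exists c, dl + A *m l = c *: l) ->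
  (1%:M - P) *m (A + dP) *m P = 0.
Proof.
move=> PE wl e [c h]; apply: endo_ext => v.
have Pl u : P *m u = (ip w u / ip w l) *: l by rewrite PE lproj_vec.
have Pll : P *m l = l by rewrite Pl mulfV // scale1r.
have e2 : (A + dP) *m l = c *: l - P *m dl.
  have -> : c *: l = (dP *m l + P *m dl) + A *m l by rewrite e.
  by rewrite mulmxDl addrAC addrK addrC.
have Ql : (1%:M - P) *m l = 0 by rewrite mulmxBl mul1mx Pll subrr.
have QP u : (1%:M - P) *m (P *m u) = 0 by rewrite Pl -scalemxAr Ql scaler0.
by rewrite mul0mx -!mulmxA Pl -!scalemxAr e2 mulmxBr QP subr0 -scalemxAr Ql !scaler0.
Qed.

End GaugeField.

Lemma ev_init {F : numFieldType} {m} (N q : 'M[F]_m) lam :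
  ev (QFamily (- N - q) N q) lam = (lam - 1) *: N + (lam ^+ 2 - 1) *: q.
Proof. by rewrite /ev; mx_lin; ring. Qed.

(** At infinity each step adds a correction by a multiple of [adjm g P - P], which anticommutes with
    [rho]. It therefore moves [v] into the [-1] eigenspace of [rho], where [c2 f0] vanishes, so
    nothing reaches the coefficient of [lam]. *)
Lemma double_gauge_kill {F : numFieldType} {m} (g : 'M[F]_m) (gg : g *m g = 1%:M)
    (rho P1 P2 : 'M[F]_m) (f0 f1 f2 : qfamily) (b1 b2 : F) (v : 'cV[F]_m) :
  line_proj g rho 0 P1 0 -> line_proj g rho 0 P2 0 ->
  c2 f1 *m gauge g 1 P1 = gauge g 1 P1 *m c2 f0 ->
  c1 f1 *m gauge g 1 P1 + c2 f1 *m (b1 *: (adjm g P1 - P1)) =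
    gauge g 1 P1 *m c1 f0 + (b1 *: (adjm g P1 - P1)) *m c2 f0 ->
  c2 f2 *m gauge g (-1) P2 = gauge g (-1) P2 *m c2 f1 ->
  c1 f2 *m gauge g (-1) P2 + c2 f2 *m (b2 *: (adjm g P2 - P2)) =
    gauge g (-1) P2 *m c1 f1 + (b2 *: (adjm g P2 - P2)) *m c2 f1 ->
  c2 f0 *m rho = c2 f0 -> rho *m v = v -> c1 f0 *m v = 0 -> c2 f0 *m v = 0 ->
  c1 f2 *m (gauge g (-1) P2 *m gauge g 1 P1 *m v) = 0.
Proof.
move=> lp1 lp2; rewrite !gauge1 !mulmx1 !mul1mx => -> h1 h2 h3 qr rv Nv qv.
have odd (w : 'cV[F]_m) : rho *m w = - w -> c2 f0 *m w = 0.
  move=> h; have : c2 f0 *m w = - (c2 f0 *m w) by rewrite -{1}qr -mulmxA h mulmxN.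
  by move/eqP; rewrite -subr_eq0 opprK -mulr2n -scaler_nat scaler_eq0 pnatr_eq0 => /eqP.
have oddn (P : 'M[F]_m) b : line_proj g rho 0 P 0 ->
    rho *m ((b *: (adjm g P - P)) *m v) = - ((b *: (adjm g P - P)) *m v).
  move=> lp; rewrite -{1}rv (lp_refl lp); mx_expand.
  by rewrite (lp_rr lp) mul1mx -[_ *m rho *m rho]mulmxA (lp_rr lp) mulmx1; mx_lin; ring.
have c1v : c1 f1 *m v = 0.
  have := congr1 (fun A => A *m v) h1.
  rewrite mulmxDl -mulmxA (odd _ (oddn _ _ lp1)) addr0 => ->.
  by rewrite mulmxDl -mulmxA qv mulmx0 Nv addr0.
set G := gauge g (-1) P2 in h2 h3 *.
have n1 : -1 != 0 :> F by rewrite oppr_eq0 oner_eq0.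
have GG : G *m G = 1%:M.
  by rewrite /G -{2}[-1 : F]invrN1 (gaugeV gg lp2).
have rG : rho *m G = G *m rho.
  have := refl_gauge lp2 (-1); rewrite invrN1 => e.
  by rewrite /G -{2}e -!mulmxA (lp_rr lp2) mulmx1.
clearbody G.
have := congr1 (fun A => A *m v) h3.
set n2 := b2 *: _; have on2 := oddn _ b2 lp2; rewrite -/n2 in on2; clearbody n2.
have z : c2 f2 *m (n2 *m v) = 0.
  have -> : n2 *m v = G *m (G *m (n2 *m v)) by rewrite mulmxA GG mul1mx.
  rewrite mulmxA h2 -mulmxA odd ?mulmx0 //.
  by rewrite mulmxA rG -mulmxA on2 mulmxN.
rewrite !mulmxDl -!mulmxA z qv !mulmx0 c1v mulmx0 !addr0.
by [].
Qed.

(** * The dressed loop of connections *)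

Section Transform.
Local Opaque ip der zet zetb dz cproj NZ.
Context {R : realType} {n : nat}.
Local Notation C := R[i].
Local Notation I := ('i%C : C).
Local Notation pt := (R * R)%type.
Local Notation vec := 'cV[C]_n.+2.
Local Notation endo := 'M[C]_n.+2.
Local Notation g := (@gram R n).
Implicit Types (x y X Y : pt) (u v w : vec).
Context (U : set pt) (oU : open U) (Lam : pt -> set vec) (q : pt -> pt -> endo).
Hypothesis cw : constrained_willmore U Lam q.
Let sf : is_surface U Lam. Proof. by case: cw. Qed.
Local Notation J := (fun y => cpx U Lam y e1).
Local Notation P := (cproj U Lam).
Local Notation rho := (fun y => reflP (cproj U Lam y)).
Context (alpha : C) (t : pt -> vec).
Local Notation ah := (ahat alpha).

(** Explicit forms for a section [t] spanning [L]: [btP1] projects onto the conjugate of [L],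
    [bt_t2] spans [Ltilde], [btP2] projects onto it, and [rr], [rrinf] are [r] at finite values and
    at infinity. *)
Definition btP1 x : endo := lproj (conjm (t x)) (rho x *m conjm (t x)).
Definition bt_t2 x : vec := gauge g (1 * moebius ah alpha) (btP1 x) *m t x.
Definition btP2 x : endo := lproj (bt_t2 x) (rho x *m bt_t2 x).
Definition rr lam x : endo :=
  gauge g (-1 * moebius alpha lam) (btP2 x) *m gauge g (1 * moebius ah lam) (btP1 x).
Definition rrinf x : endo := gauge g (-1) (btP2 x) *m gauge g 1 (btP1 x).
Definition rexc : seq C := [:: alpha; - alpha; ah; - ah].

Hypotheses (a0 : alpha != 0) (a1 : `|alpha| != 1) (Ct : smooth U t).
Hypothesis t_null : forall x, U x -> ip (t x) (t x) = 0.
Hypothesis t_orth : forall x, U x -> ip (t x) (rho x *m t x) != 0.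
Hypothesis t_par : forall x X, U x -> exists c, dlq U Lam q alpha t x X = c *: t x.
Hypothesis t2_orth : forall x, U x -> ip (bt_t2 x) (rho x *m bt_t2 x) != 0.

Let CP : smooth U P := smooth_cproj oU sf.
Let Crho : smooth U rho := smooth_reflP oU CP.
Let rho2 x : U x -> rho x *m rho x = 1%:M.
Proof. by move=> Ux; apply: reflP2; exact: cproj_idem. Qed.
Let rho_adj x : U x -> adjm g (rho x) = rho x.
Proof. by move=> Ux; apply: adjm_reflP; exact: cproj_adj. Qed.

Lemma refl_real x : U x -> conjm (rho x) = rho x.
Proof. by move=> Ux; rewrite /reflP !conjmD !conjmN conjmD conjmN conjm1 (cproj_real oU sf Ux). Qed.

Lemma dlqZ_ev lam (u : pt -> vec) x : U x ->
  dlqZ U Lam q lam u x = dz J u x + ev (family0 U Lam q x) lam *m u x.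
Proof.
by move=> Ux; rewrite /dlqZ (fz_Nform oU cw Ux) /family0 ev_init.
Qed.

Lemma dlqZ_line lam (u : pt -> vec) x : U x -> smooth U u ->
  (forall X, exists c, dlq U Lam q lam u x X = c *: u x) ->
  exists c, dz J u x + ev (family0 U Lam q x) lam *m u x = c *: u x.
Proof.
move=> Ux Cu h; rewrite -dlqZ_ev // -(dlq_dz oU sf lam Ux (cw_lin cw Ux) Cu).
have [c ->] := h e1; have [c' ->] := h (cpx U Lam x e1).
by exists (c - I * c'); rewrite scalerBl -[in RHS]scalerA.
Qed.

Let ct x := conjm (t x).
Let Cct : smooth U ct := smooth_conjm oU Ct.

Let ct_null x : U x -> ip (ct x) (ct x) = 0.
Proof. by move=> Ux; rewrite ip_conj t_null // rmorph0. Qed.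

Let ct_orth x : U x -> ip (ct x) (rho x *m ct x) != 0.
Proof.
move=> Ux; have -> : rho x *m ct x = conjm (rho x *m t x) by rewrite conjmM refl_real.
by rewrite ip_conj conjc_eq0; exact: t_orth.
Qed.

Let ct_par x X : U x -> exists c, dlq U Lam q ah ct x X = c *: ct x.
Proof.
move=> Ux; rewrite -(dlq_conj oU sf alpha X Ux (fun X => cw_real cw X Ux) Ct).
by have [c ->] := t_par X Ux; exists (conjc c); rewrite conjmZ.
Qed.

Lemma btP1_facts : smooth U btP1 /\
  forall x, U x -> line_proj g (rho x) (dz J rho x) (btP1 x) (dz J btP1 x).
Proof. exact: (line_proj_dz oU J Crho Cct rho2 rho_adj ct_null ct_orth). Qed.

Let CP1 : smooth U btP1 := btP1_facts.1.
Let lp1 x (Ux : U x) : line_proj g (rho x) (dz J rho x) (btP1 x) (dz J btP1 x) := btP1_facts.2 x Ux.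

Lemma lproj_dz (l w : pt -> vec) (Q : pt -> endo) x : U x -> smooth U l -> smooth U Q ->
  (forall y, U y -> Q y = lproj (l y) (w y)) -> (forall y, U y -> ip (w y) (l y) != 0) ->
  dz J Q x *m l x + Q x *m dz J l x = dz J l x.
Proof.
move=> Ux Cl CQ QE wl; rewrite -(dzM oU J Ux CQ Cl); apply: (dz_ext oU J Ux) => y Uy.
by rewrite QE // lproj_vec mulfV ?wl // scale1r.
Qed.

Let par1 x : U x -> (1%:M - btP1 x) *m (ev (family0 U Lam q x) ah + dz J btP1 x) *m btP1 x = 0.
Proof.
move=> Ux; have wl y : U y -> ip (rho y *m ct y) (ct y) != 0 by move=> Uy; rewrite ipC ct_orth.
have e : dz J btP1 x *m ct x + btP1 x *m dz J ct x = dz J ct x.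
  by apply: (@lproj_dz ct (fun y => rho y *m ct y)).
exact: (parallel_block (w := rho x *m ct x) erefl (wl _ Ux) e (dlqZ_line Ux Cct (fun X => ct_par X Ux))).
Qed.

Lemma smooth_t2 : smooth U bt_t2.
Proof. by apply: smoothM => //; exact: smooth_gauge. Qed.

Let aa : C := 1 * moebius ah alpha.
Let aa0 : aa != 0.
Proof. by have [_ h1 h2 _ _] := ahat_facts a0 a1; rewrite /aa mul1r moebius_neq0. Qed.

Lemma t2_null x : U x -> ip (bt_t2 x) (bt_t2 x) = 0.
Proof. by move=> Ux; rewrite (gauge_isometry _ _ (lp_static (lp1 Ux)) aa0) t_null. Qed.

Lemma btP2_facts : smooth U btP2 /\
  forall x, U x -> line_proj g (rho x) (dz J rho x) (btP2 x) (dz J btP2 x).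
Proof. exact: (line_proj_dz oU J Crho smooth_t2 rho2 rho_adj t2_null t2_orth). Qed.

Let CP2 : smooth U btP2 := btP2_facts.1.
Let lp2 x (Ux : U x) : line_proj g (rho x) (dz J rho x) (btP2 x) (dz J btP2 x) := btP2_facts.2 x Ux.

Let intertwine_line (G dG A B : endo) (l dl : vec) : dG = G *m A - B *m G ->
  (exists c, dl + A *m l = c *: l) -> exists c, (dG *m l + G *m dl) + B *m (G *m l) = c *: (G *m l).
Proof.
move=> -> [c h]; exists c; rewrite scalemxAr -h mulmxDr mulmxBl !mulmxA.
by move: (G *m A *m l) (B *m G *m l) (G *m dl) => a b d; mx_lin; ring.
Qed.

Let intertwine_mul (G dG G' dG' A B B' : endo) : dG = G *m A - B *m G -> dG' = G' *m B - B' *m G' ->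
  dG' *m G + G' *m dG = G' *m G *m A - B' *m (G' *m G).
Proof.
by move=> -> ->; mx_expand; move: (G' *m B *m G) (B' *m G' *m G) (G' *m G *m A) => a b c; mx_lin; ring.
Qed.

(** Two uses of [gauge_step], at [ahat] with sign 1 and at [alpha] with sign -1. The second is
    allowed because the first gauge carries [L], parallel at [alpha], to [Ltilde], parallel at
    [alpha] for the gauged family. *)
Lemma transform_family x : U x -> exists f : qfamily,
  [/\ admissible g (rho x) (dz J rho x) f,
    forall lam, lam \notin rexc ->
      dz J (rr lam) x = rr lam x *m ev (family0 U Lam q x) lam - ev f lam *m rr lam x,
    c2 f *m rrinf x = rrinf x *m c2 (family0 U Lam q x) &
    forall v, P x *m v = v -> NZ P J x *m v = 0 -> fz U Lam q x *m v = 0 ->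
      c1 f *m (rrinf x *m v) = 0].
Proof.
move=> Ux; have [h0 n1 n2 n3 _] := ahat_facts a0 a1.
have ad0 := family0_admissible oU cw Ux.
have [f1 [ad1 dG1 c2E1 c1E1]] := gauge_step gramT gram2 (lp1 Ux) ad0 (mulr1 1) (par1 Ux).
have dG1' lam : lam != ah -> lam != - ah ->
    dz J (fun y => gauge g (1 * moebius ah lam) (btP1 y)) x =
    gauge g (1 * moebius ah lam) (btP1 x) *m ev (family0 U Lam q x) lam -
    ev f1 lam *m gauge g (1 * moebius ah lam) (btP1 x).
  by move=> l1 l2; rewrite (dz_gauge oU J _ Ux CP1); exact: dG1.
have CG1 a : smooth U (fun y => gauge g a (btP1 y)) by exact: smooth_gauge.
have CG2 a : smooth U (fun y => gauge g a (btP2 y)) by exact: smooth_gauge.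
have par2 : (1%:M - btP2 x) *m (ev f1 alpha + dz J btP2 x) *m btP2 x = 0.
  have wl y : U y -> ip (rho y *m bt_t2 y) (bt_t2 y) != 0 by move=> Uy; rewrite ipC t2_orth.
  have e : dz J btP2 x *m bt_t2 x + btP2 x *m dz J bt_t2 x = dz J bt_t2 x.
    by apply: (@lproj_dz bt_t2 (fun y => rho y *m bt_t2 y)) => //; exact: smooth_t2.
  apply: (parallel_block (w := rho x *m bt_t2 x) erefl (wl _ Ux) e).
  have -> : dz J bt_t2 x = dz J (fun y => gauge g aa (btP1 y)) x *m t x + gauge g aa (btP1 x) *m dz J t x.
    exact: (dzM oU J Ux (CG1 aa) Ct).
  exact: (intertwine_line (dG1' alpha n1 n2) (dlqZ_line Ux Ct (fun X => t_par X Ux))).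
have e1 : (-1) * (-1) = 1 :> C by rewrite mulrNN mulr1.
have [f2 [ad2 dG2 c2E2 c1E2]] := gauge_step gramT gram2 (lp2 Ux) ad1 e1 par2.
exists f2; split=> //.
- move=> lam; rewrite /rexc !inE !negb_or => /and4P[l1 l2 l3 l4].
  have -> : dz J (rr lam) x = dz J (fun y => gauge g (-1 * moebius alpha lam) (btP2 y)) x *m gauge g (1 * moebius ah lam) (btP1 x)
     + gauge g (-1 * moebius alpha lam) (btP2 x) *m dz J (fun y => gauge g (1 * moebius ah lam) (btP1 y)) x.
    exact: (dzM oU J Ux (CG2 _) (CG1 _)).
  apply: (intertwine_mul (dG1' lam l3 l4)).
  by rewrite (dz_gauge oU J _ Ux CP2); exact: dG2.
- by rewrite /rrinf mulmxA c2E2 -mulmxA c2E1 mulmxA.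
- move=> v Pv Nv qv; have [_ qr] := fz_q_refl oU cw Ux.
  have rv : rho x *m v = v by rewrite /reflP mulmxBl mulmxBl mul1mx Pv subrr subr0.
  exact: (double_gauge_kill gram2 (lp_static (lp1 Ux)) (lp_static (lp2 Ux)) c2E1 c1E1 c2E2 c1E2 qr rv Nv qv).
Qed.

End Transform.

(** * The further gauge independent of lam, algebraically *)

Section HatAlgebra.
Local Opaque ip der zet zetb dz cproj NZ.
Context {F : numFieldType} {m : nat}.
Local Notation M := 'M[F]_m.
Implicit Types (r rV dr drV rho drho : M) (f : qfamily (F := F) (m := m)).
Context (r1 rV dr1 drV : M).
Hypotheses (rVr : rV *m r1 = 1%:M) (rrV : r1 *m rV = 1%:M) (drVr : drV *m r1 + rV *m dr1 = 0).

Definition conj_family f : qfamily :=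
  QFamily (rV *m c0 f *m r1 + rV *m dr1) (rV *m c1 f *m r1) (rV *m c2 f *m r1).

Lemma ev_conj_family f lam : ev (conj_family f) lam = rV *m ev f lam *m r1 + rV *m dr1.
Proof. by rewrite /ev /=; mx_expand; mx_lin; ring. Qed.

Lemma drV_eq : drV = - (rV *m dr1 *m rV).
Proof.
by apply/eqP; rewrite -subr_eq0 opprK -[drV]mulmx1 -rrV mulmxA -mulmxDl drVr mul0mx.
Qed.

Lemma conj_family_intertwine f (fa : qfamily) r dr lam : dr = r *m ev fa lam - ev f lam *m r ->
  drV *m r + rV *m dr = (rV *m r) *m ev fa lam - ev (conj_family f) lam *m (rV *m r).
Proof.
move=> ->; rewrite ev_conj_family drV_eq; mx_expand.
have e (A : M) : A *m r1 *m rV = A by rewrite -mulmxA rrV mulmx1.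
by rewrite !e; mx_lin; ring.
Qed.

Lemma conj_family_1 f : dr1 = - (ev f 1 *m r1) -> c0 (conj_family f) = - c1 (conj_family f) - c2 (conj_family f).
Proof.
move=> h; have : ev (conj_family f) 1 = 0.
  by rewrite ev_conj_family h mulmxN mulmxA subrr.
rewrite /ev expr1n !scale1r => /eqP; rewrite -addrA addr_eq0 opprD => /eqP ->.
by [].
Qed.

(** Differentiating the conjugated reflection isolates the part of [ev f 1] that is odd under [rho],
    and by admissibility that is the coefficient of [lam]. Compare [NZ_half]. *)
Lemma conj_family_odd g rho drho f : dr1 = - (ev f 1 *m r1) ->
  admissible g rho drho f -> rho *m rho = 1%:M ->
  (drV *m rho *m r1 + rV *m drho *m r1 + rV *m rho *m dr1) *m (rV *m rho *m r1) =
  2 *: c1 (conj_family f).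
Proof.
move=> h0 ad rr; have e (A : M) : A *m r1 *m rV = A by rewrite -mulmxA rrV mulmx1.
have e' (A : M) : A *m rho *m rho = A by rewrite -mulmxA rr mulmx1.
have p0 := ad_par0 ad; have p1 := ad_par1 ad; have p2 := ad_par2 ad.
have h1 : drV = rV *m ev f 1 by rewrite drV_eq h0 mulmxN mulNmx opprK !mulmxA e.
have q0 : rho *m c0 f *m rho = c0 f + drho *m rho by rewrite -{2}p0 subrK.
transitivity (rV *m (ev f 1 *m rho *m rho + drho *m rho - rho *m ev f 1 *m rho) *m r1).
  rewrite h1 h0; mx_expand; rewrite !e; mx_lin; ring.
rewrite e' /ev !scale1r expr1n scale1r /=.
have -> : rho *m (c0 f + c1 f + c2 f) *m rho = c0 f + drho *m rho - c1 f + c2 f.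
  by rewrite !mulmxDr !mulmxDl q0 p1 p2.
by mx_expand; mx_lin; ring.
Qed.

Lemma conj_family_c2 f (ri q0 : M) : c2 f *m ri = ri *m q0 ->
  c2 (conj_family f) *m (rV *m ri) = (rV *m ri) *m q0.
Proof. by move=> h; rewrite /= !mulmxA -(mulmxA (rV *m _)) rrV mulmx1 -mulmxA h mulmxA. Qed.

Lemma conj_family_kill {k} (A ri : M) (v : 'M[F]_(m, k)) : A *m (ri *m v) = 0 ->
  (rV *m A *m r1) *m (rV *m ri *m v) = 0.
Proof. by move=> h; rewrite !mulmxA -(mulmxA (rV *m _)) rrV mulmx1 -!mulmxA h mulmx0. Qed.

Lemma conj_family_half g rho drho f (N rh D : M) : dr1 = - (ev f 1 *m r1) ->
  admissible g rho drho f -> rho *m rho = 1%:M ->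
  N = 2^-1 *: (D *m rh) -> rh = rV *m rho *m r1 ->
  D = drV *m rho *m r1 + rV *m drho *m r1 + rV *m rho *m dr1 -> c1 (conj_family f) = N.
Proof.
move=> h ad rr -> -> ->; rewrite (conj_family_odd h ad rr) scalerA mulVf ?scale1r //.
by rewrite pnatr_eq0.
Qed.

Lemma family_at_1 f (A N q dr : M) : dr = A *m ev (QFamily (- N - q) N q) 1 - ev f 1 *m A ->
  dr = - (ev f 1 *m A).
Proof. by rewrite ev_init expr1n subrr !scale0r addr0 mulmx0 sub0r. Qed.

End HatAlgebra.

Section ConjugateBy.
Local Opaque ip der zet zetb dz cproj NZ.
Context {F : fieldType} {m : nat} (V r : 'M[F]_m).
Hypotheses (rV : r *m V = 1%:M).

Lemma conj_mul {k} (A : 'M[F]_m) (B : 'M[F]_(m, k)) : (V *m A *m r) *m (V *m B) = V *m (A *m B).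
Proof. by rewrite !mulmxA -(mulmxA (V *m A)) rV mulmx1. Qed.

Lemma conj_idem (A : 'M[F]_m) : A *m A = A -> (V *m A *m r) *m (V *m A *m r) = V *m A *m r.
Proof. by move=> AA; have := conj_mul A (A *m r); rewrite !mulmxA -(mulmxA V A A) AA. Qed.

Lemma conj_one_sub (A : 'M[F]_m) : 1%:M - V *m A *m r = V *m (1%:M - A) *m r.
Proof. by rewrite mulmxBr mulmxBl mulmx1 (mulmx1C rV). Qed.

End ConjugateBy.

(** * The conjugated projection and the family of the transform *)

Section Hat.
Local Opaque ip der zet zetb dz cproj NZ.
Context {R : realType} {n : nat}.
Local Notation C := R[i].
Local Notation I := ('i%C : C).
Local Notation pt := (R * R)%type.
Local Notation vec := 'cV[C]_n.+2.
Local Notation endo := 'M[C]_n.+2.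
Local Notation g := (@gram R n).
Implicit Types (x y X Y : pt) (u v w : vec).
Context (U : set pt) (oU : open U) (Lam : pt -> set vec) (q : pt -> pt -> endo).
Hypothesis cw : constrained_willmore U Lam q.
Let sf : is_surface U Lam. Proof. by case: cw. Qed.
Local Notation J := (fun y => cpx U Lam y e1).
Local Notation P := (cproj U Lam).
Local Notation rho := (fun y => reflP (cproj U Lam y)).
Context (alpha : C) (t : pt -> vec).
Local Notation ah := (ahat alpha).
Hypotheses (a0 : alpha != 0) (a1 : `|alpha| != 1) (Ct : smooth U t).
Hypothesis t_null : forall x, U x -> ip (t x) (t x) = 0.
Hypothesis t_orth : forall x, U x -> ip (t x) (rho x *m t x) != 0.
Hypothesis t_par : forall x X, U x -> exists c, dlq U Lam q alpha t x X = c *: t x.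
Hypothesis t2_orth : forall x, U x ->
  ip (bt_t2 U Lam alpha t x) (rho x *m bt_t2 U Lam alpha t x) != 0.

Local Notation P1 := (btP1 U Lam t).
Local Notation P2 := (btP2 U Lam alpha t).
Local Notation r := (rr U Lam alpha t).
Local Notation rinf := (rrinf U Lam alpha t).
Local Notation exc := (rexc alpha).

Let CP : smooth U P := smooth_cproj oU sf.
Let Crho : smooth U rho := smooth_reflP oU CP.
Let rho2 x : U x -> rho x *m rho x = 1%:M.
Proof. by move=> Ux; apply: reflP2; exact: cproj_idem. Qed.
Let P1f := btP1_facts oU cw Ct t_null t_orth.
Let P2f := btP2_facts oU cw a0 a1 Ct t_null t_orth t2_orth.
Let lp1 x (Ux : U x) := lp_static (P1f.2 x Ux).
Let lp2 x (Ux : U x) := lp_static (P2f.2 x Ux).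

Lemma one_notin_exc : 1 \notin exc.
Proof. by have [] := ahat_facts a0 a1. Qed.

Lemma zero_notin_exc : 0 \notin exc.
Proof.
have [h0 _ _ _ _] := ahat_facts a0 a1.
by rewrite /rexc !inE ![0 == _]eq_sym !oppr_eq0 (negbTE a0) (negbTE h0).
Qed.

Let moeb lam : lam \notin exc -> -1 * moebius alpha lam != 0 /\ 1 * moebius ah lam != 0.
Proof.
rewrite /rexc !inE !negb_or => /and4P[l1 l2 l3 l4].
by rewrite mulN1r mul1r oppr_eq0 !moebius_neq0.
Qed.

Let orth_mul (A B : endo) : adjm g A *m A = 1%:M -> adjm g B *m B = 1%:M ->
  adjm g (A *m B) *m (A *m B) = 1%:M.
Proof. by move=> h1 h2; rewrite (adjmM gram2) mulmxA -(mulmxA (adjm g B)) h1 mulmx1. Qed.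

Let gauge_orth (Q : endo) x a : U x -> line_proj g (rho x) 0 Q 0 -> a != 0 ->
  adjm g (gauge g a Q) *m gauge g a Q = 1%:M.
Proof. by move=> Ux lp h; rewrite (adjm_gauge gramT gram2) (gaugeVl gram2 lp). Qed.

Lemma rr_orth lam x : lam \notin exc -> U x -> adjm g (r lam x) *m r lam x = 1%:M.
Proof.
move=> /moeb[h1 h2] Ux; apply: orth_mul.
  exact: gauge_orth Ux (lp2 Ux) h1.
exact: gauge_orth Ux (lp1 Ux) h2.
Qed.

Lemma rrinf_orth x : U x -> adjm g (rinf x) *m rinf x = 1%:M.
Proof.
move=> Ux; apply: orth_mul.
  by apply: gauge_orth Ux (lp2 Ux) _; rewrite oppr_eq0 oner_eq0.
by apply: gauge_orth Ux (lp1 Ux) _; rewrite oner_eq0.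
Qed.

Lemma smooth_rr lam : smooth U (r lam).
Proof. by apply: smoothM => //; apply: smooth_gauge => //; [case: P2f|case: P1f]. Qed.

Lemma smooth_rrinf : smooth U rinf.
Proof. by apply: smoothM => //; apply: smooth_gauge => //; [case: P2f|case: P1f]. Qed.

Let r1 := r 1.
Definition rrV x : endo := invmx (rr U Lam alpha t 1 x).
Definition RR lam x : endo := rrV x *m rr U Lam alpha t lam x.
Definition RRinf x : endo := rrV x *m rrinf U Lam alpha t x.
Definition hatP x : endo := rrV x *m P x *m rr U Lam alpha t 1 x.

Lemma rr1_unit x : U x -> r 1 x \in unitmx.
Proof. by move=> Ux; case/mulmx1_unit: (rr_orth one_notin_exc Ux). Qed.

Lemma rrV_adj x : U x -> rrV x = adjm g (r 1 x).
Proof.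
move=> Ux; have u := rr1_unit Ux.
by rewrite -[LHS]mul1mx -(rr_orth one_notin_exc Ux) -mulmxA mulmxV // mulmx1.
Qed.

Lemma rrV_l x : U x -> rrV x *m r 1 x = 1%:M.
Proof. by move=> Ux; rewrite mulVmx // rr1_unit. Qed.

Lemma rrV_r x : U x -> r 1 x *m rrV x = 1%:M.
Proof. by move=> Ux; rewrite mulmxV // rr1_unit. Qed.

Lemma smooth_rrV : smooth U rrV.
Proof. exact: (smooth_invmx oU rr1_unit (smooth_rr 1)). Qed.

Lemma smooth_RR lam : smooth U (RR lam).
Proof. exact: (smoothM oU smooth_rrV (smooth_rr lam)). Qed.

Lemma smooth_RRinf : smooth U RRinf.
Proof. exact: (smoothM oU smooth_rrV smooth_rrinf). Qed.

Lemma smooth_hatP : smooth U hatP.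
Proof.
exact: (smoothM oU (smoothM oU smooth_rrV CP) (smooth_rr 1)).
Qed.

Lemma rrV_orth x : U x -> adjm g (rrV x) *m rrV x = 1%:M.
Proof. by move=> Ux; rewrite rrV_adj // (adjmK gramT gram2) -rrV_adj // rrV_r. Qed.

Lemma RR_orth lam x : lam \notin exc -> U x -> adjm g (RR lam x) *m RR lam x = 1%:M.
Proof. by move=> h Ux; apply: orth_mul; [exact: rrV_orth|exact: rr_orth]. Qed.

Lemma RRinf_orth x : U x -> adjm g (RRinf x) *m RRinf x = 1%:M.
Proof. by move=> Ux; apply: orth_mul; [exact: rrV_orth|exact: rrinf_orth]. Qed.

Lemma RR1 x : U x -> RR 1 x = 1%:M.
Proof. exact: rrV_l. Qed.

Lemma hatP_idem x : U x -> hatP x *m hatP x = hatP x.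
Proof.
by move=> Ux; exact: (conj_idem (rrV_r Ux) (cproj_idem oU sf Ux)).
Qed.

Lemma hatP_adj x : U x -> adjm g (hatP x) = hatP x.
Proof.
move=> Ux; have alg (A B D : endo) : adjm g A = D -> adjm g D = A -> adjm g B = B ->
    adjm g (A *m B *m D) = A *m B *m D.
  by move=> h1 h2 h3; rewrite !(adjmM gram2) h1 h2 h3 mulmxA.
by apply: alg; rewrite ?rrV_adj ?(adjmK gramT gram2) // cproj_adj.
Qed.

Lemma hatP_refl x : U x -> reflP (hatP x) = rrV x *m rho x *m r 1 x.
Proof.
by move=> Ux; rewrite /reflP (conj_one_sub (rrV_r Ux)) -mulmxBl -mulmxBr.
Qed.

Local Opaque rr rrinf rrV fz gauge.

(** This is [transform_family] conjugated by [r(1)^-1]. The new family vanishes at [lam = 1] because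
    [RR 1] is the identity, its middle coefficient is the form [N] of [hatP] by parity, and the last
    two clauses come from the expansion at infinity. *)
Lemma hat_family x : U x -> exists f : qfamily,
  [/\ forall lam, lam \notin exc ->
      dz J (RR lam) x = RR lam x *m ev (family0 U Lam q x) lam - ev f lam *m RR lam x,
    c1 f = NZ hatP J x /\ c0 f = - c1 f - c2 f,
    c2 f *m RRinf x = RRinf x *m fz U Lam q x &
    forall v, L01 U Lam x v -> c1 f *m (RRinf x *m v) = 0 /\ c2 f *m (RRinf x *m v) = 0].
Proof.
move=> Ux.
have [f [ad dr c2E kill]] := transform_family oU cw a0 a1 Ct t_null t_orth t_par t2_orth Ux.
have mulmx_eq0 (A B : endo) (v : vec) : B *m v = 0 -> A *m (B *m v) = 0 by move=> ->; exact: mulmx0.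
have addmulE (A B D E : endo) : (A + B) *m D + E = A *m D + B *m D + E by rewrite mulmxDl.
have Vr := rrV_l Ux; have rV := rrV_r Ux.
have CV := smooth_rrV; have C1 := smooth_rr 1.
have drV : dz J rrV x *m r 1 x + rrV x *m dz J (r 1) x = 0.
  transitivity (dz J (fun y => rrV y *m r 1 y) x); first exact: esym (dzM oU J Ux CV C1).
  have e := dz_ext oU J Ux rrV_l; rewrite {}e; exact: dz_cst.
have dr1 : dz J (r 1) x = - (ev f 1 *m r 1 x) := family_at_1 (dr _ one_notin_exc).
exists (conj_family (r 1 x) (rrV x) (dz J (r 1) x) f); split.
- move=> lam hlam.
  have e : dz J (RR lam) x = dz J rrV x *m r lam x + rrV x *m dz J (r lam) x.
    exact: (dzM oU J Ux CV (smooth_rr lam)).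
  rewrite {}e; exact: (conj_family_intertwine rV drV (dr _ hlam)).
- split; last exact: conj_family_1 dr1.
  have CVr : smooth U (fun y => rrV y *m rho y) by exact: (smoothM oU CV Crho).
  apply: (conj_family_half rV drV dr1 ad (rho2 Ux)
    (NZ_half oU smooth_hatP hatP_idem J Ux) (hatP_refl Ux)).
  apply: (etrans (dz_ext oU J Ux hatP_refl)).
  apply: (etrans (dzM oU J Ux CVr C1)).
  exact: (etrans (congr1 (fun D => D *m r 1 x + _) (dzM oU J Ux CV Crho)) (addmulE _ _ _ _)).
- exact: conj_family_c2 c2E.
- move=> v Lv; have [Nv qv] := L01_kill oU cw Ux Lv.
  have Pv : P x *m v = v.
    have [c [c' ->]] := L01_span oU sf Ux Lv; have [Ps _ _] := cproj_fix oU sf Ux.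
    by have [_ Pz] := cproj_zet oU sf Ux; rewrite mulmxDr -!scalemxAr Ps Pz.
  split; first exact: (conj_family_kill rV (kill v Pv Nv qv)).
  apply: (conj_family_kill rV); rewrite mulmxA c2E -mulmxA; exact: mulmx_eq0.
Qed.

End Hat.

(** * Complex conjugates of simple factors *)

Section Conjugation.
Local Opaque ip der zet zetb dz cproj NZ.
Context {R : realType} {n : nat}.
Local Notation C := R[i].
Local Notation vec := 'cV[C]_n.+2.
Local Notation endo := 'M[C]_n.+2.
Local Notation g := (@gram R n).

Lemma conjm_gauge a (Q : endo) : conjm (gauge g a Q) = gauge g (conjc a) (conjm Q).
Proof.
by rewrite /gauge conjmD conjmD !conjmZ conjm1 conjm_adj !rmorphB !rmorph1 fmorphV.
Qed.

Lemma conjm_gauge_mul {k} a (Q : endo) (A : 'M[C]_(_, k)) :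
  conjm (gauge g a Q *m A) = gauge g (conjc a) (conjm Q) *m conjm A.
Proof. by rewrite conjmM conjm_gauge. Qed.

Local Opaque gauge.

Lemma conj_mulmx (A B D : endo) : D *m D = 1%:M -> D *m (A *m B) *m D = (D *m A *m D) *m (D *m B *m D).
Proof. by move=> h; rewrite !mulmxA -(mulmxA (D *m A) D D) h mulmx1. Qed.

Lemma refl_gauge_mul (rho Q Q' : endo) a b : line_proj g rho 0 Q 0 -> line_proj g rho 0 Q' 0 ->
  rho *m (gauge g a Q *m gauge g b Q') *m rho = gauge g a^-1 Q *m gauge g b^-1 Q'.
Proof.
move=> lp lp'; apply: (etrans (conj_mulmx _ _ (lp_rr lp))).
exact: (congr2 mulmx (refl_gauge lp a) (refl_gauge lp' b)).
Qed.

Lemma conjm_lproj (l w : vec) : conjm (lproj l w) = lproj (conjm l) (conjm w).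
Proof. by rewrite /lproj conjmZ !conjmM conjmT conjm_gram fmorphV ip_conj. Qed.

Lemma conjm_lproj_refl (u : vec) (A : endo) : conjm A = A ->
  conjm (lproj (conjm u) (A *m conjm u)) = lproj u (A *m u).
Proof. by move=> h; rewrite conjm_lproj conjmM h !conjmK. Qed.

(** The sign is the one distinguishing [pfacm] from [pfac], so conjugation exchanges the two kinds
    of factors along with [alpha] and [ahat]. *)
Lemma conj_moebius (a l : C) : a != 0 -> l != 0 ->
  conjc (moebius a l) = - moebius (conjc a)^-1 (conjc l)^-1.
Proof.
move=> h1 h2; have c1 : conjc a != 0 by rewrite conjc_eq0.
have c2 : conjc l != 0 by rewrite conjc_eq0.
rewrite /moebius rmorphM fmorphV rmorphB rmorphD /=.
move: (conjc a) (conjc l) c1 c2 => b m b0 m0.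
have -> : m^-1 - b^-1 = - (m - b) / (m * b) by field; rewrite b0 m0.
have -> : m^-1 + b^-1 = (m + b) / (m * b) by field; rewrite b0 m0.
by rewrite invf_div; move: (m + b)^-1 => w; field; rewrite b0 m0.
Qed.

Lemma lproj_map (G : endo) (l l' w w' : vec) : G *m l = l' -> ip w' l' != 0 ->
  (1%:M - lproj l' w') *m G *m lproj l w = 0.
Proof.
move=> h wl; apply: endo_ext => v.
have z : (1%:M - lproj l' w') *m l' = 0.
  by rewrite mulmxBl mul1mx lproj_vec mulfV // scale1r subrr.
by rewrite mul0mx -!mulmxA lproj_vec -!scalemxAr h z scaler0.
Qed.

End Conjugation.

(** * Reality of the dressed loop *)

Section Reality.
Local Opaque ip der zet zetb dz cproj NZ.
Local Opaque lproj.
Context {R : realType} {n : nat}.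
Local Notation C := R[i].
Local Notation I := ('i%C : C).
Local Notation pt := (R * R)%type.
Local Notation vec := 'cV[C]_n.+2.
Local Notation endo := 'M[C]_n.+2.
Local Notation g := (@gram R n).
Implicit Types (x y X Y : pt) (u v w : vec).
Context (U : set pt) (oU : open U) (Lam : pt -> set vec) (q : pt -> pt -> endo).
Hypothesis cw : constrained_willmore U Lam q.
Let sf : is_surface U Lam. Proof. by case: cw. Qed.
Local Notation J := (fun y => cpx U Lam y e1).
Local Notation P := (cproj U Lam).
Local Notation rho := (fun y => reflP (cproj U Lam y)).
Context (alpha : C) (t : pt -> vec).
Local Notation ah := (ahat alpha).
Hypotheses (a0 : alpha != 0) (a1 : `|alpha| != 1) (Ct : smooth U t).
Hypothesis t_null : forall x, U x -> ip (t x) (t x) = 0.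
Hypothesis t_orth : forall x, U x -> ip (t x) (rho x *m t x) != 0.
Hypothesis t_par : forall x X, U x -> exists c, dlq U Lam q alpha t x X = c *: t x.
Hypothesis t2_orth : forall x, U x ->
  ip (bt_t2 U Lam alpha t x) (rho x *m bt_t2 U Lam alpha t x) != 0.

Local Notation P1 := (btP1 U Lam t).
Local Notation P2 := (btP2 U Lam alpha t).
Local Notation r := (rr U Lam alpha t).
Local Notation rinf := (rrinf U Lam alpha t).
Local Notation exc := (rexc alpha).
Let CP : smooth U P := smooth_cproj oU sf.
Let Crho : smooth U rho := smooth_reflP oU CP.
Let rho2 x : U x -> rho x *m rho x = 1%:M.
Proof. by move=> Ux; apply: reflP2; exact: cproj_idem. Qed.
Let rho_adj x : U x -> adjm g (rho x) = rho x.
Proof. by move=> Ux; apply: adjm_reflP; exact: cproj_adj. Qed.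
Let P1f := btP1_facts oU cw Ct t_null t_orth.
Let P2f := btP2_facts oU cw a0 a1 Ct t_null t_orth t2_orth.
Let lp1 x (Ux : U x) := lp_static (P1f.2 x Ux).
Let lp2 x (Ux : U x) := lp_static (P2f.2 x Ux).

Let ct x := conjm (t x).
Let Q0 x : endo := lproj (t x) (rho x *m t x).

Let rho_real x : U x -> conjm (rho x) = rho x.
Proof. exact: (refl_real oU cw). Qed.

Let conjP1 x : U x -> conjm (P1 x) = Q0 x.
Proof. by move=> Ux; exact: (conjm_lproj_refl _ (rho_real Ux)). Qed.

Let ah0 : ah != 0. Proof. by have [] := ahat_facts a0 a1. Qed.
Let conj_alpha : (conjc alpha)^-1 = ah. Proof. by []. Qed.
Let conj_ah : (conjc ah)^-1 = alpha.
Proof. by rewrite /ahat fmorphV invrK; exact: conjcK. Qed.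

Let moeb lam : lam \notin exc -> -1 * moebius alpha lam != 0 /\ 1 * moebius ah lam != 0.
Proof.
rewrite /rexc !inE !negb_or => /and4P[l1 l2 l3 l4].
by rewrite mulN1r mul1r oppr_eq0 !moebius_neq0.
Qed.

Lemma exc_conj lam : lam \notin exc -> (conjc lam)^-1 \notin exc.
Proof.
have e (b : C) : (conjc lam)^-1 = b -> lam = (conjc b)^-1.
  by move=> <-; rewrite fmorphV invrK; exact/esym/conjcK.
apply: contra; rewrite /rexc !inE => /or4P[] /eqP /e ->;
  by rewrite ?rmorphN ?invrN /= ?conj_ah ?conj_alpha eqxx ?orbT.
Qed.

Lemma exc_opp lam : lam \notin exc -> - lam \notin exc.
Proof.
apply: contra; rewrite /rexc !inE => /or4P[] /eqP h;
  by rewrite -[lam]opprK h ?opprK eqxx ?orbT.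
Qed.

Lemma rr_parity lam x : U x -> rho x *m r lam x *m rho x = r (- lam) x.
Proof.
move=> Ux; rewrite /rr !moebiusN.
have -> : -1 * (moebius alpha lam)^-1 = (-1 * moebius alpha lam)^-1 by rewrite !mulN1r invrN.
have -> : 1 * (moebius ah lam)^-1 = (1 * moebius ah lam)^-1 by rewrite !mul1r.
exact: (refl_gauge_mul _ _ (lp2 Ux) (lp1 Ux)).
Qed.

Let conj_t2 x : U x -> conjm (bt_t2 U Lam alpha t x) = gauge g (-1 * moebius alpha ah) (Q0 x) *m ct x.
Proof.
move=> Ux; rewrite /bt_t2 conjm_gauge_mul (conjP1 Ux).
by rewrite mul1r (conj_moebius ah0 a0) conj_ah conj_alpha mulN1r.
Qed.

Local Opaque btP2 btP1 bt_t2.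

(** The conjugate of [r(lam)] is a product of factors at the inverse conjugate of [lam], with the
    same poles as [r] but in the opposite order; [permutability] compares them. Infinity is
    conjugate to zero. *)
Lemma rr_conj x : U x -> exists K : endo,
  (forall lam, lam != 0 -> lam \notin exc -> r (conjc lam)^-1 x = K *m conjm (r lam x)) /\
  r 0 x = K *m conjm (rinf x).
Proof.
move=> Ux; have [h0 n1 n2 n3 _] := ahat_facts a0 a1.
have Q0lp : line_proj g (rho x) 0 (Q0 x) 0.
  exact: lproj_line_proj (rho2 Ux) (rho_adj Ux) (t_null Ux) (t_orth Ux).
have ct2_null : ip (conjm (bt_t2 U Lam alpha t x)) (conjm (bt_t2 U Lam alpha t x)) = 0.
  by rewrite ip_conj (t2_null oU cw a0 a1 Ct t_null t_orth Ux) rmorph0.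
have ct2_orth : ip (conjm (bt_t2 U Lam alpha t x)) (rho x *m conjm (bt_t2 U Lam alpha t x)) != 0.
  by rewrite -{1}(rho_real Ux) -conjmM ip_conj conjc_eq0 t2_orth.
have Pt'lp := lproj_line_proj (rho2 Ux) (rho_adj Ux) ct2_null ct2_orth.
have cPt : conjm (P2 x) = lproj (conjm (bt_t2 U Lam alpha t x)) (rho x *m conjm (bt_t2 U Lam alpha t x)).
  by rewrite conjm_lproj conjmM rho_real.
rewrite -cPt in Pt'lp.
have aa0 : 1 * moebius ah alpha != 0 by rewrite mul1r moebius_neq0.
have bb0 : -1 * moebius alpha ah != 0.
  rewrite mulN1r oppr_eq0 moebius_neq0 1?eq_sym //.
  by apply: contra n2 => /eqP e; rewrite -e opprK.
(* The four conditions of [permutability] hold because [bt_t2] is the image of [t] under the first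
   factor, and its conjugate the image of the conjugate of [t]. *)
have k1 : (1%:M - P2 x) *m gauge g (1 * moebius ah alpha) (P1 x) *m Q0 x = 0.
  by apply: lproj_map => //; rewrite ipC t2_orth.
have k2 : (1%:M - Q0 x) *m adjm g (gauge g (1 * moebius ah alpha) (P1 x)) *m P2 x = 0.
  apply: lproj_map; last by rewrite ipC t_orth.
  by rewrite (adjm_gauge gramT gram2) mulmxA (gaugeVl gram2 (lp1 Ux) aa0) mul1mx.
have k3 : (1%:M - conjm (P2 x)) *m gauge g (-1 * moebius alpha ah) (Q0 x) *m P1 x = 0.
  by rewrite cPt; apply: lproj_map; [rewrite conj_t2|rewrite ipC].
have k4 : (1%:M - P1 x) *m adjm g (gauge g (-1 * moebius alpha ah) (Q0 x)) *m conjm (P2 x) = 0.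
  rewrite cPt; apply: lproj_map.
    by rewrite conj_t2 // (adjm_gauge gramT gram2) mulmxA (gaugeVl gram2 Q0lp bb0) mul1mx.
  by rewrite ipC -{1}(rho_real Ux) -conjmM ip_conj conjc_eq0 t_orth.
have [K hK] := permutability gramT gram2 Q0lp (lp2 Ux) (lp1 Ux) Pt'lp n3 k1 k2 k3 k4.
have cr (a b a' b' : C) : conjc a = a' -> conjc b = b' ->
    gauge g a' (conjm (P2 x)) *m gauge g b' (Q0 x) = conjm (gauge g a (P2 x) *m gauge g b (P1 x)).
  move=> <- <-; apply: esym; apply: (etrans (conjm_gauge_mul _ _ _)).
  exact: (congr1 (mulmx _) (etrans (conjm_gauge _ _) (congr1 (gauge g _) (conjP1 Ux)))).
exists K; split.
  move=> lam l0 hl; apply: (etrans (hK _ (exc_conj hl))); apply: (congr1 (mulmx K)); apply: cr.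
    by rewrite mulN1r rmorphN /= (conj_moebius a0 l0) opprK mul1r.
  by rewrite mul1r (conj_moebius ah0 l0) conj_ah mulN1r.
have m0 (b : C) : b != 0 -> moebius b 0 = -1.
  by move=> b0; rewrite /moebius sub0r add0r mulNr mulfV.
apply: (etrans (hK _ (zero_notin_exc a0 a1))); apply: (congr1 (mulmx K)); apply: cr.
  by rewrite mul1r m0 // rmorphN rmorph1.
by rewrite m0 // mulrNN mulr1 rmorph1.
Qed.

Local Notation V := (rrV U Lam alpha t).

Let one_exc := one_notin_exc a0 a1.

Let Vr x (Ux : U x) : V x *m r 1 x = 1%:M :=
  rrV_l oU cw a0 a1 Ct t_null t_orth t2_orth Ux.
Let rV x (Ux : U x) : r 1 x *m V x = 1%:M :=
  rrV_r oU cw a0 a1 Ct t_null t_orth t2_orth Ux.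

Let conj_V x (Ux : U x) : conjm (V x) *m conjm (r 1 x) = 1%:M /\ conjm (r 1 x) *m conjm (V x) = 1%:M.
Proof.
have h1 := congr1 conjm (Vr Ux); have h2 := congr1 conjm (rV Ux).
move: (V x) (r 1 x) h1 h2 => A B h1 h2.
by rewrite -!conjmM h1 h2 conjm1.
Qed.

Let rr_conj1 x (Ux : U x) K : (forall lam, lam != 0 -> lam \notin exc -> r (conjc lam)^-1 x = K *m conjm (r lam x)) ->
  r 1 x = K *m conjm (r 1 x) /\ V x *m K = conjm (V x).
Proof.
move=> h; have := h 1 (oner_neq0 _) one_exc; rewrite rmorph1 invr1 => e.
split=> //; have [h1 h2] := conj_V Ux; have h3 := Vr Ux.
have alg (A B K' A' B' : endo) : A *m B = 1%:M -> B = K' *m B' -> B' *m A' = 1%:M -> A *m K' = A'.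
  by move=> k1 k2 k3; rewrite -[A *m K']mulmx1 -k3 mulmxA -(mulmxA A) -k2 k1 mul1mx.
exact: alg h3 e h2.
Qed.

(** The unknown [K] disappears: comparing at [lam = 1], [V x] times [K] is the conjugate of
    [V x]. *)
Lemma conj_RR lam x : lam != 0 -> lam \notin exc -> U x ->
  conjm (RR U Lam alpha t lam x) = RR U Lam alpha t (conjc lam)^-1 x.
Proof.
move=> l0 hl Ux; have [K [hK _]] := rr_conj Ux; have [_ VK] := rr_conj1 Ux hK.
apply: (etrans (conjmM _ _)); apply: (etrans (congr1 (fun A => A *m _) (esym VK))).
apply: (etrans (esym (mulmxA _ _ _))); exact: (congr1 (mulmx _) (esym (hK _ l0 hl))).
Qed.

Lemma conj_RRinf x : U x -> conjm (RRinf U Lam alpha t x) = RR U Lam alpha t 0 x.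
Proof.
move=> Ux; have [K [hK hK0]] := rr_conj Ux; have [_ VK] := rr_conj1 Ux hK.
apply: (etrans (conjmM _ _)); apply: (etrans (congr1 (fun A => A *m _) (esym VK))).
apply: (etrans (esym (mulmxA _ _ _))); exact: (congr1 (mulmx _) (esym hK0)).
Qed.

(** Comparing [rr_conj] at [1] and [-1] through parity shows that [K] commutes with [rho], hence
    with [P], and so cancels. *)
Lemma hatP_real x : U x -> conjm (hatP U Lam alpha t x) = hatP U Lam alpha t x.
Proof.
move=> Ux; have [K [hK _]] := rr_conj Ux; have [r1E VK] := rr_conj1 Ux hK.
have e1 := hK (-1); rewrite rmorphN rmorph1 invrN1 oppr_eq0 oner_eq0 in e1.
have {}e1 := e1 isT (exc_opp one_exc).
rewrite -(rr_parity 1 Ux) in e1.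
have cP := cproj_real oU sf Ux; have [_ cV] := conj_V Ux.
have alg (r1 c1 V1 V2 A B : endo) : r1 = K *m c1 -> V1 *m K = V2 -> B = A - (1%:M - A) ->
    B *m B = 1%:M -> c1 *m V2 = 1%:M -> B *m r1 *m B = K *m (B *m c1 *m B) ->
    V2 *m A *m c1 = V1 *m A *m r1.
  move=> k1 k2 k3 BB k4 k5.
  have KB : K *m B = B *m K.
    have : B *m r1 = K *m B *m c1.
      by rewrite -[LHS]mulmx1 -BB mulmxA k5 !mulmxA -(mulmxA (K *m B *m c1)) BB mulmx1.
    by rewrite k1 mulmxA => k6; rewrite -[K *m B]mulmx1 -k4 mulmxA -k6 -mulmxA k4 mulmx1.
  have KA : K *m A = A *m K.
    have AE : A = 2^-1 *: (B + 1%:M).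
      by rewrite k3; move: (1%:M) => E; mx_lin; field.
    by rewrite AE -scalemxAr -scalemxAl mulmxDr mulmxDl KB mulmx1 mul1mx.
  by rewrite k1 -k2 -(mulmxA V1 K) KA !mulmxA.
have r2 := rho2 Ux.
have rc : conjm (rho x *m r 1 x *m rho x) = rho x *m conjm (r 1 x) *m rho x.
  have rr := rho_real Ux; move: (r 1 x) (rho x) rr => A B rr.
  by rewrite !conjmM rr.
rewrite rc in e1.
apply: etrans (alg _ _ _ _ _ _ r1E VK (erefl (rho x)) r2 cV e1).
rewrite /hatP; clear -cP; move: (V x) (r 1 x) (P x) cP => A B D cP.
by rewrite !conjmM cP.
Qed.

End Reality.

(** * Equality of projections, and a criterion for the complex structure *)

Section RankFour.
Local Opaque ip der dz cproj NZ gauge rr rrinf rrV fz.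
Context {F : fieldType} {m : nat}.

Lemma idem_rank_eq (A B : 'M[F]_m) : B *m B = B -> A *m B = B -> B *m A = B -> \rank A = \rank B -> B = A.
Proof.
move=> BB AB BA rk; have sBA : (B <= A)%MS by apply/submxP; exists B.
have /submxP[D e] : (A <= B)%MS by rewrite -(mxrank_leqif_sup sBA) rk.
have : A *m B = A.
  by rewrite {1}e -mulmxA BB -e.
by rewrite AB.
Qed.

End RankFour.

Section ConformalDirection.
Local Opaque ip der dz cproj NZ gauge rr rrinf rrV fz.
Context {R : realType}.
Implicit Types E F G a j k : R.

(** The two equations say that [e1 - i (j e1 + k e2)] is null for the metric. This fixes
    [j e1 + k e2] up to sign, and [0 < k] chooses the orientation. *)
Lemma conformal_alg E F G a j k : 0 < E -> 0 < a -> a ^+ 2 = E * G - F ^+ 2 -> 0 < k ->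
  j * E + k * F = 0 -> j ^+ 2 * E + 2 * j * k * F + k ^+ 2 * G = E ->
  j = - F / a /\ k = E / a.
Proof.
move=> E0 a0 a2 k0 h1 h2.
have En : E != 0 by rewrite gt_eqF.
have an : a != 0 by rewrite gt_eqF.
have jE : j = - (k * F) / E by apply: (mulIf En); rewrite divfK //; apply/eqP; rewrite -addr_eq0 h1.
have ka : (k * a) ^+ 2 = E ^+ 2.
  rewrite exprMn a2 -[E ^+ 2]/(E * E) -{3}h2 jE; field; exact: En.
have {}ka : k * a = E.
  by apply/eqP; rewrite -(eqrXn2 (n := 2)) ?ka // ?mulr_ge0 // ltW.
have kE : k = E / a by rewrite -ka mulfK.
split=> //; rewrite jE kE; field; by rewrite En an.
Qed.

End ConformalDirection.

(** * Conformal structure and central sphere congruence of the transform *)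

Section HatSurface.
Local Opaque ip der dz cproj NZ gauge rr rrinf rrV fz.
Context {R : realType} {n : nat}.
Local Notation C := R[i].
Local Notation I := ('i%C : C).
Local Notation pt := (R * R)%type.
Local Notation vec := 'cV[C]_n.+2.
Local Notation endo := 'M[C]_n.+2.
Local Notation g := (@gram R n).
Implicit Types (x y X Y : pt) (u v w : vec).
Context (U : set pt) (oU : open U) (Lam : pt -> set vec) (q : pt -> pt -> endo).
Hypothesis cw : constrained_willmore U Lam q.
Let sf : is_surface U Lam. Proof. by case: cw. Qed.
Local Notation J := (fun y => cpx U Lam y e1).
Local Notation P := (cproj U Lam).
Local Notation rho := (fun y => reflP (cproj U Lam y)).
Context (alpha : C) (t : pt -> vec).
Local Notation ah := (ahat alpha).
Hypotheses (a0 : alpha != 0) (a1 : `|alpha| != 1) (Ct : smooth U t).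
Hypothesis t_null : forall x, U x -> ip (t x) (t x) = 0.
Hypothesis t_orth : forall x, U x -> ip (t x) (rho x *m t x) != 0.
Hypothesis t_par : forall x X, U x -> exists c, dlq U Lam q alpha t x X = c *: t x.
Hypothesis t2_orth : forall x, U x ->
  ip (bt_t2 U Lam alpha t x) (rho x *m bt_t2 U Lam alpha t x) != 0.

Local Notation P1 := (btP1 U Lam t).
Local Notation P2 := (btP2 U Lam alpha t).
Local Notation r := (rr U Lam alpha t).
Local Notation rinf := (rrinf U Lam alpha t).
Local Notation exc := (rexc alpha).
Let CP : smooth U P := smooth_cproj oU sf.
Let Crho : smooth U rho := smooth_reflP oU CP.
Let rho2 x : U x -> rho x *m rho x = 1%:M.
Proof. by move=> Ux; apply: reflP2; exact: cproj_idem. Qed.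
Let rho_adj x : U x -> adjm g (rho x) = rho x.
Proof. by move=> Ux; apply: adjm_reflP; exact: cproj_adj. Qed.
Let P1f := btP1_facts oU cw Ct t_null t_orth.
Let P2f := btP2_facts oU cw a0 a1 Ct t_null t_orth t2_orth.
Let lp1 x (Ux : U x) := lp_static (P1f.2 x Ux).
Let lp2 x (Ux : U x) := lp_static (P2f.2 x Ux).
Local Notation s := (Defs.lift U Lam).
Local Notation V := (rrV U Lam alpha t).
Local Notation RR := (RR U Lam alpha t).
Local Notation RRinf := (RRinf U Lam alpha t).
Local Notation hatP := (hatP U Lam alpha t).
Context (LamH : pt -> set vec) (sfh : is_surface U LamH).
Hypothesis LamH10 : forall x v, U x -> LamH x v -> exists2 u, L10 U Lam x u & v = RR 0 x *m u.
Hypothesis LamH01 : forall x v, U x -> LamH x v -> exists2 u, L01 U Lam x u & v = RRinf x *m u.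
Local Notation sh := (Defs.lift U LamH).

Let Csh : smooth U sh := smooth_lift sfh.
Let sh_mem x : U x -> LamH x (sh x).
Proof. by move=> Ux; rewrite (lift_line sfh Ux); exists 1; rewrite ?scale1r. Qed.

Let z_exc := zero_notin_exc a0 a1.
Let CR lam : smooth U (RR lam) := smooth_RR oU cw a0 a1 Ct t_null t_orth t2_orth lam.
Let R0o x (Ux : U x) : adjm g (RR 0 x) *m RR 0 x = 1%:M :=
  RR_orth oU cw a0 a1 Ct t_null t_orth t2_orth z_exc Ux.

Let hatP_RR0 x : U x -> hatP x *m RR 0 x = RR 0 x *m P x.
Proof.
move=> Ux; have rV := rrV_r oU cw a0 a1 Ct t_null t_orth t2_orth Ux.
have := rr_parity oU cw a0 a1 Ct t_null t_orth t2_orth 0 Ux; rewrite oppr0 => e.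
have alg (A B r0 rh : endo) : B = A - (1%:M - A) -> B *m B = 1%:M -> B *m r0 *m B = r0 -> A *m r0 = r0 *m A.
  move=> k1 BB k2.
  have AE : A = 2^-1 *: (B + 1%:M) by rewrite k1; move: (1%:M) => D; mx_lin; field.
  have KB : B *m r0 = r0 *m B by rewrite -[LHS]mulmx1 -BB mulmxA k2.
  by rewrite AE -scalemxAr -scalemxAl mulmxDl mulmxDr KB mulmx1 mul1mx.
have PR := alg (P x) (rho x) (r 0 x) 0 erefl (rho2 Ux) e.
exact: (etrans (conj_mul rV (P x) (r 0 x)) (etrans (congr1 (mulmx (V x)) PR) (mulmxA _ _ _))).
Qed.

(** The new lift pulled back by the orthogonal [RR 0]; a section of the old (1,0) osculating
    plane. *)
Let u0 x : vec := adjm g (RR 0 x) *m sh x.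
Let Cu0 : smooth U u0.
Proof. exact: (smoothM oU (smooth_adj oU (CR 0)) Csh). Qed.

Let u0_facts x : U x -> L10 U Lam x (u0 x) /\ RR 0 x *m u0 x = sh x.
Proof.
move=> Ux; have [u Lu e] := LamH10 Ux (sh_mem Ux).
have -> : u0 x = u by rewrite /u0 e mulmxA R0o // mul1mx.
by [].
Qed.

Lemma T10_sub x v w c : U x -> T10 U Lam x v -> w = v - c *: s x -> T10 U Lam x w.
Proof.
move=> Ux [h1 h2 h3] ->; have [Ps _ _] := cproj_fix oU sf Ux.
have [z1 _ _ _ _] := zet_ip oU sf Ux; have z0 := lift_null sf Ux.
split; first by rewrite mulmxBr -scalemxAr Ps h1.
  by rewrite ipDl ipNl ipZl h2 z0 mulr0 subr0.
by rewrite ipDl ipNl ipZl h3 z1 mulr0 subr0.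
Qed.

Let dz_alg (D0 R0 F0 Fh N Q : endo) (u dR sv : vec) : D0 = R0 *m F0 - Fh *m R0 ->
  F0 = - N - Q -> R0 *m u = sv -> Fh *m sv = 0 -> D0 *m u + R0 *m dR = R0 *m (dR - N *m u - Q *m u).
Proof.
move=> -> -> <-; rewrite mulmxA => h.
by rewrite mulmxBl h subr0; mx_expand; mx_lin; ring.
Qed.

(** At [lam = 0] the gauge relation compares [d - N - q] before and after. The new [N] and [q] kill
    the lift, since it lies in the image under [RRinf] of the (0,1) plane; the old connection
    preserves the (1,0) plane by [T10_dz] and [L10_q]. *)
Lemma dz_hat_lift x : U x -> exists2 w, T10 U Lam x w & dz J sh x = RR 0 x *m w.
Proof.
move=> Ux; have [f [dR [c1E c0E] c2E kill]] :=
  hat_family oU cw a0 a1 Ct t_null t_orth t_par t2_orth Ux.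
have [Lu Ru] := u0_facts Ux; have [v Lv shE] := LamH01 Ux (sh_mem Ux).
have [k1 k2] := kill v Lv; rewrite -shE in k1 k2.
have k0 : ev f 0 *m sh x = 0.
  have -> : ev f 0 = - c1 f - c2 f by rewrite /ev c0E expr0n /= !scale0r !addr0.
  by rewrite mulmxBl mulNmx k1 k2 subr0 oppr0.
have F0E : ev (family0 U Lam q x) 0 = - NZ P J x - fz U Lam q x.
  by rewrite /ev /= expr0n /= !scale0r !addr0.
exists (dz J u0 x - NZ P J x *m u0 x - fz U Lam q x *m u0 x).
  have [c qE] := L10_q oU cw Ux Lu.
  apply: (T10_sub (v := dz J u0 x - NZ P J x *m u0 x) (c := c) Ux); last by rewrite qE.
  apply: (T10_dz oU sf Ux Cu0) => y Uy; apply: (L10_T10 oU sf Uy).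
  by have [] := u0_facts Uy.
apply: etrans (dz_alg (dz J u0 x) (dR 0 z_exc) F0E Ru k0).
rewrite -(dzM oU J Ux (CR 0) Cu0); apply: (dz_ext oU J Ux) => y Uy.
by have [_ ->] := u0_facts Uy.
Qed.

Let real_eq0 (a b : R) : a%:C%C + I * b%:C%C = 0 :> C -> a = 0 /\ b = 0.
Proof.
move=> h; have h1 := congr1 (@complex.Re R) h; have h2 := congr1 (@complex.Im R) h.
split; first by rewrite -[RHS]h1 /=; ring.
by rewrite -[RHS]h2 /=; ring.
Qed.

Let isotropic_alg (u v : vec) (E F G j k : R) :
  ip u u = E%:C%C -> ip u v = F%:C%C -> ip v v = G%:C%C ->
  let b := j%:C%C *: u + k%:C%C *: v in
  ip (u - I *: b) (u - I *: b) = 0 ->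
  j * E + k * F = 0 /\ j ^+ 2 * E + 2 * j * k * F + k ^+ 2 * G = E.
Proof.
move=> uu uv vv b.
have bb : ip b b = (j ^+ 2 * E + 2 * j * k * F + k ^+ 2 * G)%:C%C.
  rewrite /b !ipDl !ipZl !ipDr !ipZr [ip v u]ipC uu uv vv.
  rewrite !(rmorphD, rmorphM, rmorphXn, rmorph_nat) /=.
  by move: (E%:C%C) (F%:C%C) (G%:C%C) (j%:C%C) (k%:C%C) => ? ? ? ? ?; ring.
have ub : ip u b = (j * E + k * F)%:C%C by rewrite /b ipDr !ipZr uu uv rmorphD !rmorphM.
clearbody b; have -> : ip (u - I *: b) (u - I *: b) = ip u u - 2 * (I * ip u b) + I * I * ip b b.
  by rewrite !ipDl !ipNl !ipZl !ipDr !ipNr !ipZr [ip b u]ipC; clear; move: (I) => i; ring.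
rewrite II uu bb ub; move: (j * E + k * F) (j ^+ 2 * E + 2 * j * k * F + k ^+ 2 * G) => p p'.
have -> : E%:C%C - 2 * (I * p%:C%C) + -1 * p'%:C%C = (E - p')%:C%C + I * (- (2 * p))%:C%C :> C.
  rewrite rmorphB rmorphN rmorphM rmorph_nat /=.
  by move: (I) (E%:C%C) (p%:C%C) (p'%:C%C) => ? ? ? ?; ring.
case/real_eq0 => h1 h2; split; last by apply/eqP; rewrite eq_sym -subr_eq0 h1.
by move/eqP: h2; rewrite oppr_eq0 mulf_eq0 pnatr_eq0 => /eqP.
Qed.

Let derJ x : U x -> der sh x (J x) = (j1 U Lam x)%:C%C *: der sh x e1 + (j2 U Lam x)%:C%C *: der sh x e2.
Proof.
move=> Ux; apply: (etrans (congr1 (der sh x) (cpx_e1 U Lam x))).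
exact: (der_lin oU Ux _ _ _ _ Csh).
Qed.

Let dz_sh x : dz J sh x = der sh x e1 - I *: der sh x (J x).
Proof. by []. Qed.

Let iso_alg (R0 : endo) (c c' : C) (w v z : vec) : adjm g R0 *m R0 = 1%:M ->
  w = c *: v + c' *: z -> ip w v = 0 -> ip w z = 0 -> ip (R0 *m w) (R0 *m w) = 0.
Proof.
move=> h1 wE h2 h3; rewrite ip_adjl mulmxA h1 mul1mx {2}wE ipDr !ipZr h2 h3.
by rewrite !mulr0 addr0.
Qed.

(** By [dz_hat_lift] the (1,0) derivative of the new lift is the orthogonal image of a null vector,
    so the old complex structure is conformal for the new metric; positivity of [j2] settles the
    orientation. *)
Lemma hat_cpx x : U x -> cpx U LamH x e1 = J x.
Proof.
move=> Ux; have [w hw e] := dz_hat_lift Ux.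
have [c [c' wE]] : exists c c', w = c *: s x + c' *: zet U Lam x.
  by case: hw => h1 h2 h3; exact: (cproj_T10 oU sf Ux h1 h2 h3).
have iso : ip (dz J sh x) (dz J sh x) = 0.
  rewrite e; case: hw => _ h2 h3; exact: iso_alg (R0o Ux) wE h2 h3.
have e3 := etrans (dz_sh x) (congr1 (fun z => der sh x e1 - I *: z) (derJ Ux)).
have {}iso := etrans (esym (congr2 ip e3 e3)) iso.
have [i1 i2] := isotropic_alg (ip_der oU sfh Ux _ _) (ip_der oU sfh Ux _ _) (ip_der oU sfh Ux _ _) iso.
have j0 : 0 < j2 U Lam x by rewrite divr_gt0 ?(gE_pos oU sf Ux) ?(area_pos oU sf Ux).
have [k1 k2] := conformal_alg (gE_pos oU sfh Ux) (area_pos oU sfh Ux) (area_sqr oU sfh Ux) j0 i1 i2.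
by rewrite !cpx_e1 k1 k2.
Qed.

Let comb_fix (M : endo) (A B : vec) : M *m (A - I *: B) = A - I *: B -> M *m (A + I *: B) = A + I *: B ->
  M *m A = A /\ M *m B = B.
Proof.
move=> h1 h2; have hA : M *m A = A.
  have AE : A = 2^-1 *: ((A - I *: B) + (A + I *: B)) by move: (I) => i; mx_lin; field.
  by rewrite AE -scalemxAr mulmxDr h1 h2.
split=> //; have BE : B = - I *: (A + I *: B - A).
  by rewrite addrC addKr scalerA mulNr II opprK scale1r.
by rewrite BE -scalemxAr mulmxBr h2 hA.
Qed.

Let conj_dz_sh x : U x -> conjm (dz J sh x) = der sh x e1 + I *: der sh x (J x).
Proof.
move=> Ux; rewrite dz_sh; have := der_lift_real oU sfh Ux e1; have := der_lift_real oU sfh Ux (J x).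
move: (der sh x e1) (der sh x (J x)) => A B hB hA.
by rewrite conjmD conjmN conjmZ hA hB -scaleNr; congr (_ + _ *: _); apply: complex_ext => /=; ring.
Qed.

Let fix_map (H R0 A : endo) (u v : vec) : H *m R0 = R0 *m A -> A *m u = u -> R0 *m u = v -> H *m v = v.
Proof. by move=> h1 h2 <-; rewrite mulmxA h1 -mulmxA h2. Qed.

Let fix_conj (H : endo) (v : vec) : conjm H = H -> H *m v = v -> H *m conjm v = conjm v.
Proof. by move=> h1 h2; rewrite -{1}h1 -conjmM h2. Qed.

Let lin_fix (H : endo) (a b : C) (v w : vec) : H *m v = v -> H *m w = w ->
  H *m (a *: v + b *: w) = a *: v + b *: w.
Proof. by move=> h1 h2; rewrite mulmxDr -!scalemxAr h1 h2. Qed.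

(** [RR 0] intertwines [P] with [hatP], which handles the lift and its (1,0) derivative; reality of
    [hatP] handles the conjugate derivative. *)
Lemma hat_fix x : U x -> hatP x *m sh x = sh x /\ forall X, hatP x *m der sh x X = der sh x X.
Proof.
move=> Ux; have [w [hw _ _] e] := dz_hat_lift Ux.
split.
  have [/(L10_T10 oU sf Ux)[Pu _ _] Ru] := u0_facts Ux.
  exact: fix_map (hatP_RR0 Ux) Pu Ru.
have h1 : hatP x *m dz J sh x = dz J sh x := fix_map (hatP_RR0 Ux) hw (esym e).
have h2 := fix_conj (hatP_real oU cw a0 a1 Ct t_null t_orth t2_orth Ux) h1.
have e4 := conj_dz_sh Ux.
have {}h2 := etrans (etrans (congr1 (mulmx _) (esym e4)) h2) e4.
have [f1 f2] := comb_fix h1 h2.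
move=> X; have [a [b ->]] := cpx_basis oU sf X Ux.
by rewrite (der_lin oU Ux _ _ _ _ Csh); exact: lin_fix.
Qed.

Lemma T10_conj x w : U x -> T10 U Lam x w -> L01 U Lam x (conjm w).
Proof.
move=> Ux [h1 h2 h3]; have [c [c' ->]] := cproj_T10 oU sf Ux h1 h2 h3.
have -> : conjm (c *: s x + c' *: zet U Lam x) = conjc c *: s x + conjc c' *: zetb U Lam x.
  rewrite conjmD !conjmZ (lift_real sf Ux); congr (_ + _ *: _).
  rewrite /zet /zetb; have := der_lift_real oU sf Ux e1; have := der_lift_real oU sf Ux (J x).
  move: (der s x e1) (der s x (J x)) => A B hB hA.
  by rewrite conjmD conjmN conjmZ hA hB -scaleNr; congr (_ + _ *: _); apply: complex_ext => /=; ring.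
have [X EX] := span_L01 oU sf (conjc c') Ux.
exists (conjc c *: s x), (conjc c' *: zetb U Lam x); split=> //; last by exists X.
by rewrite (lift_line sf Ux); exists (conjc c).
Qed.

Let fix_of_compl (H : endo) (v : vec) : (1%:M - H) *m v = 0 -> H *m v = v.
Proof. by rewrite mulmxBl mul1mx => /eqP; rewrite subr_eq0 => /eqP <-. Qed.

(** [NN_trace] read backwards: the new [zetb] is the image under [RRinf] of an old vector of type
    (0,1), so [N] of [hatP] kills it and the normal part of the Laplacian is zero. *)
Lemma hat_lap x : U x -> hatP x *m lap U LamH x = lap U LamH x.
Proof.
move=> Ux; have CH := smooth_hatP oU cw a0 a1 Ct t_null t_orth t2_orth.
have HH y (Uy : U y) := hatP_idem oU cw a0 a1 Ct t_null t_orth t2_orth Uy.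
have fixH y X (Uy : U y) := (hat_fix Uy).2 X.
have tr := NN_trace oU sfh CH HH fixH Ux.
have [w hw e] := dz_hat_lift Ux; have [f [_ [c1E _] _ kill]] :=
  hat_family oU cw a0 a1 Ct t_null t_orth t_par t2_orth Ux.
have eZ : zetb U LamH x = der sh x e1 + I *: der sh x (J x) :=
  congr1 (fun X => der sh x e1 + I *: der sh x X) (hat_cpx Ux).
have cR : conjm (RR 0 x) = RRinf x.
  have := congr1 conjm (conj_RRinf oU cw a0 a1 Ct t_null t_orth t2_orth Ux).
  by rewrite conjmK => ->.
have {}eZ : zetb U LamH x = RRinf x *m conjm w.
  apply: (etrans eZ); apply: (etrans (esym (conj_dz_sh Ux))); apply: (etrans (congr1 conjm e)).
  exact: (etrans (conjmM _ _) (congr1 (fun A => A *m conjm w) cR)).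
have [h _] := kill _ (T10_conj Ux hw); rewrite c1E in h.
have z : (NN hatP x e1 - I *: NN hatP x (cpx U LamH x e1)) *m zetb U LamH x = 0.
  apply: etrans (congr1 (fun X => (NN hatP x e1 - I *: NN hatP x X) *m _) (hat_cpx Ux)) _.
  apply: etrans (congr1 (mulmx _) eZ) _; exact: h.
have {}z := etrans (esym tr) z.
have E0 : (gE U LamH x)%:C%C != 0.
  apply/eqP => h'; have := gE_pos oU sfh Ux; have := congr1 (@complex.Re R) h'.
  by rewrite /= => ->; rewrite ltxx.
apply: fix_of_compl; move/eqP: z; rewrite scaler_eq0 (negbTE E0) => /eqP; exact.
Qed.

Let lin_fix4 (H : endo) (a b c d : C) (u v w z : vec) : H *m u = u -> H *m v = v -> H *m w = w ->
  H *m z = z -> H *m (a *: u + b *: v + c *: w + d *: z) = a *: u + b *: v + c *: w + d *: z.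
Proof. by move=> h1 h2 h3 h4; rewrite !mulmxDr -!scalemxAr h1 h2 h3 h4. Qed.

(** The range of the left side lies in that of the right by the three preceding facts; both are
    self-adjoint idempotents of rank four. *)
Lemma hat_cproj x : U x -> cproj U LamH x = hatP x.
Proof.
move=> Ux; have [f0 f1] := hat_fix Ux; have f3 := hat_lap Ux.
have HC : hatP x *m cproj U LamH x = cproj U LamH x.
  apply: endo_ext => v; apply: (etrans (esym (mulmxA _ _ _))).
  have /(cproj_mem oU sfh Ux)[c0 [c1 [c2 [c3 ->]]]] : cproj U LamH x *m (cproj U LamH x *m v) = cproj U LamH x *m v.
    by apply: (etrans (mulmxA _ _ _)); rewrite (cproj_idem oU sfh Ux).
  have := lin_fix4 c0 c1 c2 c3 f0 (f1 e1) (f1 e2) f3; exact.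
have CH : cproj U LamH x *m hatP x = cproj U LamH x.
  have := congr1 (adjm g) HC; rewrite (adjmM gram2) cproj_adj.
  by rewrite (hatP_adj oU cw a0 a1 Ct t_null t_orth t2_orth Ux).
apply: (idem_rank_eq (cproj_idem oU sfh Ux) HC CH).
rewrite (cproj_rank oU sfh Ux) -(cproj_rank oU sf Ux) /hatP.
have u := rr1_unit oU cw a0 a1 Ct t_null t_orth t2_orth Ux.
rewrite mxrankMfree ?row_free_unit //.
by rewrite eqmxMfull // row_full_unit unitmx_inv.
Qed.

End HatSurface.

(** * The transformed multiplier and the connection of the transform *)

Section HatForm.
Context {R : realType} {n : nat}.
Local Notation C := R[i].
Local Notation I := ('i%C : C).
Local Notation pt := (R * R)%type.
Local Notation vec := 'cV[C]_n.+2.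
Local Notation endo := 'M[C]_n.+2.
Local Notation g := (@gram R n).
Implicit Types (x y X Y : pt) (u v w : vec).
Context (U : set pt) (oU : open U) (Lam : pt -> set vec) (q : pt -> pt -> endo).
Hypothesis cw : constrained_willmore U Lam q.
Let sf : is_surface U Lam. Proof. by case: cw. Qed.
Local Notation J := (fun y => cpx U Lam y e1).
Local Notation P := (cproj U Lam).
Local Notation rho := (fun y => reflP (cproj U Lam y)).
Context (alpha : C) (t : pt -> vec).
Local Notation ah := (ahat alpha).
Hypotheses (a0 : alpha != 0) (a1 : `|alpha| != 1) (Ct : smooth U t).
Hypothesis t_null : forall x, U x -> ip (t x) (t x) = 0.
Hypothesis t_orth : forall x, U x -> ip (t x) (rho x *m t x) != 0.
Hypothesis t_par : forall x X, U x -> exists c, dlq U Lam q alpha t x X = c *: t x.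
Hypothesis t2_orth : forall x, U x ->
  ip (bt_t2 U Lam alpha t x) (rho x *m bt_t2 U Lam alpha t x) != 0.

Local Notation P1 := (btP1 U Lam t).
Local Notation P2 := (btP2 U Lam alpha t).
Local Notation r := (rr U Lam alpha t).
Local Notation rinf := (rrinf U Lam alpha t).
Local Notation exc := (rexc alpha).
Let CP : smooth U P := smooth_cproj oU sf.
Let Crho : smooth U rho := smooth_reflP oU CP.
Let rho2 x : U x -> rho x *m rho x = 1%:M.
Proof. by move=> Ux; apply: reflP2; exact: cproj_idem. Qed.
Let rho_adj x : U x -> adjm g (rho x) = rho x.
Proof. by move=> Ux; apply: adjm_reflP; exact: cproj_adj. Qed.
Let P1f := btP1_facts oU cw Ct t_null t_orth.
Let P2f := btP2_facts oU cw a0 a1 Ct t_null t_orth t2_orth.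
Let lp1 x (Ux : U x) := lp_static (P1f.2 x Ux).
Let lp2 x (Ux : U x) := lp_static (P2f.2 x Ux).
Local Opaque ip der dz NZ gauge rr rrinf rrV.
Local Notation RR := (RR U Lam alpha t).
Local Notation RRinf := (RRinf U Lam alpha t).
Local Notation hatP := (hatP U Lam alpha t).
Local Notation V := (rrV U Lam alpha t).
Context (LamH : pt -> set vec) (sfh : is_surface U LamH).
Hypothesis LamH10 : forall x v, U x -> LamH x v -> exists2 u, L10 U Lam x u & v = RR 0 x *m u.
Hypothesis LamH01 : forall x v, U x -> LamH x v -> exists2 u, L01 U Lam x u & v = RRinf x *m u.
Context (om : pt -> pt -> endo).
Hypothesis omE : forall x X, U x -> om x X =
  V x *m (rinf x *m tp10 U Lam q x X *m invmx (rinf x) +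
          r 0 x *m tp01 U Lam q x X *m invmx (r 0 x)) *m r 1 x.

Let hcpx x (Ux : U x) : cpx U LamH x e1 = J x :=
  hat_cpx oU cw a0 a1 Ct t_null t_orth t_par t2_orth sfh LamH10 LamH01 Ux.
Let hcproj x (Ux : U x) : cproj U LamH x = hatP x :=
  hat_cproj oU cw a0 a1 Ct t_null t_orth t_par t2_orth sfh LamH10 LamH01 Ux.

Let Winf x := invmx (rinf x) *m r 1 x.
Let W0 x := invmx (r 0 x) *m r 1 x.

Let om_split x X (Ux : U x) : om x X = RRinf x *m tp10 U Lam q x X *m Winf x + RR 0 x *m tp01 U Lam q x X *m W0 x.
Proof.
rewrite (omE X Ux) /RRinf /RR /Winf /W0.
move: (V x) (rinf x) (r 0 x) (r 1 x) (tp10 _ _ _ _ _) (tp01 _ _ _ _ _) => A B D E T T'.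
by rewrite mulmxDr mulmxDl !mulmxA.
Qed.

Let inv_alg (A B D : endo) : A *m D = 1%:M -> B \in unitmx -> (A *m B) *m (invmx B *m D) = 1%:M.
Proof. by move=> h u; rewrite mulmxA -(mulmxA A) mulmxV // mulmx1. Qed.

Let Vr x (Ux : U x) : V x *m r 1 x = 1%:M := rrV_l oU cw a0 a1 Ct t_null t_orth t2_orth Ux.

Let RRinfW x (Ux : U x) : RRinf x *m Winf x = 1%:M.
Proof.
apply: inv_alg (Vr Ux) _.
by case/mulmx1_unit: (rrinf_orth oU cw a0 a1 Ct t_null t_orth t2_orth Ux).
Qed.

Let RR0W x (Ux : U x) : RR 0 x *m W0 x = 1%:M.
Proof.
apply: inv_alg (Vr Ux) _.
by case/mulmx1_unit: (rr_orth oU cw a0 a1 Ct t_null t_orth t2_orth (zero_notin_exc a0 a1) Ux).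
Qed.

Lemma hatq_lin x : U x -> formlin om x.
Proof.
move=> Ux a b X Y; rewrite !om_split //; have [l1 l2] := tp_lin U Lam (cw_lin cw Ux).
rewrite l1 l2; clear; move: (RRinf x) (RR 0 x) (Winf x) (W0 x) => A B D E.
move: (tp10 _ _ _ _ _) (tp10 _ _ _ _ _) (tp01 _ _ _ _ _) (tp01 _ _ _ _ _) => T1 T2 T3 T4.
by mx_expand; mx_lin; ring.
Qed.

(** Conjugation exchanges [RRinf] with [RR 0] as well as the two types of [q], hence the two
    summands of [om]. *)
Lemma hatq_real x X : U x -> conjm (om x X) = om x X.
Proof.
move=> Ux; rewrite om_split //.
have [k1 k2] := tp_conj (cw_real cw X Ux) (cw_real cw (cpx U Lam x X) Ux).
have c0 := conj_RRinf oU cw a0 a1 Ct t_null t_orth t2_orth Ux.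
have w1 := RRinfW Ux; have w2 := RR0W Ux.
move: (RRinf x) (RR 0 x) (Winf x) (W0 x) (tp10 _ _ _ _ _) (tp01 _ _ _ _ _) c0 w1 w2 k1 k2.
move=> A B D E T T' c0 w1 w2 k1 k2.
have c0' : conjm B = A by rewrite -c0 conjmK.
have uniq_inv (M N N' : endo) : M *m N = 1%:M -> M *m N' = 1%:M -> N = N'.
  by move=> h1 h2; rewrite -[N]mul1mx -(mulmx1C h2) -mulmxA h1 mulmx1.
have cD : conjm D = E.
  by apply: (@uniq_inv B) => //; rewrite -c0 -conjmM w1 conjm1.
have cE : conjm E = D by rewrite -cD conjmK.
by rewrite conjmD !conjmM c0 c0' k1 k2 cD cE addrC.
Qed.

Let fz_alg (A B D E T1 T2 T3 T4 Z : endo) : T1 - I *: T2 = Z -> T3 - I *: T4 = 0 ->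
  A *m T1 *m D + B *m T3 *m E - I *: (A *m T2 *m D + B *m T4 *m E) = A *m Z *m D.
Proof.
move=> <- h; have -> : T3 = I *: T4 by apply/eqP; rewrite -subr_eq0 h.
by clear; move: (I) => i; mx_expand; mx_lin; ring.
Qed.

Let hatq_fz x (Ux : U x) : fz U LamH om x = RRinf x *m fz U Lam q x *m Winf x.
Proof.
apply: (etrans (congr1 (fun X => om x e1 - I *: om x X) (hcpx Ux))).
rewrite !om_split //; have [k1 k2] := tp_z oU sf Ux (cw_lin cw Ux).
exact: fz_alg k1 k2.
Qed.

Let NN_hat x X (Ux : U x) : NN (cproj U LamH) x X = NN hatP x X.
Proof.
exact: (congr2 (fun A D => - (reflP A *m D)) (hcproj Ux) (der_ext oU Ux X (fun y Uy => hcproj Uy))).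
Qed.

Let hat_ev_alg (f : qfamily (F := C) (m := n.+2)) (N Q A D : endo) lam : c1 f = N -> c0 f = - c1 f - c2 f ->
  c2 f *m A = A *m Q -> A *m D = 1%:M ->
  (lam - 1) *: N + (lam ^+ 2 - 1) *: (A *m Q *m D) = ev f lam.
Proof.
move=> h1 h0 h2 h3; rewrite -h2 -mulmxA h3 mulmx1 -h1 /ev h0.
by move: (c1 f) (c2 f) => M M'; mx_lin; ring.
Qed.

(** The connection computed from the transform's own central sphere congruence and multiplier turns
    out to be the gauged one: [hat_cpx] and [hat_cproj] identify the direction and [N], and
    conjugation by [RRinf] identifies [q]. *)
Lemma hat_dlqZ x : U x -> exists f : qfamily,
  [/\ forall lam, lam \notin exc ->
      dz J (RR lam) x = RR lam x *m ev (family0 U Lam q x) lam - ev f lam *m RR lam x &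
    forall lam (w : pt -> vec), dlqZ U LamH om lam w x = dz J w x + ev f lam *m w x].
Proof.
move=> Ux; have [f [dR [c1E c0E] c2E _]] :=
  hat_family oU cw a0 a1 Ct t_null t_orth t_par t2_orth Ux.
exists f; split; first exact: dR.
move=> lam w; rewrite /dlqZ.
have eN : fz U LamH (Nform U LamH) x = NZ hatP J x.
  apply: (etrans (congr1 (fun X => Nform U LamH x e1 - I *: Nform U LamH x X) (hcpx Ux))).
  exact: (congr2 (fun A D => A - I *: D) (etrans (Nform_eq oU sfh _ Ux) (NN_hat _ Ux)) (etrans (Nform_eq oU sfh _ Ux) (NN_hat _ Ux))).
have eD : dz (fun y => cpx U LamH y e1) w x = dz J w x.
  exact: (congr1 (fun X => der w x e1 - I *: der w x X) (hcpx Ux)).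
apply: (congr2 (fun a (A : endo) => a + A *m w x) eD).
apply: (etrans (congr2 (fun A B : endo => (lam - 1) *: A + (lam ^+ 2 - 1) *: B) eN (hatq_fz Ux))).
exact: (hat_ev_alg lam c1E c0E c2E (RRinfW Ux)).
Qed.

Let intertwine_vec (dG G A B : endo) (l dl : vec) : dG = G *m A - B *m G ->
  dl + A *m l = 0 -> (dG *m l + G *m dl) + B *m (G *m l) = 0.
Proof.
move=> -> h; transitivity (G *m (dl + A *m l)); last by rewrite h mulmx0.
rewrite mulmxDr mulmxBl !mulmxA.
by move: (G *m A *m l) (B *m G *m l) (G *m dl) => a b d; mx_lin; ring.
Qed.

Lemma hat_dlqZ_gauge lam (u : pt -> vec) x : lam \notin exc -> U x -> smooth U u ->
  (forall X, dlq U Lam q lam u x X = 0) ->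
  dlqZ U LamH om lam (fun y => RR lam y *m u y) x = 0.
Proof.
move=> hl Ux Cu h; have [f [dR hE]] := hat_dlqZ Ux; rewrite hE.
have CR := smooth_RR oU cw a0 a1 Ct t_null t_orth t2_orth lam.
have e : dz J u x + ev (family0 U Lam q x) lam *m u x = 0.
  rewrite -(dlqZ_ev oU cw lam u Ux) -(dlq_dz oU sf lam Ux (cw_lin cw Ux) Cu) !h scaler0 subrr //.
apply: (etrans (congr1 (fun z => z + _) (dzM oU J Ux CR Cu))).
exact: intertwine_vec (dR _ hl) e.
Qed.

Lemma hat_csc x v : U x -> (csc U LamH x v <-> hatP x *m v = v) /\ (cscp U LamH x v <-> hatP x *m v = 0).
Proof.
by move=> Ux; rewrite -(hcproj Ux); split; [exact: csc_mem|exact: (piS_eq oU sfh Ux).2].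
Qed.

End HatForm.

(** * Polynomials with vector coefficients: products and exact division *)

Section VectorPolynomials.
Context {F : numFieldType} {m : nat}.
Local Notation vec := 'cV[F]_m.

Definition shift1 (b : nat -> vec) j : vec := if j is j'.+1 then b j' else 0.

(** The coefficients of [ev f] times the polynomial with coefficients [b] ([sum_qstep]). *)
Definition qstep (f : qfamily (F := F) (m := m)) (b : nat -> vec) j : vec :=
  c0 f *m b j + c1 f *m shift1 b j + c2 f *m shift1 (shift1 b) j.

Lemma sum_shift1 (b : nat -> vec) N lam :
  \sum_(i < N.+1) lam ^+ i *: shift1 b i = lam *: \sum_(i < N) lam ^+ i *: b i.
Proof.
rewrite big_ord_recl /= scaler0 add0r scaler_sumr; apply: eq_bigr => i _.
by rewrite /bump /= add1n exprS scalerA.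
Qed.

Lemma sum_widen (b : nat -> vec) N N' lam : (forall i, (N <= i)%N -> b i = 0) -> (N <= N')%N ->
  \sum_(i < N') lam ^+ i *: b i = \sum_(i < N) lam ^+ i *: b i.
Proof.
move=> b0 le; rewrite -(subnKC le) big_split_ord /= [X in _ + X]big1 ?addr0 // => i _.
by rewrite b0 ?scaler0 // leq_addr.
Qed.

Lemma sum_qstep f (b : nat -> vec) N lam : (forall i, (N <= i)%N -> b i = 0) ->
  \sum_(i < N.+2) lam ^+ i *: qstep f b i = ev f lam *m (\sum_(i < N) lam ^+ i *: b i).
Proof.
move=> b0; rewrite /qstep /ev !mulmxDl -!scalemxAl.
have e : \sum_(i < N.+2) lam ^+ i *: (c0 f *m b i + c1 f *m shift1 b i + c2 f *m shift1 (shift1 b) i) =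
  c0 f *m (\sum_(i < N.+2) lam ^+ i *: b i) + c1 f *m (\sum_(i < N.+2) lam ^+ i *: shift1 b i) +
  c2 f *m (\sum_(i < N.+2) lam ^+ i *: shift1 (shift1 b) i).
  rewrite !mulmx_sumr -!big_split /=; apply: eq_bigr => i _.
  by rewrite !scalerDr -!scalemxAr.
rewrite {}e !sum_shift1 (sum_widen (N := N)) //; last by rewrite -addn2 leq_addr.
rewrite (sum_widen (N := N) (N' := N.+1)) // -!scalemxAr !scalerA.
by rewrite expr2.
Qed.

Lemma qstep0 f (b : nat -> vec) N : (forall i, (N <= i)%N -> b i = 0) ->
  forall i, (N.+2 <= i)%N -> qstep f b i = 0.
Proof.
move=> b0 [|[|i]] //; rewrite !ltnS => h; rewrite /qstep /=.
by rewrite !b0 ?mulmx0 ?addr0 // (leq_trans h) // -addn2 ?leq_addr // -addn1 leq_addr.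
Qed.

Variable (rs : seq F).
Let D : {poly F} := \prod_(z <- rs) ('X - z%:P).

(** The coefficients of the quotient by [D]. Division being linear, they are combinations of the
    [c j] with constant scalars, which makes smoothness in the base point immediate. *)
Definition quot_coef (M : nat) (c : nat -> vec) i : vec := \sum_(j < M) ('X^j %/ D)`_i *: c j.

Lemma sum_quot_coef M (c : nat -> vec) lam : uniq rs ->
  (forall z, z \in rs -> \sum_(j < M) z ^+ j *: c j = 0) ->
  D.[lam] *: (\sum_(i < M - size rs) lam ^+ i *: quot_coef M c i) = \sum_(j < M) lam ^+ j *: c j.
Proof.
move=> urs c0; apply/matrixP => r k; rewrite mxE !summxE.
pose Q : {poly F} := \sum_(j < M) c j r k *: 'X^j.
have evQ z : Q.[z] = \sum_(j < M) (z ^+ j *: c j) r k.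
  rewrite /Q horner_sum; apply: eq_bigr => j _.
  by rewrite hornerZ hornerXn mxE mulrC.
have dvd : D %| Q.
  apply: uniq_roots_dvdp; last by rewrite uniq_rootsE.
  apply/allP => z /c0 h; rewrite rootE evQ -summxE h mxE //.
have sQ : (size Q <= M)%N.
  have -> : Q = \poly_(j < M) c j r k by rewrite poly_def.
  exact: size_poly.
have qc i : (Q %/ D)`_i = quot_coef M c i r k.
  rewrite /Q (big_morph (fun p => p %/ D) (divpD D) (div0p D)) coef_sum summxE.
  by apply: eq_bigr => j _; rewrite divpZl coefZ mxE mulrC.
have D0 : D != 0 by apply: monic_neq0; exact: monic_prod_XsubC.
have sq : (size (Q %/ D)%R <= M - size rs)%N.
  by rewrite size_divp // size_prod_XsubC /= leq_sub2r.
rewrite -evQ -{1}(divpK dvd) hornerM (horner_coef_wide _ sq) mulrC; congr (_ * _).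
by apply: eq_bigr => i _; rewrite qc mxE mulrC.
Qed.

Lemma poly_coef_uniq (b c : nat -> vec) N (s : seq F) :
  (forall lam, lam \notin s -> \sum_(i < N) lam ^+ i *: b i = \sum_(i < N) lam ^+ i *: c i) ->
  forall i, (i < N)%N -> b i = c i.
Proof.
move=> h i iN; apply/eqP; rewrite -subr_eq0; apply/eqP.
apply: (@mx_poly_generic _ _ _ N (fun i => b i - c i) s) => // x /h e.
rewrite -[RHS](subrr (\sum_(i < N) x ^+ i *: b i)) {2}e -sumrB.
by apply: eq_bigr => j _; rewrite scalerBr.
Qed.

End VectorPolynomials.

(** * Laurent polynomials with section coefficients *)

Section LaurentPolynomials.
Context {R : realType} {n : nat}.
Local Notation C := R[i].
Local Notation pt := (R * R)%type.
Local Notation vec := 'cV[C]_n.+2.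
Implicit Types (p : int -> pt -> vec) (lam : C) (d : nat).

(** The coefficients of [lam^d] times the Laurent polynomial, an ordinary polynomial; past degree
    [2 d] they must be zero for products to be truncated correctly. *)
Definition lcoef d p x (i : nat) : vec := if (i <= d + d)%N then p (i%:Z - d%:Z) x else 0.

Lemma lcoef0 d p x i : ((d + d).+1 <= i)%N -> lcoef d p x i = 0.
Proof. by rewrite /lcoef ltnNge => /negbTE ->. Qed.

Lemma laurentE d p lam x : lam != 0 ->
  laurent d p lam x = lam ^- d *: \sum_(i < (d + d).+1) lam ^+ i *: lcoef d p x i.
Proof.
move=> l0; rewrite /laurent scaler_sumr; apply: eq_bigr => i _.
by rewrite /lcoef -ltnS ltn_ord scalerA expfzDr // mulrC exprnN.
Qed.

Lemma laurent_uniq d p p' x x' (s : seq C) :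
  (forall lam, lam != 0 -> lam \notin s -> laurent d p lam x = laurent d p' lam x') ->
  forall k : int, (`|k| <= d)%N -> p k x = p' k x'.
Proof.
move=> h k kd.
have ij : exists2 i : nat, (i <= d + d)%N & k = i%:Z - d%:Z.
  by exists (absz (k + d%:Z)); lia.
case: ij => i id ->.
have : lcoef d p x i = lcoef d p' x' i.
  apply: (@poly_coef_uniq C _ _ _ (d + d).+1 (0 :: s)) => // lam.
  rewrite inE negb_or => /andP[l0 ls]; have := h _ l0 ls; rewrite !laurentE //.
  by apply: scalerI; rewrite invr_eq0 expf_neq0.
by rewrite /lcoef id.
Qed.

Lemma laurent_conj d p lam x : lam != 0 ->
  conjm (laurent d p lam x) = laurent d (fun k y => conjm (p (- k) y)) (conjc lam)^-1 x.
Proof.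
move=> l0; rewrite /laurent conjm_sum (reindex_inj rev_ord_inj) /=.
apply: eq_bigr => i _; rewrite conjmZ subSS.
have id := ltn_ord i; rewrite ltnS in id.
have -> : (d + d - i)%N%:Z - d%:Z = - (i%:Z - d%:Z) by lia.
congr (_ *: _); rewrite exprz_inv; move: (- (i%:Z - d%:Z)) => z.
by rewrite rmorphXz // unitfE.
Qed.

Lemma laurent_opp d p lam x : laurent d p (- lam) x = laurent d (fun k y => (-1) ^ k *: p k y) lam x.
Proof.
have e : - lam = lam * -1 by rewrite mulrN1.
by apply: eq_bigr => i _; rewrite scalerA e expfzMl.
Qed.

Lemma laurent_mul d (A : 'M[C]_n.+2) p lam x :
  A *m laurent d p lam x = laurent d (fun k y => A *m p k y) lam x.
Proof. by rewrite /laurent mulmx_sumr; apply: eq_bigr => i _; rewrite scalemxAr. Qed.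

Lemma laurent_eq d p p' lam x x' : (forall k : int, (`|k| <= d)%N -> p k x = p' k x') ->
  laurent d p lam x = laurent d p' lam x'.
Proof.
move=> h; apply: eq_bigr => i _; rewrite h //.
have := ltn_ord i; lia.
Qed.

End LaurentPolynomials.

(** * Parity, degeneration and smoothness of the cleared factors *)

Section GaugePolynomial.
Context {F : numFieldType} {m : nat} (g rho P : 'M[F]_m) (b eps : F).
Hypotheses (ee : eps * eps = 1).

Let epsV : eps^-1 = eps.
Proof.
have e0 : eps != 0 by apply/eqP => h; move/eqP: ee; rewrite h mul0r eq_sym oner_eq0.
by apply: (mulfI e0); rewrite ee mulfV.
Qed.

(** At its pole the cleared factor degenerates to a multiple of the projection onto the reflected
    line, which kills everything orthogonal to the line itself. *)
Lemma ev_gpoly_self : ev (gpoly g b eps P) b = (4 * b ^+ 2 * eps) *: adjm g P.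
Proof.
rewrite /ev /gpoly /gauge /= invrN epsV; move: (adjm g P) (1%:M) => Q E; clear.
by mx_lin; ring.
Qed.

Lemma refl_gpoly lam : line_proj g rho 0 P 0 -> rho *m ev (gpoly g b eps P) lam *m rho = ev (gpoly g b eps P) (- lam).
Proof.
move=> lp; have h1 := refl_gauge lp eps; have h2 := refl_gauge lp (- eps).
rewrite invrN epsV in h2; rewrite epsV in h1.
have h3 : rho *m (adjm g P - P) *m rho = - (adjm g P - P).
  rewrite (lp_refl lp) mulmxBr mulmxBl !mulmxA (lp_rr lp) mul1mx -(mulmxA P) (lp_rr lp) mulmx1.
  by rewrite opprB.
rewrite /ev /gpoly /=; move: (gauge g eps P) (gauge g (- eps) P) (adjm g P - P) h1 h2 h3 => A B D h1 h2 h3.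
rewrite !mulmxDr !mulmxDl -!scalemxAr -!scalemxAl h1 h2 h3.
by mx_lin; ring.
Qed.

End GaugePolynomial.

Section ParitySign.
Context {R : realType}.
Local Notation C := R[i].

Lemma signz_odd (k : int) : (-1 : C) ^ k = (-1) ^+ odd (absz k).
Proof.
case: k => m; first by rewrite -exprnP signr_odd.
by rewrite NegzE -exprnN -exprVn invrN1 abszN absz_nat signr_odd.
Qed.

(** Turns the alternation of the coefficients between [S] and its complement into one linear
    equation, which can be compared coefficientwise with [p(- lam)]. *)
Lemma refl_sign {n} (A : 'M[C]_n.+2) (v : 'cV[C]_n.+2) (k : int) (d : nat) :
  (if odd (absz k) == odd d then A *m v = 0 else A *m v = v) <->
  (-1) ^ k *: v = (- (-1) ^+ d) *: (reflP A *m v).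
Proof.
have rE : reflP A *m v = A *m v + A *m v - v.
  by rewrite /reflP !mulmxBl mul1mx opprB addrA.
have two (a w : 'cV[C]_n.+2) : a + a = w + w -> a = w.
  move=> h; apply: (@scalerI _ _ (2 : C)); first by rewrite pnatr_eq0.
  by rewrite !scaler_nat (mulr2n a) (mulr2n w).
rewrite signz_odd -(signr_odd _ d) rE.
case: (odd (absz k)); case: (odd d); rewrite /= ?expr0 ?expr1 ?opprK ?scale1r ?scaleN1r; split=> h.
- by rewrite h add0r sub0r.
- apply: two; rewrite addr0; apply: (addIr (- v)); by rewrite -h sub0r.
- by rewrite h addrK.
- apply: two; apply: (addIr (- v)); apply: oppr_inj; by rewrite -h addrK.
- by rewrite h addrK.
- apply: two; apply: (addIr (- v)); by rewrite -h addrK.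
- by rewrite h add0r sub0r opprK.
- apply: two; rewrite addr0; apply: (addIr (- v)); apply: oppr_inj; by rewrite -h sub0r opprK.
Qed.

End ParitySign.

Section SmoothSteps.
Context {R : realType} {m : nat} (U : set (R * R)) (oU : open U).
Local Notation C := R[i].
Local Notation pt := (R * R)%type.

Lemma smooth_shift1 (b : pt -> nat -> 'cV[C]_m) : (forall j, smooth U (fun x => b x j)) ->
  forall j, smooth U (fun x => shift1 (b x) j).
Proof. by move=> h [|j]; [exact: smooth_cst|exact: h]. Qed.

Lemma smooth_qstep (f : pt -> qfamily) (b : pt -> nat -> 'cV[C]_m) :
  smooth U (fun x => c0 (f x)) -> smooth U (fun x => c1 (f x)) -> smooth U (fun x => c2 (f x)) ->
  (forall j, smooth U (fun x => b x j)) -> forall j, smooth U (fun x => qstep (f x) (b x) j).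
Proof.
move=> h0 h1 h2 hb j; have s1 := smooth_shift1 hb; have s2 := smooth_shift1 s1.
exact: (smoothD oU (smoothD oU (smoothM oU h0 (hb j)) (smoothM oU h1 (s1 j))) (smoothM oU h2 (s2 j))).
Qed.

End SmoothSteps.

Lemma smooth_gpoly {R : realType} {n : nat} (U : set (R * R)) (oU : open U) b eps
    (Q : R * R -> 'M[R[i]]_n.+2) : smooth U Q ->
  smooth U (fun x => c0 (gpoly gram b eps (Q x))) /\
  smooth U (fun x => c1 (gpoly gram b eps (Q x))) /\
  smooth U (fun x => c2 (gpoly gram b eps (Q x))).
Proof.
move=> CQ; split; first exact: (smoothZc oU _ (smooth_gauge oU _ CQ)).
split; first exact: (smoothZc oU _ (smoothB oU (smooth_adj oU CQ) CQ)).
exact: (smooth_gauge oU _ CQ).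
Qed.

Lemma sum_qstep2 {F : numFieldType} {m : nat} (f1 f2 : qfamily (F := F) (m := m)) (A : 'M[F]_m) b N lam :
  (forall i, (N <= i)%N -> b i = 0) ->
  \sum_(j < N.+4) lam ^+ j *: (A *m qstep f2 (qstep f1 b) j) =
  A *m (ev f2 lam *m (ev f1 lam *m (\sum_(i < N) lam ^+ i *: b i))).
Proof.
move=> b0; rewrite -(sum_qstep f1 lam b0) -(sum_qstep f2 lam (qstep0 f1 b0)) mulmx_sumr.
by apply: eq_bigr => i _; rewrite scalemxAr.
Qed.

(** * The transformed conserved quantity *)

Section HatConserved.
Context {R : realType} {n : nat}.
Local Notation C := R[i].
Local Notation I := ('i%C : C).
Local Notation pt := (R * R)%type.
Local Notation vec := 'cV[C]_n.+2.
Local Notation endo := 'M[C]_n.+2.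
Local Notation g := (@gram R n).
Implicit Types (x y X Y : pt) (u v w : vec).
Context (U : set pt) (oU : open U) (Lam : pt -> set vec) (q : pt -> pt -> endo).
Hypothesis cw : constrained_willmore U Lam q.
Let sf : is_surface U Lam. Proof. by case: cw. Qed.
Local Notation J := (fun y => cpx U Lam y e1).
Local Notation P := (cproj U Lam).
Local Notation rho := (fun y => reflP (cproj U Lam y)).
Context (alpha : C) (t : pt -> vec).
Local Notation ah := (ahat alpha).
Hypotheses (a0 : alpha != 0) (a1 : `|alpha| != 1) (Ct : smooth U t).
Hypothesis t_null : forall x, U x -> ip (t x) (t x) = 0.
Hypothesis t_orth : forall x, U x -> ip (t x) (rho x *m t x) != 0.
Hypothesis t_par : forall x X, U x -> exists c, dlq U Lam q alpha t x X = c *: t x.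
Hypothesis t2_orth : forall x, U x ->
  ip (bt_t2 U Lam alpha t x) (rho x *m bt_t2 U Lam alpha t x) != 0.

Local Notation P1 := (btP1 U Lam t).
Local Notation P2 := (btP2 U Lam alpha t).
Local Notation r := (rr U Lam alpha t).
Local Notation rinf := (rrinf U Lam alpha t).
Local Notation exc := (rexc alpha).
Let CP : smooth U P := smooth_cproj oU sf.
Let Crho : smooth U rho := smooth_reflP oU CP.
Let rho2 x : U x -> rho x *m rho x = 1%:M.
Proof. by move=> Ux; apply: reflP2; exact: cproj_idem. Qed.
Let rho_adj x : U x -> adjm g (rho x) = rho x.
Proof. by move=> Ux; apply: adjm_reflP; exact: cproj_adj. Qed.
Let P1f := btP1_facts oU cw Ct t_null t_orth.
Let P2f := btP2_facts oU cw a0 a1 Ct t_null t_orth t2_orth.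
Let lp1 x (Ux : U x) := lp_static (P1f.2 x Ux).
Let lp2 x (Ux : U x) := lp_static (P2f.2 x Ux).
Local Opaque ip der dz NZ gauge rrinf rrV gpoly.
Local Notation RR := (RR U Lam alpha t).
Local Notation RRinf := (RRinf U Lam alpha t).
Local Notation hatP := (hatP U Lam alpha t).
Local Notation V := (rrV U Lam alpha t).
Context (LamH : pt -> set vec) (sfh : is_surface U LamH).
Hypothesis LamH10 : forall x v, U x -> LamH x v -> exists2 u, L10 U Lam x u & v = RR 0 x *m u.
Hypothesis LamH01 : forall x v, U x -> LamH x v -> exists2 u, L01 U Lam x u & v = RRinf x *m u.
Context (om : pt -> pt -> endo).
Hypothesis omE : forall x X, U x -> om x X =
  V x *m (rinf x *m tp10 U Lam q x X *m invmx (rinf x) +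
          r 0 x *m tp01 U Lam q x X *m invmx (r 0 x)) *m r 1 x.
Context (d : nat) (p : int -> pt -> vec).
Hypothesis pq : is_pcq U Lam q d p.
Hypothesis p_perp : forall x, U x -> ip (t x) (laurent d p alpha x) = 0.

Local Notation G1 := (fun x => gpoly g ah 1 (P1 x)).
Local Notation G2 := (fun x => gpoly g alpha (-1) (P2 x)).

(** The coefficients of [r(1)^-1 r(lam) lam^d p(lam)] with the four poles cleared, of degree at most
    [2 d + 4]. Dividing by the four linear factors leaves degree [2 d], and [hat_coef] shifts the
    index back by [d]. *)
Definition hat_num x (j : nat) : vec := V x *m qstep (gpoly g alpha (-1) (P2 x))
  (qstep (gpoly g ah 1 (P1 x)) (lcoef d p x)) j.
Definition hat_coef (k : int) x : vec :=
  quot_coef exc (d + d).+1.+4 (hat_num x) (absz (k + d%:Z)).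

Let af := ahat_facts a0 a1.
Let ah0 : ah != 0. Proof. by case: af. Qed.
Let ee1 : 1 * 1 = 1 :> C. Proof. exact: mulr1. Qed.
Let eeN : -1 * -1 = 1 :> C. Proof. by rewrite mulrNN mulr1. Qed.

Lemma hat_num_sum x lam : \sum_(j < (d + d).+1.+4) lam ^+ j *: hat_num x j =
  V x *m (ev (G2 x) lam *m (ev (G1 x) lam *m (\sum_(i < (d + d).+1) lam ^+ i *: lcoef d p x i))).
Proof.
exact: (sum_qstep2 _ _ _ lam (@lcoef0 _ _ d p x)).
Qed.

Let mem_exc z : (z \in exc) = [|| z == alpha, z == - alpha, z == ah | z == - ah].
Proof. by rewrite !inE. Qed.

Let p_parity lam x : U x -> laurent d p (- lam) x = (- (-1) ^+ d) *: (rho x *m laurent d p lam x).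
Proof.
move=> Ux; rewrite laurent_opp scalemxAl laurent_mul; apply: laurent_eq => k kd.
rewrite -scalemxAl; apply/refl_sign; case: pq => _ _ /(_ k x kd Ux) + _ _.
by case: ifP => _; [move/(piS_eq oU sf Ux).2|move/(csc_mem oU sf _ Ux)].
Qed.

Let p_conj lam x : U x -> lam != 0 -> conjm (laurent d p lam x) = laurent d p (conjc lam)^-1 x.
Proof.
move=> Ux l0; rewrite laurent_conj //; apply: laurent_eq => k kd.
case: pq => /(_ (- k)) h _ _ _ _; rewrite abszN in h; have [_ e] := h kd.
by rewrite -e // opprK.
Qed.

Let kill_self (l w u : vec) b eps : eps * eps = 1 -> ip l u = 0 -> ev (gpoly g b eps (lproj l w)) b *m u = 0.
Proof.
move=> ee h; rewrite ev_gpoly_self // adjm_lproj -scalemxAl lproj_vec h mul0r scale0r scaler0.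
by [].
Qed.

Let numer x lam : vec := ev (G2 x) lam *m (ev (G1 x) lam *m laurent d p lam x).

Let numer_opp x lam : U x -> numer x lam = 0 -> numer x (- lam) = 0.
Proof.
move=> Ux h.
have alg (A B D : endo) (v : vec) (c : C) : D *m D = 1%:M -> A *m (B *m v) = 0 ->
    D *m A *m D *m (D *m B *m D *m (c *: (D *m v))) = 0.
  move=> DD z; have e (M : endo) : M *m D *m D = M by rewrite -mulmxA DD mulmx1.
  by rewrite -!scalemxAr !mulmxA !e -!mulmxA z mulmx0 scaler0.
apply: (etrans (congr2 mulmx (esym (refl_gpoly alpha eeN lam (lp2 Ux)))
  (congr2 mulmx (esym (refl_gpoly ah ee1 lam (lp1 Ux))) (p_parity lam Ux)))).
exact: alg (rho2 Ux) h.
Qed.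

Let ip_scaled (A : endo) (c : C) (l u : vec) : ip (A *m l) (A *m u) = 0 -> ip (A *m l) ((c *: A) *m u) = 0.
Proof. by move=> h; rewrite -scalemxAl ipZr h mulr0. Qed.

(** At [ah] the first factor pairs its argument with [conjm t], and [p(ah)] is the conjugate of
    [p(alpha)]. At [alpha] the second pairs with [bt_t2], and there the first is a scalar times an
    isometry taking [t] to [bt_t2]. Both reduce to [p_perp]; parity gives the opposite points. *)
Let numer_exc x z : U x -> z \in exc -> numer x z = 0.
Proof.
move=> Ux; have [_ n1 n2 _ _] := af.
have h1 : numer x alpha = 0.
  refine (@kill_self (bt_t2 U Lam alpha t x) (rho x *m bt_t2 U Lam alpha t x)
    (ev (G1 x) alpha *m laurent d p alpha x) alpha (-1) eeN _).
  have e := gpolyE g (P1 x) ee1 n1 n2.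
  apply: (etrans (congr1 (fun A => ip (bt_t2 U Lam alpha t x) (A *m _)) e)).
  apply: ip_scaled; apply: (etrans (gauge_isometry _ _ (lp1 Ux) _)); last exact: p_perp.
  by rewrite mul1r moebius_neq0.
have h2 : numer x ah = 0.
  have k : ev (G1 x) ah *m laurent d p ah x = 0.
    refine (@kill_self (conjm (t x)) (rho x *m conjm (t x)) (laurent d p ah x) ah 1 ee1 _).
    apply: (etrans (congr1 (ip _) (esym (p_conj Ux a0)))).
    by apply: (etrans (ip_conj _ _)); rewrite p_perp // rmorph0.
  exact: (etrans (congr1 (mulmx _) k) (mulmx0 _ _)).
rewrite mem_exc => /or4P[] /eqP ->; [exact: h1|exact: (numer_opp Ux h1)|exact: h2|exact: (numer_opp Ux h2)].
Qed.

Let scaled_kill (A B D : endo) (v : vec) (c : C) : c != 0 -> A *m (B *m (c *: v)) = 0 -> D *m (A *m (B *m v)) = 0.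
Proof.
move=> cn; rewrite -!scalemxAr => /eqP; rewrite scaler_eq0 (negbTE cn) /= => /eqP ->.
exact: mulmx0.
Qed.

Let hat_num_exc x z : U x -> z \in exc -> \sum_(j < (d + d).+1.+4) z ^+ j *: hat_num x j = 0.
Proof.
move=> Ux zE; have z0 : z != 0 by apply: contraL zE => /eqP ->; exact: zero_notin_exc.
have zd : z ^- d != 0 by rewrite invr_eq0 expf_neq0.
apply: (etrans (hat_num_sum x z)); refine (@scaled_kill (ev (G2 x) z) (ev (G1 x) z) (V x) _ (z ^- d) zd _).
exact: (etrans (congr1 (fun v => _ *m (_ *m v)) (esym (laurentE d p x z0))) (numer_exc Ux zE)).
Qed.

Lemma hat_laurent lam x : lam != 0 -> lam \notin exc -> U x ->
  laurent d hat_coef lam x = RR lam x *m laurent d p lam x.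
Proof.
move=> l0 le Ux; have [_ n1 n2 n3 _] := af.
have uexc : uniq exc.
  have nN (z : C) : z != 0 -> z != - z by move=> z0; rewrite -addr_eq0 -mulr2n mulrn_eq0 negb_or.
  have m1 : - alpha != ah by rewrite eqr_oppLR.
  have m2 : - alpha != - ah by rewrite eqr_opp.
  by rewrite /rexc /= !inE !negb_or (nN _ a0) n1 n2 m1 m2 (nN _ ah0).
(* [D] is the product of the two scalars by which [gpolyE] clears the factors. *)
pose D := (\prod_(z <- exc) ('X - z%:P)).[lam].
have DE : D = (lam ^+ 2 - alpha ^+ 2) * (lam ^+ 2 - ah ^+ 2).
  rewrite /D !big_cons big_nil !hornerM !hornerXsubC hornerC !opprK; ring.
have D0 : D != 0.
  move: le; rewrite mem_exc !negb_or => /and4P[h1 h2 h3 h4].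
  by rewrite DE !subr_sqr !mulf_neq0 // ?subr_eq0 // addr_eq0.
have e := sum_quot_coef (M := (d + d).+1.+4) lam uexc (fun z => @hat_num_exc x z Ux).
have h1 : lam != alpha by apply: contra le => /eqP ->; rewrite mem_exc eqxx.
have h2 : lam != - alpha by apply: contra le => /eqP ->; rewrite mem_exc eqxx orbT.
have h3 : lam != ah by apply: contra le => /eqP ->; rewrite mem_exc eqxx !orbT.
have h4 : lam != - ah by apply: contra le => /eqP ->; rewrite mem_exc eqxx !orbT.
have g1 := gpolyE g (P1 x) ee1 h3 h4; have g2 := gpolyE g (P2 x) eeN h1 h2.
have alg (Vx A B A' B' : endo) (u v : vec) (k1 k2 k : C) : k1 * k2 != 0 -> A' = k1 *: A -> B' = k2 *: B ->
    (k1 * k2) *: u = Vx *m (A' *m (B' *m v)) -> k *: u = Vx *m (A *m B) *m (k *: v).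
  move=> kn -> -> h; rewrite -scalemxAr; congr (_ *: _); apply: (scalerI kn); rewrite h.
  by rewrite -!scalemxAl -!scalemxAr scalerA !mulmxA.
apply: (etrans (laurentE d hat_coef x l0)); apply: (etrans _ (congr1 (mulmx _) (esym (laurentE d p x l0)))).
rewrite DE in D0.
refine (alg (V x) (gauge g (-1 * moebius alpha lam) (P2 x)) (gauge g (1 * moebius ah lam) (P1 x))
  (ev (G2 x) lam) (ev (G1 x) lam) _ _ _ _ _ D0 g2 g1 _).
apply: etrans (etrans e (hat_num_sum x lam)).
rewrite -DE -/D; congr (_ *: _); apply: eq_bigr => i _; congr (_ *: _).
by rewrite /lcoef -ltnS ltn_ord /hat_coef subrK.
Qed.

Let CV : smooth U V := smooth_rrV oU cw a0 a1 Ct t_null t_orth t2_orth.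

Let smooth_lcoef j : smooth U (fun x => lcoef d p x j).
Proof.
rewrite /lcoef; have [jd|jd] := boolP (j <= d + d)%N; last exact: smooth_cst.
have k : (absz (j%:Z - d%:Z) <= d)%N by lia.
by case: pq => /(_ _ k)[h _] _ _ _ _; exact: h.
Qed.

Lemma hat_coef_smooth k : smooth U (hat_coef k).
Proof.
have [b0 [b1 b2]] := smooth_gpoly oU ah 1 P1f.1.
have [e0 [e1' e2']] := smooth_gpoly oU alpha (-1) P2f.1.
have C1 := smooth_qstep oU b0 b1 b2 smooth_lcoef.
have C2 := smooth_qstep oU e0 e1' e2' C1.
rewrite /hat_coef /quot_coef; apply: (smooth_sum oU) => j _.
exact: (smoothZc oU _ (smoothM oU CV (C2 j))).
Qed.

Let smooth_laurent (w : int -> pt -> vec) lam : (forall k : int, (absz k <= d)%N -> smooth U (w k)) ->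
  smooth U (laurent d w lam).
Proof.
move=> h; rewrite /laurent; apply: (smooth_sum oU) => k _; apply: (smoothZc oU); apply: h.
have := ltn_ord k; lia.
Qed.

(** The Laurent polynomials of both sides agree off [exc] by [conj_RR], so their coefficients do. *)
Lemma hat_coef_conj k x : (absz k <= d)%N -> U x -> hat_coef (- k) x = conjm (hat_coef k x).
Proof.
move=> kd Ux; suff h (k' : int) : (absz k' <= d)%N -> hat_coef k' x = conjm (hat_coef (- k') x).
  by rewrite h ?abszN // opprK.
apply: (@laurent_uniq _ _ d hat_coef (fun k y => conjm (hat_coef (- k) y)) x x exc) => lam l0 le.
set mu := (conjc lam)^-1.
have mu0 : mu != 0 by rewrite invr_eq0 conjc_eq0.
have mue : mu \notin exc := exc_conj le.
have ml : (conjc mu)^-1 = lam by rewrite /mu fmorphV invrK; exact: conjcK.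
apply: (etrans (hat_laurent l0 le Ux)).
have e := laurent_conj d hat_coef x mu0; rewrite ml in e; apply: (etrans _ e).
apply: (etrans _ (esym (congr1 conjm (hat_laurent mu0 mue Ux)))); apply: (etrans _ (esym (conjmM _ _))).
have e1' := conj_RR oU cw a0 a1 Ct t_null t_orth t2_orth mu0 mue Ux; rewrite ml in e1'.
have e2' := p_conj Ux mu0; rewrite ml in e2'.
exact: (congr2 mulmx (esym e1') (esym e2')).
Qed.

Let hat_refl lam x : U x -> reflP (hatP x) *m RR lam x = RR (- lam) x *m rho x.
Proof.
move=> Ux; have rV := rrV_r oU cw a0 a1 Ct t_null t_orth t2_orth Ux.
apply: (etrans (congr1 (fun A => A *m _) (hatP_refl oU cw a0 a1 Ct t_null t_orth t2_orth Ux))).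
apply: (etrans (conj_mul rV (rho x) (r lam x))).
have pr := rr_parity oU cw a0 a1 Ct t_null t_orth t2_orth lam Ux.
have alg (A B D E : endo) : A *m B *m A = E -> A *m A = 1%:M -> D *m (A *m B) = D *m E *m A.
  by move=> <- AA; rewrite -!mulmxA AA mulmx1.
exact: alg pr (rho2 Ux).
Qed.

Let hat_coef_parity k x : (absz k <= d)%N -> U x ->
  (-1) ^ k *: hat_coef k x = (- (-1) ^+ d) *: (reflP (hatP x) *m hat_coef k x).
Proof.
move=> kd Ux; rewrite scalemxAl; move: k kd.
apply: (@laurent_uniq _ _ d (fun k y => (-1) ^ k *: hat_coef k y)
  (fun k y => ((- (-1) ^+ d) *: reflP (hatP x)) *m hat_coef k y) x x exc) => lam l0 le.
apply: (etrans (esym (laurent_opp d hat_coef lam x))).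
apply: (etrans _ (laurent_mul d _ hat_coef lam x)).
have l0' : - lam != 0 by rewrite oppr_eq0.
apply: (etrans (hat_laurent l0' (exc_opp le) Ux)).
apply: (etrans (congr1 (mulmx _) (p_parity lam Ux))).
apply: (etrans _ (congr1 (mulmx _) (esym (hat_laurent l0 le Ux)))).
have alg (A B D E : endo) (c : C) (v : vec) : A *m B = D *m E -> D *m (c *: (E *m v)) = (c *: A) *m (B *m v).
  by move=> h; rewrite -scalemxAr -scalemxAl !mulmxA h.
exact: alg (hat_refl lam Ux).
Qed.

Let dz_laurent lam x : U x ->
  dz J (laurent d hat_coef lam) x = laurent d (fun k => dz J (hat_coef k)) lam x.
Proof.
move=> Ux; have alg (k : nat) (c : 'I_k -> C) (a b : 'I_k -> vec) (i : C) :
    \sum_j c j *: a j - i *: (\sum_j c j *: b j) = \sum_j c j *: (a j - i *: b j).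
  rewrite scaler_sumr -sumrB; apply: eq_bigr => j _.
  by rewrite scalerBr !scalerA mulrC.
have dE X : der (laurent d hat_coef lam) x X =
    \sum_(k < (d + d).+1) lam ^ (k%:Z - d%:Z) *: der (hat_coef (k%:Z - d%:Z)) x X.
  apply: (etrans (der_sum oU Ux _ X (fun k : 'I_(d + d).+1 => smoothZc oU _ (hat_coef_smooth (k%:Z - d%:Z))))).
  by apply: eq_bigr => k _; exact: (derZc oU Ux _ _ (hat_coef_smooth _)).
exact: (etrans (congr2 (fun a b => a - I *: b) (dE e1) (dE _)) (alg _ _ _ _ I)).
Qed.

(** Off [exc] this is [hat_dlqZ_gauge]. The left side is a Laurent polynomial in [lam], so its
    coefficients [ee] vanish and the exceptional values are covered as well. *)
Let hat_dlqZ0 lam x : lam != 0 -> U x -> dlqZ U LamH om lam (laurent d hat_coef lam) x = 0.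
Proof.
move=> l0 Ux; have [f [_ hE]] := hat_dlqZ oU cw a0 a1 Ct t_null t_orth t_par t2_orth sfh LamH10 LamH01 omE Ux.
pose ee i : vec := lcoef d (fun k => dz J (hat_coef k)) x i + qstep f (lcoef d hat_coef x) i.
have eeE mu : mu != 0 -> dlqZ U LamH om mu (laurent d hat_coef mu) x =
    mu ^- d *: \sum_(i < (d + d).+1.+2) mu ^+ i *: ee i.
  move=> m0; rewrite hE dz_laurent // !laurentE // -scalemxAr -scalerDr; congr (_ *: _).
  rewrite -(sum_qstep f mu (@lcoef0 _ _ d hat_coef x)).
  rewrite -(sum_widen (N' := (d + d).+1.+2) mu (@lcoef0 _ _ d (fun k => dz J (hat_coef k)) x)); last by rewrite -addn2 leq_addr.
  by rewrite -big_split /=; apply: eq_bigr => i _; rewrite -scalerDr.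
have ee0 i : (i < (d + d).+1.+2)%N -> ee i = 0.
  apply: (@mx_poly_generic _ _ _ _ ee (0 :: exc)) => mu.
  rewrite inE negb_or => /andP[m0 me].
  have md : mu ^- d != 0 by rewrite invr_eq0 expf_neq0.
  apply: (scalerI md); rewrite scaler0 -eeE //.
  have Cp : smooth U (laurent d p mu).
    by apply: smooth_laurent => k kd; case: pq => /(_ k kd)[h _].
  have p0 X : dlq U Lam q mu (laurent d p mu) x X = 0 by case: pq => _ _ _ _; exact.
  have := hat_dlqZ_gauge oU cw a0 a1 Ct t_null t_orth t_par t2_orth sfh LamH10 LamH01 omE me Ux Cp p0.
  apply: etrans; rewrite !hE; apply: (congr2 (fun a b => a + _ *m b)).
    by apply: (dz_ext oU J Ux) => y Uy; exact: hat_laurent.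
  exact: hat_laurent.
by rewrite eeE // big1 ?scaler0 // => i _; rewrite ee0 ?scaler0.
Qed.

Lemma hat_pcq : is_pcq U LamH om d hat_coef.
Proof.
have par k x : (absz k <= d)%N -> U x ->
    if odd (absz k) == odd d then cscp U LamH x (hat_coef k x) else csc U LamH x (hat_coef k x).
  move=> kd Ux; have := (refl_sign _ _ k d).2 (hat_coef_parity kd Ux).
  have [h1 h2] := hat_csc oU cw a0 a1 Ct t_null t_orth t_par t2_orth sfh LamH10 LamH01 (hat_coef k x) Ux.
  by case: ifP => _; [move/h2|move/h1].
split.
- by move=> k kd; split; [exact: hat_coef_smooth|move=> x Ux; exact: hat_coef_conj].
- move=> x Ux; have := par d%:Z x; rewrite absz_nat eqxx; exact.
- by move=> k x kd Ux; exact: par.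
(* The operator is the identity at [lam = 1], so the value there is that of [p]. *)
- move=> x Ux; rewrite (hat_laurent (oner_neq0 _) (one_notin_exc a0 a1) Ux).
  rewrite (RR1 oU cw a0 a1 Ct t_null t_orth t2_orth Ux) mul1mx.
  by case: pq => _ _ _ h _; exact: h.
- move=> lam x X l0 Ux.
  have Cl mu : smooth U (laurent d hat_coef mu) by apply: smooth_laurent => k _; exact: hat_coef_smooth.
  have lo := hatq_lin cw omE Ux.
  apply: (dlq_eq0 oU sfh Ux lo (Cl lam) (hat_dlqZ0 l0 Ux)).
  (* The (0,1) equation at [lam] is the conjugate of the (1,0) equation at [mu]. *)
  pose mu := (conjc lam)^-1.
  have mu0 : mu != 0 by rewrite invr_eq0 conjc_eq0.
  have cl y : U y -> conjm (laurent d hat_coef lam y) = laurent d hat_coef mu y.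
    move=> Uy; rewrite laurent_conj //; apply: laurent_eq => k kd.
    by rewrite -hat_coef_conj ?abszN // opprK.
  have rom Y : conjm (om x Y) = om x Y := hatq_real oU cw a0 a1 Ct t_null t_orth t2_orth omE Y Ux.
  have cd Y := dlq_conj oU sfh lam Y Ux rom (Cl lam).
  have z : dlqZ U LamH om mu (fun y => conjm (laurent d hat_coef lam y)) x = 0.
    exact: (etrans (congr2 (fun a b => a + _ *m b) (dz_ext oU _ Ux cl) (cl _ Ux)) (hat_dlqZ0 mu0 Ux)).
  have {}z := etrans (dlq_dz oU sfh mu Ux lo (smooth_conjm oU (Cl lam))) z.
  have {}z := etrans (congr2 (fun a b => a - I *: b) (cd _) (cd _)) z.
  have alg (A B : vec) : conjm A - I *: conjm B = 0 -> A + I *: B = 0.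
    move=> h; apply: (can_inj conjmK); rewrite conjmD conjmZ conjm0 -[RHS]h -scaleNr; congr (_ + _ *: _).
    by apply: complex_ext => /=; ring.
  exact: alg z.
Qed.

End HatConserved.

(** * Spanned line bundles, and the unit circle *)

Section LineBundles.
Context {R : realType} {n : nat}.
Local Notation C := R[i].
Local Notation pt := (R * R)%type.
Local Notation vec := 'cV[C]_n.+2.
Local Notation endo := 'M[C]_n.+2.
Implicit Types (u v w : vec) (A : endo).

Lemma img_line A v : img A (line v) = line (A *m v).
Proof.
apply/seteqP; split=> w /=.
  by move=> [u [c _ <-] <-]; exists c; rewrite ?scalemxAr.
by move=> [c _ <-]; exists (c *: v); [exists c|rewrite scalemxAr].
Qed.

Lemma conj_line (L : pt -> set vec) v x : L x = line v -> conjB L x = line (conjm v).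
Proof.
move=> e; rewrite /conjB e; apply/seteqP; split=> w /=.
  by move=> [u [c _ <-] <-]; exists (conjc c); rewrite ?conjmZ.
by move=> [c _ <-]; exists (conjc c *: v); [exists (conjc c)|rewrite conjmZ; congr (_ *: _); exact: conjcK].
Qed.

Lemma orth_line A (V W : set vec) v : V = line v -> W = img A (line v) ->
  (exists u w, [/\ V u, W w & ip u w <> 0]) -> ip v (A *m v) != 0.
Proof.
move=> -> ->; rewrite img_line => -[u [w [[c _ <-] [c' _ <-] h]]].
by apply/eqP => z; apply: h; rewrite ipZl ipZr z !mulr0.
Qed.

(** The circle is fixed pointwise by inversion composed with conjugation, which takes [ahat] to
    [alpha]; so none of the four poles is on it. *)
Lemma unit_circle_exc (alpha lam : C) : `|alpha| != 1 -> `|lam| = 1 ->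
  [/\ lam != 0, (conjc lam)^-1 = lam & lam \notin rexc alpha].
Proof.
move=> a1 l1; have l0 : lam != 0 by rewrite -normr_eq0 l1 oner_eq0.
have e : (conjc lam)^-1 = lam.
  have h : lam * conjc lam = 1 by rewrite -sqr_normc l1 expr1n.
  have c0 : conjc lam != 0 by rewrite conjc_eq0.
  by apply: (mulIf c0); rewrite h mulVf.
split=> //; have na (z : C) : z = alpha \/ z = - alpha -> lam != z.
  case=> ->; apply: contra a1 => /eqP h; first by rewrite -h l1.
  by rewrite -normrN -h l1.
have nh (z : C) : (conjc z)^-1 = alpha \/ (conjc z)^-1 = - alpha -> lam != z.
  move=> h; have := na _ h; apply: contra => /eqP hl; apply/eqP.
  by rewrite -hl e.
have ch : (conjc (ahat alpha))^-1 = alpha by rewrite /ahat fmorphV invrK; exact: conjcK.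
have h1 : lam != alpha by apply: na; left.
have h2 : lam != - alpha by apply: na; right.
have h3 : lam != ahat alpha by apply: nh; left.
have h4 : lam != - ahat alpha by apply: nh; right; rewrite rmorphN invrN; congr (- _).
by rewrite /rexc !inE (negbTE h1) (negbTE h2) (negbTE h3) (negbTE h4).
Qed.

End LineBundles.

Theorem theorem4p2 (R : realType) (n : nat) (n_ge3 : (3 <= n)%N)
    (U : set (R * R)) (U_open : open U) (U_neq0 : U !=set0)
    (Lam : R * R -> set 'cV[R[i]]_n.+2)
    (q : R * R -> R * R -> 'M[R[i]]_n.+2)
    (cw : constrained_willmore U Lam q)
    (d : nat) (p : int -> R * R -> 'cV[R[i]]_n.+2)
    (p_pcq : is_pcq U Lam q d p)
    (alpha : R[i]) (L : R * R -> set 'cV[R[i]]_n.+2)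
    (par : baecklund_parameters U Lam q alpha L)
    (Lt_orth : never_orth U (Ltilde U Lam alpha L)
                            (reflB U Lam (Ltilde U Lam alpha L)))
    (hat_surface : is_surface U (bt_Lam U Lam alpha L))
    (p_perp : forall x, U x -> perp (L x) (laurent d p alpha x)) :
  exists ph : int -> R * R -> 'cV[R[i]]_n.+2,
    [/\ is_pcq U (bt_Lam U Lam alpha L) (bt_q U Lam q alpha L) d ph,
        forall (lam : R[i]) x, `|lam| = 1 -> U x ->
          laurent d ph lam x =
            bt_op U Lam alpha L (conjc lam)^-1 x *m laurent d p lam x &
        forall (lam : R[i]) x, lam != 0 ->
          lam \notin [:: alpha; - alpha; ahat alpha; - ahat alpha] -> U x ->
          laurent d ph lam x =
            bt_op U Lam alpha L lam x *m laurent d p lam x].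
Proof.
have sf : is_surface U Lam by case: cw.
have [[a0 a1] [t Ct ht] L_orth L_par] := par.
have Lt x (Ux : U x) : L x = line (t x) by have [] := ht x Ux.
have t_null x (Ux : U x) : ip (t x) (t x) = 0 by have [] := ht x Ux.
have rE x (Ux : U x) : refl U Lam x = reflP (cproj U Lam x) := refl_eq U_open sf Ux.
have t_orth x : U x -> ip (t x) (reflP (cproj U Lam x) *m t x) != 0.
  move=> Ux; rewrite -rE //; apply: (orth_line (Lt x Ux) _ (L_orth x Ux)).
  by rewrite /reflB Lt.
have t_par x X : U x -> exists c, dlq U Lam q alpha t x X = c *: t x.
  move=> Ux; have h y : U y -> L y (t y) by move=> Uy; rewrite Lt //; exists 1; rewrite ?scale1r.
  by have := L_par t Ct h x X Ux; rewrite Lt // => -[c _ <-]; exists c.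
pose t2 := bt_t2 U Lam alpha t; pose P1 := btP1 U Lam t.
have [h0 n1 n2 n3 one_exc] := ahat_facts a0 a1.
have r2 x (Ux : U x) : reflP (cproj U Lam x) *m reflP (cproj U Lam x) = 1%:M :=
  reflP2 (cproj_idem U_open sf Ux).
have radj x : adjm gram (reflP (cproj U Lam x)) = reflP (cproj U Lam x) :=
  adjm_reflP (cproj_adj U Lam).
have rnull x l : U x -> ip l l = 0 -> ip (reflP (cproj U Lam x) *m l) (reflP (cproj U Lam x) *m l) = 0.
  move=> Ux l0; have alg (A : 'M[R[i]]_n.+2) : A *m A = 1%:M -> adjm gram A = A -> ip (A *m l) (A *m l) = 0.
    by move=> AA Aj; rewrite ip_adjl Aj mulmxA AA mul1mx.
  exact: alg (r2 _ Ux) (radj x).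
(* From here on the factors defined by choice are replaced by explicit gauges, with the spanning
   sections [conjm t] and [t2]. *)
have act (B : R * R -> set 'cV[R[i]]_n.+2) a x l : U x -> B x = line l -> a != 0 -> ip l l = 0 ->
    ip l (reflP (cproj U Lam x) *m l) != 0 ->
    acting U Lam a B x = gauge gram a (lproj l (reflP (cproj U Lam x) *m l)).
  move=> Ux Bl an ln lo; have e := rE x Ux.
  have := @actingE R n U Lam B a x l Bl an ln; rewrite e; apply; first exact: rnull.
  by rewrite ipC.
have ct_null x (Ux : U x) : ip (conjm (t x)) (conjm (t x)) = 0.
  by rewrite ip_conj t_null // rmorph0.
have ct_orth x (Ux : U x) : ip (conjm (t x)) (reflP (cproj U Lam x) *m conjm (t x)) != 0.
  have rr := refl_real U_open cw Ux; have := t_orth x Ux.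
  move: (reflP _) rr => A rr; rewrite -[in X in _ -> X]rr -conjmM ip_conj; by rewrite conjc_eq0.
have cL x (Ux : U x) : conjB L x = line (conjm (t x)) := conj_line (Lt x Ux).
have mb (b l : R[i]) : l != b -> l != - b -> moebius b l != 0 by exact: moebius_neq0.
have LtE x (Ux : U x) : Ltilde U Lam alpha L x = line (t2 x).
  rewrite /Ltilde Lt // img_line; congr (line (_ *m _)).
  rewrite /t2 /bt_t2 mul1r; exact: (act _ _ _ _ Ux (cL x Ux) (mb _ _ n1 n2) (ct_null x Ux) (ct_orth x Ux)).
have t2_orth x : U x -> ip (t2 x) (reflP (cproj U Lam x) *m t2 x) != 0.
  move=> Ux; rewrite -rE //; apply: (orth_line (LtE x Ux) _ (Lt_orth x Ux)).
  by rewrite /reflB LtE.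
have t2n x (Ux : U x) : ip (t2 x) (t2 x) = 0 := t2_null U_open cw a0 a1 Ct t_null t_orth Ux.
have rrE lam x : lam \notin rexc alpha -> U x -> bt_r U Lam alpha L (Some lam) x = rr U Lam alpha t lam x.
  rewrite /rexc !inE !negb_or => /and4P[l1 l2 l3 l4] Ux; apply: (congr2 mulmx).
    rewrite mulN1r; apply: (act _ _ _ _ Ux (LtE x Ux)) => //; last exact: t2_orth.
      by rewrite oppr_eq0 mb.
    exact: t2n.
  by rewrite mul1r; apply: (act _ _ _ _ Ux (cL x Ux) (mb _ _ l3 l4) (ct_null x Ux) (ct_orth x Ux)).
have rinfE x : U x -> bt_r U Lam alpha L None x = rrinf U Lam alpha t x.
  move=> Ux; apply: (congr2 mulmx).
    apply: (act _ _ _ _ Ux (LtE x Ux) _ (t2n x Ux) (t2_orth x Ux)).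
    by rewrite oppr_eq0 oner_eq0.
  apply: (act _ _ _ _ Ux (cL x Ux) _ (ct_null x Ux) (ct_orth x Ux)); exact: oner_neq0.
have r1E x (Ux : U x) := rrE 1 x one_exc Ux.
have r0E x (Ux : U x) := rrE 0 x (zero_notin_exc a0 a1) Ux.
have opE lam x : lam \notin rexc alpha -> U x -> bt_op U Lam alpha L lam x = RR U Lam alpha t lam x.
  move=> le Ux; exact: (congr2 (fun A B => invmx A *m B) (r1E x Ux) (rrE lam x le Ux)).
have H10 x v : U x -> bt_Lam U Lam alpha L x v -> exists2 u, L10 U Lam x u & v = RR U Lam alpha t 0 x *m u.
  move=> Ux [[u Lu <-] _]; exists u; first exact: Lu.
  exact: (congr2 (fun A B => invmx A *m B *m u) (r1E x Ux) (r0E x Ux)).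
have H01 x v : U x -> bt_Lam U Lam alpha L x v -> exists2 u, L01 U Lam x u & v = RRinf U Lam alpha t x *m u.
  move=> Ux [_ [u Lu <-]]; exists u; first exact: Lu.
  exact: (congr2 (fun A B => invmx A *m B *m u) (r1E x Ux) (rinfE x Ux)).
have omE x X : U x -> bt_q U Lam q alpha L x X =
    rrV U Lam alpha t x *m (rrinf U Lam alpha t x *m tp10 U Lam q x X *m invmx (rrinf U Lam alpha t x) +
      rr U Lam alpha t 0 x *m tp01 U Lam q x X *m invmx (rr U Lam alpha t 0 x)) *m rr U Lam alpha t 1 x.
  move=> Ux; rewrite /bt_q /bt_qtilde.
  exact: (congr2 (fun A D => invmx A *m D *m A) (r1E x Ux) (congr2 (fun B E =>
    B *m tp10 U Lam q x X *m invmx B + E *m tp01 U Lam q x X *m invmx E) (rinfE x Ux) (r0E x Ux))).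
have pp x : U x -> ip (t x) (laurent d p alpha x) = 0.
  move=> Ux; rewrite ipC; apply: p_perp => //; rewrite Lt //; exists 1; rewrite ?scale1r //.
exists (hat_coef U Lam alpha t d p); split.
- exact: (hat_pcq U_open cw a0 a1 Ct t_null t_orth t_par t2_orth hat_surface H10 H01 omE p_pcq pp).
- move=> lam x l1 Ux; have [l0 le lexc] := unit_circle_exc a1 l1.
  (* On the unit circle the inverse conjugate of [lam] is [lam], so this clause is the holomorphic
     formula. *)
  rewrite le opE //; exact: (hat_laurent U_open cw a0 a1 Ct t_null t_orth t2_orth p_pcq pp l0 lexc Ux).
- move=> lam x l0 lexc Ux; rewrite opE //.
  exact: (hat_laurent U_open cw a0 a1 Ct t_null t_orth t2_orth p_pcq pp l0 lexc Ux).
Qed.
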